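(* Let $K$ be a field with $\mathrm{char}\,K\neq 2$, and let $\mathbb{G}$ be a connected smooth algebraic supergroup over $K$. Then $\mathbb{G}$ is solvable if and only if the algebraic group $\mathbb{G}_{ev}$ is solvable.
   Context: ''Super'' means $\mathbb{Z}_2$-graded. $\mathsf{SAlg}_K$ is the category of super-commutative superalgebras over $K$. An affine supergroup $\mathbb{G}$ is a representable group-valued functor on $\mathsf{SAlg}_K$, represented by a super-commutative Hopf superalgebra $K[\mathbb{G}]$; it is an algebraic supergroup if $K[\mathbb{G}]$ is finitely generated. $\mathbb{G}_{ev}$ is the affine group (scheme) represented by $K[\mathbb{G}]/(K[\mathbb{G}]_1)$, where $(K[\mathbb{G}]_1)$ is the ideal generated by the odd component. Closed super-subgroups correspond to quotient Hopf superalgebras of $K[\mathbb{G}]$. For a normal closed super-subgroup $\mathbb{N}$, the quotient $\mathbb{G}/\mathbb{N}$ is represented by the unique Hopf super-subalgebra $B\subset K[\mathbb{G}]$ with $K[\mathbb{G}]/B^+K[\mathbb{G}]=K[\mathbb{N}]$, $B^+=\mathrm{Ker}\,\varepsilon_B$. $\mathbb{G}$ is connected if the largest (purely even, commutative) finite-dimensional separable subalgebra $\pi_0(K[\mathbb{G}])$ of $K[\mathbb{G}]$ is trivial (equal to $K$); equivalently, $\mathbb{G}_{ev}$ is connected. $\mathbb{G}$ is smooth if every epimorphism (surjection) onto $K[\mathbb{G}]$ in $\mathsf{SAlg}_K$ with nilpotent kernel splits in $\mathsf{SAlg}_K$. The derived super-subgroup $\mathcal{D}\mathbb{G}$ is the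 smallest closed normal super-subgroup $\mathbb{N}$ such that $\mathbb{G}/\mathbb{N}$ is abelian. Put $\mathcal{D}^0\mathbb{G}=\mathbb{G}$ and $\mathcal{D}^r\mathbb{G}=\mathcal{D}(\mathcal{D}^{r-1}\mathbb{G})$ for $r>0$. $\mathbb{G}$ is solvable if $\mathcal{D}^r\mathbb{G}=1$ for some $r$ (and similarly for algebraic groups). *)

(* Defs.v *)
From HB Require Import structures.
From mathcomp Require Import all_boot all_order all_algebra all_field.
From mathcomp Require Import boolp.

Set Implicit Arguments.
Unset Strict Implicit.
Unset Printing Implicit Defensive.

Import GRing.Theory.
Local Open Scope ring_scope.
Local Open Scope quotient_scope.

(* [gr false] is the even component and [gr true] the odd one.  An [algType]
   is nonzero; leaving out the zero superalgebra is harmless, since a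
   representable functor has exactly one point there. *)
Record superalgebra (K : fieldType) := Superalgebra {
  superalgebra_sort :> algType K;
  gr : bool -> superalgebra_sort -> Prop;
  gr0 : forall i, gr i 0;
  grP : forall i (c : K) x y, gr i x -> gr i y -> gr i (c *: x + y);
  gr_split : forall x, exists x0 x1, [/\ gr false x0, gr true x1 & x = x0 + x1];
  gr_direct : forall x, gr false x -> gr true x -> x = 0;
  gr1 : gr false 1;
  grM : forall i j x y, gr i x -> gr j y -> gr (i (+) j) (x * y)
}.

Definition supercommutative (K : fieldType) (A : superalgebra K) : Prop :=
  forall (i j : bool) (x y : A), gr i x -> gr j y ->
    x * y = (-1) ^+ (i && j) * (y * x).

Definition purely_even (K : fieldType) (A : superalgebra K) : Prop :=
  forall x : A, gr true x -> x = 0.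

Record shom (K : fieldType) (A B : superalgebra K) := SHom {
  shom_fun :> {lrmorphism A -> B};
  shom_gr : forall i x, gr i x -> gr i (shom_fun x)
}.

Lemma shom_ext (K : fieldType) (A B : superalgebra K) (f g : shom A B) :
  (forall x, f x = g x) -> f = g.
Proof.
case: f g => [[f cf] hf] [[g cg] hg] /= fg.
have {fg} efg : f = g by apply/funext.
subst g.
have ecc : cf = cg.
  case: cf {hf} => [[a] [b] [c]]; case: cg {hg} => [[a'] [b'] [c']].
  by congr (GRing.LRMorphism.Class _ _ _); f_equal; apply: Prop_irrelevance.
by subst cg; congr SHom; apply: Prop_irrelevance.
Qed.

Section Composition.
Variables (K : fieldType) (A B C : superalgebra K).
Variables (g : shom B C) (f : shom A B).

Lemma scomp_gr i (x : A) : gr i x -> gr i ((g \o f) x).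
Proof. by move=> /(shom_gr f) /(shom_gr g). Qed.

Definition scomp : shom A C := @SHom K A C (g \o f) scomp_gr.

End Composition.

Section Ground.
Variable K : fieldType.

Let grK (i : bool) (x : K^o) : Prop := i -> x = 0.

Let grK0 i : grK i 0. Proof. by []. Qed.
Let grKP i (c : K) x y : grK i x -> grK i y -> grK i (c *: x + y).
Proof. by move=> hx hy ti; rewrite hx // hy // scaler0 addr0. Qed.
Let grK_split x : exists x0 x1, [/\ grK false x0, grK true x1 & x = x0 + x1].
Proof. by exists x, 0; split=> //; rewrite addr0. Qed.
Let grK_direct x : grK false x -> grK true x -> x = 0.
Proof. by move=> _ ->. Qed.
Let grK1 : grK false 1. Proof. by []. Qed.
Let grKM i j x y : grK i x -> grK j y -> grK (i (+) j) (x * y).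
Proof.
case: i; case: j => //= hx hy _; first by rewrite hx // mul0r.
by rewrite hy // mulr0.
Qed.

Definition ground : superalgebra K :=
  Superalgebra grK0 grKP grK_split grK_direct grK1 grKM.

Lemma ground_supercommutative : supercommutative ground.
Proof.
move=> i j x y hx hy; case: i hx; case: j hy => /= hy hx.
- by rewrite hx // hy // !mul0r mulr0.
- by rewrite expr0 mul1r mulrC.
- by rewrite expr0 mul1r mulrC.
- by rewrite expr0 mul1r mulrC.
Qed.

Lemma ground_purely_even : purely_even ground.
Proof. by move=> x; apply. Qed.

End Ground.

Record superideal (K : fieldType) (A : superalgebra K) := Superideal {
  superideal_pred :> A -> Prop;
  superideal0 : superideal_pred 0;
  superidealB : forall x y,
    superideal_pred x -> superideal_pred y -> superideal_pred (x - y);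
  superidealMl : forall a x, superideal_pred x -> superideal_pred (a * x);
  superidealMr : forall a x, superideal_pred x -> superideal_pred (x * a);
  superideal1 : ~ superideal_pred 1;
  superideal_gr : forall x0 x1, gr false x0 -> gr true x1 ->
    superideal_pred (x0 + x1) -> superideal_pred x0
}.

Section Quotient.
Variables (K : fieldType) (A : superalgebra K) (I : superideal A).

Definition superideal_mem : {pred A} := fun x => `[< I x >].

Lemma superideal_mem_zmod_closed : zmod_closed superideal_mem.
Proof.
split=> [|x y /asboolP hx /asboolP hy]; first exact/asboolP/superideal0.
exact/asboolP/superidealB.
Qed.

HB.instance Definition _ :=
  GRing.isZmodClosed.Build A superideal_mem superideal_mem_zmod_closed.

Let Q := Quotient.quot (superideal_mem : zmodClosed A).
Definition squot : Type := Q.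
HB.instance Definition _ := GRing.Zmodule.on squot.

Definition squot_pi_fun (x : A) : squot := \pi_Q x.

Lemma squot_piP x y : squot_pi_fun x = squot_pi_fun y <-> I (x - y).
Proof.
split=> [/eqP|h]; last apply/eqP.
  by rewrite -(Quotient.idealrBE (superideal_mem : zmodClosed A)) => /asboolP.
by rewrite -(Quotient.idealrBE (superideal_mem : zmodClosed A)); apply/asboolP.
Qed.

Lemma squot_pi_surj (q : squot) : exists x, squot_pi_fun x = q.
Proof. by exists (repr q); rewrite /squot_pi_fun reprK. Qed.

Lemma squot_piB x y :
  squot_pi_fun (x - y) = squot_pi_fun x - squot_pi_fun y.
Proof. by rewrite /squot_pi_fun [LHS]raddfB. Qed.

Lemma squot_piD x y :
  squot_pi_fun (x + y) = squot_pi_fun x + squot_pi_fun y.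
Proof. by rewrite /squot_pi_fun [LHS]raddfD. Qed.

Lemma squot_pi0 : squot_pi_fun 0 = 0.
Proof. by rewrite /squot_pi_fun [LHS]raddf0. Qed.

Definition squot_repr (q : squot) : A := repr (q : Q).

Lemma squot_reprK q : squot_pi_fun (squot_repr q) = q.
Proof. exact: reprK. Qed.

Definition squot_one : squot := squot_pi_fun 1.
Definition squot_mul (p q : squot) : squot :=
  squot_pi_fun (squot_repr p * squot_repr q).
Definition squot_scale (c : K) (q : squot) : squot :=
  squot_pi_fun (c *: squot_repr q).

Lemma squot_piM x y :
  squot_pi_fun (x * y) = squot_mul (squot_pi_fun x) (squot_pi_fun y).
Proof.
apply/squot_piP; set x' := squot_repr _; set y' := squot_repr _.
have hx : I (x - x') by apply/squot_piP; rewrite squot_reprK.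
have hy : I (y - y') by apply/squot_piP; rewrite squot_reprK.
have -> : x * y - x' * y' = x * (y - y') - (- (x - x') * y').
  by rewrite mulrBr mulNr opprK mulrBl addrA addrNK.
apply: superidealB; first exact: superidealMl.
rewrite -mulN1r -mulrA; apply: superidealMl; exact: superidealMr.
Qed.

Lemma squot_piZ c x : squot_pi_fun (c *: x) = squot_scale c (squot_pi_fun x).
Proof.
apply/squot_piP; set x' := squot_repr _.
have hx : I (x - x') by apply/squot_piP; rewrite squot_reprK.
by rewrite -scalerBr -mulr_algl; apply: superidealMl.
Qed.

Lemma squot_mulA : associative squot_mul.
Proof.
move=> p q r; rewrite -(squot_reprK p) -(squot_reprK q) -(squot_reprK r).
by rewrite -!squot_piM mulrA.
Qed.
Lemma squot_mul1l : left_id squot_one squot_mul.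
Proof. by move=> p; rewrite -(squot_reprK p) -squot_piM mul1r. Qed.
Lemma squot_mul1r : right_id squot_one squot_mul.
Proof. by move=> p; rewrite -(squot_reprK p) -squot_piM mulr1. Qed.
Lemma squot_mulDl : left_distributive squot_mul +%R.
Proof.
move=> p q r; rewrite -(squot_reprK p) -(squot_reprK q) -(squot_reprK r).
by rewrite -squot_piD -!squot_piM mulrDl squot_piD.
Qed.
Lemma squot_mulDr : right_distributive squot_mul +%R.
Proof.
move=> p q r; rewrite -(squot_reprK p) -(squot_reprK q) -(squot_reprK r).
by rewrite -squot_piD -!squot_piM mulrDr squot_piD.
Qed.
Lemma squot_one_neq0 : squot_one != 0.
Proof.
apply/eqP; rewrite -squot_pi0 => /squot_piP; rewrite subr0.
exact: superideal1.
Qed.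

HB.instance Definition _ := GRing.Zmodule_isNzRing.Build squot
  squot_mulA squot_mul1l squot_mul1r squot_mulDl squot_mulDr squot_one_neq0.

Lemma squot_scaleA a b q : squot_scale a (squot_scale b q) = squot_scale (a * b) q.
Proof. by rewrite -(squot_reprK q) -!squot_piZ scalerA. Qed.
Lemma squot_scale1 : left_id 1 squot_scale.
Proof. by move=> q; rewrite -(squot_reprK q) -!squot_piZ scale1r. Qed.
Lemma squot_scaleDr : right_distributive squot_scale +%R.
Proof.
move=> a p q; rewrite -(squot_reprK p) -(squot_reprK q).
by rewrite -squot_piD -!squot_piZ scalerDr squot_piD.
Qed.
Lemma squot_scaleDl q : {morph squot_scale^~ q : a b / a + b}.
Proof.
by move=> a b; rewrite -(squot_reprK q) -!squot_piZ scalerDl squot_piD.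
Qed.

HB.instance Definition _ := GRing.Zmodule_isLmodule.Build K squot
  squot_scaleA squot_scale1 squot_scaleDr squot_scaleDl.

Lemma squot_scaleAl (a : K) (p q : squot) : a *: (p * q) = a *: p * q.
Proof.
rewrite -(squot_reprK p) -(squot_reprK q).
by rewrite [LHS](_ : _ = squot_scale a (squot_mul (squot_pi_fun (squot_repr p))
  (squot_pi_fun (squot_repr q)))) // -squot_piM -squot_piZ scalerAl squot_piM
  squot_piZ.
Qed.

HB.instance Definition _ := GRing.Lmodule_isLalgebra.Build K squot squot_scaleAl.

Lemma squot_scaleAr (a : K) (p q : squot) : a *: (p * q) = p * (a *: q).
Proof.
rewrite -(squot_reprK p) -(squot_reprK q).
by rewrite [LHS](_ : _ = squot_scale a (squot_mul (squot_pi_fun (squot_repr p))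
  (squot_pi_fun (squot_repr q)))) // -squot_piM -squot_piZ scalerAr squot_piM
  squot_piZ.
Qed.

HB.instance Definition _ := GRing.Lalgebra_isAlgebra.Build K squot squot_scaleAr.

Definition squot_gr (i : bool) (q : squot) : Prop :=
  exists2 x : A, gr i x & squot_pi_fun x = q.

Lemma squot_gr0 i : squot_gr i 0.
Proof. by exists 0; [exact: gr0 | exact: squot_pi0]. Qed.
Lemma squot_grP i (c : K) p q :
  squot_gr i p -> squot_gr i q -> squot_gr i (c *: p + q).
Proof.
move=> [x hx <-] [y hy <-]; exists (c *: x + y); first exact: grP.
by rewrite squot_piD squot_piZ.
Qed.
Lemma squot_gr_split q :
  exists q0 q1, [/\ squot_gr false q0, squot_gr true q1 & q = q0 + q1].
Proof.
have [x <-] := squot_pi_surj q; have [x0 [x1 [h0 h1 ->]]] := gr_split x.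
exists (squot_pi_fun x0), (squot_pi_fun x1).
by split; [exists x0 | exists x1 | rewrite squot_piD].
Qed.
Lemma squot_gr_direct q : squot_gr false q -> squot_gr true q -> q = 0.
Proof.
move=> [x hx <-] [y hy /squot_piP hyx]; rewrite -squot_pi0.
apply/squot_piP; rewrite subr0.
apply: (@superideal_gr _ _ I x (- y)) => //.
  by rewrite -[- y]addr0 -scaleN1r; apply: grP => //; apply: gr0.
by rewrite -[x - y]opprB -[- _]sub0r; apply: superidealB => //; apply: superideal0.
Qed.
Lemma squot_gr1 : squot_gr false 1.
Proof. by exists 1; first exact: gr1. Qed.
Lemma squot_grM i j p q :
  squot_gr i p -> squot_gr j q -> squot_gr (i (+) j) (p * q).
Proof.
move=> [x hx <-] [y hy <-]; exists (x * y); first exact: grM.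
exact: squot_piM.
Qed.

Definition squotient : superalgebra K :=
  @Superalgebra K squot squot_gr squot_gr0 squot_grP squot_gr_split
    squot_gr_direct squot_gr1 squot_grM.

Lemma squot_pi_linear : linear squot_pi_fun.
Proof. by move=> a x y; rewrite squot_piD squot_piZ. Qed.
Lemma squot_pi_monoid : monoid_morphism squot_pi_fun.
Proof. by split=> // x y; rewrite squot_piM. Qed.

HB.instance Definition _ :=
  GRing.isLinear.Build K A squot _ squot_pi_fun squot_pi_linear.
HB.instance Definition _ :=
  GRing.isMonoidMorphism.Build A squot squot_pi_fun squot_pi_monoid.

Lemma squot_pi_gr i x : gr i x -> squot_gr i (squot_pi_fun x).
Proof. by exists x. Qed.

Definition squot_pi : shom A squotient :=
  @SHom K A squotient squot_pi_fun squot_pi_gr.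

Lemma squot_pi_epi (R : superalgebra K) (f g : shom squotient R) :
  scomp f squot_pi = scomp g squot_pi -> f = g.
Proof.
move=> e; apply: shom_ext => q; have [x <-] := squot_pi_surj q.
by have := congr1 (fun h : shom A R => h x) e.
Qed.

Section Lift.
Variables (R : superalgebra K) (h : shom A R) (hI : forall x, I x -> h x = 0).

Definition squot_lift_fun (q : squot) : R := h (squot_repr q).

Lemma squot_lift_pi x : squot_lift_fun (squot_pi_fun x) = h x.
Proof.
apply/eqP; rewrite -subr_eq0 -raddfB; apply/eqP/hI/squot_piP.
by rewrite squot_reprK.
Qed.

Lemma squot_lift_linear : linear squot_lift_fun.
Proof.
move=> a p q; rewrite -(squot_reprK p) -(squot_reprK q).
rewrite -[_ + _]squot_pi_linear !squot_lift_pi; exact: linearP.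
Qed.
Lemma squot_lift_monoid : monoid_morphism squot_lift_fun.
Proof.
split=> [|p q]; first by rewrite -[1]/(squot_pi_fun 1) squot_lift_pi rmorph1.
rewrite -(squot_reprK p) -(squot_reprK q) -[_ * _]squot_piM !squot_lift_pi.
exact: rmorphM.
Qed.

HB.instance Definition _ :=
  GRing.isLinear.Build K squot R _ squot_lift_fun squot_lift_linear.
HB.instance Definition _ :=
  GRing.isMonoidMorphism.Build squot R squot_lift_fun squot_lift_monoid.

Lemma squot_lift_gr i q : squot_gr i q -> gr i (squot_lift_fun q).
Proof. by move=> [x hx <-]; rewrite squot_lift_pi; apply: shom_gr. Qed.

Definition squot_lift : shom squotient R :=
  @SHom K squotient R squot_lift_fun squot_lift_gr.

Lemma squot_liftK : scomp squot_lift squot_pi = h.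
Proof. by apply: shom_ext => x; apply: squot_lift_pi. Qed.

End Lift.

Lemma squotient_supercommutative : supercommutative A -> supercommutative squotient.
Proof.
move=> sA i j _ _ [x hx <-] [y hy <-].
rewrite -[LHS]/(squot_mul _ _) -squot_piM (sA _ _ _ _ hx hy).
rewrite -[LHS]/(squot_pi _) rmorphM rmorphM rmorphXn rmorphN1 //.
Qed.

End Quotient.

(* A full subcategory of the category of superalgebras containing the ground
   field.  Group functors, their closed subgroups, quotients and derived
   subgroups are defined once over such a category and used for [salg_cat]
   (affine supergroups) and [alg_cat] (affine groups). *)
Record test_category (K : fieldType) := TestCategory {
  in_test :> superalgebra K -> Prop;
  ground_in_test : in_test (ground K)
}.

Definition salg_cat (K : fieldType) : test_category K :=
  @TestCategory K (@supercommutative K) (@ground_supercommutative K).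

(* Commutative algebras, seen as purely even superalgebras. *)
Definition alg_cat (K : fieldType) : test_category K :=
  @TestCategory K (fun A => supercommutative A /\ purely_even A)
    (conj (@ground_supercommutative K) (@ground_purely_even K)).

Record obj (K : fieldType) (C : test_category K) := Obj {
  obj_sort :> superalgebra K;
  objP : C obj_sort
}.

Definition ground_obj (K : fieldType) (C : test_category K) : obj C :=
  Obj (ground_in_test C).

Definition salg_of_alg (K : fieldType) (R : obj (alg_cat K)) : obj (salg_cat K) :=
  @Obj K (salg_cat K) R (proj1 (objP R)).

(* A group-valued functor on [C] represented by the object [coord]: a group
   structure on [shom coord R], natural in [R].  By Yoneda's lemma, when [C]
   is [salg_cat K] this is a Hopf superalgebra structure on [coord], with
   counit [gone (ground_obj C)]. *)
Record group_scheme (K : fieldType) (C : test_category K) := GroupScheme {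
  coord : obj C;
  gmul : forall R : obj C, shom coord R -> shom coord R -> shom coord R;
  gone : forall R : obj C, shom coord R;
  ginv : forall R : obj C, shom coord R -> shom coord R;
  gmulA : forall R : obj C, associative (@gmul R);
  gmul1 : forall R : obj C, left_id (@gone R) (@gmul R);
  gmulV : forall R : obj C, left_inverse (@gone R) (@ginv R) (@gmul R);
  gmul_nat : forall (R S : obj C) (phi : shom R S) (f g : shom coord R),
    scomp phi (@gmul R f g) = @gmul S (scomp phi f) (scomp phi g)
}.

Definition affine_supergroup (K : fieldType) := group_scheme (salg_cat K).
Definition affine_group (K : fieldType) := group_scheme (alg_cat K).

Section GroupSchemes.
Variables (K : fieldType) (C : test_category K).
Implicit Types G H N Q D : group_scheme C.

Definition point G (R : obj C) := shom (coord G) R.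

Definition counit G : point G (ground_obj C) := gone G (ground_obj C).

(* A morphism [H -> G], given by its comorphism. *)
Record gmor H G := GMor {
  comorph : shom (coord G) (coord H);
  comorphM : forall (R : obj C) (f g : point H R),
    scomp (gmul f g) comorph = gmul (scomp f comorph) (scomp g comorph)
}.

Definition on_points H G (p : gmor H G) (R : obj C) (f : point H R) : point G R :=
  scomp f (comorph p).

Definition closed_embedding H G (p : gmor H G) : Prop :=
  forall y : coord H, exists x : coord G, comorph p x = y.

Definition normal_embedding N G (p : gmor N G) : Prop :=
  closed_embedding p /\
  forall (R : obj C) (g : point G R) (n : point N R),
    exists n' : point N R,
      gmul (gmul g (on_points p n)) (ginv g) = on_points p n'.

(* [pi : G -> Q] exhibits [Q] as [G / N]: the comorphism of [pi] identifies
   [B = K[Q]] with a Hopf sub-superalgebra of [K[G]] such that the kernel of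
   [K[G] -> K[N]] is [B^+ K[G]]. *)
Definition is_quotient N G Q (p : gmor N G) (pi : gmor G Q) : Prop :=
  injective (comorph pi) /\
  forall x : coord G, comorph p x = 0 <->
    exists n (b : 'I_n -> coord Q) (a : 'I_n -> coord G),
      (forall i, counit Q (b i) = 0) /\ x = \sum_(i < n) comorph pi (b i) * a i.

Definition abelian_scheme G : Prop :=
  forall R : obj C, commutative (@gmul _ _ G R).

Definition trivial_scheme G : Prop :=
  forall (R : obj C) (f : point G R), f = gone G R.

Definition abelian_quotient N G (p : gmor N G) : Prop :=
  exists Q (pi : gmor G Q), is_quotient p pi /\ abelian_scheme Q.

Definition subgroup_le N N' G (p : gmor N G) (p' : gmor N' G) : Prop :=
  forall x : coord G, comorph p' x = 0 -> comorph p x = 0.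

Definition is_derived D G (p : gmor D G) : Prop :=
  [/\ normal_embedding p, abelian_quotient p
    & forall N (p' : gmor N G),
        normal_embedding p' -> abelian_quotient p' -> subgroup_le p p'].

(* [derived_series G r H]: [H] is (isomorphic to) the [r]-th derived
   subgroup of [G]. *)
Inductive derived_series G : nat -> group_scheme C -> Prop :=
| derived_series0 : derived_series G 0 G
| derived_seriesS r H D (p : gmor D H) :
    derived_series G r H -> is_derived p -> derived_series G r.+1 D.

Definition solvable_scheme G : Prop :=
  exists r H, derived_series G r H /\ trivial_scheme H.

End GroupSchemes.

Definition finitely_generated (K : fieldType) (A : superalgebra K) : Prop :=
  exists s : seq A, forall S : A -> Prop,
    S 1 -> (forall (c : K) x y, S x -> S y -> S (c *: x + y)) ->
    (forall x y, S x -> S y -> S (x * y)) ->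
    (forall x, x \in s -> S x) -> forall x, S x.

(* A finite-dimensional separable commutative algebra is a finite product of
   finite separable field extensions; [phi] is an isomorphism from such a
   product onto the subalgebra [E]. *)
Definition separable_subalgebra (K : fieldType) (A : superalgebra K)
    (E : A -> Prop) : Prop :=
  (forall x, E x -> gr false x) /\
  exists (n : nat) (L : 'I_n -> fieldExtType K) (phi : (forall i, L i) -> A),
    [/\ forall i, separable 1%VS {:L i},
        [/\ forall (c : K) u v, phi (fun i => c *: u i + v i) = c *: phi u + phi v,
            forall u v, phi (fun i => u i * v i) = phi u * phi v
          & phi (fun=> 1) = 1],
        injective phi
      & forall x, E x <-> exists u, phi u = x].

(* The union of all separable subalgebras, hence the largest one when that
   exists. *)
Definition pi0 (K : fieldType) (A : superalgebra K) (x : A) : Prop :=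
  exists2 E : A -> Prop, separable_subalgebra E & E x.

Definition algebraic_supergroup (K : fieldType) (G : affine_supergroup K) : Prop :=
  finitely_generated (coord G).

Definition connected_supergroup (K : fieldType) (G : affine_supergroup K) : Prop :=
  forall x : coord G, pi0 x <-> exists c : K, x = c%:A.

Definition nilpotent_kernel (K : fieldType) (A B : superalgebra K)
    (p : shom B A) : Prop :=
  exists n, forall x : 'I_n -> B,
    (forall i, p (x i) = 0) -> \prod_(i < n) x i = 0.

Definition smooth_supergroup (K : fieldType) (G : affine_supergroup K) : Prop :=
  forall (B : obj (salg_cat K)) (p : shom B (coord G)),
    (forall a, exists b, p b = a) -> nilpotent_kernel p ->
    exists s : shom (coord G) B, forall a, p (s a) = a.

Section OddIdeal.
Variables (K : fieldType) (A : superalgebra K) (e : shom A (ground K)).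

Definition odd_ideal_pred (x : A) : Prop :=
  forall J : A -> Prop, J 0 ->
    (forall u v, J u -> J v -> J (u - v)) ->
    (forall a u, J u -> J (a * u)) -> (forall a u, J u -> J (u * a)) ->
    (forall u, gr true u -> J u) -> J x.

Lemma odd_ideal0 : odd_ideal_pred 0. Proof. by move=> J *. Qed.
Lemma odd_idealB x y :
  odd_ideal_pred x -> odd_ideal_pred y -> odd_ideal_pred (x - y).
Proof.
by move=> hx hy J J0 JB Jl Jr Jo; exact: (JB _ _ (hx J J0 JB Jl Jr Jo) (hy J J0 JB Jl Jr Jo)).
Qed.
Lemma odd_idealMl a x : odd_ideal_pred x -> odd_ideal_pred (a * x).
Proof. by move=> hx J J0 JB Jl Jr Jo; exact: Jl (hx J J0 JB Jl Jr Jo). Qed.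
Lemma odd_idealMr a x : odd_ideal_pred x -> odd_ideal_pred (x * a).
Proof. by move=> hx J J0 JB Jl Jr Jo; exact: Jr (hx J J0 JB Jl Jr Jo). Qed.
Lemma odd_ideal_odd x : gr true x -> odd_ideal_pred x.
Proof. by move=> hx J J0 JB Jl Jr Jo; apply: Jo. Qed.

Lemma odd_ideal_kills (R : superalgebra K) (h : shom A R) :
  purely_even R -> forall x, odd_ideal_pred x -> h x = 0.
Proof.
move=> evR x hx; apply: (hx (fun u => h u = 0)) => {x hx} /=.
- exact: raddf0.
- by move=> u v hu hv; rewrite raddfB /= hu hv subr0.
- by move=> a u hu; rewrite rmorphM /= hu mulr0.
- by move=> a u hu; rewrite rmorphM /= hu mul0r.
- by move=> u hu; apply/evR/shom_gr.
Qed.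

Lemma odd_ideal1 : ~ odd_ideal_pred 1.
Proof.
move=> /(odd_ideal_kills e (@ground_purely_even K)) /eqP.
by rewrite rmorph1 oner_eq0.
Qed.
Lemma odd_ideal_gr x0 x1 : gr false x0 -> gr true x1 ->
  odd_ideal_pred (x0 + x1) -> odd_ideal_pred x0.
Proof.
move=> _ h1 h; rewrite -(addrK x1 x0).
exact: odd_idealB h (odd_ideal_odd h1).
Qed.

(* [e] serves only to show that the ideal is proper. *)
Definition odd_ideal : superideal A :=
  Superideal odd_ideal0 odd_idealB odd_idealMl odd_idealMr odd_ideal1
    odd_ideal_gr.

Lemma odd_quotient_purely_even : purely_even (squotient odd_ideal).
Proof.
move=> _ [x hx <-]; rewrite -[RHS](squot_pi0 odd_ideal).
by apply/squot_piP; rewrite subr0; apply: odd_ideal_odd.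
Qed.

End OddIdeal.

Section EvenPart.
Variables (K : fieldType) (G : affine_supergroup K).

Let I : superideal (coord G) := odd_ideal (counit G).

Definition even_coord : obj (alg_cat K) :=
  @Obj K (alg_cat K) (squotient I)
    (conj (squotient_supercommutative (objP (coord G)))
       (@odd_quotient_purely_even _ _ (counit G))).

Definition even_lift (R : obj (alg_cat K)) (h : shom (coord G) R) :
    shom even_coord R :=
  squot_lift (I := I) (odd_ideal_kills h (proj2 (objP R))).

Definition even_res (R : obj (alg_cat K)) (f : shom even_coord R) :
    point G (salg_of_alg R) :=
  scomp f (squot_pi I).

Lemma even_liftK (R : obj (alg_cat K)) (h : shom (coord G) R) : even_res (even_lift h) = h.
Proof. exact: squot_liftK. Qed.

Lemma even_res_inj (R : obj (alg_cat K)) : injective (@even_res R).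
Proof. by move=> f g; apply: squot_pi_epi. Qed.

(* The group structure is the one of [G] on commutative algebras [R], through
   the bijection [even_res] from [shom (K[G] / (K[G]_1)) R] to
   [shom (K[G]) R]. *)
Definition even_mul (R : obj (alg_cat K)) (f g : shom even_coord R) : shom even_coord R :=
  even_lift (gmul (even_res f) (even_res g)).
Definition even_one (R : obj (alg_cat K)) : shom even_coord R :=
  even_lift (gone G (salg_of_alg R)).
Definition even_inv (R : obj (alg_cat K)) (f : shom even_coord R) : shom even_coord R :=
  even_lift (ginv (even_res f)).

Lemma even_mulA (R : obj (alg_cat K)) : associative (@even_mul R).
Proof.
by move=> f g h; apply: even_res_inj; rewrite !even_liftK gmulA.
Qed.
Lemma even_mul1 (R : obj (alg_cat K)) : left_id (@even_one R) (@even_mul R).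
Proof. by move=> f; apply: even_res_inj; rewrite !even_liftK gmul1. Qed.
Lemma even_mulV (R : obj (alg_cat K)) : left_inverse (@even_one R) (@even_inv R) (@even_mul R).
Proof. by move=> f; apply: even_res_inj; rewrite !even_liftK gmulV. Qed.
Lemma even_mul_nat (R S : obj (alg_cat K)) (phi : shom R S)
    (f g : shom even_coord R) :
  scomp phi (even_mul f g) = even_mul (scomp phi f) (scomp phi g).
Proof.
have resE h : even_res (scomp phi h) =
    @scomp _ _ (salg_of_alg R) (salg_of_alg S) phi (even_res h).
  exact: shom_ext.
by apply: even_res_inj; rewrite resE !even_liftK gmul_nat -!resE.
Qed.

Definition even_part : affine_group K :=
  GroupScheme even_mulA even_mul1 even_mulV even_mul_nat.

End EvenPart.

(* Main.v *)
Require Import Defs.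
From HB Require Import structures.
From mathcomp Require Import all_boot all_order all_algebra all_field.
From mathcomp Require Import boolp classical_sets.
From mathcomp Require Import zify ring.
Require Import Defs.

(* Write [V] for the odd part of the Lie superalgebra of [G], on which the
   affine group [G_ev] acts through the adjoint representation.  Over a finite
   extension [L] of [K] splitting enough characteristic polynomials, let
   [W <= V^*_L] be a [G_ev]-stable subspace vanishing on the odd tangent space
   [V_H] of some member [H] of the derived series.  If [W] is not everything,
   the Lie-Kolchin theorem gives a functional [l] outside [W] which is an
   eigenvector modulo [W].  Its restriction to [V_H] is an eigenvector of
   [H_ev], so it kills all brackets [[x, y], z] of odd elements by the Jacobi
   identity; a Poincare lemma in the odd directions integrates it to a function
   [f] on [H] with [f(xy) = f(x) + a(x) f(y)], where [a] is a character.  Hence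
   [a = 1] and [f] is additive on the derived subgroup of [H], [f] vanishes on
   the second derived subgroup [H2], and [W + L l] vanishes on [V_H2].  When [W]
   is everything, [V_H = 0], so [H] is purely even, hence a subgroup of [G_ev],
   and [G] is solvable.

   Connectedness and smoothness enter through the Lie-Kolchin theorem, in the
   form: [K[G_ev] (x) R] is a domain for every domain [R].  Krull's intersection
   theorem and translations produce an idempotent generating the intersection of
   the powers of the augmentation ideal, which therefore vanishes; smoothness
   then provides enough curves [K[G_ev] -> K[t]/(t^N)] to compare lowest order
   terms. *)

Set Implicit Arguments.
Unset Strict Implicit.
Unset Printing Implicit Defensive.

Import GRing.Theory.
Local Open Scope ring_scope.

(** * Linear functionals *)

(** Two obstacles shape the proof. [K] may be finite or imperfect, so rational points say little:
    the action of [G_ev] is tested on points over auxiliary algebras [S], and matrices over [K] or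
    [L] are recovered by applying linear functionals on [S]. Such a family of points supports
    rigidity arguments because [S] is required to stay a domain after tensoring with any domain, a
    condition that survives tensor products, and because the family specialises to the identity at a
    [K]-point of [S]. Secondly, smoothness and connectedness are only assumed for [G], not for the
    members of its derived series. Hence the Lie-Kolchin theorem is applied to [G_ev] alone, acting
    on the dual of the odd tangent space of [G], with iterated commutators of points in place of
    derived subgroups; a member [H] of the series enters only through the restriction of functionals
    to its odd tangent vectors. A finite extension [L] suffices because the coefficient matrices of
    each commutator level span a finite-dimensional space, so that finitely many characteristic
    polynomials have to be split. *)

Section Lin.
Variable K : fieldType.
Implicit Types U V W : lmodType K.

Definition lin U V (f : U -> V) : Prop :=
  forall (c : K) x y, f (c *: x + y) = c *: f x + f y.

Section LinTheory.
Variables (U V W : lmodType K) (f : U -> V).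
Hypothesis linf : lin f.

Lemma linD x y : f (x + y) = f x + f y.
Proof. by rewrite -[x]scale1r linf !scale1r. Qed.
Lemma lin0 : f 0 = 0.
Proof. by apply: (addrI (f 0)); rewrite -linD !addr0. Qed.
Lemma linZ c x : f (c *: x) = c *: f x.
Proof. by rewrite -[c *: x]addr0 linf lin0 addr0. Qed.
Lemma linN x : f (- x) = - f x.
Proof. by rewrite -scaleN1r linZ scaleN1r. Qed.
Lemma linB x y : f (x - y) = f x - f y.
Proof. by rewrite linD linN. Qed.
Lemma lin_sum I (r : seq I) (P : pred I) (F : I -> U) :
  f (\sum_(i <- r | P i) F i) = \sum_(i <- r | P i) f (F i).
Proof. by elim/big_rec2: _ => [|i x y _ <-]; rewrite ?lin0 ?linD. Qed.

End LinTheory.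

Lemma lin_comp U V W (f : U -> V) (g : V -> W) :
  lin f -> lin g -> lin (g \o f).
Proof. by move=> lf lg c x y; rewrite /= lf lg. Qed.

Lemma lin_add U V (f g : U -> V) : lin f -> lin g -> lin (fun x => f x + g x).
Proof. by move=> lf lg c x y; rewrite lf lg scalerDr addrACA. Qed.

Lemma lin_opp U V (f : U -> V) : lin f -> lin (fun x => - f x).
Proof. by move=> lf c x y; rewrite lf opprD scalerN. Qed.

Lemma lin_sub U V (f g : U -> V) : lin f -> lin g -> lin (fun x => f x - g x).
Proof. by move=> lf lg; apply: lin_add => //; apply: lin_opp. Qed.

Lemma lin_scale U V (f : U -> V) c : lin f -> lin (fun x => c *: f x).
Proof. by move=> lf d x y; rewrite lf scalerDr !scalerA mulrC. Qed.

Lemma lin_scalel U V (f : U -> K^o) (v : V) : lin f -> lin (fun x => f x *: v).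
Proof. by move=> lf d x y; rewrite lf scalerDl scalerA. Qed.

Lemma lin_bigsum U V I (r : seq I) (P : pred I) (F : I -> U -> V) :
  (forall i, lin (F i)) -> lin (fun x => \sum_(i <- r | P i) F i x).
Proof.
move=> lF c x y; rewrite scaler_sumr -big_split /=.
by apply: eq_bigr => i _; rewrite lF.
Qed.

Lemma lin_linear U V (f : {linear U -> V}) : lin f.
Proof. by move=> c x y; rewrite linearP. Qed.

Definition bilin U V W (f : U -> V -> W) : Prop :=
  (forall v, lin (f^~ v)) /\ (forall u, lin (f u)).

Record subspace U (X : U -> Prop) : Prop := Subspace {
  subspace0 : X 0;
  subspaceP : forall c x y, X x -> X y -> X (c *: x + y)
}.

Section SubspaceTheory.
Variables (U : lmodType K) (X : U -> Prop).
Hypothesis sX : subspace X.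

Lemma subspaceD x y : X x -> X y -> X (x + y).
Proof. by move=> hx hy; rewrite -[x]scale1r; apply: subspaceP. Qed.
Lemma subspaceZ c x : X x -> X (c *: x).
Proof. by move=> hx; rewrite -[_ *: _]addr0; apply: subspaceP => //; apply: subspace0. Qed.
Lemma subspaceN x : X x -> X (- x).
Proof. by move=> hx; rewrite -scaleN1r; apply: subspaceZ. Qed.
Lemma subspaceB x y : X x -> X y -> X (x - y).
Proof. by move=> hx hy; apply: subspaceD => //; apply: subspaceN. Qed.
Lemma subspace_sum I (r : seq I) (P : pred I) (F : I -> U) :
  (forall i, P i -> X (F i)) -> X (\sum_(i <- r | P i) F i).
Proof.
move=> h; elim/big_rec: _ => [|i x Pi hx]; first exact: subspace0.
by apply: subspaceD => //; apply: h.
Qed.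
Lemma subspace_sum_mem (I : eqType) (r : seq I) (F : I -> U) :
  (forall i, i \in r -> X (F i)) -> X (\sum_(i <- r) F i).
Proof.
move=> h; rewrite big_seq; apply: subspace_sum => i; exact: h.
Qed.
End SubspaceTheory.

(** Zorn's lemma yields a subspace [M] maximal among those that contain [X] and miss [a]. Maximality
    forces the whole space to be [M + K a], and [f] is the coordinate along [a]. *)
Lemma subspace_separation U (X : U -> Prop) (a : U) :
  subspace X -> ~ X a ->
  exists f : U -> K^o, [/\ lin f, f a = 1 & forall x, X x -> f x = 0].
Proof.
move=> sX nXa.
pose P (M : set U) := M = set0 \/ [/\ subspace M, forall x, X x -> M x & ~ M a].
have [|M [PM maxM]] := @Zorn_bigcup U P.
  move=> F FP totF; have [[N FN N0]|allE] := pselect (exists2 N, F N & N <> set0);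
    last first.
    left; apply/seteqP; split=> // x [N FN Nx].
    by case: (pselect (N = set0)) => [N0|N0]; [rewrite N0 in Nx|case: allE; exists N].
  have good N' : F N' -> N' <> set0 -> [/\ subspace N', forall x, X x -> N' x & ~ N' a].
    by move=> /FP [].
  right; have [sN XN _] := good _ FN N0; split.
  - split; first by exists N => //; apply: subspace0.
    move=> c x y [N1 F1 x1] [N2 F2 y2].
    have n1 : N1 <> set0 by move=> e; rewrite e in x1.
    have n2 : N2 <> set0 by move=> e; rewrite e in y2.
    have [s1 _ _] := good _ F1 n1; have [s2 _ _] := good _ F2 n2.
    have [h|h] := totF _ _ F1 F2.
      by exists N2 => //; apply: subspaceP => //; apply: h.
    by exists N1 => //; apply: subspaceP => //; apply: h.
  - by move=> x /XN Nx; exists N.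
  - move=> [N1 F1 a1].
    have n1 : N1 <> set0 by move=> e; rewrite e in a1.
    by have [_ _] := good _ F1 n1; apply.
have {PM} [sM XM nMa] : [/\ subspace M, forall x, X x -> M x & ~ M a].
  case: PM => // M0; case: (maxM X); last by right.
  rewrite M0; split=> // h; exact: (h 0 (subspace0 sX)).
(* For [x] outside [M] the larger subspace [M + K x] must contain [a], so [x] is a multiple of [a]
   modulo [M]. *)
have dec x : exists c, M (x - c *: a).
  have [Mx|nMx] := pselect (M x); first by exists 0; rewrite scale0r subr0.
  pose N (y : U) := exists d, M (y - d *: x).
  have sN : subspace N.
    split; first by exists 0; rewrite scale0r subr0; apply: subspace0.
    move=> c y z [d hd] [e he]; exists (c * d + e).
    have -> : c *: y + z - (c * d + e) *: x = c *: (y - d *: x) + (z - e *: x).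
      by rewrite scalerBr scalerDl scalerA opprD addrACA.
    exact: subspaceP.
  have [[d hd]|nNa] := pselect (N a).
    have [d0|dn0] := eqVneq d 0; first by move: hd; rewrite d0 scale0r subr0.
    exists d^-1; rewrite -[_ - _]opprB -scaleN1r; apply: subspaceZ => //.
    have -> : d^-1 *: a - x = d^-1 *: (a - d *: x).
      by rewrite scalerBr scalerA mulVf // scale1r.
    exact: subspaceZ.
  case: (maxM N); last first.
    right; split; [exact: sN| |exact: nNa].
    by move=> y /XM My; exists 0; rewrite scale0r subr0.
  split; last first.
    move=> h; apply: nMx; apply: h; exists 1; rewrite scale1r subrr.
    exact: subspace0.
  by move=> y My; exists 0; rewrite scale0r subr0.
have uniq c x : M (x - c *: a) -> projT1 (cid (dec x)) = c.
  case: cid => d /= hd hc; apply/eqP; rewrite -subr_eq0; apply/negPn/negP => n0.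
  apply: nMa; have := subspaceZ sM (d - c)^-1 (subspaceB sM hc hd).
  have -> : x - c *: a - (x - d *: a) = (d - c) *: a.
    by rewrite scalerBl opprB [d *: a - x]addrC addrACA subrr add0r addrC.
  by rewrite scalerA mulVf // scale1r.
exists (fun x => projT1 (cid (dec x))); split.
- move=> c x y; case: (cid (dec x)) => d /= hd; case: (cid (dec y)) => e /= he.
  apply: uniq; rewrite scalerDl -scalerA opprD addrACA -scalerBr.
  exact: subspaceP.
- by apply: uniq; rewrite scale1r subrr; apply: subspace0.
- by move=> x /XM Mx; apply: uniq; rewrite scale0r subr0.
Qed.

Lemma subspace_eq0 U : subspace (fun x : U => x = 0).
Proof. by split=> // c x y -> ->; rewrite scaler0 addr0. Qed.

Lemma functional_eq0 U (x : U) : (forall f : U -> K^o, lin f -> f x = 0) -> x = 0.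
Proof.
move=> h; apply: contrapT => nx.
have [f [lf f1 _]] := subspace_separation (subspace_eq0 U) nx.
by have /eqP := h f lf; rewrite f1 oner_eq0.
Qed.

Lemma functional_mem U (X : U -> Prop) (x : U) : subspace X ->
  (forall f : U -> K^o, lin f -> (forall y, X y -> f y = 0) -> f x = 0) -> X x.
Proof.
move=> sX h; apply: contrapT => nx.
have [f [lf f1 f0]] := subspace_separation sX nx.
by have /eqP := h f lf f0; rewrite f1 oner_eq0.
Qed.

End Lin.

(** * Tensor products *)

Section Parity.
Variables (K : fieldType) (A : superalgebra K).

Lemma gr_subspace i : subspace (gr (s := A) i).
Proof. by split; [exact: gr0 | exact: grP]. Qed.

Lemma pj_ex (x : A) : exists x0, gr false x0 /\ gr true (x - x0).
Proof.
have [x0 [x1 [h0 h1 ->]]] := gr_split x; exists x0; split=> //.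
by rewrite addrC addKr.
Qed.

Lemma pj_sig : {p : bool -> A -> A |
  forall x, [/\ gr false (p false x), gr true (p true x) & x = p false x + p true x]}.
Proof.
exists (fun i x => let x0 := projT1 (cid (pj_ex x)) in if i then x - x0 else x0) => x /=.
by case: cid => x0 /= [h0 h1]; split=> //; rewrite addrC addrNK.
Qed.

Definition pj : bool -> A -> A := sval pj_sig.

Lemma pj_gr i x : gr i (pj i x).
Proof. by have [] := svalP pj_sig x; case: i. Qed.

Lemma pj_split x : x = pj false x + pj true x.
Proof. by have [] := svalP pj_sig x. Qed.

Lemma gr_eq (x0 x1 y0 y1 : A) : gr false x0 -> gr false y0 -> gr true x1 ->
  gr true y1 -> x0 + x1 = y0 + y1 -> x0 = y0 /\ x1 = y1.
Proof.
move=> hx0 hy0 hx1 hy1 e.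
have e' : x0 - y0 = y1 - x1 by apply/eqP; rewrite subr_eq addrAC [y1 + _]addrC -e addrK.
have z : x0 - y0 = 0.
  apply: gr_direct; first exact: (subspaceB (gr_subspace false)).
  by rewrite e'; exact: (subspaceB (gr_subspace true)).
split; first by apply/eqP; rewrite -subr_eq0 z.
by apply/esym/eqP; rewrite -subr_eq0 -e' z.
Qed.

Lemma pj_unique x0 x1 x : gr false x0 -> gr true x1 -> x = x0 + x1 ->
  pj false x = x0 /\ pj true x = x1.
Proof. by move=> h0 h1 e; apply: gr_eq; rewrite -?pj_split //; apply: pj_gr. Qed.

Lemma pj_id i x : gr i x -> pj i x = x.
Proof.
case: i => h.
  by have [] := @pj_unique 0 x x (gr0 A _) h _; rewrite ?add0r.
by have [] := @pj_unique x 0 x h (gr0 A _) _; rewrite ?addr0.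
Qed.

Lemma pj_neq i j x : gr i x -> i != j -> pj j x = 0.
Proof.
case: i; case: j => // h _.
  by have [] := @pj_unique 0 x x (gr0 A _) h _; rewrite ?add0r.
by have [] := @pj_unique x 0 x h (gr0 A _) _; rewrite ?addr0.
Qed.

Lemma pj_lin i : lin (pj i).
Proof.
move=> c x y.
have [] := @pj_unique (c *: pj false x + pj false y) (c *: pj true x + pj true y) (c *: x + y).
- by apply: grP; apply: pj_gr.
- by apply: grP; apply: pj_gr.
- by rewrite addrACA -scalerDr -!pj_split.
by case: i.
Qed.

Lemma gr_pj i x : pj i x = x -> gr i x.
Proof. by move=> <-; apply: pj_gr. Qed.

Lemma gr_alg c : gr false (c%:A : A).
Proof. exact: (subspaceZ (gr_subspace false)) (gr1 A). Qed.

End Parity.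

Lemma shom_pj (K : fieldType) (A B : superalgebra K) (f : shom A B) i x :
  f (pj i x) = pj i (f x).
Proof.
have e : f x = f (pj false x) + f (pj true x) by rewrite -raddfD -pj_split.
have [e0 e1] := @pj_unique _ B _ _ _
  (shom_gr f (pj_gr false x)) (shom_gr f (pj_gr true x)) e.
by case: i; rewrite ?e0 ?e1.
Qed.

Lemma shom_lin (K : fieldType) (A B : superalgebra K) (f : shom A B) : lin f.
Proof. exact: lin_linear. Qed.

Lemma shomM (K : fieldType) (A B : superalgebra K) (f : shom A B) x y :
  f (x * y) = f x * f y.
Proof. exact: rmorphM. Qed.
Lemma shom1 (K : fieldType) (A B : superalgebra K) (f : shom A B) : f 1 = 1.
Proof. exact: rmorph1. Qed.
Lemma shom0 (K : fieldType) (A B : superalgebra K) (f : shom A B) : f 0 = 0.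
Proof. exact: raddf0. Qed.
Lemma shomD (K : fieldType) (A B : superalgebra K) (f : shom A B) x y :
  f (x + y) = f x + f y.
Proof. exact: raddfD. Qed.
Lemma shomB (K : fieldType) (A B : superalgebra K) (f : shom A B) x y :
  f (x - y) = f x - f y.
Proof. exact: raddfB. Qed.
Lemma shomZ (K : fieldType) (A B : superalgebra K) (f : shom A B) c x :
  f (c *: x) = c *: f x.
Proof. exact: linearZ. Qed.
Lemma shom_sum (K : fieldType) (A B : superalgebra K) (f : shom A B) I (r : seq I)
    (P : pred I) (F : I -> A) :
  f (\sum_(i <- r | P i) F i) = \sum_(i <- r | P i) f (F i).
Proof. exact: raddf_sum. Qed.

(* [A (x) B] is realised inside the functions from the dual of [A] to [B],
   [a (x) b] being [phi |-> phi a *: b]. *)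
Section TensorModule.
Variables (K : fieldType) (A B : superalgebra K).

Definition dual := {phi : A -> K^o | lin phi}.

Definition tfun (s : seq (A * B)) (phi : dual) : B :=
  \sum_(w <- s) sval phi w.1 *: w.2.

Record tens : Type := Tens { tenv : dual -> B; tenvP : exists s, tenv = tfun s }.

Lemma tens_eq (F G : tens) : tenv F = tenv G -> F = G.
Proof.
case: F G => f hf [g hg] /= e; move: hf; rewrite e => hf.
by congr Tens; apply: Prop_irrelevance.
Qed.

HB.instance Definition _ := gen_eqMixin tens.
HB.instance Definition _ := gen_choiceMixin tens.

Definition tseq (s : seq (A * B)) : tens := @Tens (tfun s) (ex_intro _ s erefl).

Lemma tadd_sub (F G : tens) : exists s, (fun phi => tenv F phi + tenv G phi) = tfun s.
Proof.
have [s es] := tenvP F; have [t et] := tenvP G; exists (s ++ t).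
by apply/funext => phi; rewrite es et /tfun big_cat.
Qed.
Definition tadd (F G : tens) := Tens (tadd_sub F G).

Lemma tscale_sub c (F : tens) : exists s, (fun phi => c *: tenv F phi) = tfun s.
Proof.
have [s es] := tenvP F; exists [seq (w.1, c *: w.2) | w <- s].
apply/funext => phi; rewrite es /tfun big_map scaler_sumr.
by apply: eq_bigr => w _; rewrite !scalerA mulrC.
Qed.
Definition tscale c (F : tens) := Tens (tscale_sub c F).

Lemma taddA : associative tadd.
Proof. by move=> F G H; apply: tens_eq; apply/funext => phi /=; rewrite addrA. Qed.
Lemma taddC : commutative tadd.
Proof. by move=> F G; apply: tens_eq; apply/funext => phi /=; rewrite addrC. Qed.
Lemma tadd0 : left_id (tseq [::]) tadd.
Proof.
by move=> F; apply: tens_eq; apply/funext => phi /=; rewrite /tfun big_nil add0r.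
Qed.
Lemma taddN : left_inverse (tseq [::]) (tscale (-1)) tadd.
Proof.
move=> F; apply: tens_eq; apply/funext => phi /=.
by rewrite /tfun big_nil scaleN1r addNr.
Qed.

HB.instance Definition _ := GRing.isZmodule.Build tens taddA taddC tadd0 taddN.

Lemma tscaleA a b F : tscale a (tscale b F) = tscale (a * b) F.
Proof. by apply: tens_eq; apply/funext => phi /=; rewrite scalerA. Qed.
Lemma tscale1 : left_id 1 tscale.
Proof. by move=> F; apply: tens_eq; apply/funext => phi /=; rewrite scale1r. Qed.
Lemma tscaleDr : right_distributive tscale +%R.
Proof. by move=> a F G; apply: tens_eq; apply/funext => phi /=; rewrite scalerDr. Qed.
Lemma tscaleDl F : {morph tscale^~ F : a b / a + b}.
Proof. by move=> a b; apply: tens_eq; apply/funext => phi /=; rewrite scalerDl. Qed.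

HB.instance Definition _ := GRing.Zmodule_isLmodule.Build K tens
  tscaleA tscale1 tscaleDr tscaleDl.

Lemma tenvD F G phi : tenv (F + G) phi = tenv F phi + tenv G phi.
Proof. by []. Qed.
Lemma tenvZ c F phi : tenv (c *: F) phi = c *: tenv F phi.
Proof. by []. Qed.
Lemma tenv0 phi : tenv 0 phi = 0.
Proof. by rewrite /= /tfun big_nil. Qed.
Lemma tenv_sum I (r : seq I) (F : I -> tens) phi :
  tenv (\sum_(i <- r) F i) phi = \sum_(i <- r) tenv (F i) phi.
Proof. by elim/big_rec2: _ => [|i x y _ <-]; rewrite ?tenv0 ?tenvD. Qed.

Definition pure (a : A) (b : B) : tens := tseq [:: (a, b)].

Lemma tenv_pure a b phi : tenv (pure a b) phi = sval phi a *: b.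
Proof. by rewrite /= /tfun big_seq1. Qed.

Lemma pure_bilin : bilin pure.
Proof.
split=> [b c x y|a c x y]; apply: tens_eq; apply/funext => phi.
  by rewrite tenvD tenvZ !tenv_pure (svalP phi) scalerDl scalerA.
by rewrite tenvD tenvZ !tenv_pure scalerDr !scalerA mulrC.
Qed.

Lemma tseq_pure s : tseq s = \sum_(w <- s) pure w.1 w.2.
Proof.
apply: tens_eq; apply/funext => phi; rewrite tenv_sum.
by apply: eq_bigr => w _; rewrite tenv_pure.
Qed.

Definition trep (F : tens) : seq (A * B) := projT1 (cid (tenvP F)).

Lemma trepK F : \sum_(w <- trep F) pure w.1 w.2 = F.
Proof. by rewrite -tseq_pure /trep; case: cid => s /= e; apply: tens_eq. Qed.

Lemma tens_sum F : exists n (a : 'I_n -> A) (b : 'I_n -> B),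
  F = \sum_(i < n) pure (a i) (b i).
Proof.
exists (size (trep F)), (fun i => (nth (0, 0) (trep F) i).1),
  (fun i => (nth (0, 0) (trep F) i).2).
by rewrite -[LHS]trepK (big_nth (0, 0)) big_mkord.
Qed.

Lemma tens_ind (P : tens -> Prop) : P 0 -> (forall F G, P F -> P G -> P (F + G)) ->
  (forall a b, P (pure a b)) -> forall F, P F.
Proof.
move=> P0 PD Pp F; have [n [a [b ->]]] := tens_sum F.
by elim/big_rec: _ => // i x _; apply: PD.
Qed.

Lemma lincomb_subspace (V : lmodType K) n (a : 'I_n -> V) :
  subspace (fun x => exists c : 'I_n -> K, x = \sum_(i < n) c i *: a i).
Proof.
split; first by exists (fun=> 0); rewrite big1 // => i _; rewrite scale0r.
move=> c x y [d ->] [e ->]; exists (fun i => c * d i + e i).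
rewrite scaler_sumr -big_split /=; apply: eq_bigr => i _.
by rewrite scalerA scalerDl.
Qed.

Lemma lincomb_mem (V : lmodType K) n (a : 'I_n -> V) i :
  exists c : 'I_n -> K, a i = \sum_(i < n) c i *: a i.
Proof.
exists (fun j => (j == i)%:R); rewrite (bigD1 i) //= eqxx scale1r big1 ?addr0 //.
by move=> j /negPf ->; rewrite scale0r.
Qed.

(** Well-definedness of the extension of a bilinear map, by induction on the number of terms. If
    [a0] depends linearly on the other left entries, its term is absorbed by them; otherwise a
    functional that is 1 on [a0] and 0 on the others shows that [b0] vanishes. *)
Lemma tens_bil0 (V : lmodType K) (beta : A -> B -> V) n (a : 'I_n -> A)
    (b : 'I_n -> B) : bilin beta ->
  \sum_(i < n) pure (a i) (b i) = 0 -> \sum_(i < n) beta (a i) (b i) = 0.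
Proof.
move=> [bl br]; elim: n a b => [|n IHn] a b; first by rewrite !big_ord0.
rewrite !big_ord_recl => e.
set a0 := a ord0 in e *; set b0 := b ord0 in e *.
have [[c ec]|nspan] := pselect (exists c : 'I_n -> K,
    a0 = \sum_(i < n) c i *: a (lift ord0 i)).
  have [pl pr] := pure_bilin.
  have := IHn (fun i => a (lift ord0 i)) (fun i => b (lift ord0 i) + c i *: b0).
  have eq (W : lmodType K) (g : A -> B -> W) : bilin g ->
      g a0 b0 + \sum_(i < n) g (a (lift ord0 i)) (b (lift ord0 i)) =
      \sum_(i < n) g (a (lift ord0 i)) (b (lift ord0 i) + c i *: b0).
    move=> [gl gr]; rewrite ec (lin_sum (gl _)) -big_split /=.
    by apply: eq_bigr => i _; rewrite (linD (gr _)) (linZ (gr _)) (linZ (gl _)) addrC.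
  by rewrite -(eq _ pure pure_bilin) -(eq _ beta (conj bl br)); apply.
have [phi [lphi phi1 phi0]] := subspace_separation (lincomb_subspace _) nspan.
have b00 : b0 = 0.
  move/(congr1 (fun F => tenv F (exist _ phi lphi))): e.
  rewrite tenv0 tenvD tenv_pure /= phi1 scale1r tenv_sum big1 ?addr0 // => i _.
  by rewrite tenv_pure /= phi0 ?scale0r //; apply: lincomb_mem.
move: e; rewrite b00 (lin0 (br _)) (lin0 (proj2 pure_bilin _)) !add0r.
exact: IHn.
Qed.

(** The linear map induced by a bilinear one, computed on a chosen representative; [tens_bil0] makes
    it independent of the choice. *)
Definition text (V : lmodType K) (beta : A -> B -> V) (F : tens) : V :=
  \sum_(w <- trep F) beta w.1 w.2.

Lemma text_seq (V : lmodType K) (beta : A -> B -> V) (s : seq (A * B)) : bilin beta ->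
  text beta (\sum_(w <- s) pure w.1 w.2) = \sum_(w <- s) beta w.1 w.2.
Proof.
move=> bb; apply/eqP; rewrite -subr_eq0; apply/eqP.
set F := \sum_(_ <- _) _; rewrite /text.
have opp (W : lmodType K) (g : A -> B -> W) : bilin g ->
    \sum_(w <- trep F) g w.1 w.2 - \sum_(w <- s) g w.1 w.2 =
    \sum_(w <- trep F ++ [seq (- w.1, w.2) | w <- s]) g w.1 w.2.
  move=> [gl _]; rewrite big_cat big_map /= -sumrN; congr (_ + _).
  by apply: eq_bigr => w _; rewrite (linN (gl _)).
rewrite opp // (big_nth (0, 0)) big_mkord.
apply: (tens_bil0 (a := fun i => (nth (0, 0) _ i).1) (b := fun i => (nth (0, 0) _ i).2)) => //.
rewrite -(big_mkord xpredT (fun i => pure (nth (0, 0) _ i).1 (nth (0, 0) _ i).2)).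
rewrite -(big_nth (0, 0) xpredT (fun w => pure w.1 w.2)) -opp; last exact: pure_bilin.
by rewrite trepK subrr.
Qed.

Lemma text_pure (V : lmodType K) (beta : A -> B -> V) a b : bilin beta ->
  text beta (pure a b) = beta a b.
Proof.
by move=> bb; have := text_seq [:: (a, b)] bb; rewrite !big_seq1.
Qed.

Lemma text_lin (V : lmodType K) (beta : A -> B -> V) : bilin beta -> lin (text beta).
Proof.
move=> bb c F G; rewrite -[F in LHS]trepK -[G in LHS]trepK.
have -> : c *: (\sum_(w <- trep F) pure w.1 w.2) + \sum_(w <- trep G) pure w.1 w.2 =
  \sum_(w <- [seq (c *: w.1, w.2) | w <- trep F] ++ trep G) pure w.1 w.2.
  rewrite big_cat big_map /= scaler_sumr; congr (_ + _).
  by apply: eq_bigr => w _; rewrite (linZ (proj1 pure_bilin _)).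
rewrite text_seq // big_cat big_map /= /text scaler_sumr; congr (_ + _).
by apply: eq_bigr => w _; rewrite (linZ (proj1 bb _)).
Qed.

Lemma lin_eq_tens (V : lmodType K) (f g : tens -> V) : lin f -> lin g ->
  (forall a b, f (pure a b) = g (pure a b)) -> forall F, f F = g F.
Proof.
move=> lf lg e; apply: tens_ind => [|F G eF eG|//]; first by rewrite !lin0.
by rewrite !linD // eF eG.
Qed.

End TensorModule.

Section LinMul.
Variables (K : fieldType) (A : algType K).
Lemma lin_mull (a : A) : lin (fun x => x * a).
Proof. by move=> c x y; rewrite mulrDl scalerAl. Qed.
Lemma lin_mulr (a : A) : lin (fun x => a * x).
Proof. by move=> c x y; rewrite mulrDr scalerAr. Qed.

Lemma sign_scale n (x : A) : (-1) ^+ n * x = ((-1) ^+ n : K) *: x.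
Proof.
rewrite -signr_odd -[in RHS]signr_odd.
by case: odd; rewrite ?expr1 ?expr0 ?mul1r ?scale1r ?mulN1r ?scaleN1r.
Qed.
End LinMul.

Section TensorAlgebra.
Variables (K : fieldType) (A B : superalgebra K).
Local Notation T := (tens A B).
Local Notation pure := (@pure K A B).

Definition koszul (i j : bool) : K := (-1) ^+ (i && j).

Lemma pureDl a a' b : pure (a + a') b = pure a b + pure a' b.
Proof. exact: (linD (proj1 (pure_bilin A B) b)). Qed.
Lemma pureDr a b b' : pure a (b + b') = pure a b + pure a b'.
Proof. exact: (linD (proj2 (pure_bilin A B) a)). Qed.
Lemma pureZl c a b : pure (c *: a) b = c *: pure a b.
Proof. exact: (linZ (proj1 (pure_bilin A B) b)). Qed.
Lemma pureZr c a b : pure a (c *: b) = c *: pure a b.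
Proof. exact: (linZ (proj2 (pure_bilin A B) a)). Qed.
Lemma pure0l b : pure 0 b = 0.
Proof. exact: (lin0 (proj1 (pure_bilin A B) b)). Qed.
Lemma pure0r a : pure a 0 = 0.
Proof. exact: (lin0 (proj2 (pure_bilin A B) a)). Qed.

(** The Koszul sign rule: exchanging [b] with [a'] costs a sign when both are odd, so both are split
    into homogeneous components. *)
Definition mul4 a b a' b' : T :=
  \sum_(i : bool) \sum_(j : bool) koszul i j *: pure (a * pj i a') (pj j b * b').

Lemma mul4_bilin a b : bilin (mul4 a b).
Proof.
split=> v; apply: lin_bigsum => i; apply: lin_bigsum => j; apply: lin_scale.
- exact: (lin_comp (lin_comp (pj_lin i) (lin_mulr a)) (proj1 (pure_bilin A B) _)).
- exact: (lin_comp (lin_mulr (pj j b)) (proj2 (pure_bilin A B) _)).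
Qed.

Lemma mul4_bilinl a' b' : bilin (fun a b => mul4 a b a' b').
Proof.
split=> v; apply: lin_bigsum => i; apply: lin_bigsum => j; apply: lin_scale.
- exact: (lin_comp (lin_mull (pj i a')) (proj1 (pure_bilin A B) _)).
- exact: (lin_comp (lin_comp (pj_lin j) (lin_mull b')) (proj2 (pure_bilin A B) _)).
Qed.

Definition tmul (F G : T) : T := text (fun a b => text (mul4 a b) G) F.

Lemma text_mul4_bilin G : bilin (fun a b => text (mul4 a b) G).
Proof.
split=> v; apply: lin_bigsum => w.
  exact: (proj1 (mul4_bilinl _ _)).
exact: (proj2 (mul4_bilinl _ _)).
Qed.

Lemma tmul_linl G : lin (tmul^~ G).
Proof. exact: text_lin (text_mul4_bilin G). Qed.

Lemma tmul_linr F : lin (tmul F).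
Proof. by apply: lin_bigsum => w; apply/text_lin/mul4_bilin. Qed.

Lemma tmul_pure a b a' b' : tmul (pure a b) (pure a' b') = mul4 a b a' b'.
Proof. by rewrite /tmul text_pure ?text_pure //; [exact: mul4_bilin|exact: text_mul4_bilin]. Qed.

Lemma tmul_hom i j a b a' b' : gr i a' -> gr j b ->
  tmul (pure a b) (pure a' b') = koszul i j *: pure (a * a') (b * b').
Proof.
move=> ha hb; rewrite tmul_pure /mul4 (bigD1 i) //= (bigD1 j) //=.
rewrite !pj_id // [X in _ + X + _]big1 ?addr0 => [|k nk]; last first.
  by rewrite (pj_neq hb) ?mul0r ?pure0r ?scaler0 // eq_sym.
rewrite [X in _ + X]big1 ?addr0 // => k nk; apply: big1 => l _.
by rewrite (pj_neq ha) ?mulr0 ?pure0l ?scaler0 // eq_sym.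
Qed.

Lemma tens_hom_ind (P : T -> Prop) : P 0 -> (forall F G, P F -> P G -> P (F + G)) ->
  (forall i j a b, gr i a -> gr j b -> P (pure a b)) -> forall F, P F.
Proof.
move=> P0 PD Pp; apply: tens_ind => // a b.
rewrite (pj_split a) (pj_split b) !(pureDl, pureDr).
by apply: (PD); apply: (PD); exact: Pp (pj_gr _ _) (pj_gr _ _).
Qed.

Lemma lin_eq_tens_hom (V : lmodType K) (f g : T -> V) : lin f -> lin g ->
  (forall i j a b, gr i a -> gr j b -> f (pure a b) = g (pure a b)) -> forall F, f F = g F.
Proof.
move=> lf lg e; apply: tens_hom_ind => [|F G eF eG|//]; first by rewrite !lin0.
by rewrite !linD // eF eG.
Qed.

Lemma tmulA : associative tmul.
Proof.
move=> F G H; move: F; apply: lin_eq_tens_hom => [||i j a b ha hb].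
- exact: tmul_linl.
- by apply: lin_comp; apply: tmul_linl.
move: G; apply: lin_eq_tens_hom => [||k l a' b' ha' hb'].
- exact: (lin_comp (tmul_linl H) (tmul_linr _)).
- exact: (lin_comp (tmul_linr _) (tmul_linl H)).
move: H; apply: lin_eq_tens_hom => [||m n a'' b'' ha'' hb''].
- by apply: lin_comp; apply: tmul_linr.
- exact: tmul_linr.
rewrite (tmul_hom _ _ ha'' hb') (tmul_hom _ _ ha' hb) (linZ (tmul_linr _)).
rewrite (linZ (tmul_linl _)) (tmul_hom _ _ (grM ha' ha'') hb).
rewrite (tmul_hom _ _ ha'' (grM hb hb')) !mulrA !scalerA; congr (_ *: _).
rewrite /koszul -!exprD -signr_odd -[RHS]signr_odd !oddD !oddb.
by case: k ha'; case: m ha''; case: j hb; case: l hb'.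
Qed.

Lemma tmul1 : left_id (pure 1 1) tmul.
Proof.
apply: lin_eq_tens_hom => [|//|i j a b ha hb]; first exact: tmul_linr.
by rewrite (tmul_hom _ _ ha (gr1 B)) /koszul andbF scale1r !mul1r.
Qed.
Lemma tmulr1 : right_id (pure 1 1) tmul.
Proof.
apply: lin_eq_tens_hom => [|//|i j a b ha hb]; first exact: tmul_linl.
by rewrite (tmul_hom _ _ (gr1 A) hb) /koszul scale1r !mulr1.
Qed.
Lemma tmulDl : left_distributive tmul +%R.
Proof. by move=> F G H; rewrite (linD (tmul_linl _)). Qed.
Lemma tmulDr : right_distributive tmul +%R.
Proof. by move=> F G H; rewrite (linD (tmul_linr _)). Qed.
Lemma tone_neq0 : pure 1 1 != 0.
Proof.
apply/eqP => e.
have n1 : (1 : A) <> 0 by apply/eqP; apply: oner_neq0.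
have [f [lf f1 _]] := subspace_separation (subspace_eq0 A) n1.
move/(congr1 (fun F => tenv F (exist _ f lf))): e.
by rewrite tenv0 tenv_pure /= f1 scale1r; apply/eqP/oner_neq0.
Qed.

HB.instance Definition _ := GRing.Zmodule_isNzRing.Build T
  tmulA tmul1 tmulr1 tmulDl tmulDr tone_neq0.

Lemma tscaleAl (a : K) (F G : T) : a *: (F * G) = a *: F * G.
Proof. by rewrite [RHS](linZ (tmul_linl _)). Qed.
HB.instance Definition _ := GRing.Lmodule_isLalgebra.Build K T tscaleAl.
Lemma tscaleAr (a : K) (F G : T) : a *: (F * G) = F * (a *: G).
Proof. by rewrite [RHS](linZ (tmul_linr _)). Qed.
HB.instance Definition _ := GRing.Lalgebra_isAlgebra.Build K T tscaleAr.

Definition tpj (k : bool) (F : T) : T :=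
  text (fun a b => \sum_(i : bool) pure (pj i a) (pj (i (+) k) b)) F.

Lemma tpj_lin k : lin (tpj k).
Proof.
apply: text_lin; split=> v; apply: lin_bigsum => i.
  exact: (lin_comp (pj_lin i) (proj1 (pure_bilin A B) _)).
exact: (lin_comp (pj_lin _) (proj2 (pure_bilin A B) _)).
Qed.

Lemma tpj_hom k i j a b : gr i a -> gr j b ->
  tpj k (pure a b) = if i (+) j == k then pure a b else 0.
Proof.
move=> ha hb; rewrite /tpj text_pure; last first.
  split=> v; apply: lin_bigsum => l.
    exact: (lin_comp (pj_lin l) (proj1 (pure_bilin A B) _)).
  exact: (lin_comp (pj_lin _) (proj2 (pure_bilin A B) _)).
rewrite (bigD1 i) //= big1 ?addr0 => [|l nl]; last first.
  by rewrite (pj_neq ha) ?pure0l // eq_sym.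
rewrite pj_id //; have [<-|n] := eqVneq (i (+) j) k; first by rewrite addbA addbb pj_id.
by rewrite (pj_neq hb) ?pure0r //; case: i j k n {ha hb} => [] [] [].
Qed.

Definition tgr (k : bool) (F : T) : Prop := tpj k F = F.

Lemma tgr_pure i j a b : gr i a -> gr j b -> tgr (i (+) j) (pure a b).
Proof. by move=> ha hb; rewrite /tgr (tpj_hom _ ha hb) eqxx. Qed.

Lemma tgr_subspace k : subspace (tgr k).
Proof.
split; first by rewrite /tgr (lin0 (tpj_lin _)).
by move=> c F G; rewrite /tgr tpj_lin => -> ->.
Qed.

Lemma tpj_tgr k F : tgr k (tpj k F).
Proof.
move: F; apply: tens_hom_ind => [|F G hF hG|i j a b ha hb].
- by rewrite (lin0 (tpj_lin _)); apply: subspace0 (tgr_subspace k).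
- by rewrite (linD (tpj_lin _)); apply: (subspaceD (tgr_subspace k)).
- rewrite (tpj_hom _ ha hb); case: eqP => [<-|_]; first exact: tgr_pure.
  exact: subspace0 (tgr_subspace k).
Qed.

Lemma tgr_ind k (P : T -> Prop) : P 0 -> (forall F G, P F -> P G -> P (F + G)) ->
  (forall i j a b, gr i a -> gr j b -> i (+) j = k -> P (pure a b)) ->
  forall F, tgr k F -> P F.
Proof.
move=> P0 PD Pp F <-; move: F; apply: tens_hom_ind => [|F G hF hG|i j a b ha hb].
- by rewrite (lin0 (tpj_lin _)).
- by rewrite (linD (tpj_lin _)); apply: PD.
- by rewrite (tpj_hom _ ha hb); case: eqP => // e; apply: Pp e.
Qed.

Lemma tgr0 k : tgr k 0. Proof. exact: subspace0 (tgr_subspace k). Qed.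
Lemma tgrP k (c : K) F G : tgr k F -> tgr k G -> tgr k (c *: F + G).
Proof. by move=> hF hG; apply: (subspaceP (tgr_subspace k) c hF hG). Qed.
Lemma tgr_split F : exists F0 F1, [/\ tgr false F0, tgr true F1 & F = F0 + F1].
Proof.
exists (tpj false F), (tpj true F); split; [exact: tpj_tgr|exact: tpj_tgr|].
move: F; apply: lin_eq_tens_hom => //.
  by apply: lin_add; apply: tpj_lin.
move=> i j a b ha hb; rewrite !(tpj_hom _ ha hb).
by case: (i (+) j); rewrite ?addr0 ?add0r.
Qed.
Lemma tgr_direct F : tgr false F -> tgr true F -> F = 0.
Proof.
move=> h0 <-; move: F h0; apply: tgr_ind => [|F G hF hG|i j a b ha hb e].
- exact: (lin0 (tpj_lin _)).
- by rewrite (linD (tpj_lin _)) hF hG addr0.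
- by rewrite (tpj_hom _ ha hb) e.
Qed.
Lemma tgr1 : tgr false 1.
Proof. exact: tgr_pure (gr1 A) (gr1 B). Qed.
Lemma tgrM i j F G : tgr i F -> tgr j G -> tgr (i (+) j) (F * G).
Proof.
move=> hF hG; move: F hF; apply: tgr_ind => [|F F' hF hF'|k l a b ha hb <-].
- by rewrite mul0r; apply: tgr0.
- by rewrite mulrDl; exact: (subspaceD (tgr_subspace _) hF hF').
move: G hG; apply: tgr_ind => [|G G' hG hG'|m n a' b' ha' hb' <-].
- by rewrite mulr0; apply: tgr0.
- by rewrite mulrDr; exact: (subspaceD (tgr_subspace _) hG hG').
rewrite [_ * _](tmul_hom _ _ ha' hb); apply: (subspaceZ (tgr_subspace _)).
by rewrite addbACA; apply: tgr_pure; apply: grM.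
Qed.

Definition tensor : superalgebra K :=
  @Superalgebra K T tgr tgr0 tgrP tgr_split tgr_direct tgr1 tgrM.

Lemma pure_hom i j a b a' b' : gr i a' -> gr j b ->
  (pure a b : tensor) * pure a' b' = koszul i j *: pure (a * a') (b * b').
Proof. exact: tmul_hom. Qed.

Lemma pure_mull a a' b : (pure a 1 : tensor) * pure a' b = pure (a * a') b.
Proof.
rewrite (pj_split a') mulrDr !pureDl mulrDr !(pure_hom _ _ (pj_gr _ _) (gr1 B)).
by rewrite /koszul !andbF !scale1r !mul1r.
Qed.

Lemma pure_mulr a b b' : (pure a b : tensor) * pure 1 b' = pure a (b * b').
Proof.
rewrite (pj_split b) mulrDl !pureDr mulrDl !(pure_hom _ _ (gr1 A) (pj_gr _ _)).
by rewrite /koszul !scale1r !mulr1.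
Qed.

Lemma tens_supercommutative :
  supercommutative A -> supercommutative B -> supercommutative tensor.
Proof.
move=> sA sB i j F G hF hG.
rewrite sign_scale; move: F hF; apply: tgr_ind => [|F F' hF hF'|k l a b ha hb <-].
- by rewrite mul0r mulr0 scaler0.
- by rewrite mulrDl mulrDr scalerDr hF hF'.
move: G hG; apply: tgr_ind => [|G G' hG hG'|m n a' b' ha' hb' <-].
- by rewrite mul0r mulr0 scaler0.
- by rewrite mulrDl mulrDr scalerDr hG hG'.
rewrite (pure_hom _ _ ha' hb) (pure_hom _ _ ha hb') (sA _ _ _ _ ha ha') (sB _ _ _ _ hb hb').
rewrite !sign_scale pureZl pureZr !scalerA; congr (_ *: _).
rewrite /koszul -!exprD -signr_odd -[RHS]signr_odd !oddD !oddb.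
by case: k ha; case: l hb; case: m ha'; case: n hb'.
Qed.

Lemma tens_purely_even : purely_even A -> purely_even B -> purely_even tensor.
Proof.
move=> eA eB; apply: tgr_ind => // [F G -> ->|i j a b ha hb]; first by rewrite addr0.
case: i ha => ha; first by rewrite (eA _ ha) pure0l.
by case: j hb => // hb _; rewrite (eB _ hb) pure0r.
Qed.

Definition inl_fun (a : A) : tensor := pure a 1.
Definition inr_fun (b : B) : tensor := pure 1 b.

Lemma inl_linear : linear inl_fun.
Proof. exact: (proj1 (pure_bilin A B) 1). Qed.
Lemma inl_monoid : monoid_morphism inl_fun.
Proof. by split=> // a a'; rewrite /inl_fun pure_mull. Qed.
Lemma inr_linear : linear inr_fun.
Proof. exact: (proj2 (pure_bilin A B) 1). Qed.
Lemma inr_monoid : monoid_morphism inr_fun.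
Proof. by split=> // a a'; rewrite /inr_fun pure_mulr. Qed.

HB.instance Definition _ := GRing.isLinear.Build K A tensor _ inl_fun inl_linear.
HB.instance Definition _ := GRing.isMonoidMorphism.Build A tensor inl_fun inl_monoid.
HB.instance Definition _ := GRing.isLinear.Build K B tensor _ inr_fun inr_linear.
HB.instance Definition _ := GRing.isMonoidMorphism.Build B tensor inr_fun inr_monoid.

Lemma inl_gr i a : gr i a -> gr i (inl_fun a).
Proof. by move=> ha; rewrite -[i]addbF; apply: tgr_pure ha (gr1 B). Qed.
Lemma inr_gr i b : gr i b -> gr i (inr_fun b).
Proof. by move=> hb; rewrite -[i]addFb; apply: tgr_pure (gr1 A) hb. Qed.

Definition tinl : shom A tensor := @SHom K A tensor inl_fun inl_gr.
Definition tinr : shom B tensor := @SHom K B tensor inr_fun inr_gr.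

Lemma tinl_tinr a b : tinl a * tinr b = pure a b.
Proof. by rewrite [LHS]pure_mull mulr1. Qed.

Section Lift.
Variables (R : superalgebra K) (f : shom A R) (g : shom B R).
Hypothesis sR : supercommutative R.

Definition tlift_fun (F : tensor) : R := text (fun a b => f a * g b) F.

Lemma tlift_bilin : bilin (fun a b => f a * g b).
Proof.
split=> v c x y; first by rewrite linearP mulrDl scalerAl.
by rewrite linearP mulrDr scalerAr.
Qed.

Lemma tlift_pure a b : tlift_fun (pure a b) = f a * g b.
Proof. by rewrite /tlift_fun text_pure //; apply: tlift_bilin. Qed.

Lemma tlift_linear : linear tlift_fun.
Proof. exact: text_lin tlift_bilin. Qed.

Lemma tlift_monoid : monoid_morphism tlift_fun.
Proof.
split=> [|F G]; first by rewrite [LHS]tlift_pure !rmorph1 mulr1.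
move: F; apply: lin_eq_tens_hom => [||i j a b ha hb].
- by apply: (lin_comp (lin_mull G) tlift_linear).
- by apply: (lin_comp tlift_linear (lin_mull _)).
move: G; apply: lin_eq_tens_hom => [||k l a' b' ha' hb'].
- by apply: (lin_comp (lin_mulr _) tlift_linear).
- by apply: (lin_comp tlift_linear (lin_mulr _)).
rewrite (pure_hom _ _ ha' hb) (linZ tlift_linear) !tlift_pure !rmorphM /=.
rewrite -!mulrA [g b * (_ * _)]mulrA (sR (shom_gr g hb) (shom_gr f ha')).
by rewrite sign_scale -scalerAl -scalerAr /koszul andbC !mulrA.
Qed.

HB.instance Definition _ := GRing.isLinear.Build K tensor R _ tlift_fun tlift_linear.
HB.instance Definition _ := GRing.isMonoidMorphism.Build tensor R tlift_fun tlift_monoid.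

Lemma tlift_gr i F : gr i F -> gr i (tlift_fun F).
Proof.
move: F; apply: tgr_ind => [|F G hF hG|k l a b ha hb <-].
- by rewrite (lin0 tlift_linear); apply: gr0.
- by rewrite (linD tlift_linear); exact: (subspaceD (gr_subspace _ _) hF hG).
- by rewrite tlift_pure; apply: grM; apply: shom_gr.
Qed.

Definition tlift : shom tensor R := @SHom K tensor R tlift_fun tlift_gr.

Lemma tliftE a b : tlift (pure a b) = f a * g b.
Proof. exact: tlift_pure. Qed.

Lemma tlift_inl : scomp tlift tinl = f.
Proof. by apply: shom_ext => a; rewrite /= tlift_pure rmorph1 mulr1. Qed.
Lemma tlift_inr : scomp tlift tinr = g.
Proof. by apply: shom_ext => a; rewrite /= tlift_pure rmorph1 mul1r. Qed.
End Lift.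

Lemma tens_shom_ext (R : superalgebra K) (f g : shom tensor R) :
  scomp f tinl = scomp g tinl -> scomp f tinr = scomp g tinr -> f = g.
Proof.
move=> el er; apply: shom_ext; apply: lin_eq_tens => [||a b].
- exact: lin_linear.
- exact: lin_linear.
rewrite -tinl_tinr !rmorphM /=; congr (_ * _).
  exact: (congr1 (fun h : shom A R => h a) el).
exact: (congr1 (fun h : shom B R => h b) er).
Qed.

(** Slices replace the choice of bases: an element of the tensor product vanishes when all its
    slices do, and it lies in [X (x) B] as soon as its slices lie in the subspace [X]. *)
Definition lslice (phi : A -> K^o) (F : tensor) : B := text (fun a b => phi a *: b) F.
Definition rslice (psi : B -> K^o) (F : tensor) : A := text (fun a b => psi b *: a) F.

Lemma lslice_bilin (phi : A -> K^o) : lin phi -> bilin (fun (a : A) (b : B) => phi a *: b).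
Proof.
move=> lp; split=> v; first exact: lin_scalel.
by move=> c x y; rewrite scalerDr !scalerA mulrC.
Qed.
Lemma rslice_bilin (psi : B -> K^o) : lin psi -> bilin (fun (a : A) (b : B) => psi b *: a).
Proof.
move=> lp; split=> v; last exact: lin_scalel.
by move=> c x y; rewrite scalerDr !scalerA mulrC.
Qed.
Lemma lslice_lin phi : lin phi -> lin (lslice phi).
Proof. by move=> lp; apply/text_lin/lslice_bilin. Qed.
Lemma rslice_lin psi : lin psi -> lin (rslice psi).
Proof. by move=> lp; apply/text_lin/rslice_bilin. Qed.
Lemma lslice_pure phi a b : lin phi -> lslice phi (pure a b) = phi a *: b.
Proof. by move=> lp; rewrite /lslice text_pure //; apply: lslice_bilin. Qed.
Lemma rslice_pure psi a b : lin psi -> rslice psi (pure a b) = psi b *: a.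
Proof. by move=> lp; rewrite /rslice text_pure //; apply: rslice_bilin. Qed.

Lemma slice_swap phi psi F : lin phi -> lin psi -> phi (rslice psi F) = psi (lslice phi F).
Proof.
move=> lp lq; move: F; apply: lin_eq_tens => [||a b].
- exact: lin_comp (rslice_lin lq) lp.
- exact: lin_comp (lslice_lin lp) lq.
by rewrite rslice_pure // lslice_pure // (linZ lp) (linZ lq) [LHS]mulrC.
Qed.

Lemma lslice_eq0 F : (forall phi, lin phi -> lslice phi F = 0) -> F = 0.
Proof.
move=> h; apply: tens_eq; apply/funext => -[phi lp]; rewrite tenv0 -(h phi lp).
rewrite -[F in LHS]trepK /lslice tenv_sum /text.
by apply: eq_bigr => w _; rewrite tenv_pure.
Qed.

Lemma rslice_eq0 F : (forall psi, lin psi -> rslice psi F = 0) -> F = 0.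
Proof.
move=> h; apply: lslice_eq0 => phi lp; apply: functional_eq0 => psi lq.
by rewrite -slice_swap // h // (lin0 lp).
Qed.

(** The sum is shortened until the right entries are linearly independent; each left entry is then
    itself a slice. *)
Lemma rslice_decomp (X : A -> Prop) F : subspace X ->
  (forall psi, lin psi -> X (rslice psi F)) ->
  exists n (a : 'I_n -> A) (b : 'I_n -> B),
    (forall i, X (a i)) /\ F = \sum_(i < n) pure (a i) (b i).
Proof.
move=> sX hX; have [n [a [b eF]]] := tens_sum F; elim: n a b F eF hX => [|n IHn] a b F eF hX.
  by exists 0%N, a, b; split=> // -[].
have [[c ec]|nspan] := pselect (exists c : 'I_n -> K,
    b ord0 = \sum_(i < n) c i *: b (lift ord0 i)).
  apply: (IHn (fun i => a (lift ord0 i) + c i *: a ord0) (fun i => b (lift ord0 i))) => //.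
  rewrite eF big_ord_recl ec (lin_sum (proj2 (pure_bilin A B) _)) -big_split /=.
  by apply: eq_bigr => i _; rewrite pureDl pureZl pureZr addrC.
have [psi [lpsi psi1 psi0]] := subspace_separation (lincomb_subspace _) nspan.
have X0 : X (a ord0).
  have := hX psi lpsi; rewrite eF (lin_sum (rslice_lin lpsi)) big_ord_recl.
  rewrite rslice_pure // psi1 scale1r big1 ?addr0 // => i _.
  by rewrite rslice_pure // psi0 ?scale0r //; apply: lincomb_mem.
have [||m [a' [b' [Xa' eF']]]] := IHn (fun i => a (lift ord0 i))
    (fun i => b (lift ord0 i)) (F - pure (a ord0) (b ord0)).
- by rewrite eF big_ord_recl addrC addKr.
- move=> chi lchi; rewrite (linB (rslice_lin lchi)) rslice_pure //.
  by apply: (subspaceB sX); [apply: hX|apply: (subspaceZ sX)].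
exists m.+1, (fun i => if unlift ord0 i is Some j then a' j else a ord0),
  (fun i => if unlift ord0 i is Some j then b' j else b ord0); split.
  by move=> i; case: unlift.
rewrite big_ord_recl unlift_none -(subrK (pure (a ord0) (b ord0)) F) eF' addrC.
by congr (_ + _); apply: eq_bigr => i _; rewrite liftK.
Qed.

End TensorAlgebra.

(** * Convolution *)

(** The closure properties under which derived subgroups can be constructed. Both categories of test
    algebras have them, so affine groups and supergroups are treated together. *)
Record cat_closed (K : fieldType) (C : test_category K) : Prop := CatClosed {
  closed_supercommutative : forall A : superalgebra K, C A -> supercommutative A;
  closed_tensor : forall A B : superalgebra K, C A -> C B -> C (tensor A B);
  closed_quotient : forall (A : superalgebra K) (I : superideal A), C A -> C (squotient I);
  closed_sub : forall (A B : superalgebra K) (f : shom B A), injective f -> C A -> C B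
}.

Lemma salg_cat_closed (K : fieldType) : cat_closed (salg_cat K).
Proof.
split=> //.
- exact: tens_supercommutative.
- by move=> A I; apply: squotient_supercommutative.
- move=> A B f f_inj sA i j x y hx hy; apply: f_inj.
  rewrite sign_scale linearZ !rmorphM /= -sign_scale.
  by apply: sA; apply: shom_gr.
Qed.

Lemma alg_cat_closed (K : fieldType) : cat_closed (alg_cat K).
Proof.
split.
- by move=> A [].
- move=> A B [sA eA] [sB eB]; split; first exact: tens_supercommutative.
  exact: tens_purely_even.
- move=> A I [sA eA]; split; first exact: squotient_supercommutative.
  by move=> _ [x hx <-]; rewrite (eA _ hx) -[RHS]squot_pi0.
- move=> A B f f_inj [sA eA]; split; first exact: (closed_sub (salg_cat_closed K)) f_inj sA.
  by move=> x hx; apply: f_inj; rewrite raddf0; apply/eA/shom_gr.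
Qed.

Section Identity.
Variables (K : fieldType) (A : superalgebra K).
Definition sid : shom A A := @SHom K A A idfun (fun _ _ h => h).
Lemma sidE a : sid a = a. Proof. by []. Qed.

Lemma scomp_id (B : superalgebra K) (f : shom A B) : scomp f sid = f.
Proof. exact: shom_ext. Qed.
Lemma id_scomp (B : superalgebra K) (f : shom B A) : scomp sid f = f.
Proof. exact: shom_ext. Qed.
Lemma scompA (B C D : superalgebra K) (h : shom C D) (g : shom B C) (f : shom A B) :
  scomp h (scomp g f) = scomp (scomp h g) f.
Proof. exact: shom_ext. Qed.

Definition galg_fun (c : ground K) : A := c%:A.
Lemma galg_linear : linear galg_fun.
Proof. by move=> c x y; rewrite /galg_fun scalerDl scalerA. Qed.
Lemma galg_monoid : monoid_morphism galg_fun.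
Proof.
split=> [|x y]; first exact: scale1r.
by rewrite /galg_fun mulr_algl scalerA.
Qed.
HB.instance Definition _ := GRing.isLinear.Build K (ground K) A _ galg_fun galg_linear.
HB.instance Definition _ := GRing.isMonoidMorphism.Build (ground K) A galg_fun galg_monoid.
Lemma galg_gr i c : gr i c -> gr i (galg_fun c).
Proof.
case: i => /= h; last exact: gr_alg.
by rewrite /galg_fun (h isT) scale0r; apply: gr0.
Qed.
Definition galg : shom (ground K) A := @SHom K (ground K) A galg_fun galg_gr.
Lemma galgE c : galg c = c%:A. Proof. by []. Qed.
End Identity.

Section GroupLaws.
Variables (K : fieldType) (C : test_category K) (G : group_scheme C).
Variable R : obj C.
Implicit Types f g h : point G R.

Lemma gmulVr f : gmul f (ginv f) = gone G R.
Proof.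
rewrite -[LHS]gmul1 -(gmulV (ginv f)) -gmulA [gmul (ginv f) (gmul _ _)]gmulA.
by rewrite gmulV gmul1.
Qed.
Lemma gmulr1 f : gmul f (gone G R) = f.
Proof. by rewrite -(gmulV f) gmulA gmulVr gmul1. Qed.
Lemma gmulI f g h : gmul f g = gmul f h -> g = h.
Proof. by move=> /(congr1 (gmul (ginv f))); rewrite !gmulA gmulV !gmul1. Qed.
Lemma gmul_idem f : gmul f f = f -> f = gone G R.
Proof. by move=> e; apply: (@gmulI f); rewrite gmulr1. Qed.
Lemma ginv_uniq f g : gmul g f = gone G R -> g = ginv f.
Proof. by move=> e; rewrite -[RHS]gmul1 -e -gmulA gmulVr gmulr1. Qed.
Lemma ginvK f : ginv (ginv f) = f.
Proof. by apply/esym/ginv_uniq/gmulVr. Qed.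
Lemma ginvM f g : ginv (gmul f g) = gmul (ginv g) (ginv f).
Proof.
apply/esym/ginv_uniq; rewrite -gmulA [gmul (ginv f) _]gmulA gmulV gmul1.
exact: gmulV.
Qed.
Lemma ginv1 : ginv (gone G R) = gone G R.
Proof. by rewrite -[LHS]gmulr1 gmulV. Qed.

Definition gconj f g : point G R := gmul (gmul f g) (ginv f).
Definition gcomm f g : point G R := gmul (gmul f g) (ginv (gmul g f)).

Lemma gcommE f g : gmul (gcomm f g) (gmul g f) = gmul f g.
Proof. by rewrite /gcomm -gmulA gmulV gmulr1. Qed.
End GroupLaws.

Section GroupNat.
Variables (K : fieldType) (C : test_category K) (G : group_scheme C).
Variables (R S : obj C) (phi : shom R S).

Lemma gone_nat : scomp phi (gone G R) = gone G S.
Proof. by apply: gmul_idem; rewrite -gmul_nat gmul1. Qed.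
Lemma ginv_nat (f : point G R) : scomp phi (ginv f) = ginv (scomp phi f).
Proof. by apply: ginv_uniq; rewrite -gmul_nat gmulV gone_nat. Qed.
Lemma gcomm_nat (f g : point G R) :
  scomp phi (gcomm f g) = gcomm (scomp phi f) (scomp phi g).
Proof. by rewrite /gcomm gmul_nat ginv_nat !gmul_nat. Qed.
Lemma gconj_nat (f g : point G R) :
  scomp phi (gconj f g) = gconj (scomp phi f) (scomp phi g).
Proof. by rewrite /gconj !gmul_nat ginv_nat. Qed.
End GroupNat.

Section GroupMor.
Variables (K : fieldType) (C : test_category K) (H G : group_scheme C) (p : gmor H G).
Variable R : obj C.

Lemma gone_mor : scomp (gone H R) (comorph p) = gone G R.
Proof. by apply: gmul_idem; rewrite -comorphM gmul1. Qed.
Lemma ginv_mor (f : point H R) : scomp (ginv f) (comorph p) = ginv (scomp f (comorph p)).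
Proof. by apply: ginv_uniq; rewrite -comorphM gmulV gone_mor. Qed.
Lemma gcomm_mor (f g : point H R) :
  scomp (gcomm f g) (comorph p) = gcomm (scomp f (comorph p)) (scomp g (comorph p)).
Proof. by rewrite /gcomm comorphM ginv_mor !comorphM. Qed.
Lemma counit_mor a : counit H (comorph p a) = counit G a.
Proof.
rewrite /counit.
have e : gmul (scomp (gone H (ground_obj C)) (comorph p)) (scomp (gone H (ground_obj C)) (comorph
  p))
   = scomp (gone H (ground_obj C)) (comorph p) by rewrite -comorphM gmul1.
exact: (congr1 (fun f : point G (ground_obj C) => f a) (gmul_idem e)).
Qed.
End GroupMor.

Section Convolution.
Variables (K : fieldType) (C : test_category K) (hC : cat_closed C).
Variable G : group_scheme C.
Let A : obj C := coord G.

Definition tens_obj (R S : obj C) : obj C := Obj (closed_tensor hC (objP R) (objP S)).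

Definition obj_lift (P R S : obj C) (f : shom P S) (g : shom R S) : shom (tens_obj P R) S :=
  tlift f g (closed_supercommutative hC (objP S)).

(** The product of the two universal points. By naturality every product of points factors through
    it, which is how the coproduct is recovered from the functor ([gmulE]). *)
Definition comult : point G (tens_obj A A) :=
  @gmul _ _ G (tens_obj A A) (tinl A A) (tinr A A).

Definition cop (a : A) : seq (A * A) := trep (comult a).

Definition conv (R : algType K) (p q : A -> R) (a : A) : R :=
  \sum_(w <- cop a) p w.1 * q w.2.

Lemma mul_bilin (R : algType K) (U V : lmodType K) (p : U -> R) (q : V -> R) :
  lin p -> lin q -> bilin (fun x y => p x * q y).
Proof.
move=> lp lq; split=> v; first exact: (lin_comp lp (lin_mull (q v))).
exact: (lin_comp lq (lin_mulr (p v))).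
Qed.

Lemma convE (R : algType K) (p q : A -> R) a :
  conv p q a = text (fun x y => p x * q y) (comult a).
Proof. by []. Qed.

Lemma gmulE (R : obj C) (f g : point G R) a : gmul f g a = conv f g a.
Proof.
have e : gmul f g = scomp (obj_lift f g) comult.
  by rewrite /comult gmul_nat [scomp _ (tinl _ _)]tlift_inl [scomp _ (tinr _ _)]tlift_inr.
rewrite e /= convE -[RHS]/(tlift_fun f g (comult a)) //.
Qed.

Lemma conv_lin (R : algType K) (p q : A -> R) : lin p -> lin q -> lin (conv p q).
Proof.
move=> lp lq c x y; rewrite !convE linearP.
by rewrite (text_lin (mul_bilin lp lq)).
Qed.

(** Coassociativity is associativity for the three universal points over the triple tensor product.
    As [p], [q], [r] are merely linear, they are applied afterwards, through the linear map
    [text beta]. *)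
Lemma convA (R : algType K) (p q r : A -> R) : lin p -> lin q -> lin r ->
  conv p (conv q r) = conv (conv p q) r.
Proof.
move=> lp lq lr; apply/funext => a.
pose T3 := tens_obj A (tens_obj A A).
pose X : point G T3 := tinl A (tensor A A).
pose Y : point G T3 := scomp (tinr A (tensor A A)) (tinl A A).
pose Z : point G T3 := scomp (tinr A (tensor A A)) (tinr A A).
pose beta (x : A) (F : tensor A A) : R := p x * text (fun y z => q y * r z) F.
have bb : bilin beta.
  apply: (mul_bilin lp); exact: text_lin (mul_bilin lq lr).
have lb : lin (text beta : T3 -> R) by apply: text_lin.
have e3 x y z : text beta (X x * (Y y * Z z)) = p x * (q y * r z).
  rewrite /X /Y /Z /= -rmorphM tinl_tinr text_pure // /beta.
  have -> : inl_fun A y * inr_fun A z = pure y z :> tensor A A by exact: tinl_tinr.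
  by rewrite text_pure //; apply: mul_bilin.
have lZ (f : point G T3) : lin f by apply: shom_lin.
have := congr1 (fun f : point G T3 => text beta (f a)) (gmulA X Y Z).
rewrite /= !gmulE /conv !(lin_sum lb) => e.
rewrite -[LHS](_ : \sum_(w <- cop a) text beta (X w.1 * gmul Y Z w.2) = _); last first.
  apply: eq_bigr => w _; rewrite gmulE /conv mulr_sumr (lin_sum lb) mulr_sumr.
  by apply: eq_bigr => v _; rewrite e3.
rewrite e; apply: eq_bigr => w _; rewrite gmulE /conv mulr_suml (lin_sum lb) mulr_suml.
by apply: eq_bigr => v _; rewrite -mulrA e3 mulrA.
Qed.

Definition eps (R : algType K) (a : A) : R := (counit G a : K)%:A.

Lemma goneE (R : obj C) a : gone G R a = eps R a.
Proof.
rewrite -(gone_nat G (R := ground_obj C) (galg R)) //.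
Qed.

Lemma conv1 (R : algType K) (p : A -> R) : lin p -> conv (@eps R) p = p.
Proof.
move=> lp; apply/funext => a.
have := congr1 (fun f : point G A => p (f a)) (gmul1 (sid A : point G A)).
rewrite gmulE sidE => <-; rewrite /conv (lin_sum lp); apply: eq_bigr => w _.
by rewrite goneE /eps sidE !mulr_algl (linZ lp).
Qed.

Lemma convr1 (R : algType K) (p : A -> R) : lin p -> conv p (@eps R) = p.
Proof.
move=> lp; apply/funext => a.
have := congr1 (fun f : point G A => p (f a)) (gmulr1 (sid A : point G A)).
rewrite gmulE sidE => <-; rewrite /conv (lin_sum lp); apply: eq_bigr => w _.
by rewrite goneE /eps sidE !mulr_algr (linZ lp).
Qed.

Definition antip : point G A := ginv (sid A : point G A).

Lemma ginvE (R : obj C) (f : point G R) : ginv f = scomp f antip.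
Proof. by rewrite /antip ginv_nat scomp_id. Qed.

Lemma convS (R : obj C) (f : point G R) : conv f (f \o antip) = @eps R.
Proof.
apply/funext => a; rewrite -goneE -(gmulVr f) gmulE ginvE //.
Qed.

Lemma cop_rslice (psi : A -> K^o) a : lin psi ->
  rslice psi (comult a) = \sum_(w <- cop a) psi w.2 *: w.1.
Proof. by []. Qed.
Lemma cop_lslice (psi : A -> K^o) a : lin psi ->
  lslice psi (comult a) = \sum_(w <- cop a) psi w.1 *: w.2.
Proof. by []. Qed.

End Convolution.

(* Names that stay available where a local notation hides the constant. *)
Notation convolution := conv (only parsing).
Notation comultiplication := comult (only parsing).

Section MkShom.
Variables (K : fieldType) (A B : superalgebra K) (f : A -> B).
Hypotheses (lf : linear f) (mf : monoid_morphism f) (gf : forall i x, gr i x -> gr i (f x)).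
(** The proofs are arguments of the alias so that the canonical instances attached to it can
    retrieve them. *)
Definition mkf (_ : linear f) (_ : monoid_morphism f) := f.
HB.instance Definition _ := GRing.isLinear.Build K A B _ (mkf lf mf) lf.
HB.instance Definition _ := GRing.isMonoidMorphism.Build A B (mkf lf mf) mf.
Definition mk_shom : shom A B := @SHom K A B (mkf lf mf) gf.

End MkShom.

Lemma shom_factor_inj (K : fieldType) (P S R : superalgebra K) (j : shom S R) (f : shom P R) :
  injective j -> (forall x, exists y, j y = f x) -> exists h : shom P S, scomp j h = f.
Proof.
move=> j_inj ex; pose h x := projT1 (cid (ex x)).
have hE x : j (h x) = f x by rewrite /h; case: cid.
move: h hE => h hE.
have lh : linear h.
  by move=> c x y; apply: j_inj; rewrite hE (shom_lin f) (shom_lin j) !hE.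
have mh : monoid_morphism h.
  by split=> [|x y]; apply: j_inj; rewrite ?(shomM j) ?shom1 !hE ?shomM ?shom1.
have gh i x : gr i x -> gr i (h x).
  move=> hx; apply: gr_pj; apply: j_inj; rewrite shom_pj hE.
  by rewrite pj_id //; apply: shom_gr.
by exists (mk_shom lh mh gh); apply: shom_ext => x; exact (hE x).
Qed.

Lemma shom_factor_surj (K : fieldType) (A B R : superalgebra K) (p : shom A B) (f : shom A R) :
  (forall y, exists x, p x = y) -> (forall x, p x = 0 -> f x = 0) ->
  exists g : shom B R, scomp g p = f.
Proof.
move=> surj kill; pose h y := f (projT1 (cid (surj y))).
have hE x : h (p x) = f x.
  apply/eqP; rewrite -subr_eq0 -raddfB; apply/eqP/kill.
  by rewrite raddfB; case: cid => z /= ->; rewrite subrr.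
move: h hE => h hE.
have lh : linear h.
  move=> c u v; have [x <-] := surj u; have [y <-] := surj v.
  by rewrite -(shom_lin p) !hE (shom_lin f).
have mh : monoid_morphism h.
  split=> [|u v]; first by rewrite -(shom1 p) hE shom1.
  by have [x <-] := surj u; have [y <-] := surj v; rewrite -shomM !hE shomM.
have gh i u : gr i u -> gr i (h u).
  move=> hu; have [x ex] := surj u; rewrite -(pj_id hu) -ex -shom_pj hE.
  exact/shom_gr/pj_gr.
by exists (mk_shom lh mh gh); apply: shom_ext => x; exact (hE x).
Qed.

Section SubSuper.
Variables (K : fieldType) (A : superalgebra K).

Record subsuper := SubSuper {
  subsuper_pred :> A -> Prop;
  subsuper_sub : subspace subsuper_pred;
  subsuper1 : subsuper_pred 1;
  subsuperM : forall x y, subsuper_pred x -> subsuper_pred y -> subsuper_pred (x * y);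
  subsuper_pj : forall i x, subsuper_pred x -> subsuper_pred (pj i x)
}.

Variable X : subsuper.

Definition subsuper_mem : {pred A} := fun x => `[< X x >].

Record ssub := SSub { ssval : A; ssvalP : subsuper_mem ssval }.
HB.instance Definition _ := [isSub for ssval].
HB.instance Definition _ := [Choice of ssub by <:].

Lemma subsuper_closed : GRing.subsemialg_closed subsuper_mem.
Proof.
split; first exact/asboolP/subsuper1.
- split; first by apply/asboolP; apply: (subspace0 (subsuper_sub X)).
    by move=> x y /asboolP hx /asboolP hy; apply/asboolP/(subspaceD (subsuper_sub X)).
  by move=> c x /asboolP hx; apply/asboolP/(subspaceZ (subsuper_sub X)).
- by move=> x y /asboolP hx /asboolP hy; apply/asboolP/subsuperM.
Qed.

HB.instance Definition _ :=
  GRing.SubChoice_isSubAlgebra.Build K A subsuper_mem ssub subsuper_closed.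

Definition ssub_gr (i : bool) (x : ssub) : Prop := gr i (ssval x).

Lemma ssval_lin (c : K) (x y : ssub) : ssval (c *: x + y) = c *: ssval x + ssval y.
Proof. exact: (linearP (\val : ssub -> A)). Qed.
Lemma ssvalD (x y : ssub) : ssval (x + y) = ssval x + ssval y.
Proof. exact: (raddfD (\val : ssub -> A)). Qed.
Lemma ssval0 : ssval 0 = 0.
Proof. exact: (raddf0 (\val : ssub -> A)). Qed.
Lemma ssval1 : ssval 1 = 1.
Proof. exact: (rmorph1 (\val : ssub -> A)). Qed.
Lemma ssvalM (x y : ssub) : ssval (x * y) = ssval x * ssval y.
Proof. exact: (rmorphM (\val : ssub -> A)). Qed.

Lemma ssub_gr0 i : ssub_gr i 0.
Proof. by rewrite /ssub_gr ssval0; apply: gr0. Qed.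
Lemma ssub_grP i (c : K) x y : ssub_gr i x -> ssub_gr i y -> ssub_gr i (c *: x + y).
Proof. by rewrite /ssub_gr ssval_lin; apply: grP. Qed.
Lemma ssub_gr_split x : exists x0 x1, [/\ ssub_gr false x0, ssub_gr true x1 & x = x0 + x1].
Proof.
have h i : subsuper_mem (pj i (ssval x)).
  by apply/asboolP/subsuper_pj/asboolP; apply: (ssvalP x).
exists (SSub (h false)), (SSub (h true)); split; try exact: pj_gr.
by apply: val_inj; rewrite [RHS]ssvalD [LHS]pj_split.
Qed.
Lemma ssub_gr_direct x : ssub_gr false x -> ssub_gr true x -> x = 0.
Proof. by move=> h0 h1; apply: val_inj; rewrite [RHS]ssval0; apply: gr_direct. Qed.
Lemma ssub_gr1 : ssub_gr false 1.
Proof. by rewrite /ssub_gr ssval1; apply: gr1. Qed.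
Lemma ssub_grM i j x y : ssub_gr i x -> ssub_gr j y -> ssub_gr (i (+) j) (x * y).
Proof. by rewrite /ssub_gr ssvalM; apply: grM. Qed.

Definition ssubalg : superalgebra K :=
  @Superalgebra K ssub ssub_gr ssub_gr0 ssub_grP ssub_gr_split ssub_gr_direct
    ssub_gr1 ssub_grM.

Lemma ssval_linear : linear (ssval : ssubalg -> A).
Proof. exact: ssval_lin. Qed.
Lemma ssval_monoid : monoid_morphism (ssval : ssubalg -> A).
Proof. by split; [exact: ssval1 | exact: ssvalM]. Qed.
Definition sincl : shom ssubalg A :=
  mk_shom ssval_linear ssval_monoid (fun _ _ h => h).

Lemma sincl_inj : injective sincl.
Proof. exact: val_inj. Qed.
Lemma sinclP x : X (sincl x).
Proof. exact/asboolP/(ssvalP x). Qed.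
Lemma sincl_surj x : X x -> exists y, sincl y = x.
Proof. by move=> h; exists (SSub (introT (asboolP _) h)). Qed.
End SubSuper.

Section TensorMap.
Variables (K : fieldType) (A B A' B' : superalgebra K) (f : shom A' A) (g : shom B' B).
Variables (sA : supercommutative A) (sB : supercommutative B).

Definition tmap : shom (tensor A' B') (tensor A B) :=
  tlift (scomp (tinl A B) f) (scomp (tinr A B) g) (tens_supercommutative sA sB).

Lemma tmap_pure a b : tmap (pure a b) = pure (f a) (g b).
Proof. by rewrite tliftE [LHS]tinl_tinr. Qed.

Lemma tmap_inl : scomp tmap (tinl A' B') = scomp (tinl A B) f.
Proof. exact: tlift_inl. Qed.
Lemma tmap_inr : scomp tmap (tinr A' B') = scomp (tinr A B) g.
Proof. exact: tlift_inr. Qed.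

Lemma tmap_rslice (psi : B -> K^o) F : lin psi ->
  rslice psi (tmap F) = f (rslice (psi \o g) F).
Proof.
move=> lpsi; have lpg : lin (psi \o g) := lin_comp (shom_lin g) lpsi.
move: F; apply: lin_eq_tens => [||a b].
- exact: lin_comp (shom_lin tmap) (rslice_lin lpsi).
- exact: lin_comp (rslice_lin lpg) (shom_lin f).
by rewrite tmap_pure !rslice_pure // linearZ.
Qed.

Lemma tmap_lslice (phi : A -> K^o) F : lin phi ->
  lslice phi (tmap F) = g (lslice (phi \o f) F).
Proof.
move=> lphi; have lpg : lin (phi \o f) := lin_comp (shom_lin f) lphi.
move: F; apply: lin_eq_tens => [||a b].
- exact: lin_comp (shom_lin tmap) (lslice_lin lphi).
- exact: lin_comp (lslice_lin lpg) (shom_lin g).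
by rewrite tmap_pure !lslice_pure // linearZ.
Qed.

Lemma tmap_inj : injective f -> injective g -> injective tmap.
Proof.
move=> fi gi; apply: raddf_inj => F e0; apply: lslice_eq0 => phi lphi.
apply: gi; rewrite raddf0; apply: functional_eq0 => psi lpsi.
have lpg : lin (psi \o g) := lin_comp (shom_lin g) lpsi.
have := tmap_rslice F lpsi; rewrite e0 (lin0 (rslice_lin lpsi)).
move=> /esym; rewrite -[X in _ = X -> _](raddf0 f) => /fi e.
by rewrite -[LHS]/((psi \o g) _) -slice_swap // e (lin0 lphi).
Qed.
End TensorMap.

(** Complement to [rslice_decomp], for left entries that already lie in [X]: once these are linearly
    independent, each right entry is a slice and lies in [Y]. *)
Lemma lslice_decomp (K : fieldType) (A B : superalgebra K) (X : A -> Prop) (Y : B -> Prop)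
    (F : tensor A B) n (a : 'I_n -> A) (b : 'I_n -> B) : subspace Y ->
  (forall i, X (a i)) -> F = \sum_(i < n) pure (a i) (b i) ->
  (forall phi, lin phi -> Y (lslice phi F)) ->
  exists n (a : 'I_n -> A) (b : 'I_n -> B),
    [/\ forall i, X (a i), forall i, Y (b i) & F = \sum_(i < n) pure (a i) (b i)].
Proof.
move=> sY; elim: n a b F => [|n IHn] a b F Xa eF hY.
  by exists 0%N, a, b; split=> // -[].
have [[c ec]|nspan] := pselect (exists c : 'I_n -> K,
    a ord0 = \sum_(i < n) c i *: a (lift ord0 i)).
  apply: (IHn (fun i => a (lift ord0 i)) (fun i => b (lift ord0 i) + c i *: b ord0)) => //.
  rewrite eF big_ord_recl ec (lin_sum (proj1 (pure_bilin A B) _)) -big_split /=.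
  by apply: eq_bigr => i _; rewrite pureDr pureZl pureZr addrC.
have [phi [lphi phi1 phi0]] := subspace_separation (lincomb_subspace _) nspan.
have Y0 : Y (b ord0).
  have := hY phi lphi; rewrite eF (lin_sum (lslice_lin lphi)) big_ord_recl.
  rewrite lslice_pure // phi1 scale1r big1 ?addr0 // => i _.
  by rewrite lslice_pure // phi0 ?scale0r //; apply: lincomb_mem.
have [|||m [a' [b' [Xa' Yb' eF']]]] := IHn (fun i => a (lift ord0 i))
    (fun i => b (lift ord0 i)) (F - pure (a ord0) (b ord0)).
- by move=> i; apply: Xa.
- by rewrite eF big_ord_recl addrC addKr.
- move=> chi lchi; rewrite (linB (lslice_lin lchi)) lslice_pure //.
  by apply: (subspaceB sY); [apply: hY|apply: (subspaceZ sY)].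
exists m.+1, (fun i => if unlift ord0 i is Some j then a' j else a ord0),
  (fun i => if unlift ord0 i is Some j then b' j else b ord0); split.
- by move=> i; case: unlift.
- by move=> i; case: unlift.
rewrite big_ord_recl unlift_none -(subrK (pure (a ord0) (b ord0)) F) eF' addrC.
by congr (_ + _); apply: eq_bigr => i _; rewrite liftK.
Qed.

(** * The derived subgroup *)

Section ClosedSubgroup.
Variables (K : fieldType) (C : test_category K) (hC : cat_closed C).
Variables (G : group_scheme C) (I : superideal (coord G)).

(** The points of the closed subfunctor cut out by [I]. The subgroup axioms below are imposed on
    these points over all test algebras rather than on the coproduct of [I]. *)
Definition kills (R : obj C) (f : point G R) : Prop := forall x, I x -> f x = 0.

Hypothesis killsM : forall (R : obj C) (f g : point G R), kills f -> kills g -> kills (gmul f g).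
Hypothesis kills1 : forall R : obj C, kills (gone G R).
Hypothesis killsV : forall (R : obj C) (f : point G R), kills f -> kills (ginv f).

Definition subg_coord : obj C := Obj (closed_quotient hC I (objP (coord G))).

Definition subg_res (R : obj C) (f : shom subg_coord R) : point G R := scomp f (squot_pi I).

Lemma subg_res_kills (R : obj C) (f : shom subg_coord R) : kills (subg_res f).
Proof.
move=> x hx; rewrite /subg_res /=.
have -> : squot_pi_fun I x = 0 by rewrite -(squot_pi0 I); apply/squot_piP; rewrite subr0.
exact: raddf0.
Qed.

Definition subg_lift (R : obj C) (f : point G R) (kf : kills f) : shom subg_coord R :=
  squot_lift kf.

Lemma subg_liftK (R : obj C) (f : point G R) (kf : kills f) : subg_res (subg_lift kf) = f.
Proof. exact: squot_liftK. Qed.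

Lemma subg_res_inj (R : obj C) : injective (@subg_res R).
Proof. by move=> f g; apply: squot_pi_epi. Qed.

Definition subg_mul (R : obj C) (f g : shom subg_coord R) : shom subg_coord R :=
  subg_lift (killsM (@subg_res_kills R f) (@subg_res_kills R g)).
Definition subg_one (R : obj C) : shom subg_coord R := subg_lift (@kills1 R).
Definition subg_inv (R : obj C) (f : shom subg_coord R) : shom subg_coord R :=
  subg_lift (killsV (@subg_res_kills R f)).

Lemma subg_mulA (R : obj C) : associative (@subg_mul R).
Proof. by move=> f g h; apply: subg_res_inj; rewrite !subg_liftK gmulA. Qed.
Lemma subg_mul1 (R : obj C) : left_id (@subg_one R) (@subg_mul R).
Proof. by move=> f; apply: subg_res_inj; rewrite !subg_liftK gmul1. Qed.
Lemma subg_mulV (R : obj C) : left_inverse (@subg_one R) (@subg_inv R) (@subg_mul R).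
Proof. by move=> f; apply: subg_res_inj; rewrite !subg_liftK gmulV. Qed.
Lemma subg_mul_nat (R S : obj C) (phi : shom R S) (f g : shom subg_coord R) :
  scomp phi (subg_mul f g) = subg_mul (scomp phi f) (scomp phi g).
Proof.
have resE h : subg_res (scomp phi h) = scomp phi (subg_res h) by exact: shom_ext.
by apply: subg_res_inj; rewrite resE !subg_liftK gmul_nat -!resE.
Qed.

Definition subg : group_scheme C :=
  GroupScheme subg_mulA subg_mul1 subg_mulV subg_mul_nat.

Lemma subg_morM (R : obj C) (f g : point subg R) :
  scomp (gmul f g) (squot_pi I) = gmul (scomp f (squot_pi I)) (scomp g (squot_pi I)).
Proof. exact: subg_liftK. Qed.

Definition subg_mor : gmor subg G := @GMor K C subg G (squot_pi I) subg_morM.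

Lemma subg_mor_closed : closed_embedding subg_mor.
Proof. exact: squot_pi_surj. Qed.

Lemma subg_mor0 x : comorph subg_mor x = 0 <-> I x.
Proof.
rewrite -[in X in _ <-> X](subr0 x) -squot_piP squot_pi0 //.
Qed.

Lemma subg_mor_point (R : obj C) (f : point G R) : kills f ->
  exists f' : point subg R, on_points subg_mor f' = f.
Proof. by move=> kf; exists (subg_lift kf); apply: subg_liftK. Qed.

End ClosedSubgroup.

Section Derived.
Variables (K : fieldType) (C : test_category K) (hC : cat_closed C).
Variables (G : group_scheme C).
Local Notation A := (coord G).
Local Notation comult := (comult hC G).
Local Notation cop := (@cop K C hC G).

(* The functions on [G / [G, G]]. *)
Definition cocomm (a : A) : Prop :=
  forall (R : obj C) (x y z w : point G R),
    gmul (gmul (gmul x y) z) w a = gmul (gmul (gmul x z) y) w a.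

Lemma cocomm_subspace : subspace cocomm.
Proof.
split; first by move=> R x y z w; rewrite !shom0.
by move=> c a b ha hb R x y z w; rewrite !shom_lin ha hb.
Qed.
Lemma cocomm1 : cocomm 1.
Proof. by move=> R x y z w; rewrite !shom1. Qed.
Lemma cocommM a b : cocomm a -> cocomm b -> cocomm (a * b).
Proof. by move=> ha hb R x y z w; rewrite !shomM ha hb. Qed.
Lemma cocomm_pj i a : cocomm a -> cocomm (pj i a).
Proof. by move=> ha R x y z w; rewrite !shom_pj ha. Qed.

Definition cosub : subsuper A := SubSuper cocomm_subspace cocomm1 cocommM cocomm_pj.
Local Notation B := (ssubalg cosub).
Local Notation incl := (sincl cosub).

Definition cosub_obj : obj C := Obj (closed_sub hC (@sincl_inj _ _ cosub) (objP A)).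

Lemma point_lslice (phi : A -> K^o) (R : obj C) (f : point G R) a : lin phi ->
  f (lslice phi (comult a)) = lslice phi
    (gmul (R := tens_obj hC A R) (tinl A R) (scomp (tinr A R) f) a).
Proof.
move=> lphi; rewrite cop_lslice // (gmulE hC) /conv (lin_sum (lslice_lin lphi)) shom_sum.
apply: eq_bigr => w _; rewrite shomZ [X in lslice _ X](tinl_tinr (A := A) (B := R)).
by rewrite lslice_pure.
Qed.

Lemma point_rslice (phi : A -> K^o) (R : obj C) (f : point G R) a : lin phi ->
  f (rslice phi (comult a)) = rslice phi
    (gmul (R := tens_obj hC R A) (scomp (tinl R A) f) (tinr R A) a).
Proof.
move=> lphi; rewrite cop_rslice // (gmulE hC) /conv (lin_sum (rslice_lin lphi)) shom_sum.
apply: eq_bigr => w _; rewrite shomZ [X in rslice _ X](tinl_tinr (A := R) (B := A)).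
by rewrite rslice_pure.
Qed.

(** A slice evaluates [a] at a product with one more factor on the left, the universal point, and
    this factor is absorbed by the first of the four points. The outer points [x] and [w] in
    [cocomm] are there to absorb factors on either side. *)
Lemma cocomm_lslice (phi : A -> K^o) a : lin phi -> cocomm a -> cocomm (lslice phi (comult a)).
Proof.
move=> lphi ha R x y z w; rewrite !point_lslice //; congr (lslice phi _).
have nat3 (f g : point G R) : @scomp _ _ R (tens_obj hC A R) (tinr A R) (gmul f g) =
    @gmul _ _ _ (tens_obj hC A R) (scomp (tinr A R) f) (scomp (tinr A R) g).
  exact: (@gmul_nat _ _ G R (tens_obj hC A R)).
rewrite !nat3 !gmulA.
exact (ha (tens_obj hC A R)
  (@gmul _ _ G (tens_obj hC A R) (tinl A R) (scomp (tinr A R) x))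
  (scomp (tinr A R) y) (scomp (tinr A R) z) (scomp (tinr A R) w)).
Qed.

Lemma cocomm_rslice (phi : A -> K^o) a : lin phi -> cocomm a -> cocomm (rslice phi (comult a)).
Proof.
move=> lphi ha R x y z w; rewrite !point_rslice //; congr (rslice phi _).
have nat3 (f g : point G R) : @scomp _ _ R (tens_obj hC R A) (tinl R A) (gmul f g) =
    @gmul _ _ _ (tens_obj hC R A) (scomp (tinl R A) f) (scomp (tinl R A) g).
  exact: (@gmul_nat _ _ G R (tens_obj hC R A)).
have assoc (f1 f2 f3 f4 g : point G (tens_obj hC R A)) :
    gmul (gmul (gmul (gmul f1 f2) f3) f4) g = gmul (gmul (gmul f1 f2) f3) (gmul f4 g).
  by rewrite -gmulA.
rewrite !nat3 !assoc.
exact (ha (tens_obj hC R A) (scomp (tinl R A) x) (scomp (tinl R A) y)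
  (scomp (tinl R A) z) (@gmul _ _ G (tens_obj hC R A) (scomp (tinl R A) w) (tinr R A))).
Qed.

(** Right slices put the left entries into the subalgebra, left slices then do the same for the
    right entries. *)
Lemma cocomm_comult a : cocomm a -> exists n (b c : 'I_n -> A),
  [/\ forall i, cocomm (b i), forall i, cocomm (c i) &
      comult a = \sum_(i < n) pure (b i) (c i)].
Proof.
move=> ha; have [|n [b [c [hb e]]]] := rslice_decomp cocomm_subspace (F := comult a).
  by move=> psi lpsi; apply: cocomm_rslice.
apply: (lslice_decomp cocomm_subspace hb e) => phi lphi; exact: cocomm_lslice.
Qed.

Local Notation sA := (closed_supercommutative hC (objP A)).

Definition cosub2 : shom (tensor B B) (tensor A A) := tmap incl incl sA sA.

Lemma cosub2_inj : injective cosub2.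
Proof. by apply: tmap_inj; apply: sincl_inj. Qed.

Lemma cosub_comult_ex : exists h : shom B (tensor B B),
  scomp cosub2 h = scomp comult incl.
Proof.
apply: shom_factor_inj; first exact: cosub2_inj.
move=> x; have [n [b [c [hb hc e]]]] := cocomm_comult (sinclP x).
have /choice [b' hb'] : forall i, exists y, incl y = b i
  by move=> i; exact: (sincl_surj (X := cosub) (hb i)).
have /choice [c' hc'] : forall i, exists y, incl y = c i
  by move=> i; exact: (sincl_surj (X := cosub) (hc i)).
exists (\sum_(i < n) pure (b' i) (c' i)); rewrite shom_sum [RHS]e.
by apply: eq_bigr => i _; rewrite tmap_pure hb' hc'.
Qed.

Definition cosub_comult : shom B (tensor B B) := projT1 (cid cosub_comult_ex).
Lemma cosub_comultE : scomp cosub2 cosub_comult = scomp comult incl.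
Proof. by rewrite /cosub_comult; case: cid. Qed.

Lemma cocomm_antip a : cocomm a -> cocomm (antip G a).
Proof.
move=> ha R x y z w.
have e (f : point G R) : f (antip G a) = ginv f a by rewrite ginvE.
rewrite !e !ginvM !gmulA; exact/esym/ha.
Qed.

Lemma cosub_antip_ex : exists h : shom B B, scomp incl h = scomp (antip G) incl.
Proof.
apply: (shom_factor_inj (@sincl_inj _ _ cosub)).
move=> x; exact: (sincl_surj (X := cosub) (cocomm_antip (sinclP x))).
Qed.

Definition cosub_antip : shom B B := projT1 (cid cosub_antip_ex).
Lemma cosub_antipE : scomp incl cosub_antip = scomp (antip G) incl.
Proof. by rewrite /cosub_antip; case: cid. Qed.

Definition qmul (R : obj C) (f g : shom cosub_obj R) : shom cosub_obj R :=
  scomp (@tlift K B B R f g (closed_supercommutative hC (objP R))) cosub_comult.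
Definition qone (R : obj C) : shom cosub_obj R := scomp (gone G R) incl.
Definition qinv (R : obj C) (f : shom cosub_obj R) : shom cosub_obj R :=
  scomp f cosub_antip.

Lemma qmul_res (R : obj C) (f g : point G R) :
  qmul (scomp f incl) (scomp g incl) = scomp (gmul f g) incl.
Proof.
have sR := closed_supercommutative hC (objP R).
have -> : gmul f g = scomp (obj_lift hC f g) comult.
  by rewrite /comultiplication gmul_nat [scomp _ (tinl _ _)]tlift_inl [scomp _ (tinr _ _)]tlift_inr.
rewrite -scompA -cosub_comultE scompA /qmul; congr (scomp _ _).
apply: tens_shom_ext; rewrite ?tlift_inl ?tlift_inr -scompA ?tmap_inl ?tmap_inr scompA.
  by rewrite tlift_inl.
by rewrite tlift_inr.
Qed.

Lemma qmul_nat (R S : obj C) (phi : shom R S) (f g : shom cosub_obj R) :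
  scomp phi (qmul f g) = qmul (scomp phi f) (scomp phi g).
Proof.
rewrite /qmul scompA; congr (scomp _ _).
by apply: tens_shom_ext; rewrite -scompA ?tlift_inl ?tlift_inr.
Qed.

Lemma scomp_inj (P S R : superalgebra K) (j : shom S R) (f g : shom P S) :
  injective j -> scomp j f = scomp j g -> f = g.
Proof.
move=> ji e; apply: shom_ext => x; apply: ji.
exact: (congr1 (fun h : shom P R => h x) e).
Qed.

(** Points of the quotient need not lift to [G], so the law is checked on the universal points over
    the triple tensor power of the subalgebra. That algebra embeds into the triple tensor power of
    [K[G]], where the law comes from [G]; specialisation gives the rest. *)
Lemma qmulA (R : obj C) : associative (@qmul R).
Proof.
pose B2 := tens_obj hC cosub_obj cosub_obj; pose B3 := tens_obj hC cosub_obj B2.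
pose A2 := tens_obj hC A A; pose A3 := tens_obj hC A A2.
pose J : shom B3 A3 :=
  tmap incl cosub2 sA (closed_supercommutative hC (objP A2)).
have Ji : injective J by apply: tmap_inj; [exact: sincl_inj|exact: cosub2_inj].
pose X : shom cosub_obj B3 := tinl B (tensor B B).
pose Y : shom cosub_obj B3 := scomp (tinr B (tensor B B)) (tinl B B).
pose Z : shom cosub_obj B3 := scomp (tinr B (tensor B B)) (tinr B B).
have JX : scomp J X = scomp (tinl A (tensor A A) : point G A3) incl by exact: tmap_inl.
have JY : scomp J Y = scomp (scomp (tinr A (tensor A A)) (tinl A A) : point G A3) incl.
  by rewrite /Y scompA tmap_inr -!scompA tmap_inl.
have JZ : scomp J Z = scomp (scomp (tinr A (tensor A A)) (tinr A A) : point G A3) incl.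
  by rewrite /Z scompA tmap_inr -!scompA tmap_inr.
have U : qmul X (qmul Y Z) = qmul (qmul X Y) Z.
  apply: (scomp_inj Ji).
  by rewrite !(qmul_nat (R := B3) (S := A3) J) JX JY JZ !(qmul_res (R := A3)) gmulA.
move=> f g h.
pose phi : shom B3 R := obj_lift hC f (obj_lift hC g h).
have eX : scomp phi X = f by exact: tlift_inl.
have eY : scomp phi Y = g by rewrite /Y scompA [scomp phi _]tlift_inr; exact: tlift_inl.
have eZ : scomp phi Z = h by rewrite /Z scompA [scomp phi _]tlift_inr; exact: tlift_inr.
have := congr1 (fun k : shom cosub_obj B3 => scomp phi k) U.
by rewrite !(qmul_nat (R := B3) (S := R) phi) eX eY eZ.
Qed.

Lemma qone_nat (R S : obj C) (phi : shom R S) : scomp phi (qone R) = qone S.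
Proof. by rewrite /qone scompA gone_nat. Qed.

Lemma qmul1 (R : obj C) : left_id (@qone R) (@qmul R).
Proof.
have U : qmul (qone cosub_obj) (sid B) = sid B.
  apply: (scomp_inj (@sincl_inj _ _ cosub)).
  rewrite (qmul_nat (R := cosub_obj) (S := A) incl) (qone_nat (R := cosub_obj) (S := A) incl)
    scomp_id.
  have := qmul_res (R := A) (gone G A) (sid A); rewrite gmul1 !id_scomp => e; exact e.
move=> f; have := congr1 (fun k : shom cosub_obj cosub_obj => scomp f k) U.
by rewrite (qmul_nat f) qone_nat scomp_id.
Qed.

Lemma qmulV (R : obj C) : left_inverse (@qone R) (@qinv R) (@qmul R).
Proof.
have U : qmul (R := cosub_obj) cosub_antip (sid B) = qone cosub_obj.
  apply: (scomp_inj (@sincl_inj _ _ cosub)).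
  rewrite (qmul_nat (R := cosub_obj) (S := A) incl) (qone_nat (R := cosub_obj) (S := A) incl)
    scomp_id cosub_antipE.
  have := qmul_res (R := A) (antip G) (sid A); rewrite gmulV !id_scomp => e; exact e.
move=> f; have := congr1 (fun k : shom cosub_obj cosub_obj => scomp f k) U.
by rewrite (qmul_nat f) qone_nat scomp_id.
Qed.

Definition abelianization : group_scheme C := GroupScheme qmulA qmul1 qmulV qmul_nat.

Lemma abelianization_morM (R : obj C) (f g : point G R) :
  scomp (gmul f g) incl = @gmul _ _ abelianization R (scomp f incl) (scomp g incl).
Proof. exact/esym/qmul_res. Qed.

Definition abelianization_mor : gmor G abelianization :=
  @GMor K C G abelianization incl abelianization_morM.

(** For universal points, embedded into [A (x) A], this is the identity defining [cocomm] with both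
    outer points equal to 1. *)
Lemma abelianization_abelian : abelian_scheme abelianization.
Proof.
pose B2 := tens_obj hC cosub_obj cosub_obj; pose A2 := tens_obj hC A A.
have U : qmul (tinl B B : shom cosub_obj B2) (tinr B B) = qmul (tinr B B : shom cosub_obj B2)
  (tinl B B).
  apply: (scomp_inj cosub2_inj).
  rewrite !(qmul_nat (R := B2) (S := A2) cosub2).
  rewrite [scomp _ (tinl B B)]tmap_inl [scomp _ (tinr B B)]tmap_inr.
  rewrite !(qmul_res (R := A2)); apply: shom_ext => x.
  have h := sinclP (X := cosub) x; have := h A2 (gone G A2) (tinl A A) (tinr A A) (gone G A2).
  by rewrite !gmulr1 !gmul1.
move=> R f g.
have := congr1 (fun k : shom cosub_obj B2 => scomp (obj_lift hC f g) k) U.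
by rewrite !(qmul_nat (R := B2) (S := R)) [scomp _ (tinl _ _)]tlift_inl [scomp _ (tinr _
  _)]tlift_inr.
Qed.

Lemma abelianization_counit b : counit abelianization b = counit G (incl b).
Proof. by rewrite -(counit_mor abelianization_mor). Qed.

(* The ideal [B^+ K[G]]. *)
Definition coideal (x : A) : Prop :=
  exists n (b : 'I_n -> B) (a : 'I_n -> A),
    (forall i, counit abelianization (b i) = 0) /\ x = \sum_(i < n) incl (b i) * a i.

(** The same ideal indexed by lists and with the first factors taken in [K[G]], a form that is
    easier to close under operations. *)
Definition coseq (x : A) : Prop :=
  exists s : seq (A * A), (forall w, w \in s -> cocomm w.1 /\ counit G w.1 = 0) /\
    x = \sum_(w <- s) w.1 * w.2.

Lemma coidealE x : coideal x <-> coseq x.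
Proof.
split=> [[n [b [a [hb ->]]]]|[s [hs ->]]].
  exists [seq (incl (b i), a i) | i <- enum 'I_n]; split.
    move=> w /mapP [i _ ->] /=; split; first exact: (sinclP (X := cosub)).
    by rewrite -abelianization_counit.
  by rewrite big_map big_enum.
have /choice [b hb] : forall i : 'I_(size s), exists y, incl y = (nth (0, 0) s i).1.
  by move=> i; apply: (sincl_surj (X := cosub)); exact: (hs _ (mem_nth _ (ltn_ord i))).1.
exists (size s), b, (fun i => (nth (0, 0) s i).2); split.
  by move=> i; rewrite abelianization_counit hb; exact: (hs _ (mem_nth _ (ltn_ord i))).2.
by rewrite (big_nth (0, 0)) big_mkord; apply: eq_bigr => i _; rewrite hb.
Qed.

Lemma coseq_gen b a : cocomm b -> counit G b = 0 -> coseq (b * a).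
Proof.
move=> hb eb; exists [:: (b, a)]; rewrite big_seq1; split=> // w.
by rewrite inE => /eqP ->.
Qed.

Lemma coseq_subspace : subspace coseq.
Proof.
split; first by exists [::]; rewrite big_nil.
move=> c x y [s [hs ->]] [t [ht ->]].
exists ([seq (w.1, c *: w.2) | w <- s] ++ t); split.
  by move=> w; rewrite mem_cat => /orP [/mapP [v /hs hv ->]|/ht].
rewrite big_cat big_map scaler_sumr; congr (_ + _).
by apply: eq_bigr => w _; rewrite scalerAr.
Qed.

Lemma counit_pj i (b : A) : counit G b = 0 -> counit G (pj i b) = 0.
Proof. by move=> e; rewrite shom_pj e (lin0 (pj_lin i)). Qed.

Lemma coseq_gen_pj b a i j : cocomm b -> counit G b = 0 -> coseq (pj i b * pj j a).
Proof. by move=> hb eb; apply: coseq_gen; [apply: cocomm_pj|apply: counit_pj]. Qed.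

Lemma coseq_ind (P : A -> Prop) : subspace P ->
  (forall b a, cocomm b -> counit G b = 0 -> P (b * a)) -> forall x, coseq x -> P x.
Proof.
move=> sP h x [s [hs ->]]; apply: (subspace_sum_mem sP) => w /hs [].
exact: h.
Qed.

Lemma coseqMr a x : coseq x -> coseq (x * a).
Proof.
move: x; apply: coseq_ind => [|b a' hb eb]; last by rewrite -mulrA; apply: coseq_gen.
split; first by rewrite mul0r; apply: (subspace0 coseq_subspace).
by move=> c x y hx hy; rewrite (lin_mull a); apply: (subspaceP coseq_subspace).
Qed.

Lemma coseqMl a x : coseq x -> coseq (a * x).
Proof.
move: x; apply: coseq_ind => [|b a' hb eb].
  split; first by rewrite mulr0; apply: (subspace0 coseq_subspace).
  by move=> c x y hx hy; rewrite (lin_mulr a); apply: (subspaceP coseq_subspace).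
rewrite mulrA; apply: coseqMr; rewrite (pj_split a) (pj_split b) mulrDl !mulrDr.
have h i j : coseq (pj i a * pj j b).
  rewrite (sA (pj_gr i a) (pj_gr j b)) sign_scale.
  by apply: (subspaceZ coseq_subspace); apply: coseq_gen_pj.
by apply: (subspaceD coseq_subspace); apply: (subspaceD coseq_subspace).
Qed.

Lemma coseq_counit x : coseq x -> counit G x = 0.
Proof.
move: x; apply: coseq_ind => [|b a _ e]; last by rewrite shomM e mul0r.
split; first exact: shom0.
by move=> c x y hx hy; rewrite shom_lin hx hy scaler0 addr0.
Qed.

Lemma coseq_pj i x : coseq x -> coseq (pj i x).
Proof.
move: x; apply: coseq_ind => [|b a hb eb].
  split; first by rewrite (lin0 (pj_lin i)); apply: (subspace0 coseq_subspace).
  by move=> c x y hx hy; rewrite (pj_lin i); apply: (subspaceP coseq_subspace).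
have h j k : coseq (pj i (pj j b * pj k a)).
  have hg := grM (pj_gr j b) (pj_gr k a).
  have [ei|ni] := eqVneq (j (+) k) i; first by rewrite pj_id -?ei //; apply: coseq_gen_pj.
  by rewrite (pj_neq hg ni); apply: (subspace0 coseq_subspace).
rewrite (pj_split a) (pj_split b) mulrDl !mulrDr !(linD (pj_lin i)).
by apply: (subspaceD coseq_subspace); apply: (subspaceD coseq_subspace).
Qed.

Lemma coideal_sub : subspace coideal.
Proof.
split; first exact/coidealE/(subspace0 coseq_subspace).
move=> c x y /coidealE hx /coidealE hy; apply/coidealE.
exact: (subspaceP coseq_subspace).
Qed.

Lemma coidealB x y : coideal x -> coideal y -> coideal (x - y).
Proof. exact: (subspaceB coideal_sub). Qed.
Lemma coidealMl a x : coideal x -> coideal (a * x).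
Proof. by move=> /coidealE hx; apply/coidealE/coseqMl. Qed.
Lemma coidealMr a x : coideal x -> coideal (x * a).
Proof. by move=> /coidealE hx; apply/coidealE/coseqMr. Qed.
Lemma coideal1 : ~ coideal 1.
Proof.
by move=> /coidealE /coseq_counit; rewrite shom1; apply/eqP/oner_neq0.
Qed.
Lemma coideal_gr x0 x1 : gr false x0 -> gr true x1 -> coideal (x0 + x1) -> coideal x0.
Proof.
move=> h0 h1 /coidealE /(coseq_pj false); rewrite (linD (pj_lin false)).
by rewrite (pj_id h0) (pj_neq h1) // addr0 => /coidealE.
Qed.

Definition derived_ideal : superideal A :=
  Superideal (subspace0 coideal_sub) coidealB coidealMl coidealMr coideal1 coideal_gr.

(** The derived subgroup is the kernel of the map to the abelianization; its subgroup axioms and its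
    normality are read off from this description. *)
Lemma derived_killsP (R : obj C) (f : point G R) :
  kills derived_ideal f <-> scomp f incl = qone R.
Proof.
split=> [kf|e x /coidealE [s [hs ->]]].
  apply: shom_ext => b; rewrite /= goneE /eps.
  have : f (incl b - (counit G (incl b))%:A) = 0.
    apply: kf; apply/coidealE; rewrite -[X in coseq X]mulr1; apply: coseq_gen.
      by apply: (subspaceB cocomm_subspace); [exact: (sinclP (X := cosub))|apply: (subspaceZ
        cocomm_subspace); exact: cocomm1].
    by rewrite shomB shomZ shom1 /= [X in _ - X]mulr1 subrr.
  by rewrite shomB shomZ shom1 => /eqP; rewrite subr_eq0 => /eqP.
rewrite shom_sum; apply: big1_seq => w /hs [hw ew]; rewrite shomM.
have [b eb] := sincl_surj (X := cosub) hw.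
suff -> : f w.1 = 0 by rewrite mul0r.
rewrite -eb; transitivity (gone G R (incl b)).
  exact (congr1 (fun k : shom cosub_obj R => k b) e).
by rewrite goneE eb /eps ew scale0r.
Qed.

Lemma derived_killsM (R : obj C) (f g : point G R) :
  kills derived_ideal f -> kills derived_ideal g -> kills derived_ideal (gmul f g).
Proof.
move=> /derived_killsP ef /derived_killsP eg; apply/derived_killsP.
by rewrite -qmul_res ef eg qmul1.
Qed.
Lemma derived_kills1 (R : obj C) : kills derived_ideal (gone G R).
Proof. exact/derived_killsP. Qed.
Lemma derived_killsV (R : obj C) (f : point G R) :
  kills derived_ideal f -> kills derived_ideal (ginv f).
Proof.
move=> /derived_killsP ef; apply/derived_killsP.
have := qmul_res (ginv f) f; rewrite gmulV ef.
exact: (etrans (esym (@gmulr1 _ _ abelianization R (scomp (ginv f) incl)))).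
Qed.

Definition derived : group_scheme C :=
  subg hC derived_killsM derived_kills1 derived_killsV.
Definition derived_mor : gmor derived G :=
  subg_mor hC derived_killsM derived_kills1 derived_killsV.

Lemma derived_normal : normal_embedding derived_mor.
Proof.
split; first exact: subg_mor_closed.
move=> R g n.
have kn : kills derived_ideal (on_points derived_mor n) by exact: subg_res_kills.
have [|n' e] := @subg_mor_point _ _ hC _ _ derived_killsM derived_kills1 derived_killsV R
    (gmul (gmul g (on_points derived_mor n)) (ginv g)).
  apply/derived_killsP; move/derived_killsP: kn => en.
  rewrite !abelianization_morM en -[qone R]/(gone abelianization R) gmulr1.
  by rewrite -abelianization_morM gmulVr.
by exists n'; rewrite e.
Qed.

Lemma derived_quotient : is_quotient derived_mor abelianization_mor.
Proof.
split; first exact: sincl_inj.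
by move=> x; apply: subg_mor0.
Qed.

Lemma abelian_cocomm (Q : group_scheme C) (pi : gmor G Q) b :
  abelian_scheme Q -> cocomm (comorph pi b).
Proof.
move=> aQ R x y z w.
rewrite -[LHS]/((scomp (gmul (gmul (gmul x y) z) w) (comorph pi)) b).
rewrite -[RHS]/((scomp (gmul (gmul (gmul x z) y) w) (comorph pi)) b).
rewrite !comorphM; move: (scomp x _) (scomp y _) (scomp z _) (scomp w _) => x' y' z' w'.
by rewrite -[gmul (gmul x' y') z']gmulA (aQ _ y' z') gmulA.
Qed.

(** Functions pulled back from an abelian quotient satisfy [cocomm], so the ideal of any such [N] is
    contained in the one constructed here. This is the minimality of the derived subgroup. *)
Lemma min_coideal N (p : gmor N G) : abelian_quotient p ->
  forall x, comorph p x = 0 -> coideal x.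
Proof.
move=> [Q [pi [[_ hpi] aQ]]] x /hpi [n [b [a [hb ->]]]].
apply/coidealE; apply: (subspace_sum coseq_subspace) => i _.
apply: coseq_gen; first exact: abelian_cocomm.
by rewrite counit_mor hb.
Qed.

Lemma derived_is_derived : is_derived derived_mor.
Proof.
split; first exact: derived_normal.
  by exists abelianization, abelianization_mor; split;
    [exact: derived_quotient|exact: abelianization_abelian].
by move=> N p _ /min_coideal h x /h /(subg_mor0 hC derived_killsM derived_kills1 derived_killsV).
Qed.

(** The subgroup constructed above competes in the minimality clause of [is_derived], which pins
    down the ideal of every derived subgroup. *)
Lemma is_derivedE D (p : gmor D G) : is_derived p ->
  closed_embedding p /\ forall x, comorph p x = 0 <-> coideal x.
Proof.
move=> [nE aq minp]; split; first exact: nE.1.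
move=> x; split; first exact: min_coideal.
move=> h; apply: (minp derived derived_mor).
- exact: derived_normal.
- by exists abelianization, abelianization_mor; split;
    [exact: derived_quotient|exact: abelianization_abelian].
- exact/subg_mor0.
Qed.

Lemma derived_cocomm D (p : gmor D G) b : is_derived p -> cocomm b ->
  comorph p b = (counit G b)%:A.
Proof.
move=> /is_derivedE [_ kerp] hb; apply/eqP; rewrite -subr_eq0; apply/eqP.
have -> : (counit G b)%:A = comorph p (counit G b)%:A.
  by rewrite shomZ shom1.
rewrite -shomB; apply/kerp/coidealE.
rewrite -[X in coseq X]mulr1; apply: coseq_gen.
  by apply: (subspaceB cocomm_subspace) => //; apply: (subspaceZ cocomm_subspace); exact: cocomm1.
by rewrite shomB shomZ shom1 [X in _ - X]mulr1 subrr.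
Qed.

(** A commutator becomes trivial in the abelianization, hence kills the ideal of the derived
    subgroup. *)
Lemma derived_comm D (p : gmor D G) (R : obj C) (x y : point G R) : is_derived p ->
  exists d : point D R, on_points p d = gcomm x y.
Proof.
move=> dp; have [surj kerp] := is_derivedE dp.
apply: shom_factor_surj => // a /kerp.
suff : kills derived_ideal (gcomm x y) by apply.
apply/derived_killsP; apply: (etrans (gcomm_mor abelianization_mor x y)).
rewrite /gcomm; set f := scomp x _; set g := scomp y _.
by rewrite (@abelianization_abelian R f g) gmulVr.
Qed.

End Derived.

(** * Points of the derived series *)

Lemma scomp_surj (K : fieldType) (A B R : superalgebra K) (p : shom A B) (f g : shom B R) :
  (forall y, exists x, p x = y) -> scomp f p = scomp g p -> f = g.
Proof.
move=> sp e; apply: shom_ext => y; have [x <-] := sp y.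
exact: (congr1 (fun h : shom A R => h x) e).
Qed.

Section DerivedPoints.
Variables (K : fieldType) (C : test_category K) (hC : cat_closed C).
Variable G : group_scheme C.

(** Products of iterated commutators of [R]-points. They are among the points of the corresponding
    derived subgroup, and triviality of the latter is all that solvability has to supply to the
    Lie-Kolchin argument. Unlike the points of a scheme they come with an induction principle. *)
Inductive dpoint (R : obj C) : nat -> point G R -> Prop :=
| dpoint0 g : dpoint 0 g
| dpoint1 i : dpoint i (gone G R)
| dpointM i f g : dpoint i f -> dpoint i g -> dpoint i (gmul f g)
| dpointC i f g : dpoint i f -> dpoint i g -> dpoint i.+1 (gcomm f g).

Lemma gmor_idP (R : obj C) (f g : point G R) :
  scomp (gmul f g) (sid (coord G)) = gmul (scomp f (sid (coord G))) (scomp g (sid (coord G))).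
Proof. by rewrite !scomp_id. Qed.

Definition gmor_id : gmor G G := GMor gmor_idP.

Lemma gmor_compP (H D : group_scheme C) (q : gmor H G) (p : gmor D H) (R : obj C)
  (f g : point D R) :
  scomp (gmul f g) (scomp (comorph p) (comorph q)) =
  gmul (scomp f (scomp (comorph p) (comorph q))) (scomp g (scomp (comorph p) (comorph q))).
Proof. by rewrite !scompA !comorphM. Qed.

Definition gmor_comp (H D : group_scheme C) (q : gmor H G) (p : gmor D H) : gmor D G :=
  GMor (gmor_compP q p).

Lemma derived_series_dpoint r H : derived_series G r H ->
  exists q : gmor H G, closed_embedding q /\
    forall (R : obj C) (g : point G R), dpoint r g ->
      exists h : point H R, on_points q h = g.
Proof.
elim=> [|{}r {}H D p hH [q [cq hq]] dp].
  exists gmor_id; split; first by move=> y; exists y.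
  by move=> R g _; exists g; apply: scomp_id.
exists (gmor_comp q p); split.
  move=> z; have [y <-] := (is_derivedE hC dp).1 z; have [x <-] := cq y.
  by exists x.
have onE (R : obj C) (d : point D R) : on_points (gmor_comp q p) d = on_points q (on_points p d).
  exact: scompA.
move=> R g; move: {-2}r.+1 (erefl r.+1) => k ek hg; elim: hg ek => //= {k g}.
- by move=> i _; exists (gone D R); rewrite /on_points gone_mor.
- move=> i f g _ IHf _ IHg e; have [f' <-] := IHf e; have [g' <-] := IHg e.
  by exists (gmul f' g'); rewrite /on_points comorphM.
- move=> i f g hf _ hg _ [e]; rewrite {}e in hf hg.
  have [x <-] := hq _ _ hf; have [y <-] := hq _ _ hg.
  have [d ed] := derived_comm hC x y dp; exists d.
  by rewrite onE ed /on_points gcomm_mor.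
Qed.

Lemma solvable_dpoint : solvable_scheme G ->
  exists r, forall (R : obj C) (g : point G R), dpoint r g -> g = gone G R.
Proof.
move=> [r [H [hH tH]]]; exists r => R g; have [q [_ hq]] := derived_series_dpoint hH.
by move=> /hq [h <-]; rewrite (tH _ h) /on_points gone_mor.
Qed.

Lemma dpoint_nat (R S : obj C) (phi : shom R S) i (g : point G R) :
  dpoint i g -> dpoint i (scomp phi g).
Proof.
elim=> {i g} [g|i|i f g _ hf _ hg|i f g _ hf _ hg].
- exact: dpoint0.
- by rewrite gone_nat; apply: dpoint1.
- by rewrite gmul_nat; apply: dpointM.
- by rewrite gcomm_nat; apply: dpointC.
Qed.

Lemma dpointS (R : obj C) i (g : point G R) : dpoint i.+1 g -> dpoint i g.
Proof.
move=> h; move: {-2}i.+1 h (erefl i.+1) => k h.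
elim: h i => //= {k g} [i j _|i f g _ IHf _ IHg j e|i f g hf IHf hg IHg j [e]].
- exact: dpoint1.
- by apply: dpointM; [apply: IHf|apply: IHg].
- rewrite e; case: i hf IHf hg IHg {e} => [|i] hf IHf hg IHg; first exact: dpoint0.
  by apply: dpointC; [apply: IHf|apply: IHg].
Qed.

Lemma gconjC (R : obj C) (d f g : point G R) :
  gconj d (gcomm f g) = gcomm (gconj d f) (gconj d g).
Proof.
have M a b : gconj d (gmul a b) = gmul (gconj d a) (gconj d b).
  by rewrite /gconj -!gmulA [gmul (ginv d) (gmul d _)]gmulA gmulV gmul1.
have V a : gconj d (ginv a) = ginv (gconj d a).
  by apply: ginv_uniq; rewrite -M gmulV /gconj gmulr1 gmulVr.
by rewrite /gcomm M V !M.
Qed.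

Lemma dpointJ (R : obj C) i (d g : point G R) : dpoint i g -> dpoint i (gconj d g).
Proof.
elim=> {i g} [g|i|i f g _ hf _ hg|i f g _ hf _ hg].
- exact: dpoint0.
- by rewrite /gconj gmulr1 gmulVr; apply: dpoint1.
- suff -> : gconj d (gmul f g) = gmul (gconj d f) (gconj d g) by apply: dpointM.
  by rewrite /gconj -!gmulA [gmul (ginv d) (gmul d _)]gmulA gmulV gmul1.
- by rewrite gconjC; apply: dpointC.
Qed.

End DerivedPoints.

(** * Comparison of the derived series of a supergroup and of its even part *)

Section Comparison.
Variable K : fieldType.
Local Notation hS := (salg_cat_closed K).
Local Notation hA := (alg_cat_closed K).

Section Restrict.
Variables (H : affine_supergroup K) (H' : affine_group K) (k : shom (coord H) (coord H')).

Definition even_res_point (R : obj (alg_cat K)) (f : point H' R) : point H (salg_of_alg R) :=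
  scomp f k.

(** [H'] is an affine group and [H] a supergroup, so compatibility with the products is required
    over commutative test algebras, where both functors are defined. *)
Definition even_morph : Prop := forall (R : obj (alg_cat K)) (f g : point H' R),
  even_res_point (gmul f g) = gmul (even_res_point f) (even_res_point g).

Hypothesis mk : even_morph.

Lemma even_morph1 (R : obj (alg_cat K)) : even_res_point (gone H' R) = gone H (salg_of_alg R).
Proof. by apply: gmul_idem; rewrite -mk gmul1. Qed.

Lemma even_morph_counit a : counit H' (k a) = counit H a.
Proof.
transitivity (even_res_point (gone H' (ground_obj (alg_cat K))) a) => //.
rewrite even_morph1 goneE; exact: mulr1.
Qed.

Lemma even_morph_cocomm a : cocomm a -> cocomm (k a).
Proof.
move=> ha R x y z w.
rewrite -[LHS]/(even_res_point (gmul (gmul (gmul x y) z) w) a).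
rewrite -[RHS]/(even_res_point (gmul (gmul (gmul x z) y) w) a).
by rewrite !mk ha.
Qed.
End Restrict.

(** Restriction to [H'] preserves [cocomm] and the counit, hence carries the ideal of the derived
    subgroup of [H] into that of [H']. *)
Lemma even_morph_derived (H D : affine_supergroup K) (H' D' : affine_group K)
  (k : shom (coord H) (coord H')) (p : gmor D H) (p' : gmor D' H') :
  even_morph k -> (forall y, exists x, k x = y) -> is_derived p -> is_derived p' ->
  exists k' : shom (coord D) (coord D'), even_morph k' /\ (forall y, exists x, k' x = y).
Proof.
move=> mk sk dp dp'; have [sp kerp] := is_derivedE hS dp.
have [sp' kerp'] := is_derivedE hA dp'.
have [x|k' ek] := @shom_factor_surj K _ _ _ (comorph p) (scomp (comorph p') k) sp.
  move=> /kerp /coidealE; move: x; apply: coseq_ind => [|b a hb eb].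
    split; first exact: shom0.
    by move=> c x y hx hy; rewrite shom_lin hx hy scaler0 addr0.
  rewrite shomM [X in X * _](derived_cocomm hA dp' (even_morph_cocomm mk hb)).
  by rewrite even_morph_counit // eb scale0r mul0r.
exists k'; split; last first.
  move=> z; have [y <-] := sp' z; have [x <-] := sk y; exists (comorph p x).
  exact: (congr1 (fun f : shom (coord H) (coord D') => f x) ek).
move=> R f g; apply: (scomp_surj sp).
have e (h : point D' R) : scomp (even_res_point k' h) (comorph p) =
    even_res_point k (scomp h (comorph p')).
  by apply: (etrans (esym (scompA _ _ _))); rewrite ek; apply: scompA.
by rewrite comorphM !e comorphM mk.
Qed.

(** Step by step, the derived series of [G_ev] embeds into that of [G], so it becomes trivial no
    later. *)
Lemma solvable_even_part (G : affine_supergroup K) :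
  solvable_scheme G -> solvable_scheme (even_part G).
Proof.
move=> [r [H [hH tH]]].
suff [H' [k [hH' mk sk]]] : exists H' (k : shom (coord H) (coord H')),
    [/\ derived_series (even_part G) r H', even_morph k & forall y, exists x, k x = y].
  exists r, H'; split=> // R f; apply: (scomp_surj sk).
  have := even_morph1 mk R; rewrite /even_res_point => ->.
  exact: (tH (salg_of_alg R)).
elim: hH {tH} => [|{}r {}H D p hH [H' [k [hH' mk sk]]] dp].
  exists (even_part G), (squot_pi (odd_ideal (counit G))); split.
  - constructor.
  - by move=> R f g; apply: even_liftK.
  - exact: squot_pi_surj.
have dp' := derived_is_derived hA H'.
have [k' [mk' sk']] := even_morph_derived mk sk dp dp'.
by exists (derived hA H'), k'; split=> //; apply: derived_seriesS hH' dp'.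
Qed.

Section EvenSub.
Variable R : superalgebra K.
Hypothesis sR : supercommutative R.

Lemma even_subM (x y : R) : gr false x -> gr false y -> gr false (x * y).
Proof. exact: grM. Qed.

Lemma even_sub_pj i (x : R) : gr false x -> gr false (pj i x).
Proof.
by move=> hx; case: i; [rewrite (pj_neq hx) //; apply: gr0|rewrite pj_id].
Qed.

Definition even_sub : subsuper R :=
  SubSuper (gr_subspace R false) (gr1 R) even_subM even_sub_pj.

Lemma even_sub_alg : alg_cat K (ssubalg even_sub).
Proof.
split; first exact: (closed_sub hS (@sincl_inj _ _ even_sub) sR).
move=> x hx; apply: (@sincl_inj _ _ even_sub); rewrite shom0.
apply: gr_direct; [exact: (sinclP (X := even_sub))|exact: hx].
Qed.

Definition even_obj : obj (alg_cat K) := Obj even_sub_alg.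

(** A purely even group has no other points over [R] than those over the even subalgebra of [R].
    This reduces identities over superalgebras to commutative test algebras. *)
Lemma even_factor (A : superalgebra K) (f : shom A R) : purely_even A ->
  exists g : shom A even_obj, scomp (sincl even_sub) g = f.
Proof.
move=> eA; apply: (shom_factor_inj (@sincl_inj _ _ even_sub)) => x.
apply: (sincl_surj (X := even_sub)); rewrite -[x](@pj_id _ A false) ?shom_pj; first exact: pj_gr.
by rewrite [x](pj_split x) (eA _ (pj_gr true x)) addr0; apply: pj_gr.
Qed.
End EvenSub.

Section Extend.
Variables (H : affine_supergroup K) (E : affine_group K) (k : shom (coord E) (coord H)).

Definition even_ext_point (R : obj (alg_cat K)) (f : point H (salg_of_alg R)) : point E R :=
  scomp f k.

Definition even_comorph : Prop := forall (R : obj (alg_cat K)) (f g : point H (salg_of_alg R)),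
  even_ext_point (gmul f g) = gmul (even_ext_point f) (even_ext_point g).

Hypothesis mk : even_comorph.
Hypothesis eH : purely_even (coord H).

Lemma even_comorph1 (R : obj (alg_cat K)) : even_ext_point (gone H (salg_of_alg R)) = gone E R.
Proof. by apply: gmul_idem; rewrite -mk gmul1. Qed.

Lemma even_comorph_counit a : counit H (k a) = counit E a.
Proof.
transitivity (even_ext_point (gone H (salg_of_alg (ground_obj (alg_cat K)))) a).
  change (counit H (k a) = gone H (salg_of_alg (ground_obj (alg_cat K))) (k a)).
  rewrite goneE; exact/esym/mulr1.
by rewrite even_comorph1.
Qed.

Lemma even_comorph_cocomm a : cocomm a -> cocomm (k a).
Proof.
move=> ha R x y z w.
pose R0 := even_obj (objP R); pose i : shom (salg_of_alg R0) R := sincl (even_sub R).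
have fac (f : point H R) : exists g : point H (salg_of_alg R0), scomp i g = f.
  exact: even_factor.
have [x0 <-] := fac x; have [y0 <-] := fac y; have [z0 <-] := fac z; have [w0 <-] := fac w.
rewrite -!gmul_nat; congr (i _).
rewrite -[LHS]/(even_ext_point (R := R0) (gmul (gmul (gmul x0 y0) z0) w0) a).
rewrite -[RHS]/(even_ext_point (R := R0) (gmul (gmul (gmul x0 z0) y0) w0) a).
by rewrite !mk ha.
Qed.
End Extend.

(** Mirror image of [even_morph_derived]: here a purely even supergroup is a closed subgroup of the
    affine group [E]. The points over superalgebras in [cocomm] are handled by [even_factor]. *)
Lemma even_comorph_derived (H D : affine_supergroup K) (E D' : affine_group K)
  (k : shom (coord E) (coord H)) (p : gmor D H) (p' : gmor D' E) :
  even_comorph k -> purely_even (coord H) -> (forall y, exists x, k x = y) ->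
  is_derived p -> is_derived p' ->
  exists k' : shom (coord D') (coord D),
    [/\ even_comorph k', purely_even (coord D) & forall y, exists x, k' x = y].
Proof.
move=> mk eH sk dp dp'; have [sp kerp] := is_derivedE hS dp.
have [sp' kerp'] := is_derivedE hA dp'.
have [x|k' ek] := @shom_factor_surj K _ _ _ (comorph p') (scomp (comorph p) k) sp'.
  move=> /kerp' /coidealE; move: x; apply: coseq_ind => [|b a hb eb].
    split; first exact: shom0.
    by move=> c x y hx hy; rewrite shom_lin hx hy scaler0 addr0.
  rewrite shomM [X in X * _](derived_cocomm hS dp (even_comorph_cocomm mk eH hb)).
  by rewrite even_comorph_counit // eb scale0r mul0r.
exists k'; split.
- move=> R f g; apply: (scomp_surj sp').
  have e (h : point D (salg_of_alg R)) : scomp (even_ext_point k' h) (comorph p') =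
      even_ext_point k (scomp h (comorph p)).
    by apply: (etrans (esym (scompA _ _ _))); rewrite ek; apply: scompA.
  by rewrite comorphM !e comorphM mk.
- move=> y hy; have [x ex] := sp y; rewrite -(pj_id hy) -ex -shom_pj.
  by rewrite (eH _ (pj_gr _ _)) shom0.
- move=> z; have [y <-] := sp z; have [x <-] := sk y; exists (comorph p' x).
  exact: (congr1 (fun f : shom (coord E) (coord D) => f x) ek).
Qed.

(** A purely even closed subgroup of [G] lies in [G_ev]. The derived series of [G] continued from
    [H] is thus bounded by that of [G_ev] and stops after [r] further steps. *)
Lemma solvable_of_even (G H : affine_supergroup K) n (q : gmor H G) :
  derived_series G n H -> closed_embedding q -> purely_even (coord H) ->
  solvable_scheme (even_part G) -> solvable_scheme G.
Proof.
move=> hH cq eH [r [E [hE tE]]].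
suff [H' [k [hH' mk eH' sk]]] : exists H' (k : shom (coord E) (coord H')),
    [/\ derived_series G (n + r) H', even_comorph k, purely_even (coord H')
      & forall y, exists x, k x = y].
  exists (n + r)%N, H'; split=> // R f.
  have [f0 <-] := even_factor (objP R) f eH'.
  rewrite -(@gone_nat _ _ H' (salg_of_alg (even_obj (objP R))) R (sincl (even_sub R))).
  congr (scomp _ _); apply: (scomp_surj sk).
  rewrite -[RHS]/(even_ext_point k (gone H' (salg_of_alg (even_obj (objP R))))).
  by rewrite even_comorph1 //; exact: (tE (even_obj (objP R)) (scomp f0 k)).
elim: hE {tE} => [|{}r {}E D p hE [H' [k [hH' mk eH' sk]]] dp].
  rewrite addn0; pose I := odd_ideal (counit G).
  have kI x : I x -> comorph q x = 0 by apply: odd_ideal_kills.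
  exists H, (squot_lift (I := I) kI); split=> //.
    move=> R f g; apply: even_res_inj; rewrite even_liftK.
    have e (h : point H (salg_of_alg R)) : even_res (@even_ext_point H (even_part G) (squot_lift
      (I := I) kI) R h) = on_points q h.
      by apply: shom_ext => x; rewrite /= squot_lift_pi.
    by rewrite !e /on_points comorphM.
  by move=> z; have [x <-] := cq z; exists (squot_pi_fun I x); apply: squot_lift_pi.
have dp' := derived_is_derived hS H'.
have [k' [mk' eD sk']] := even_comorph_derived mk eH' sk dp' dp.
by exists (derived hS H'), k'; split=> //; rewrite addnS; apply: derived_seriesS hH' dp'.
Qed.

End Comparison.

(** * The filtration by odd ideals and a Poincare lemma *)

Section OddFiltration.
Variables (K : fieldType) (R : superalgebra K).
Hypothesis sR : supercommutative R.

(** The powers of the ideal generated by the odd elements. *)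
Inductive oddpow : nat -> R -> Prop :=
| oddpow0 x : oddpow 0 x
| oddpow_zero k : oddpow k 0
| oddpowD k x y : oddpow k x -> oddpow k y -> oddpow k (x + y)
| oddpowS k o x : gr true o -> oddpow k x -> oddpow k.+1 (o * x).

Lemma oddpow_ind' k (P : R -> Prop) : P 0 -> (forall x y, P x -> P y -> P (x + y)) ->
  (forall o x, gr true o -> oddpow k x -> P (o * x)) -> forall x, oddpow k.+1 x -> P x.
Proof.
move=> P0 PD PS x; move: {-2}k.+1 (erefl k.+1) => n en h.
elim: h en => // {n x} [n x y _ hx _ hy e|n o x ho hx _ [e]].
  by apply: PD; [apply: hx|apply: hy].
by apply: PS => //; rewrite -e.
Qed.

Lemma odd_even_comm (x y : R) : gr true x -> gr false y -> y * x = x * y.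
Proof. by move=> hx hy; rewrite (sR hx hy) expr0 mul1r. Qed.

Lemma odd_odd_comm (x y : R) : gr true x -> gr true y -> y * x = - (x * y).
Proof. by move=> hx hy; rewrite (sR hx hy) expr1 mulN1r opprK. Qed.

Lemma oddpowMr k x y : oddpow k x -> oddpow k (x * y).
Proof.
elim=> {k x} [x|k|k x x' _ hx _ hx'|k o x ho _ hx].
- exact: oddpow0.
- by rewrite mul0r; apply: oddpow_zero.
- by rewrite mulrDl; apply: oddpowD.
- by rewrite -mulrA; apply: oddpowS.
Qed.

Lemma oddpowMl k r x : oddpow k x -> oddpow k (r * x).
Proof.
move=> h; elim: h r => {k x} [x|k|k x x' _ hx _ hx'|k o x ho hx IH] r.
- exact: oddpow0.
- by rewrite mulr0; apply: oddpow_zero.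
- by rewrite mulrDr; apply: oddpowD.
- rewrite [r]pj_split mulrDl; apply: oddpowD.
    by rewrite mulrA; apply: oddpowS => //; apply: (grM (pj_gr false r) ho).
  have -> : pj true r * (o * x) = o * - (pj true r * x).
    by rewrite mulrA (odd_odd_comm ho (pj_gr true r)) mulNr mulrN mulrA.
  by apply: oddpowS => //; rewrite -mulNr; apply: IH.
Qed.

Lemma oddpow_subspace k : subspace (oddpow k).
Proof.
split; first exact: oddpow_zero.
move=> c x y hx hy; apply: oddpowD => //.
by rewrite -mulr_algl; apply: oddpowMl.
Qed.

Lemma oddpowN k x : oddpow k x -> oddpow k (- x).
Proof. exact: (subspaceN (oddpow_subspace k)). Qed.
Lemma oddpowB k x y : oddpow k x -> oddpow k y -> oddpow k (x - y).
Proof. exact: (subspaceB (oddpow_subspace k)). Qed.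
Lemma oddpowZ k c x : oddpow k x -> oddpow k (c *: x).
Proof. exact: (subspaceZ (oddpow_subspace k)). Qed.
Lemma oddpow_sum k I (r : seq I) (P : pred I) (F : I -> R) :
  (forall i, P i -> oddpow k (F i)) -> oddpow k (\sum_(i <- r | P i) F i).
Proof. exact: (subspace_sum (oddpow_subspace k)). Qed.

Lemma oddpowM j k x y : oddpow j x -> oddpow k y -> oddpow (j + k) (x * y).
Proof.
move=> hx hy; elim: hx => {j x} [x|j|j x x' _ hx _ hx'|j o x ho _ IH].
- exact: oddpowMl.
- by rewrite mul0r; apply: oddpow_zero.
- by rewrite mulrDl; apply: oddpowD.
- by rewrite -mulrA addSn; apply: oddpowS.
Qed.

Lemma oddpow_pred k x : oddpow k.+1 x -> oddpow k x.
Proof.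
move: x; apply: oddpow_ind' => [|x y|o x ho hx].
- exact: oddpow_zero.
- exact: oddpowD.
- exact: oddpowMl.
Qed.

Lemma oddpow_leq j k x : (j <= k)%N -> oddpow k x -> oddpow j x.
Proof.
move=> /subnK <-; elim: (k - j)%N => // n IH; rewrite addSn => /oddpow_pred.
exact: IH.
Qed.

Lemma oddpow_odd x : gr true x -> oddpow 1 x.
Proof. by move=> hx; rewrite -[x]mulr1; apply: oddpowS => //; apply: oddpow0. Qed.

Lemma pj_oddMl i (o x : R) : gr true o -> pj i (o * x) = o * pj (~~ i) x.
Proof.
move=> ho; rewrite {1}(pj_split x) mulrDr (linD (@pj_lin _ R i)).
have h j : pj i (o * pj j x) = if j == ~~ i then o * pj j x else 0.
  have hg := grM ho (pj_gr j x).
  case: eqP => [e|/eqP n].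
    by rewrite e in hg *; rewrite pj_id //; case: i hg {e}.
  by rewrite (pj_neq hg) //; case: i j n {hg} => [] [].
by rewrite !h; case: i {h} => /=; rewrite ?addr0 ?add0r.
Qed.

(** A product of [k] odd elements has the parity of [k]; a component of the other parity needs one
    odd factor more. This gains one step of the filtration for free. *)
Lemma oddpow_pj k x : oddpow k x -> oddpow k.+1 (pj (~~ odd k) x).
Proof.
elim=> {k x} [x|k|k x y _ hx _ hy|k o x ho _ IH].
- exact: oddpow_odd (pj_gr true x).
- by rewrite (lin0 (@pj_lin _ R _)); apply: oddpow_zero.
- by rewrite (linD (@pj_lin _ R _)); apply: oddpowD.
- by rewrite pj_oddMl //= negbK; apply: oddpowS.
Qed.

Lemma oddpow_parity k i x : oddpow k x -> gr i x -> i = ~~ odd k -> oddpow k.+1 x.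
Proof. by move=> h hx e; rewrite -(pj_id hx) e; apply: oddpow_pj. Qed.

Definition superder (Y : R -> R) : Prop :=
  [/\ lin Y, forall i x, gr i x -> gr (~~ i) (Y x)
    & forall i x y, gr i x -> Y (x * y) = Y x * y + (-1) ^+ i * (x * Y y)].

Section Superder.
Variables (Y Z : R -> R).
Hypotheses (dY : superder Y) (dZ : superder Z).

Lemma superder_odd o x : gr true o -> Y (o * x) = Y o * x - o * Y x.
Proof. by case: dY => _ _ h ho; rewrite (h true) // expr1 mulN1r. Qed.
Lemma superder_even o x : gr false o -> Y (o * x) = Y o * x + o * Y x.
Proof. by case: dY => _ _ h ho; rewrite (h false) // expr0 mul1r. Qed.

Lemma superder_oddpow k x : oddpow k.+1 x -> oddpow k (Y x).
Proof.
have [lY _ _] := dY.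
move: x; elim: k => [|k IH] x; first by move=> _; apply: oddpow0.
move: x; apply: oddpow_ind' => [|x y|o x ho hx].
- by rewrite (lin0 lY); apply: oddpow_zero.
- by rewrite (linD lY); apply: oddpowD.
- rewrite (superder_odd) //; apply: oddpowB; first exact: oddpowMl.
  by apply: oddpowS => //; apply: IH.
Qed.
End Superder.

(** For odd derivations this is their superbracket, an even derivation. *)
Definition acomm (Y Z : R -> R) x := Y (Z x) + Z (Y x).

Lemma acomm_oddM Y Z o x : superder Y -> superder Z -> gr true o ->
  acomm Y Z (o * x) = acomm Y Z o * x + o * acomm Y Z x.
Proof.
move=> dY dZ ho; have [lY pY _] := dY; have [lZ pZ _] := dZ.
rewrite /acomm (superder_odd dZ _ ho) (superder_odd dY _ ho) (linB lY) (linB lZ).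
rewrite (superder_odd dY _ ho) (superder_odd dZ _ ho).
rewrite (superder_even dY _ (pZ _ _ ho)) (superder_even dZ _ (pY _ _ ho)).
rewrite mulrDl mulrDr !opprB.
set a := Y (Z o) * x; set b := Z (Y o) * x; set c := Z o * Y x; set d := Y o * Z x.
rewrite addrACA [a + c + _]addrACA [X in _ + X]addrACA [X in X = _]addrACA.
by rewrite -opprD [d + c]addrC subrr addr0.
Qed.

Lemma acomm_lin Y Z : lin Y -> lin Z -> lin (acomm Y Z).
Proof. by move=> lY lZ; apply: lin_add; apply: lin_comp. Qed.

Lemma acomm_gr Y Z i x : superder Y -> superder Z -> gr i x -> gr i (acomm Y Z x).
Proof.
move=> [_ pY _] [_ pZ _] hx; apply: (subspaceD (gr_subspace R i)).
  by rewrite -[i]negbK; apply/pY/pZ.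
by rewrite -[i]negbK; apply/pZ/pY.
Qed.

Lemma acomm_oddpow Y Z k x : superder Y -> superder Z -> oddpow k x -> oddpow k (acomm Y Z x).
Proof.
move=> dY dZ; have [lY _ _] := dY; have [lZ _ _] := dZ.
elim=> {k x} [x|k|k x y _ hx _ hy|k o x ho hx IH].
- exact: oddpow0.
- by rewrite (lin0 (acomm_lin lY lZ)); apply: oddpow_zero.
- by rewrite (linD (acomm_lin lY lZ)); apply: oddpowD.
- rewrite acomm_oddM //; apply: oddpowD; apply: oddpowS => //.
  exact: acomm_gr.
Qed.

End OddFiltration.

(** * A Poincare lemma for odd derivations with approximate coordinates *)

Section Poincare.
Variables (K : fieldType) (R : superalgebra K).
Hypotheses (sR : supercommutative R) (char2 : 2 \notin [pchar K]).
Variables (m : nat) (Y : 'I_m -> R -> R) (b : 'I_m -> R) (N : nat).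
Local Notation F := (@oddpow K R).
Hypothesis dY : forall i, superder (Y i).
Hypothesis b_odd : forall i, gr true (b i).
Hypothesis Yb : forall i j, F 1 (Y j (b i) - (i == j)%:R).
Hypothesis Ygen : forall a, gr true a -> F 2 (a - \sum_(i < m) b i * Y i a).
Hypothesis nilp : forall x, F N x -> x = 0.

Let lY i : lin (Y i). Proof. by case: (dY i). Qed.
Let oddY i x : gr true x -> gr false (Y i x). Proof. by case: (dY i) => _ h _; apply: (h true). Qed.
Let evenY i x : gr false x -> gr true (Y i x). Proof. by case: (dY i) => _ h _; apply: (h false).
  Qed.

Lemma two_unit : (2%:R : K) != 0.
Proof. by move: char2; rewrite inE /=. Qed.

Lemma half x (P : R -> Prop) : subspace P -> P (x + x) -> P x.
Proof.
move=> sP h; have := subspaceZ sP (2%:R)^-1 h.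
by rewrite -mulr2n -scaler_nat scalerA mulVf ?two_unit // scale1r.
Qed.

Lemma odd_sq (x : R) : gr true x -> x * x = 0.
Proof.
move=> hx; apply: (half (subspace_eq0 R)).
by apply/eqP; rewrite addr_eq0; apply/eqP; apply: odd_odd_comm.
Qed.

Lemma star_rep k x : F k.+1 x -> exists a : 'I_m -> R,
  (forall i, F k (a i)) /\ F k.+2 (x - \sum_(i < m) b i * a i).
Proof.
move: x; apply: oddpow_ind' => [|x y [a [ha ea]] [c [hc ec]]|o x ho hx].
- exists (fun=> 0); split=> [i|]; first exact: oddpow_zero.
  rewrite big1 ?subr0; first exact: oddpow_zero.
  by move=> i _; rewrite mulr0.
- exists (fun i => a i + c i); split=> [i|]; first by apply: oddpowD.
  under eq_bigr do rewrite mulrDr; rewrite big_split /= opprD addrACA.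
  exact: oddpowD.
- exists (fun i => Y i o * x); split=> [i|]; first exact: oddpowMl.
  under eq_bigr do rewrite mulrA; rewrite -mulr_suml -mulrBl -add2n.
  by apply: oddpowM => //; apply: Ygen.
Qed.

(** To leading order, only zero has vanishing odd derivatives. Write [x] as a sum of [b i * a i];
    applying [Y j] expresses [a j] through the derivatives of the coefficients, and substituting
    this eliminates the coefficient of [b j], for one index after the other. *)
Lemma star k x : F k.+1 x -> (forall j, F k.+1 (Y j x)) -> F k.+2 x.
Proof.
move=> hx hYx.
suff H l : (l <= m)%N -> exists a : 'I_m -> R, [/\ forall i, F k (a i),
    forall i : 'I_m, (i < l)%N -> a i = 0 & F k.+2 (x - \sum_(i < m) b i * a i)].
  have [a [_ a0 h]] := H m (leqnn m); move: h; rewrite big1 ?subr0 // => i _.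
  by rewrite a0 ?mulr0.
elim: l => [_|l IH lm].
  by have [a [ha h]] := star_rep hx; exists a; split.
have [a [ha a0 h]] := IH (ltnW lm); pose j := Ordinal lm.
have hj : F k.+1 (a j - \sum_(i < m) b i * Y j (a i)).
  have h1 := superder_oddpow sR (dY j) h.
  rewrite (linB (@lY j)) (lin_sum (@lY j)) in h1.
  have {}h1 : F k.+1 (\sum_(i < m) Y j (b i * a i)).
    by rewrite -[\sum_(i < m) _](subKr (Y j x)); apply: oddpowB.
  move: h1; under eq_bigr do rewrite (superder_odd (dY j)) //.
  rewrite sumrB => h1.
  have h2 : F k.+1 (\sum_(i < m) Y j (b i) * a i - a j).
    have -> : a j = \sum_(i < m) (i == j)%:R * a i.
      rewrite (bigD1 j) //= eqxx mul1r big1 ?addr0 // => i /negPf ->.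
      by rewrite mul0r.
    rewrite -sumrB; apply: oddpow_sum => // i _; rewrite -mulrBl -add1n.
    exact: oddpowM.
  set s := \sum_(i < m) b i * _; set t := \sum_(i < m) Y j (b i) * _ in h1 h2.
  have -> : a j - s = (t - s) - (t - a j) by rewrite opprB [RHS]addrC addrA addrNK.
  exact: oddpowB.
(* The new coefficients come from replacing [a j] by the sum of [b i * Y j (a i)]: the term [i = j]
   dies since [b j] squares to zero, the others are reordered by anticommutation. *)
exists (fun i => if i == j then 0 else a i - b j * Y j (a i)); split.
- move=> i; case: ifP => _; first exact: oddpow_zero.
  apply: oddpowB => //; case: k ha {hx hYx h hj IH} => [|k] ha; first exact: oddpow0.
  by apply: oddpowS => //; apply: (superder_oddpow sR (dY j)).
- move=> i; rewrite ltnS leq_eqVlt => /orP [/eqP e|lt].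
    by have /eqP -> : i == j; [apply/eqP/val_inj|rewrite eqxx].
  by rewrite a0 // (lin0 (@lY j)) mulr0 subr0; case: ifP.
- have -> : \sum_(i < m) b i * (if i == j then 0 else a i - b j * Y j (a i)) =
     \sum_(i < m) b i * a i - b j * (a j - \sum_(i < m) b i * Y j (a i)).
    rewrite mulrBr mulr_sumr opprB addrA -big_split /= [RHS]addrC.
    rewrite (bigD1 j) //= eqxx mulr0 add0r [in RHS](bigD1 j) //=.
    rewrite mulrA odd_sq // mul0r addr0 addrA addNr add0r; apply: eq_bigr => i /negPf ->.
    by rewrite mulrBr !mulrA (odd_odd_comm sR (b_odd i) (b_odd j)) // mulNr.
  by rewrite opprB addrCA; apply: oddpowD => //; apply: oddpowS.
Qed.

Lemma star_iter n x : F 1 x -> (forall j, F n (Y j x)) -> F n.+1 x.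
Proof.
move=> h1 hY; suff H s : (s <= n)%N -> F s.+1 x by apply: H.
elim: s => // s IH lt; apply: star; first by apply: IH; apply: ltnW.
by move=> j; apply: oddpow_leq (hY j).
Qed.

Lemma star_zero x : F 1 x -> (forall j, Y j x = 0) -> x = 0.
Proof.
move=> h1 h; apply: nilp; apply: (@oddpow_leq _ _ sR _ N.+1) => //.
by apply: star_iter => // j; rewrite h; apply: oddpow_zero.
Qed.

(** A closed form is exact to leading order. Closedness is symmetric in the indices because the
    derivations are odd. The components are integrated one index [p] at a time by adding
    [b p * d p]; at [i = j = p] closedness reads [2 Y p (d p) = 0] to this order, which is where the
    characteristic enters. *)
Lemma poincare k (c : 'I_m -> R) : (forall j, gr false (c j)) ->
  (forall j, F k.*2.+2 (c j)) -> (forall i j, F k.*2.+2 (Y i (c j) + Y j (c i))) ->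
  exists f, [/\ gr true f, F k.*2.+3 f & forall j, F k.*2.+3 (c j - Y j f)].
Proof.
move=> ec hc cc; set n := k.*2.+2 in hc cc *.
suff H l : (l <= m)%N -> exists f, [/\ gr true f, F n.+1 f &
    forall j : 'I_m, (j < l)%N -> F n.+1 (c j - Y j f)].
  by have [f [f1 f2 f3]] := H m (leqnn m); exists f; split=> // j; apply: f3.
elim: l => [_|l IH lm]; first by exists 0; split=> //; [apply: gr0|apply: oddpow_zero].
have [f [fo fn hf]] := IH (ltnW lm); pose p := Ordinal lm.
pose d j := c j - Y j f.
have ed j : gr false (d j).
  by apply: (subspaceB (gr_subspace R false)) => //; apply: oddY.
have hd j : F n (d j) by apply: oddpowB => //; apply: (superder_oddpow sR (dY j)).
have dd i j : F n (Y i (d j) + Y j (d i)).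
  rewrite /d !(linB (@lY _)) addrACA -opprD; apply: oddpowB => //.
  apply: oddpow_pred => //; rewrite -/(acomm (Y i) (Y j) f).
  exact: (acomm_oddpow (dY i) (dY j) fn).
exists (f + b p * d p); split.
- by apply: (subspaceD (gr_subspace R true)) => //; apply: (grM (b_odd p) (ed p)).
- by apply: oddpowD => //; apply: oddpowS.
move=> j.
have -> : c j - Y j (f + b p * d p) = d j - Y j (b p) * d p + b p * Y j (d p).
  by rewrite (linD (@lY j)) (superder_odd (dY j)) // opprD opprB addrA -/(d j) addrA addrAC.
rewrite ltnS leq_eqVlt => /orP [/eqP e|lt].
  have -> : j = p by apply: val_inj.
  apply: oddpowD.
    rewrite -{1}[d p]mul1r -mulrBl -opprB mulNr; apply: oddpowN => //.
    rewrite -[n.+1]add1n; apply: oddpowM => //.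
    by have := Yb p p; rewrite eqxx.
  by apply: oddpowS => //; apply: (half (oddpow_subspace sR n)); apply: dd.
have np : (p == j) = false by apply/negbTE; apply: contraL lt => /eqP <-; rewrite ltnn.
apply: oddpowD; first apply: oddpowB => //.
- exact: hf.
- rewrite -[n.+1]add1n; apply: oddpowM => //.
  by have := Yb p j; rewrite np subr0.
- apply: oddpowS => //; rewrite -(addrK (Y p (d j)) (Y j (d p))).
  by apply: oddpowB; [|apply: dd|apply: (superder_oddpow sR (dY p)); apply: hf].
Qed.

Variable l : 'I_m -> R.
Hypothesis even_l : forall i, gr false (l i).
Hypothesis Yl : forall i j, Y i (l j) = 0.
Variable c : 'I_m -> 'I_m -> 'I_m -> 'I_m -> K.
Hypothesis acommY : forall i j k x, acomm (Y i) (Y j) (Y k x) - Y k (acomm (Y i) (Y j) x) =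
  \sum_(p < m) c i j k p *: Y p x.
Hypothesis cl : forall i j k, \sum_(p < m) c i j k p *: l p = 0.

(** Successive approximation. The remainder [l j - Y j f] fails to be closed by
    [acomm (Y i) (Y j) f], and the hypothesis [cl], saying that the form [l] kills all triple
    brackets, makes this defect small enough for [poincare]. *)
Theorem exact_form : exists f, gr true f /\ forall j, Y j f = l j.
Proof.
suff H k : exists f, gr true f /\ forall j, F k.*2.+2 (l j - Y j f).
  have [f [fo hf]] := H N; exists f; split=> // j; apply/esym/eqP.
  rewrite -subr_eq0; apply/eqP/nilp; apply: oddpow_leq (hf j) => //.
  by rewrite -addnn; apply: leq_trans (leq_addr _ _) _; rewrite ltnW.
elim: k => [|k [f [fo hf]]].
  exists (\sum_(i < m) b i * l i); split.
    by apply: (subspace_sum (gr_subspace R true)) => i _; apply: (grM (b_odd i) (even_l i)).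
  move=> j; apply: (oddpow_parity (i := false)) => //; last first.
    apply: (subspaceB (gr_subspace R false)) => //; apply: oddY.
    by apply: (subspace_sum (gr_subspace R true)) => i _; apply: (grM (b_odd i) (even_l i)).
  have -> : l j - Y j (\sum_(i < m) b i * l i) =
      - (\sum_(i < m) (Y j (b i) - (i == j)%:R) * l i).
    under [in RHS]eq_bigr do rewrite mulrBl.
    rewrite sumrB opprB (lin_sum (@lY j)); congr (_ - _).
      rewrite (bigD1 j) //= eqxx mul1r big1 ?addr0 // => i /negPf ->.
      by rewrite mul0r.
    by apply: eq_bigr => i _; rewrite (superder_odd (dY j)) // Yl mulr0 subr0.
  by apply: oddpowN => //; apply: oddpow_sum => // i _; apply: oddpowMr.
have ec j : gr false (l j - Y j f).
  by apply: (subspaceB (gr_subspace R false)) => //; apply: oddY.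
have lA i j : lin (acomm (Y i) (Y j)) by apply: acomm_lin.
(* By [star_iter] it is enough to bound the derivatives of the defect; moving [Y q] across the
   bracket leaves remainders of the present order, since the constants [l p] cancel by [cl]. *)
have hA i j : F k.*2.+2 (acomm (Y i) (Y j) f).
  apply: oddpow_pred => //; apply: star_iter => [|q].
    by apply: oddpow_odd; exact: (acomm_gr (dY i) (dY j) fo).
  have -> : Y q (acomm (Y i) (Y j) f) =
     \sum_(p < m) c i j q p *: (l p - Y p f) - acomm (Y i) (Y j) (l q - Y q f).
    have Al : acomm (Y i) (Y j) (l q) = 0 by rewrite /acomm !Yl !(lin0 (@lY _)) addr0.
    rewrite (linB (lA i j)) Al sub0r opprK.
    under eq_bigr do rewrite scalerBr.
    by rewrite sumrB cl sub0r -acommY opprB addrNK.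
  apply: oddpowB => //; last exact: (acomm_oddpow (dY i) (dY j) (hf q)).
  by apply: oddpow_sum => // p _; apply: oddpowZ.
have [|i j|g [go gn hg]] := @poincare k (fun j => l j - Y j f) ec.
- exact: hf.
- rewrite !(linB (@lY _)) !Yl !sub0r -opprD.
  by apply: oddpowN => //; apply: hA.
exists (f + g); split; first by apply: (subspaceD (gr_subspace R true)).
move=> j; rewrite (linD (@lY j)) opprD addrA doubleS.
(* The remainder is even and of odd order, so parity raises its order by one more. Each round thus
   advances by two steps. *)
apply: (@oddpow_parity _ _ _ false) => //.
  by apply: (subspaceB (gr_subspace R false)) => //; apply: oddY.
by rewrite /= odd_double.
Qed.
End Poincare.

Lemma functional_ext (K : fieldType) (U : lmodType K) (x y : U) :
  (forall f : U -> K^o, lin f -> f x = f y) -> x = y.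
Proof.
move=> h; apply/eqP; rewrite -subr_eq0; apply/eqP/functional_eq0 => f lf.
by rewrite (linB lf) h // subrr.
Qed.

Section TensorMapLeft.
Variables (K : fieldType) (A B L : superalgebra K).

(** Unlike [tmap], this makes sense for any linear [f], such as a derivation or a translation
    operator. *)
Definition tmapl (f : A -> B) (F : tensor A L) : tensor B L :=
  text (fun a l => pure (f a) l) F.

Variable f : A -> B.
Hypothesis lf : lin f.

Lemma tmapl_bilin : bilin (fun a (l : L) => pure (f a) l).
Proof.
split=> v; last exact: (proj2 (pure_bilin B L) _).
exact: (lin_comp lf (proj1 (pure_bilin B L) v)).
Qed.
Lemma tmapl_lin : lin (tmapl f).
Proof. exact: text_lin tmapl_bilin. Qed.
Lemma tmapl_pure a l : tmapl f (pure a l) = pure (f a) l.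
Proof. by rewrite /tmapl text_pure //; apply: tmapl_bilin. Qed.

Lemma tmapl_lslice (phi : B -> K^o) F : lin phi ->
  lslice phi (tmapl f F) = lslice (phi \o f) F.
Proof.
move=> lphi; have lpf : lin (phi \o f) := lin_comp lf lphi.
move: F; apply: lin_eq_tens => [||a l].
- exact: lin_comp tmapl_lin (lslice_lin lphi).
- exact: lslice_lin lpf.
by rewrite tmapl_pure !lslice_pure.
Qed.

Lemma tmapl_rslice (psi : L -> K^o) F : lin psi ->
  rslice psi (tmapl f F) = f (rslice psi F).
Proof.
move=> lpsi; move: F; apply: lin_eq_tens => [||a l].
- exact: lin_comp tmapl_lin (rslice_lin lpsi).
- exact: lin_comp (rslice_lin lpsi) lf.
by rewrite tmapl_pure !rslice_pure // (linZ lf).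
Qed.

End TensorMapLeft.

Section EvenRight.
Variables (K : fieldType) (L : superalgebra K).
Hypothesis eL : purely_even L.

Lemma purely_even_gr (l : L) : gr false l.
Proof. by rewrite (pj_split l) (eL (pj_gr true l)) addr0; apply: pj_gr. Qed.

Lemma pure_mulE (A : superalgebra K) (a a' : A) (l l' : L) :
  (pure a l : tensor A L) * pure a' l' = pure (a * a') (l * l').
Proof.
rewrite (pj_split a') mulrDr !pureDl mulrDr.
by rewrite !(pure_hom _ _ (pj_gr _ _) (purely_even_gr l)) /koszul !andbF !scale1r.
Qed.

Lemma tens_gr_even (A : superalgebra K) i (P : tensor A L -> Prop) :
  P 0 -> (forall F G, P F -> P G -> P (F + G)) ->
  (forall a l, gr i a -> P (pure a l)) -> forall F : tensor A L, gr i F -> P F.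
Proof.
move=> P0 PD Pp; apply: tgr_ind => // k j a l ha hl e; case: j hl e => hl e.
  by rewrite (eL hl) pure0r.
by apply: Pp; rewrite -e addbF.
Qed.

Lemma tmapl_inr (A B : superalgebra K) (f : A -> B) (F : tensor A L) l : lin f ->
  tmapl f (tinr A L l * F) = tinr B L l * tmapl f F.
Proof.
move=> lf; move: F; apply: lin_eq_tens => [||a l'].
- exact: lin_comp (lin_mulr _) (tmapl_lin lf).
- exact: lin_comp (tmapl_lin lf) (lin_mulr _).
by rewrite tmapl_pure // [LHS](congr1 _ (pure_mulE _ _ _ _)) tmapl_pure // [RHS]pure_mulE !mul1r.
Qed.

Lemma lslice_inr (A : superalgebra K) (phi : A -> K^o) (F : tensor A L) l : lin phi ->
  lslice phi (tinr A L l * F) = l * lslice phi F.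
Proof.
move=> lf; move: F; apply: lin_eq_tens => [||a l'].
- exact: lin_comp (lin_mulr _) (lslice_lin lf).
- exact: lin_comp (lslice_lin lf) (lin_mulr _).
by rewrite [LHS](congr1 _ (pure_mulE _ _ _ _)) !lslice_pure // mul1r scalerAr.
Qed.

Lemma tmapl_gr (A B : superalgebra K) (f : A -> B) j : lin f ->
  (forall i x, gr i x -> gr (i (+) j) (f x)) ->
  forall i (F : tensor A L), gr i F -> gr (i (+) j) (tmapl f F).
Proof.
move=> lf gf i; apply: tens_gr_even => [|F G hF hG|a l ha].
- by rewrite (lin0 (tmapl_lin lf)); apply: gr0.
- by rewrite (linD (tmapl_lin lf)); apply: (subspaceD (gr_subspace _ _)).
rewrite tmapl_pure // -[i (+) j]addbF; apply: tgr_pure; first exact: gf.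
exact: purely_even_gr.
Qed.

Lemma tmapl_superder (A : superalgebra K) (Y : A -> A) : superder Y -> superder (@tmapl K A A L Y).
Proof.
move=> [lY gY dY]; split; first exact: tmapl_lin.
  move=> i x hx; rewrite -[~~ i]addbT; apply: tmapl_gr => // k y hy.
  by rewrite addbT; apply: gY.
move=> i F G hF; rewrite sign_scale; move: F hF; apply: tens_gr_even => [|F F' hF hF'|a l ha].
- by rewrite mul0r (lin0 (tmapl_lin lY)) !mul0r scaler0 addr0.
- by rewrite !mulrDl !(linD (tmapl_lin lY)) hF hF' mulrDl scalerDr addrACA.
move: G; apply: lin_eq_tens => [||a' l'].
- exact: lin_comp (lin_mulr _) (tmapl_lin lY).
- apply: lin_add; first exact: lin_mulr.
  by apply: lin_scale; apply: (lin_comp (tmapl_lin lY) (lin_mulr _)).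
rewrite [X in tmapl _ X](pure_mulE a a' l l') !tmapl_pure // !pure_mulE (dY _ _ _ ha) sign_scale.
by rewrite pureDl pureZl.
Qed.

Lemma shom_oddpow (A B : superalgebra K) (f : shom A B) k x : oddpow k x -> oddpow k (f x).
Proof.
elim=> {k x} [x|k|k x y _ hx _ hy|k o x ho _ hx].
- exact: oddpow0.
- by rewrite shom0; apply: oddpow_zero.
- by rewrite shomD; apply: oddpowD.
- by rewrite shomM; apply: oddpowS => //; apply: shom_gr.
Qed.

(** As [L] is purely even, the odd filtration of [A (x) L] is the one induced from [A]; nilpotency
    carries over. *)
Lemma tens_oddpow (A : superalgebra K) k (P : tensor A L -> Prop) :
  supercommutative A -> subspace P -> (forall a l, oddpow k a -> P (pure a l)) ->
  forall F : tensor A L, oddpow k F -> P F.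
Proof.
move=> sA sP Pp F h; elim: h P sP Pp => {k F} [F|k|k F G _ hF _ hG|k o F ho _ IH] P sP Pp.
- move: F; apply: tens_ind => [|F G|a b]; [exact: subspace0|exact: subspaceD|].
  by apply: Pp; apply: oddpow0.
- exact: subspace0.
- by apply: (subspaceD sP); [apply: hF|apply: hG].
move: o ho; apply: tens_gr_even => [|G H hG hH|a l ha].
- by rewrite mul0r; apply: subspace0.
- by rewrite mulrDl; apply: (subspaceD sP).
apply: (IH (fun F => P (pure a l * F))).
  split; first by rewrite mulr0; apply: subspace0.
  by move=> c x y hx hy; rewrite (lin_mulr _); apply: subspaceP.
by move=> a' l' ha'; rewrite pure_mulE; apply: Pp; apply: oddpowS.
Qed.

End EvenRight.

(** * Convolution of functionals and translation operators *)

Section Translations.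
Variables (K : fieldType) (C : test_category K) (hC : cat_closed C).
Variable G : group_scheme C.
Local Notation A := (coord G).
Local Notation comult := (comult hC G).
Local Notation conv := (@conv K C hC G).

Implicit Types phi psi theta : A -> K^o.

Definition fconv phi psi : A -> K^o := conv (R := K^o) phi psi.
(** Read as integrating [a(yx)] over [y] against [phi]. Left and right translations commute, and for
    a tangent vector [phi] at the identity [ltrans phi] is the corresponding invariant vector
    field. *)
Definition ltrans phi (a : A) : A := lslice phi (comult a).
Definition rtrans phi (a : A) : A := rslice phi (comult a).
Definition feps : A -> K^o := counit G.

Lemma feps_lin : lin feps. Proof. exact (shom_lin (counit G)). Qed.

Lemma fconv_lin phi psi : lin phi -> lin psi -> lin (fconv phi psi).
Proof. exact: conv_lin. Qed.
Lemma ltrans_lin phi : lin phi -> lin (ltrans phi).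
Proof. by move=> lp; apply: lin_comp (shom_lin comult) (lslice_lin lp). Qed.
Lemma rtrans_lin phi : lin phi -> lin (rtrans phi).
Proof. by move=> lp; apply: lin_comp (shom_lin comult) (rslice_lin lp). Qed.

Lemma fconvA phi psi theta : lin phi -> lin psi -> lin theta ->
  fconv phi (fconv psi theta) = fconv (fconv phi psi) theta.
Proof. exact: convA. Qed.

Lemma eps_feps : @eps K C G (K^o) = feps.
Proof. by apply/funext => a; rewrite /eps /feps; exact: mulr1. Qed.

Lemma fconv1 phi : lin phi -> fconv feps phi = phi.
Proof. by move=> lp; rewrite -eps_feps; apply: conv1. Qed.
Lemma fconvr1 phi : lin phi -> fconv phi feps = phi.
Proof. by move=> lp; rewrite -eps_feps; apply: convr1. Qed.

Lemma f_ltrans phi psi a : lin phi -> lin psi -> psi (ltrans phi a) = fconv phi psi a.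
Proof.
move=> lp lq; rewrite /ltrans cop_lslice // (lin_sum lq); apply: eq_bigr => w _.
by rewrite (linZ lq).
Qed.
Lemma f_rtrans phi psi a : lin phi -> lin psi -> psi (rtrans phi a) = fconv psi phi a.
Proof.
move=> lp lq; rewrite /rtrans cop_rslice // (lin_sum lq); apply: eq_bigr => w _.
by rewrite (linZ lq) [LHS]mulrC.
Qed.

Lemma ltrans_comp phi psi a : lin phi -> lin psi ->
  ltrans phi (ltrans psi a) = ltrans (fconv psi phi) a.
Proof.
move=> lp lq; have lqp := fconv_lin lq lp; apply: functional_ext => theta lt.
have lpt := fconv_lin lp lt.
by rewrite !f_ltrans // fconvA.
Qed.
Lemma rtrans_comp phi psi a : lin phi -> lin psi ->
  rtrans phi (rtrans psi a) = rtrans (fconv phi psi) a.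
Proof.
move=> lp lq; have lqp := fconv_lin lp lq; apply: functional_ext => theta lt.
have lpt := fconv_lin lt lp.
by rewrite !f_rtrans // fconvA.
Qed.
Lemma ltrans_rtrans phi psi a : lin phi -> lin psi ->
  ltrans phi (rtrans psi a) = rtrans psi (ltrans phi a).
Proof.
move=> lp lq; apply: functional_ext => theta lt.
have l1 := fconv_lin lp lt; have l2 := fconv_lin lt lq.
by rewrite f_ltrans // f_rtrans // f_rtrans // f_ltrans // fconvA.
Qed.
Lemma ltrans_eps a : ltrans feps a = a.
Proof.
apply: functional_ext => theta lt; rewrite f_ltrans ?fconv1 //; exact: feps_lin.
Qed.

Lemma eps_ltrans phi a : lin phi -> feps (ltrans phi a) = phi a.
Proof. by move=> lp; rewrite f_ltrans ?fconvr1 //; exact: feps_lin. Qed.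
Lemma eps_rtrans phi a : lin phi -> feps (rtrans phi a) = phi a.
Proof. by move=> lp; rewrite f_rtrans ?fconv1 //; exact: feps_lin. Qed.

Lemma ltrans1 phi : lin phi -> ltrans phi 1 = (phi 1)%:A.
Proof. by move=> lp; rewrite /ltrans shom1 [X in lslice _ X](_ : _ = pure 1 1) // lslice_pure. Qed.
Lemma rtrans1 phi : lin phi -> rtrans phi 1 = (phi 1)%:A.
Proof. by move=> lp; rewrite /rtrans shom1 [X in rslice _ X](_ : _ = pure 1 1) // rslice_pure. Qed.

Lemma lslice_grade phi i j (F : tensor A A) : lin phi ->
  (forall x, gr (~~ j) x -> phi x = 0) -> gr i F -> gr (i (+) j) (lslice phi F).
Proof.
move=> lp h; move: F; apply: tgr_ind => [|F H hF hH|k l a b ha hb <-].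
- by rewrite (lin0 (lslice_lin lp)); apply: gr0.
- by rewrite (linD (lslice_lin lp)); apply: (subspaceD (gr_subspace _ _)).
rewrite lslice_pure //; have [e|n] := eqVneq k j.
  by rewrite e [j (+) l]addbC -addbA addbb addbF; apply: (subspaceZ (gr_subspace _ _)).
rewrite h ?scale0r; first exact: gr0.
by case: k j n ha {h} => [] [].
Qed.

Lemma rslice_grade phi i j (F : tensor A A) : lin phi ->
  (forall x, gr (~~ j) x -> phi x = 0) -> gr i F -> gr (i (+) j) (rslice phi F).
Proof.
move=> lp h; move: F; apply: tgr_ind => [|F H hF hH|k l a b ha hb <-].
- by rewrite (lin0 (rslice_lin lp)); apply: gr0.
- by rewrite (linD (rslice_lin lp)); apply: (subspaceD (gr_subspace _ _)).
rewrite rslice_pure //; have [e|n] := eqVneq l j.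
  by rewrite e -addbA addbb addbF; apply: (subspaceZ (gr_subspace _ _)).
rewrite h ?scale0r; first exact: gr0.
by case: l j n hb {h} => [] [].
Qed.

Lemma ltrans_gr phi i j a : lin phi -> (forall x, gr (~~ j) x -> phi x = 0) ->
  gr i a -> gr (i (+) j) (ltrans phi a).
Proof. by move=> lp h ha; apply: lslice_grade => //; apply: shom_gr. Qed.
Lemma rtrans_gr phi i j a : lin phi -> (forall x, gr (~~ j) x -> phi x = 0) ->
  gr i a -> gr (i (+) j) (rtrans phi a).
Proof. by move=> lp h ha; apply: rslice_grade => //; apply: shom_gr. Qed.

(* Odd [eps]-derivations, i.e. the odd part of the Lie superalgebra. *)
Definition vder (u : A -> K^o) : Prop :=
  [/\ lin u, forall x, gr false x -> u x = 0
    & forall x y, u (x * y) = u x * feps y + feps x * u y].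

Lemma feps_odd x : gr true x -> feps x = 0.
Proof. by move=> /(shom_gr (counit G)) /(_ isT). Qed.

Lemma fepsM x y : feps (x * y) = feps x * feps y.
Proof. exact (shomM (counit G) x y). Qed.

Lemma lslice_vder u i (F H : tensor A A) : vder u -> gr i F ->
  lslice u (F * H) = lslice u F * lslice feps H + (-1) ^+ i * (lslice feps F * lslice u H).
Proof.
move=> [lu u0 dU] hF; rewrite sign_scale.
move: F hF; apply: tgr_ind => [|F F' hF hF'|j k a b ha hb e].
- by rewrite !(mul0r, lin0 (lslice_lin lu), lin0 (lslice_lin feps_lin), scaler0, addr0).
- by rewrite !(mulrDl, linD (lslice_lin lu), linD (lslice_lin feps_lin), scalerDr) hF hF' addrACA.
move: H; apply: lin_eq_tens_hom => [||l m a' b' ha' hb'].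
- exact: lin_comp (lin_mulr _) (lslice_lin lu).
- apply: lin_add; first exact: (lin_comp (lslice_lin feps_lin) (lin_mulr _)).
  by apply: lin_scale; apply: (lin_comp (lslice_lin lu) (lin_mulr _)).
rewrite [X in lslice u X](pure_hom _ _ ha' hb) (linZ (lslice_lin lu)).
rewrite !lslice_pure //; try exact: feps_lin.
rewrite dU scalerDl scalerDr -!scalerAl -!scalerAr !scalerA; congr (_ + _).
  case: l ha' => ha'; first by rewrite (feps_odd ha') !mulr0 scale0r.
  by rewrite /koszul expr0 mul1r.
case: l ha' => ha'; last by rewrite (u0 _ ha') !mulr0 !scale0r.
case: j ha e => ha e; first by rewrite (feps_odd ha) !(mulr0, mul0r) !scale0r.
by rewrite -e /koszul mulrA.
Qed.

Lemma ltrans_superder u : vder u -> superder (ltrans u).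
Proof.
move=> du; have [lu u0 dU] := du; split; first exact: ltrans_lin.
  by move=> i x hx; rewrite -[~~ i]addbT; apply: ltrans_gr.
move=> i x y hx; rewrite /ltrans shomM (lslice_vder _ du (shom_gr comult hx)).
by rewrite -![lslice feps _]/(ltrans feps _) !ltrans_eps.
Qed.

End Translations.

Notation counit_form := feps (only parsing).
Notation form_conv := fconv (only parsing).
Notation left_slice := ltrans (only parsing).

(** * Odd tangent vectors and the adjoint action *)

(** A basis of the span of [s] modulo [M], selected from [s], with dual functionals that vanish on
    [M]. A new element is added when its reduction [x'] is nonzero modulo [M], and the earlier
    functionals are corrected by [f]. *)
Lemma dual_basis (K : fieldType) (U : lmodType K) (M : U -> Prop) (s : seq U) :
  subspace M -> exists m (w : 'I_m -> U) (u : 'I_m -> U -> K^o),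
    [/\ forall i, lin (u i), forall i x, M x -> u i x = 0,
        forall i j, u i (w j) = (i == j)%:R, forall i, w i \in s
      & forall x, x \in s -> M (x - \sum_(i < m) u i x *: w i)].
Proof.
move=> sM; elim: s => [|x s [m [w [u [lu uM uw ws hs]]]]].
  by exists 0%N, (fun=> 0), (fun _ _ => 0); split=> // -[].
pose x' := x - \sum_(i < m) u i x *: w i.
have [Mx'|nMx'] := pselect (M x').
  exists m, w, u; split=> // [i|y]; first by rewrite inE ws orbT.
  by rewrite inE => /orP [/eqP -> //|]; apply: hs.
pose X y := exists2 z, M z & exists c : 'I_m -> K, y = z + \sum_(i < m) c i *: w i.
have sX : subspace X.
  split.
    exists 0; first exact: subspace0.
    by exists (fun=> 0); rewrite add0r big1 // => i _; rewrite scale0r.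
  move=> c y z [y1 hy1 [d ->]] [z1 hz1 [e ->]].
  exists (c *: y1 + z1); first exact: subspaceP.
  exists (fun i => c * d i + e i); rewrite scalerDr addrACA scaler_sumr -big_split /=.
  by congr (_ + _); apply: eq_bigr => i _; rewrite scalerA scalerDl.
have ux' j : u j x' = 0.
  rewrite /x' (linB (lu j)) (lin_sum (lu j)) (bigD1 j) //= (linZ (lu j)) uw eqxx.
  rewrite [_ *: 1]mulr1 big1 ?addr0 ?subrr // => i ni.
  by rewrite (linZ (lu j)) uw eq_sym (negPf ni) scaler0.
have nX : ~ X x'.
  move=> [z Mz [c ex]]; apply: nMx'; suff c0 j : c j = 0.
    by rewrite ex big1 ?addr0 // => i _; rewrite c0 scale0r.
  have := ux' j; rewrite ex (linD (lu j)) uM // add0r (lin_sum (lu j)) (bigD1 j) //=.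
  rewrite (linZ (lu j)) uw eqxx [_ *: 1]mulr1 big1 ?addr0 // => i ni.
  by rewrite (linZ (lu j)) uw eq_sym (negPf ni) scaler0.
have [f [lf f1 f0]] := subspace_separation sX nX.
have fM z : M z -> f z = 0.
  move=> Mz; apply: f0; exists z => //; exists (fun=> 0).
  by rewrite big1 ?addr0 // => i _; rewrite scale0r.
have fw j : f (w j) = 0.
  apply: f0; exists 0; first exact: subspace0.
  by have [c ec] := lincomb_mem w j; exists c; rewrite add0r.
have fx : f x = 1.
  rewrite -f1 /x' (linB lf) (lin_sum lf) big1 ?subr0 // => i _.
  by rewrite (linZ lf) fw scaler0.
exists m.+1, (fun i => if unlift ord0 i is Some j then w j else x),
  (fun i => if unlift ord0 i is Some j then (fun y => u j y - u j x * f y) else f); split.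
- move=> i; case: unliftP => [j _|_] //; apply: lin_sub => //.
  exact: (lin_scale _ lf).
- move=> i z Mz; case: unliftP => [j _|_]; last exact: fM.
  by rewrite uM // fM // mulr0 subr0.
- move=> i k; case: unliftP => [j ->|->]; case: unliftP => [l ->|->].
  + by rewrite uw fw mulr0 subr0 (inj_eq (@lift_inj _ _)).
  + by rewrite fx mulr1 subrr eq_sym (negPf (neq_lift _ _)).
  + by rewrite fw (negPf (neq_lift _ _)).
  + by rewrite fx eqxx.
- by move=> i; case: unliftP => [j _|_]; rewrite inE ?eqxx // ws orbT.
- have e y : \sum_(i < m.+1) (if unlift ord0 i is Some j then (fun y => u j y - u j x * f y) else
  f) y
     *: (if unlift ord0 i is Some j then w j else x) = \sum_(i < m) u i y *: w i + f y *: x'.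
    rewrite big_ord_recl unlift_none; under eq_bigr do rewrite !liftK scalerBl.
    rewrite sumrB addrCA /x' scalerBr; congr (_ + (_ - _)); rewrite scaler_sumr.
    by apply: eq_bigr => i _; rewrite scalerA mulrC.
  move=> y; rewrite inE e opprD addrA => /orP [/eqP ->|hy].
    by rewrite -/x' fx scale1r subrr; apply: subspace0.
  have := hs y hy => My; have fy : f y = 0.
    apply: f0; exists (y - \sum_(i < m) u i y *: w i) => //.
    by exists (u ^~ y); rewrite subrK.
  by rewrite fy scale0r subr0.
Qed.

Section SuperGroup.
Variables (K : fieldType) (char2 : 2 \notin [pchar K]) (G : affine_supergroup K).
Local Notation A := (coord G).
Local Notation hS := (salg_cat_closed K).
Local Notation feps := (feps (G := G)).
Local Notation ltrans := (ltrans hS).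
Local Notation rtrans := (rtrans hS).
Local Notation fconv := (fconv hS).
Local Notation comult := (comult hS G).
Local Notation sA := (objP A).

(** The span of the products of an even element of the augmentation ideal with an odd element. The
    odd part modulo this subspace is the odd cotangent space at the identity. *)
Definition mred (a : A) : Prop := forall P : A -> Prop, subspace P ->
  (forall x y, gr false x -> feps x = 0 -> gr true y -> P (x * y)) -> P a.

Lemma mred_subspace : subspace mred.
Proof.
split; first by move=> P sP _; apply: subspace0.
by move=> c x y hx hy P sP h; apply: subspaceP => //; [apply: hx|apply: hy].
Qed.

Lemma mredM x y : gr false x -> feps x = 0 -> gr true y -> mred (x * y).
Proof. by move=> hx ex hy P sP; apply. Qed.

Lemma ker_subspace (V : lmodType K) (f : A -> V) : lin f -> subspace (fun x => f x = 0).
Proof.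
move=> lf; split; first exact: lin0.
by move=> c x y hx hy; rewrite lf hx hy scaler0 addr0.
Qed.

Lemma vder_mred (u : A -> K^o) a : vder u -> mred a -> u a = 0.
Proof.
move=> [lu u0 du] h; apply: (h (fun x => u x = 0)); first exact: ker_subspace.
by move=> x y hx ex hy; rewrite du u0 // ex !mul0r addr0.
Qed.

Lemma vder_pj (u : A -> K^o) a : vder u -> u (pj true a) = u a.
Proof.
by move=> [lu u0 _]; rewrite [in RHS](pj_split a) (linD lu) (u0 _ (pj_gr _ _)) add0r.
Qed.

(** Since [v] ignores even elements, only the odd part of [x * y] matters, and supercommutativity
    writes it as a sum of two products of an even and an odd element. *)
Lemma vder_crit (v : A -> K^o) : lin v -> (forall x, gr false x -> v x = 0) ->
  (forall x y, gr false x -> gr true y -> v (x * y) = feps x * v y) -> vder v.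
Proof.
move=> lv v0 ve; have vt x : v x = v (pj true x).
  by rewrite {1}(pj_split x) (linD lv) (v0 _ (pj_gr _ _)) add0r.
split=> // x y; rewrite vt.
have e : pj true (x * y) = pj false x * pj true y + pj false y * pj true x.
  rewrite (odd_even_comm sA (pj_gr true x) (pj_gr false y)).
  rewrite {1}(pj_split x) {1}(pj_split y) mulrDl !mulrDr !(linD (@pj_lin _ A true)).
  rewrite !(pj_oddMl _ _ (pj_gr true x)) /= (pj_neq (pj_gr true y)) // mulr0 addr0.
  rewrite (pj_id (pj_gr false y)) (pj_neq (grM (pj_gr false x) (pj_gr false y))) // add0r.
  by rewrite (pj_id (grM (pj_gr false x) (pj_gr true y))).
rewrite e (linD lv) !(ve _ _ (pj_gr _ _) (pj_gr _ _)) -!vt.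
have ef z : feps (pj false z) = feps z.
  by rewrite [in RHS](pj_split z) (linD (@feps_lin K _ G)) (feps_odd (pj_gr true z)) addr0.
by rewrite !ef addrC [feps y * _]mulrC.
Qed.

Definition odd_basis m (u : 'I_m -> A -> K^o) (w : 'I_m -> A) : Prop :=
  [/\ forall i, vder (u i), forall i, gr true (w i),
      forall i j, u i (w j) = (i == j)%:R
    & forall a, gr true a -> (forall i, u i a = 0) -> mred a].

Definition odd_fin (s : seq A) : Prop :=
  (forall x, x \in s -> gr true x) /\
  forall a, gr true a -> exists c : nat -> K, mred (a - \sum_(i < size s) c i *: s`_i).

(** The dual functionals are taken relative to the elements whose odd part lies in [mred]. They
    vanish on even elements and on [mred], which by [vder_crit] makes them tangent vectors. *)
Lemma odd_basis_ex s : odd_fin s -> exists m (u : 'I_m -> A -> K^o) w, odd_basis u w.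
Proof.
move=> [so hs].
have sM : subspace (fun x => mred (pj true x)).
  split; first by rewrite (lin0 (@pj_lin _ A true)); apply: (subspace0 mred_subspace).
  by move=> c x y hx hy; rewrite (@pj_lin _ A true); apply: (subspaceP mred_subspace).
have [m [w [u [lu uM uw ws h]]]] := dual_basis s sM.
have u0 i x : gr false x -> u i x = 0.
  by move=> hx; apply: uM; rewrite (pj_neq hx) //; apply: (subspace0 mred_subspace).
have um i x : mred x -> u i x = 0.
  move=> hx; rewrite (pj_split x) (linD (lu i)) (u0 _ _ (pj_gr _ _)) add0r.
  apply: uM; rewrite (pj_id (pj_gr true x)); apply: (hx (fun x => mred (pj true x))) => //.
  by move=> y z hy ey hz; rewrite (pj_id (grM hy hz)); apply: mredM.
have ut i x : u i x = u i (pj true x).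
  by rewrite {1}(pj_split x) (linD (lu i)) (u0 _ _ (pj_gr _ _)) add0r.
have wo i : gr true (w i) by apply: so.
have ue i x y : gr false x -> gr true y -> u i (x * y) = feps x * u i y.
  move=> hx hy; have hx' : gr false (x - (feps x)%:A).
    apply: (subspaceB (gr_subspace A false)) => //; exact: gr_alg.
  have ex' : feps (x - (feps x)%:A) = 0.
    by rewrite (linB (@feps_lin K _ G)) (linZ (@feps_lin K _ G)) [feps 1](shom1 (counit G)) [_ *:
      _]mulr1 subrr.
  rewrite -{1}(subrK (feps x)%:A x) mulrDl (linD (lu i)) (um i); last exact: mredM.
  by rewrite add0r mulr_algl (linZ (lu i)).
exists m, u, w; split=> //.
- move=> i; apply: vder_crit; [exact: lu|exact: u0|exact: (ue i)].
- move=> a ha ua; have [c hc] := hs a ha.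
  have ws' x : x \in s -> mred (x - \sum_(i < m) u i x *: w i).
    move=> xs; have := h x xs; rewrite pj_id //.
    apply: (subspaceB (gr_subspace A true)); first exact: so.
    by apply: (subspace_sum (gr_subspace A true)) => i _; apply: (subspaceZ (gr_subspace A true)).
  pose N b := mred (b - \sum_(i < m) u i b *: w i).
  have sN : subspace N.
    split; first by rewrite /N big1 ?subr0 => [|i _]; rewrite ?(lin0 (lu i)) ?scale0r //; apply:
      (subspace0 mred_subspace).
    move=> d x y hx hy; rewrite /N.
    have -> : d *: x + y - \sum_(i < m) u i (d *: x + y) *: w i =
       d *: (x - \sum_(i < m) u i x *: w i) + (y - \sum_(i < m) u i y *: w i).
      rewrite scalerBr addrACA -opprD scaler_sumr -big_split /=; congr (_ - _).
      by apply: eq_bigr => i _; rewrite lu scalerDl scalerA.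
    exact: (subspaceP mred_subspace).
  have Nm x : mred x -> N x.
    by move=> hx; rewrite /N big1 ?subr0 // => i _; rewrite um // scale0r.
  have : N a.
    rewrite -(subrK (\sum_(i < size s) c i *: s`_i) a).
    apply: (subspaceD sN); first exact: Nm.
    apply: (subspace_sum sN) => i _; apply: (subspaceZ sN); apply: ws'.
    exact: mem_nth.
  by rewrite /N big1 ?subr0 // => i _; rewrite ua scale0r.
Qed.

Section Basis.
Variables (m : nat) (u : 'I_m -> A -> K^o) (w : 'I_m -> A).
Hypothesis bas : odd_basis u w.

Let vu i : vder (u i). Proof. by case: bas. Qed.
Let lu i : lin (u i). Proof. by case: (vu i). Qed.
Let wo i : gr true (w i). Proof. by case: bas. Qed.
Let uw i j : u i (w j) = (i == j)%:R. Proof. by case: bas. Qed.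

Lemma basis_red a : gr true a -> mred (a - \sum_(i < m) u i a *: w i).
Proof.
case: bas => _ _ _ h ha; apply: h.
  apply: (subspaceB (gr_subspace A true)) => //.
  by apply: (subspace_sum (gr_subspace A true)) => i _; apply: (subspaceZ (gr_subspace A true)).
move=> j; rewrite (linB (lu j)) (lin_sum (lu j)) (bigD1 j) //= (linZ (lu j)) uw eqxx.
rewrite [_ *: 1]mulr1 big1 ?addr0 ?subrr // => i ni.
by rewrite (linZ (lu j)) uw eq_sym (negPf ni) scaler0.
Qed.

Lemma vder_expand v a : vder v -> v a = \sum_(i < m) u i a * v (w i).
Proof.
move=> dv; have [lv _ _] := dv; rewrite -(vder_pj a dv).
have /eqP := vder_mred dv (basis_red (pj_gr true a)).
rewrite (linB lv) subr_eq0 => /eqP ->; rewrite (lin_sum lv).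
by apply: eq_bigr => i _; rewrite (linZ lv) vder_pj.
Qed.

(* The adjoint action of [G_ev] on the odd tangent vectors: the [u]-component
   of [a (g y g^-1)]. *)
Definition Ev : obj (salg_cat K) := salg_of_alg (even_coord G).
Definition piE : point G Ev := squot_pi (odd_ideal (counit G)).

Lemma Ev_even : purely_even Ev.
Proof. exact: (proj2 (objP (even_coord G))). Qed.

Lemma piE_surj q : exists a, piE a = q.
Proof. exact: squot_pi_surj. Qed.

Lemma piE0 a : piE a = 0 <-> odd_ideal (counit G) a.
Proof. by rewrite -[in X in _ <-> X](subr0 a) -squot_piP squot_pi0. Qed.

Lemma piE_odd a : gr true a -> piE a = 0.
Proof. by move=> ha; apply/piE0; apply: odd_ideal_odd. Qed.

Lemma oddpow1E a : oddpow 1 a <-> odd_ideal (counit G) a.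
Proof.
split=> h.
  move: a h; apply: oddpow_ind' => [|x y|o x ho _]; first exact: superideal0.
    by move=> hx hy; rewrite -[y]opprK; apply: odd_idealB => //; rewrite -[- y]sub0r; apply:
      odd_idealB => //; apply: odd_ideal0.
  by apply: odd_idealMr; apply: odd_ideal_odd.
apply: (h (oddpow 1)).
- exact: oddpow_zero.
- by move=> x y; apply: (oddpowB sA).
- by move=> x y; apply: (oddpowMl sA).
- by move=> x y; apply: oddpowMr.
- by move=> x; apply: oddpow_odd.
Qed.

Definition EvA : obj (salg_cat K) := tens_obj hS Ev A.
Definition ad_g : point G EvA := scomp (tinl Ev A) piE.
Definition ad_y : point G EvA := tinr Ev A.
Definition ad_c : point G EvA := gconj ad_g ad_y.

Definition Adu (v : A -> K^o) (a : A) : Ev := rslice v (ad_c a).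

Lemma Adu_lin v : lin v -> lin (Adu v).
Proof. by move=> lv; apply: lin_comp (shom_lin ad_c) (rslice_lin lv). Qed.

Lemma pure_mulEv (q q' : Ev) (a a' : A) :
  (pure q a : EvA) * pure q' a' = pure (q * q') (a * a').
Proof.
rewrite (pj_split a) mulrDl !pureDr mulrDl.
by rewrite !(pure_hom _ _ (purely_even_gr Ev_even q') (pj_gr _ _)) /koszul !scale1r.
Qed.

Lemma rslice_der v (F H : EvA) : vder v ->
  rslice v (F * H) = rslice v F * rslice feps H + rslice feps F * rslice v H.
Proof.
move=> [lv _ dv]; have le := @feps_lin K _ G; move: F; apply: lin_eq_tens => [||q a].
- exact: lin_comp (lin_mull _) (rslice_lin lv).
- apply: lin_add; first exact: lin_comp (rslice_lin lv) (lin_mull _).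
  exact: lin_comp (rslice_lin le) (lin_mull _).
move: H; apply: lin_eq_tens => [||q' a'].
- exact: lin_comp (lin_mulr _) (rslice_lin lv).
- apply: lin_add; first exact: lin_comp (rslice_lin le) (lin_mulr _).
  exact: lin_comp (rslice_lin lv) (lin_mulr _).
rewrite [X in rslice v X](pure_mulEv q q' a a') !rslice_pure // dv scalerDl.
by rewrite -!scalerAl -!scalerAr !scalerA.
Qed.

(** Putting [y = 1] into [g y g^-1] gives the neutral element. *)
Lemma rslice_eps_ad a : rslice feps (ad_c a) = (feps a)%:A.
Proof.
pose h : shom EvA Ev := obj_lift hS (sid Ev) (scomp (galg Ev) (counit G)).
have e F : rslice feps F = h F.
  move: F; apply: lin_eq_tens => [||q b].
  - exact: rslice_lin (@feps_lin K _ G).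
  - exact (shom_lin h).
  rewrite rslice_pure; last exact: feps_lin.
  by rewrite [RHS]tliftE /= galgE mulr_algr.
rewrite e -[LHS]/(scomp h ad_c a) gconj_nat.
have -> : scomp h ad_y = gone G Ev.
  rewrite [LHS]tlift_inr; exact: (gone_nat G (R := ground_obj (salg_cat K)) (galg Ev)).
by rewrite /gconj gmulr1 gmulVr goneE.
Qed.

Lemma Adu_vder v (gamma : Ev -> K^o) : vder v -> lin gamma -> vder (gamma \o Adu v).
Proof.
move=> dv lg; have [lv v0 _] := dv; split.
- exact: lin_comp (Adu_lin lv) lg.
- move=> a ha; rewrite /= [Adu v a](Ev_even) ?(lin0 lg) //.
  have := shom_gr ad_c ha; rewrite /Adu; move: (ad_c a).
  apply: tgr_ind => [|F H hF hH|k l q b hq hb e].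
  + by rewrite (lin0 (rslice_lin lv)); apply: gr0.
  + by rewrite (linD (rslice_lin lv)); apply: (subspaceD (gr_subspace _ _)).
  rewrite rslice_pure //; case: k hq e => hq e.
    exact: (subspaceZ (gr_subspace _ _)).
  case: l hb e => hb e //; rewrite v0 ?scale0r //; exact: gr0.
- move=> x y; rewrite /= /Adu shomM rslice_der // !rslice_eps_ad mulr_algr mulr_algl.
  by rewrite (linD lg) !(linZ lg) [X in X + _]mulrC.
Qed.

Lemma Adu_expand v a : vder v -> Adu v a = \sum_(i < m) u i a *: Adu v (w i).
Proof.
move=> dv; apply: functional_ext => gamma lg.
rewrite [RHS](lin_sum lg); apply: (etrans (vder_expand a (Adu_vder dv lg))).
by apply: eq_bigr => i _; rewrite (linZ lg).
Qed.

Definition AdM (i j : 'I_m) : Ev := Adu (u j) (w i).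

(** The identity [g y = (g y g^-1) g], with [gamma] applied to [g] and [u j] to [y]. It moves an
    even functional past an odd tangent vector at the price of the adjoint matrix. *)
Lemma Ad_fconv (gamma : Ev -> K^o) j a : lin gamma ->
  fconv (gamma \o piE) (u j) a =
  \sum_(i < m) fconv (u i) ((fun q => gamma (AdM i j * q)) \o piE) a.
Proof.
move=> lg.
have e : gmul ad_g ad_y = gmul ad_c ad_g.
  by rewrite /ad_c /gconj -gmulA gmulV gmulr1.
have := congr1 (fun f : point G EvA => gamma (rslice (u j) (f a))) e.
rewrite !(gmulE hS) /convolution !(lin_sum (rslice_lin (lu j))) !(lin_sum lg) => e2.
transitivity (\sum_(i <- cop hS a) gamma (rslice (u j) (ad_g i.1 * ad_y i.2))).
  apply: eq_bigr => v _; rewrite [X in rslice _ X](tinl_tinr (A := Ev) (B := A)).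
  by rewrite rslice_pure // (linZ lg) [LHS]mulrC.
rewrite e2 /form_conv /convolution exchange_big /=; apply: eq_bigr => v _.
have -> : rslice (u j) (ad_c v.1 * ad_g v.2) = Adu (u j) v.1 * piE v.2.
  rewrite /Adu; move: (ad_c v.1); apply: lin_eq_tens => [||q b].
  - exact: lin_comp (lin_mull _) (rslice_lin (lu j)).
  - exact: lin_comp (rslice_lin (lu j)) (lin_mull _).
  by rewrite [X in rslice _ X](pure_mulEv _ _ _ _) mulr1 !rslice_pure // scalerAl.
rewrite Adu_expand // mulr_suml (lin_sum lg); apply: eq_bigr => i _.
by rewrite -scalerAl (linZ lg).
Qed.

End Basis.
End SuperGroup.

Section OddCoordinates.
Variables (K : fieldType) (char2 : 2 \notin [pchar K]) (G : affine_supergroup K).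
Local Notation A := (coord G).
Local Notation hS := (salg_cat_closed K).
Local Notation feps := (feps (G := G)).
Local Notation ltrans := (ltrans hS).
Local Notation fconv := (fconv hS).
Local Notation comult := (comult hS G).
Local Notation conv := (@conv K (salg_cat K) hS G).
Local Notation sA := (objP A).
Local Notation piE := (piE G).
Variables (m : nat) (u : 'I_m -> A -> K^o) (w : 'I_m -> A).
Hypothesis bas : odd_basis u w.

Let vu i : vder (u i). Proof. by case: bas. Qed.
Let lu i : lin (u i). Proof. by case: (vu i). Qed.
Let wo i : gr true (w i). Proof. by case: bas. Qed.
Let uw i j : u i (w j) = (i == j)%:R. Proof. by case: bas. Qed.

(** The coordinate [w i] of [x] times the inverse of its even part. Dividing by the even part makes
    the derivatives [Y j (b i)] constant modulo odd elements on the whole group, and not just at the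
    identity. *)
Definition bcoord (i : 'I_m) : A := conv (sid A) (pj false \o antip G) (w i).

Let ls0 : lin (pj false \o antip G : A -> A).
Proof. exact: lin_comp (shom_lin (antip G)) (@pj_lin _ A false). Qed.

Lemma bcoord_odd i : gr true (bcoord i).
Proof.
rewrite /bcoord convE; have := shom_gr comult (wo i); move: (comult (w i)).
have bb := mul_bilin (shom_lin (sid A)) ls0.
apply: tgr_ind => [|F H hF hH|k l x y hx hy e].
- by rewrite (lin0 (text_lin bb)); apply: gr0.
- by rewrite (linD (text_lin bb)); apply: (subspaceD (gr_subspace _ _)).
rewrite text_pure //=; case: l hy e => hy; rewrite ?addbT ?addbF => e.
  by rewrite (pj_neq (shom_gr (antip G) hy)) // mulr0; apply: gr0.
by rewrite e in hx; apply: (grM hx (pj_gr false _)).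
Qed.

Lemma piE_pj a : piE (pj false a) = piE a.
Proof. by rewrite [in RHS](pj_split a) shomD (piE_odd (pj_gr true a)) addr0. Qed.

Lemma piE_ltransM v x e : vder v -> gr false e -> piE (ltrans v (x * e)) = piE (ltrans v x) * piE e.
Proof.
move=> dv he; have [lY gY dY] := ltrans_superder hS dv.
rewrite [in LHS](pj_split x) mulrDl (linD lY) (dY _ _ _ (pj_gr _ _)) (dY _ _ _ (pj_gr _ _)).
rewrite !sign_scale addrACA shomD -mulrDl -(linD lY) -pj_split shomM.
rewrite [X in _ + X](_ : _ = 0) ?addr0 //.
have z y : piE (y * ltrans v e) = 0 by rewrite shomM (piE_odd (gY _ _ he)) mulr0.
by rewrite shomD !shomZ !z !scaler0 addr0.
Qed.

Definition femb (v : A -> K^o) (a : A) : Ev G := (v a)%:A.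
Lemma femb_lin v : lin v -> lin (femb v).
Proof. by move=> lv c x y; rewrite /femb lv scalerDl scalerA. Qed.

Lemma piE_ltrans v a : lin v -> piE (ltrans v a) = conv (femb v) piE a.
Proof.
move=> lv; rewrite /left_slice cop_lslice // shom_sum; apply: eq_bigr => x _.
by rewrite shomZ /femb mulr_algl.
Qed.

(** Modulo odd elements the even part of [x] is [x] itself, so differentiation leaves the
    convolution of [u j] with [piE] and its inverse, which collapses to [u j (w i)]. *)
Lemma ltrans_bcoord i j : oddpow 1 (ltrans (u j) (bcoord i) - (i == j)%:R).
Proof.
apply/oddpow1E/piE0; apply/eqP; rewrite shomB subr_eq0; apply/eqP.
have lpS : lin (piE \o antip G) := lin_comp (shom_lin (antip G)) (shom_lin piE).
have lY := ltrans_lin hS (lu j).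
transitivity (conv (conv (femb (u j)) piE) (piE \o antip G) (w i)).
  rewrite /bcoord {1}/convolution (lin_sum lY) shom_sum; apply: eq_bigr => x _.
  rewrite [X in piE (ltrans _ X)](_ : _ = x.1 * pj false (antip G x.2)) //.
  rewrite piE_ltransM //; last exact: pj_gr.
  by rewrite piE_pj piE_ltrans.
rewrite -convA ?convS ?convr1 //; try exact: femb_lin; try exact: shom_lin.
rewrite /femb uw eq_sym; case: eqP => _; rewrite ?scale1r ?shom1 // scale0r shom0 //.
Qed.

Section SquareQuotient.

Lemma sq1 : ~ oddpow 2 (1 : A).
Proof.
move=> /(oddpow_pred sA) /oddpow1E; exact: (@superideal1 _ _ (odd_ideal (counit G))).
Qed.

Lemma oddpow_pj_all k i (x : A) : oddpow k x -> oddpow k (pj i x).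
Proof.
move=> h; elim: h i => {k x} [x|k|k x y _ hx _ hy|k o x ho _ IH] i.
- exact: oddpow0.
- by rewrite (lin0 (@pj_lin _ A _)); apply: oddpow_zero.
- by rewrite (linD (@pj_lin _ A _)); apply: oddpowD.
- by rewrite pj_oddMl //; apply: oddpowS.
Qed.

Lemma sq_gr (x0 x1 : A) : gr false x0 -> gr true x1 -> oddpow 2 (x0 + x1) -> oddpow 2 x0.
Proof.
move=> h0 h1 /(oddpow_pj_all false); rewrite (linD (@pj_lin _ A _)).
by rewrite (pj_id h0) (pj_neq h1) // addr0.
Qed.

Definition sq_ideal : superideal A :=
  @Superideal K A (oddpow 2) (oddpow_zero A 2) (@oddpowB _ _ sA 2)
    (@oddpowMl _ _ sA 2) (fun a x h => oddpowMr a h) sq1 sq_gr.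

Definition At : obj (salg_cat K) :=
  @Obj K (salg_cat K) (squotient sq_ideal) (squotient_supercommutative (objP A)).
Definition pi2 : point G At := squot_pi sq_ideal.

Lemma pi2_0 a : pi2 a = 0 <-> oddpow 2 a.
Proof. by have := squot_piP sq_ideal a 0; rewrite subr0 squot_pi0. Qed.

(** Modulo the square of the odd ideal the projection to the even part is multiplicative, because
    products of two odd elements are zero there. So the even part of the universal point is a point
    of [G] over [At]. *)
Definition tret_fun (a : A) : At := pi2 (pj false a).

Lemma tret_linear : linear tret_fun.
Proof. by move=> c x y; rewrite /tret_fun (@pj_lin _ A) (shom_lin pi2). Qed.
Lemma tret_monoid : monoid_morphism tret_fun.
Proof.
split=> [|x y]; rewrite /tret_fun; first by rewrite (pj_id (gr1 A)) shom1.
rewrite -shomM; apply/eqP; rewrite -subr_eq0 -shomB; apply/eqP/pi2_0.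
rewrite {1}(pj_split x) {1}(pj_split y) mulrDl !mulrDr !(linD (@pj_lin _ A false)).
rewrite (pj_id (grM (pj_gr false x) (pj_gr false y))).
rewrite (pj_neq (grM (pj_gr false x) (pj_gr true y))) // addr0.
rewrite (pj_neq (grM (pj_gr true x) (pj_gr false y))) // add0r.
rewrite (pj_id (grM (pj_gr true x) (pj_gr true y))) addrAC subrr add0r.
by rewrite -[pj true y]mulr1; apply: oddpowS (pj_gr true x) _; apply: oddpowS (pj_gr true y)
  (oddpow0 _).
Qed.
Lemma tret_gr i x : gr i x -> gr i (tret_fun x).
Proof.
case: i => hx; rewrite /tret_fun.
  by rewrite (pj_neq hx) // shom0; apply: gr0.
exact/(shom_gr pi2)/pj_gr.
Qed.
Definition tret : point G At := mk_shom tret_linear tret_monoid tret_gr.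
Lemma tretE a : tret a = pi2 (pj false a). Proof. by []. Qed.

Definition zret : point G At := gmul pi2 (ginv tret).

Lemma zretE a : zret a = pi2 (conv (sid A) (pj false \o antip G) a).
Proof.
rewrite /zret (gmulE hS) ginvE /convolution shom_sum; apply: eq_bigr => x _.
by rewrite shomM.
Qed.

(** The endomorphism [kap] of [At] that forgets odd parts sends both [pi2] and [tret] to [tret],
    hence [zret] to the neutral point, while it fixes the even element [zret a]. *)
Lemma zret_even a : gr false a -> zret a = (feps a)%:A.
Proof.
move=> ha.
have [x|kap ek] := @shom_factor_surj K _ _ _ pi2 tret (squot_pi_surj (I := sq_ideal)).
  by move=> /pi2_0 h; rewrite tretE; apply/pi2_0/oddpow_pj_all.
have kE x : kap (pi2 x) = tret x by exact: (congr1 (fun f : shom A At => f x) ek).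
have kt : scomp kap tret = tret.
  by apply: shom_ext => x; rewrite [LHS]kE !tretE (pj_id (pj_gr false x)).
have e1 : scomp kap zret = gone G At by rewrite gmul_nat ginv_nat ek kt gmulVr.
have e2 : kap (zret a) = gone G At a := congr1 (fun f : point G At => f a) e1.
transitivity (kap (zret a)); last by rewrite e2 goneE.
have [x hx <-] := shom_gr zret ha.
by rewrite [RHS]kE tretE pj_id.
Qed.

Lemma zret_odd a : gr true a -> zret a = \sum_(i < m) u i a *: zret (w i).
Proof.
move=> ha; have := basis_red bas ha => h.
have sk := ker_subspace (shom_lin zret).
have : zret (a - \sum_(i < m) u i a *: w i) = 0.
  apply: (h (fun x => zret x = 0)) => // x y hx ex hy.
  by rewrite shomM zret_even // ex scale0r mul0r.
rewrite shomB => /eqP; rewrite subr_eq0 => /eqP ->; rewrite shom_sum.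
by apply: eq_bigr => i _; rewrite shomZ.
Qed.

(** This is the factorisation of the universal point as [zret] times [tret]. Being the counit on
    even elements, [zret] depends on odd elements only through the tangent vectors [u i]. *)
Lemma bcoord_gen a : gr true a -> oddpow 2 (a - \sum_(i < m) bcoord i * ltrans (u i) a).
Proof.
move=> ha; apply/pi2_0; rewrite shomB shom_sum; apply/eqP; rewrite subr_eq0; apply/eqP.
transitivity (gmul zret tret a); first by rewrite /zret -gmulA gmulV gmulr1.
rewrite (gmulE hS) convE.
have bb := mul_bilin (shom_lin zret) (shom_lin tret).
have e : forall F : tensor A A, gr true F -> text (fun x y => zret x * tret y) F =
    \sum_(i < m) zret (w i) * tret (lslice (u i) F).
  apply: tgr_ind => [|F H hF hH|k l x y hx hy e].
  - rewrite (lin0 (text_lin bb)) big1 // => i _.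
    by rewrite (lin0 (lslice_lin (lu i))) shom0 mulr0.
  - rewrite (linD (text_lin bb)) hF hH -big_split /=; apply: eq_bigr => i _.
    by rewrite (linD (lslice_lin (lu i))) (linD (shom_lin tret)) mulrDr.
  rewrite text_pure //; case: k hx e => hx e.
    rewrite zret_odd // mulr_suml; apply: eq_bigr => i _.
    by rewrite lslice_pure // shomZ -scalerAl -scalerAr.
  have ey : tret y = 0.
    by case: l hy e => hy // _; rewrite tretE (pj_neq hy) // shom0.
  rewrite ey mulr0 big1 // => i _.
  by rewrite lslice_pure // shomZ ey scaler0 mulr0.
rewrite e; last exact: (shom_gr comult).
apply: eq_bigr => i _; rewrite shomM /bcoord -zretE tretE pj_id //.
have [_ h _] := ltrans_superder hS (vu i); exact: (h true).
Qed.

End SquareQuotient.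
End OddCoordinates.

(** * Integrating an eigenfunctional *)

Lemma acomm_evenM (K : fieldType) (R : superalgebra K) (Y Z : R -> R) o x :
  superder Y -> superder Z -> gr false o ->
  acomm Y Z (o * x) = acomm Y Z o * x + o * acomm Y Z x.
Proof.
move=> dY dZ ho; have [lY pY _] := dY; have [lZ pZ _] := dZ.
rewrite /acomm (superder_even dZ _ ho) (superder_even dY _ ho) (linD lY) (linD lZ).
rewrite (superder_odd dY _ (pZ _ _ ho)) (superder_odd dZ _ (pY _ _ ho)).
rewrite (superder_even dY _ ho) (superder_even dZ _ ho).
rewrite mulrDl mulrDr.
set a := Y (Z o) * x; set b := Z (Y o) * x; set c := Z o * Y x; set d := Y o * Z x.
rewrite addrACA [a - c + _]addrACA [X in _ + X]addrACA -opprD [d + c]addrC.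
by rewrite addrA subrK.
Qed.

Section Key.
Variables (K : fieldType) (char2 : 2 \notin [pchar K]) (G : affine_supergroup K).
Local Notation A := (coord G).
Local Notation hS := (salg_cat_closed K).
Local Notation feps := (feps (G := G)).
Local Notation ltrans := (ltrans hS).
Local Notation rtrans := (rtrans hS).
Local Notation fconv := (fconv hS).
Local Notation sA := (objP A).
Local Notation piE := (piE G).
Local Notation Ev := (Ev G).
Variables (m : nat) (u : 'I_m -> A -> K^o) (w : 'I_m -> A).
Hypothesis bas : odd_basis u w.

Let vu i : vder (u i). Proof. by case: bas. Qed.
Let lu i : lin (u i). Proof. by case: (vu i). Qed.
Let wo i : gr true (w i). Proof. by case: bas. Qed.
Let uw i j : u i (w j) = (i == j)%:R. Proof. by case: bas. Qed.
Let lfeps : lin feps. Proof. exact: feps_lin. Qed.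
Let dY i : superder (ltrans (u i)). Proof. exact: ltrans_superder. Qed.

Local Notation AdM := (AdM u w).

Lemma factor_piE (x : A -> K^o) : lin x -> (forall a, oddpow 1 a -> x a = 0) ->
  exists g : Ev -> K^o, lin g /\ forall a, g (piE a) = x a.
Proof.
move=> lx x0; exists (fun q => x (projT1 (cid (piE_surj q)))).
have e a : x (projT1 (cid (piE_surj (piE a)))) = x a.
  apply/eqP; rewrite -subr_eq0 -(linB lx); apply/eqP/x0/oddpow1E/piE0.
  by rewrite shomB; case: cid => b /= ->; rewrite subrr.
split=> // c p q; have [a <-] := piE_surj p; have [b <-] := piE_surj q.
by rewrite -(shom_lin piE) !e lx.
Qed.

Lemma piE_even_lift q : exists a, gr false a /\ piE a = q.
Proof.
by have [a <-] := piE_surj q; exists (pj false a); split; [exact: pj_gr|exact: piE_pj].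
Qed.

Lemma feps_oddpow a : oddpow 1 a -> feps a = 0.
Proof.
move: a; apply: oddpow_ind' => [|x y hx hy|o x ho _]; first exact: (lin0 lfeps).
  by rewrite (linD lfeps) hx hy addr0.
by rewrite fepsM (feps_odd ho) mul0r.
Qed.

(** The adjoint matrix is the identity at the neutral element; this is [Ad_fconv] with the counit
    for [gamma]. *)
Lemma feps_AdM i j mu : piE mu = AdM i j -> feps mu = (i == j)%:R.
Proof.
move=> emu; have [g [lg hg]] := factor_piE lfeps feps_oddpow.
have := Ad_fconv bas j (w i) lg.
have -> : g \o piE = feps by apply/funext.
rewrite fconv1 // uw => e; rewrite eq_sym e.
have h k : exists x, piE x = AdM k j by apply: piE_surj.
have /choice [mu' hmu'] := h.
have gM x y : g (piE x * piE y) = feps x * feps y by rewrite -shomM hg fepsM.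
rewrite (eq_bigr (fun k => feps (mu' k) * u k (w i))); last first.
  move=> k _; rewrite -[in RHS](fconvr1 hS (lu k)) /form_conv /convolution mulr_sumr.
  by apply: eq_bigr => x _; rewrite /= -hmu' gM mulrCA.
rewrite (bigD1 i) //= uw eqxx mulr1 big1 ?addr0 => [|k ni]; last by rewrite uw (negPf ni) mulr0.
by rewrite -[LHS]hg -[RHS]hg emu hmu'.
Qed.

(** The bracket of two odd tangent vectors. It is an even tangent vector: it kills the odd ideal and
    so is a functional on [K[G_ev]]. *)
Definition xf i j (a : A) : K^o := fconv (u j) (u i) a + fconv (u i) (u j) a.

Lemma xf_lin i j : lin (xf i j).
Proof. by apply: lin_add; apply: fconv_lin. Qed.

Lemma acomm_xf i j a : acomm (ltrans (u i)) (ltrans (u j)) a = ltrans (xf i j) a.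
Proof.
rewrite /acomm !ltrans_comp //; apply: functional_ext => t lt.
have l1 := fconv_lin hS (lu i) (lu j); have l2 := fconv_lin hS (lu j) (lu i).
rewrite (linD lt) !f_ltrans //; last exact: xf_lin.
rewrite /form_conv /convolution -big_split /=; apply: eq_bigr => x _.
by rewrite -mulrDl.
Qed.

Lemma feps_acomm i j a : feps (acomm (ltrans (u i)) (ltrans (u j)) a) = xf i j a.
Proof. by rewrite acomm_xf eps_ltrans //; apply: xf_lin. Qed.

Lemma xf_oddpow i j a : oddpow 1 a -> xf i j a = 0.
Proof.
by move=> h; rewrite -feps_acomm; apply: feps_oddpow; apply: acomm_oddpow.
Qed.

Lemma acommM i j o x : gr false o ->
  feps (acomm (ltrans (u i)) (ltrans (u j)) (o * x)) = xf i j o * feps x + feps o * xf i j x.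
Proof.
move=> ho; have [lY pY _] := dY i; have [lZ pZ _] := dY j.
rewrite -!feps_acomm /acomm (superder_even (dY j) _ ho) (superder_even (dY i) _ ho).
rewrite (linD lY) (linD lZ).
rewrite (superder_odd (dY i) _ (pZ _ _ ho)) (superder_odd (dY j) _ (pY _ _ ho)).
rewrite (superder_even (dY i) _ ho) (superder_even (dY j) _ ho).
rewrite !(linD lfeps) !(linN lfeps) !fepsM (feps_odd (pY _ _ ho)) (feps_odd (pZ _ _ ho)).
by ring.
Qed.

Lemma xf_der i j o x : gr false o -> xf i j (o * x) = xf i j o * feps x + feps o * xf i j x.
Proof. by move=> ho; rewrite -acommM // feps_acomm. Qed.

(** The triple bracket [[[u i, u j], u k]], again an odd tangent vector; its coordinates [coef] are
    the structure constants of the integrability condition. *)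
Definition df i j k (a : A) : K^o := fconv (u k) (xf i j) a - fconv (xf i j) (u k) a.

Lemma df_lin i j k : lin (df i j k).
Proof. by apply: lin_sub; apply: fconv_lin => //; apply: xf_lin. Qed.

Local Notation Y i := (ltrans (u i)).

Lemma dfE i j k a : df i j k a =
  feps (acomm (Y i) (Y j) (Y k a) - Y k (acomm (Y i) (Y j) a)).
Proof.
have lx := xf_lin i j.
rewrite !acomm_xf (ltrans_comp _ _ lx (lu k)) (ltrans_comp _ _ (lu k) lx) (linB lfeps).
by rewrite !eps_ltrans //; apply: fconv_lin.
Qed.

Lemma df_expand3 i j k a : df i j k a = feps (Y i (Y j (Y k a))) + feps (Y j (Y i (Y k a)))
  - feps (Y k (Y i (Y j a))) - feps (Y k (Y j (Y i a))).
Proof.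
have [lk _ _] := dY k.
by rewrite dfE /acomm (linD lk) (linB lfeps) !(linD lfeps) opprD addrA.
Qed.

Lemma df_vder i j k : vder (df i j k).
Proof.
apply: vder_crit => [|x hx|x y hx hy]; first exact: df_lin.
  have [_ gk _] := dY k; rewrite dfE; apply: feps_odd.
  apply: (subspaceB (gr_subspace A true)).
    by apply: acomm_gr => //; apply: (gk false).
  by apply: (gk false); apply: acomm_gr.
have [lk gk _] := dY k; have X := acomm_gr (dY i) (dY j).
have eqk (z : A) : feps (Y k z) = u k z by rewrite eps_ltrans.
have lA : lin (acomm (Y i) (Y j)).
  by apply: acomm_lin; [have [? _ _] := dY i|have [? _ _] := dY j].
have Ykx := gk _ _ hx; have Ex := feps_odd Ykx; have Ey := feps_odd hy.
rewrite !dfE !(linB lfeps) !feps_acomm.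
have -> : xf i j (Y k (x * y)) = xf i j x * u k y + feps x * xf i j (Y k y).
  rewrite -feps_acomm (superder_even (dY k) _ hx) (linD lA) acomm_oddM //.
  rewrite (linD lfeps) (linD lfeps) acommM // !fepsM Ex Ey eqk.
  by rewrite mulr0 mul0r !add0r.
have -> : feps (Y k (acomm (Y i) (Y j) (x * y))) =
    xf i j x * u k y + feps x * feps (Y k (acomm (Y i) (Y j) y)).
  rewrite acomm_evenM // (linD lk) (superder_even (dY k) _ (X _ _ hx)).
  rewrite (superder_even (dY k) _ hx) (linD lfeps) (linD lfeps) (linD lfeps).
  rewrite !fepsM Ex Ey !eqk feps_acomm.
  by rewrite mulr0 mul0r !add0r.
by rewrite opprD addrACA subrr add0r mulrBr.
Qed.

Definition coef i j k p : K := df i j k (w p).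

Lemma coef_sym i j k p : coef i j k p = coef j i k p.
Proof. by rewrite /coef !df_expand3; ring. Qed.

(** After expansion into composites of three derivations both symmetry and the super Jacobi identity
    are formal. *)
Lemma coef_jacobi i j k p : coef i j k p + coef j k i p + coef k i j p = 0.
Proof. by rewrite /coef !df_expand3; ring. Qed.

(** Stated separately because the Jacobi identity only gives three times this coefficient, which
    says nothing in characteristic 3. *)
Lemma coef_diag i p : coef i i i p = 0.
Proof. by rewrite /coef !df_expand3; ring. Qed.

Lemma ltrans_expand v a : vder v -> ltrans v a = \sum_(p < m) v (w p) *: Y p a.
Proof.
move=> dv; have [lv _ _] := dv; rewrite /left_slice cop_lslice //.
transitivity (\sum_(x <- cop hS a) \sum_(p < m) v (w p) *: (u p x.1 *: x.2)).
  apply: eq_bigr => x _; rewrite (vder_expand bas _ dv) scaler_suml.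
  by apply: eq_bigr => p _; rewrite scalerA mulrC.
rewrite exchange_big /=; apply: eq_bigr => p _.
by rewrite cop_lslice // scaler_sumr.
Qed.

Lemma acomm_coef i j k a : acomm (Y i) (Y j) (Y k a) - Y k (acomm (Y i) (Y j) a) =
  \sum_(p < m) coef i j k p *: Y p a.
Proof.
have lx := xf_lin i j; rewrite -(ltrans_expand _ (df_vder i j k)).
rewrite !acomm_xf (ltrans_comp _ _ lx (lu k)) (ltrans_comp _ _ (lu k) lx).
rewrite /left_slice !cop_lslice //; try exact: fconv_lin; try exact: df_lin.
by rewrite -sumrB; apply: eq_bigr => x _; rewrite -scalerBl.
Qed.

(** Bracketing with the even tangent vector [xf i j] is, up to sign, the derivative along it of the
    adjoint representation: [Ad_fconv] is applied to [xf i j] and expanded by its Leibniz rule. *)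
Lemma coef_AdM i j : exists g : Ev -> K^o, lin g /\
  forall k p, coef i j k p = - g (AdM p k).
Proof.
have [g [lg hg]] := factor_piE (xf_lin i j) (@xf_oddpow i j).
have lx := xf_lin i j; exists g; split=> // k p.
suff e : fconv (xf i j) (u k) (w p) = g (AdM p k) + fconv (u k) (xf i j) (w p).
  by rewrite /coef /df e opprD addrCA subrr addr0.
have /choice [mu hmu] : forall q, exists x, gr false x /\ piE x = AdM q k.
  by move=> q; apply: piE_even_lift.
have := Ad_fconv bas k (w p) lg.
have -> : g \o piE = xf i j by apply/funext.
move=> ->.
transitivity (\sum_(q < m) (xf i j (mu q) * u q (w p) + feps (mu q) * fconv (u q) (xf i j) (w p))).
  apply: eq_bigr => q _; have [eq e] := hmu q.
  have e1 : u q (w p) = fconv (u q) feps (w p) by rewrite fconvr1.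
  rewrite [X in _ = _ * X + _]e1 /form_conv /convolution !mulr_sumr -big_split /=.
  apply: eq_bigr => x _.
  rewrite [X in _ * X = _](_ : _ = g (piE (mu q) * piE x.2)); last by rewrite e.
  by rewrite -shomM hg xf_der // mulrDr; congr (_ + _); apply: mulrCA.
rewrite big_split /=; congr (_ + _).
  rewrite (bigD1 p) //= uw eqxx mulr1 big1 ?addr0 => [|q nq].
    by have [_ <-] := hmu p; rewrite hg.
  by rewrite uw (negPf nq) mulr0.
rewrite (bigD1 k) //= big1 ?addr0 => [|q nq].
  by have [_ e] := hmu k; rewrite (feps_AdM e) eqxx mul1r.
by have [_ e] := hmu q; rewrite (feps_AdM e) (negPf nq) mul0r.
Qed.

Section Eigen.
Variable L : superalgebra K.
Hypotheses (eL : purely_even L) (sL : supercommutative L).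
Hypothesis fieldL : forall x : L, x <> 0 -> exists y, x * y = 1.
Variable N : nat.
Hypothesis nilp : forall x : A, oddpow N x -> x = 0.
Variables (l : 'I_m -> L) (chi : tensor Ev L).
Hypothesis eigen : forall j, \sum_(i < m) pure (AdM i j) (l i) = tinr Ev L (l j) * chi.

Lemma mulLC (x y : L) : x * y = y * x.
Proof.
by rewrite (sL (purely_even_gr eL x) (purely_even_gr eL y)) expr0 mul1r.
Qed.
Lemma mulL_eq0 (x y : L) : x <> 0 -> x * y = 0 -> y = 0.
Proof.
move=> /fieldL [z hz] e; rewrite -[y]mul1r -hz mulLC [x * z]mulLC mulrA.
by rewrite [y * z]mulLC -mulrA [y * x]mulLC e mulr0.
Qed.

(** The derivative of the eigenvector equation along the bracket [[u i, u j]]; [lam] is the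
    derivative of the character [chi], with the sign of [coef_AdM]. *)
Lemma coef_eigen i j : exists lam : L, forall k, \sum_(p < m) coef i j k p *: l p = l k * lam.
Proof.
have [g [lg hg]] := coef_AdM i j; exists (- lslice g chi) => k.
rewrite mulrN -lslice_inr // -eigen (lin_sum (lslice_lin lg)) -sumrN.
by apply: eq_bigr => p _; rewrite lslice_pure // hg scaleNr.
Qed.

(** Choose [a] with [l a] nonzero. The diagonal relation gives [lam (a, a) = 0]. The Jacobi identity
    for [a, a, b] then gives [2 T a b a = 0], so [lam (a, b) = 0], and the one for [a, i, j] finally
    gives [lam (i, j) = 0]. *)
Lemma coef_zero i j k : \sum_(p < m) coef i j k p *: l p = 0.
Proof.
have /choice [lam hlam] : forall ij, exists lam : L,
    forall k, \sum_(p < m) coef ij.1 ij.2 k p *: l p = l k * lam.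
  by move=> [i' j']; apply: coef_eigen.
pose T i j k := \sum_(p < m) coef i j k p *: l p.
have hT i' j' k' : T i' j' k' = l k' * lam (i', j') by apply: (hlam (i', j')).
have Tsym i' j' k' : T i' j' k' = T j' i' k'.
  by apply: eq_bigr => p _; rewrite coef_sym.
have Tjac a b c : T a b c + T b c a + T c a b = 0.
  rewrite /T -!big_split /= big1 // => p _.
  by rewrite -!scalerDl coef_jacobi scale0r.
have Tdiag a : T a a a = 0 by apply: big1 => p _; rewrite coef_diag scale0r.
have [[a la]|nz] := pselect (exists a, l a <> 0); last first.
  apply: big1 => p _; have -> : l p = 0.
    by apply: contrapT => h; apply: nz; exists p.
  by rewrite scaler0.
have laa : lam (a, a) = 0 by apply: (mulL_eq0 la); rewrite -hT Tdiag.
have lab b : T a b a = 0.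
  have := Tjac a a b; rewrite (hT a a b) laa mulr0 add0r (Tsym b a a).
  exact: (half char2 (subspace_eq0 L)).
have laB b : lam (a, b) = 0 by apply: (mulL_eq0 la); rewrite -hT lab.
have := Tjac a i j; rewrite (hT a i j) laB mulr0 add0r (Tsym j a i) (hT a j i) laB.
rewrite mulr0 addr0 hT => /(mulL_eq0 la) e.
by rewrite -/(T i j k) hT e mulr0.
Qed.

Local Notation TL := (tensor A L).
Local Notation Yl i := (@tmapl K A A L (Y i)).
Let sTL : supercommutative TL. Proof. exact: tens_supercommutative sA sL. Qed.
Let lY i : lin (Y i). Proof. by case: (dY i). Qed.

Lemma nilp_TL (F : TL) : oddpow N F -> F = 0.
Proof.
apply: (tens_oddpow eL sA (subspace_eq0 _)) => a x /nilp ->.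
by rewrite pure0l.
Qed.

Lemma tmapl_tinr (Z : A -> A) x : lin Z -> @tmapl K A A L Z (tinr A L x) = pure (Z 1) x.
Proof. by move=> lZ; exact (tmapl_pure lZ 1 x). Qed.

Lemma vder1 (v : A -> K^o) : vder v -> v 1 = 0.
Proof. by move=> [_ v0 _]; apply: v0; apply: gr1. Qed.

Lemma Yl_tinr i x : Yl i (tinr A L x) = 0.
Proof. by rewrite tmapl_tinr // ltrans1 // (vder1 (vu i)) scale0r pure0l. Qed.

Lemma Yl_dY i : superder (Yl i).
Proof. exact: tmapl_superder. Qed.

Lemma Yl_bcoord i j : oddpow 1 (Yl j (tinl A L (bcoord w i)) - (i == j)%:R).
Proof.
have -> : Yl j (tinl A L (bcoord w i)) = tinl A L (Y j (bcoord w i)).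
  exact (tmapl_pure (lY j) _ _).
have -> : ((i == j)%:R : TL) = tinl A L (i == j)%:R.
  by case: (i == j); rewrite ?shom1 ?shom0.
rewrite -shomB; apply: shom_oddpow; exact: ltrans_bcoord.
Qed.

Lemma Yl_gen (a : TL) : gr true a ->
  oddpow 2 (a - \sum_(i < m) tinl A L (bcoord w i) * Yl i a).
Proof.
move: a; apply: (tens_gr_even eL) => [|F H hF hH|a x ha].
- rewrite big1 ?subr0 => [|i _]; first exact: oddpow_zero.
  by rewrite (lin0 (tmapl_lin (lY i))) mulr0.
- under eq_bigr do rewrite (linD (tmapl_lin (lY _))) mulrDr.
  by rewrite big_split /= opprD addrACA; apply: oddpowD.
have -> : pure a x - \sum_(i < m) tinl A L (bcoord w i) * Yl i (pure a x) =
    tinl A L (a - \sum_(i < m) bcoord w i * Y i a) * tinr A L x.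
  rewrite shomB mulrBl shom_sum mulr_suml [X in _ = X - _]tinl_tinr; congr (_ - _).
  apply: eq_bigr => i _; rewrite tmapl_pure // -[in LHS](tinl_tinr (A := A) (B := L)).
  by rewrite shomM mulrA.
by apply: oddpowMr; apply: shom_oddpow; apply: bcoord_gen.
Qed.

Lemma Yl_acomm i j k (a : TL) : acomm (Yl i) (Yl j) (Yl k a) - Yl k (acomm (Yl i) (Yl j) a) =
  \sum_(p < m) coef i j k p *: Yl p a.
Proof.
have lYl q : lin (Yl q) := tmapl_lin (lY q).
have lA : lin (acomm (Yl i) (Yl j)) by apply: acomm_lin.
move: a; apply: lin_eq_tens => [||a x].
- by apply: lin_sub; apply: (lin_comp (V := TL)).
- by apply: lin_bigsum => p; apply: lin_scale.
have pB (p q : A) : pure p x - pure q x = pure (p - q) x.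
  by rewrite (linB (proj1 (pure_bilin A L) x)).
rewrite /acomm !tmapl_pure // -!pureDl tmapl_pure // pB.
rewrite (eq_bigr (fun p => pure (coef i j k p *: Y p a) x)); last first.
  by move=> p _; rewrite tmapl_pure // pureZl.
rewrite -(lin_sum (proj1 (pure_bilin A L) x)) -acomm_coef.
by [].
Qed.

Lemma form_ex : exists f : TL, gr true f /\ forall j, Yl j f = tinr A L (l j).
Proof.
apply: (@exact_form K TL sTL char2 m (fun i => Yl i) (fun i => tinl A L (bcoord w i)) N
  Yl_dY _ Yl_bcoord Yl_gen nilp_TL (fun i => tinr A L (l i)) _ _ coef).
- by move=> i; apply: shom_gr; apply: (bcoord_odd bas).
- by move=> i; apply: shom_gr; exact: (purely_even_gr eL).
- by move=> i j; apply: Yl_tinr.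
- exact: Yl_acomm.
- move=> i j k; rewrite -[RHS](shom0 (tinr A L)) -(coef_zero i j k) shom_sum.
  by apply: eq_bigr => p _; rewrite shomZ.
Qed.

(** The uniqueness principle behind every identity for [f] below: modulo functions that vanish on
    [G_ev], it suffices to compare odd derivatives. *)
Lemma Yl_inj (F : TL) : oddpow 1 F -> (forall j, Yl j F = 0) -> F = 0.
Proof.
apply: (@star_zero K TL sTL char2 m (fun i => Yl i) (fun i => tinl A L (bcoord w i)) N
  Yl_dY _ Yl_bcoord Yl_gen nilp_TL).
by move=> i; apply: shom_gr; apply: (bcoord_odd bas).
Qed.

Variable f : TL.
Hypotheses (f_odd : gr true f) (Yf : forall j, Yl j f = tinr A L (l j)).

Lemma u_f j : lslice (u j) f = l j.
Proof.
have -> : lslice (u j) f = lslice feps (Yl j f).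
  rewrite tmapl_lslice //; congr (lslice _ f).
  by apply/funext => a; rewrite /= eps_ltrans.
by rewrite Yf lslice_pure // [feps 1](shom1 (counit G)) scale1r.
Qed.

(** In terms of points, [f(gx) = chi(g) f(x)] for even [g]. Both sides are odd, and their odd
    derivatives agree: [Ad_fconv] moves [Y j] past the translation, and the eigenvector equation
    evaluates the result. *)
Lemma left_f (g : Ev -> K^o) : lin g ->
  @tmapl K A A L (ltrans (g \o piE)) f = tinr A L (lslice g chi) * f.
Proof.
move=> lg; have lgp : lin (g \o piE) := lin_comp (shom_lin piE) lg.
have lT := ltrans_lin hS lgp; apply/eqP; rewrite -subr_eq0; apply/eqP.
have lYl q : lin (Yl q) := tmapl_lin (lY q).
apply: Yl_inj => [|j].
  apply: oddpow_odd; apply: (subspaceB (gr_subspace TL true)).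
    rewrite -[true]addbF; apply: tmapl_gr => // i x hx; apply: ltrans_gr => // y hy.
    by rewrite /= piE_odd // (lin0 lg).
  exact: (grM (shom_gr (tinr A L) (purely_even_gr eL _)) f_odd).
have lgi i : lin ((fun q => g (AdM i j * q)) \o piE).
  exact: lin_comp (shom_lin piE) (lin_comp (lin_mulr _) lg).
rewrite (linB (lYl j)) tmapl_inr // Yf -shomM.
have -> : Yl j (tmapl (ltrans (g \o piE)) f) =
    \sum_(i < m) @tmapl K A A L (ltrans ((fun q => g (AdM i j * q)) \o piE)) (Yl i f).
  move: (f); apply: lin_eq_tens => [||a x].
  - exact: (lin_comp (tmapl_lin lT) (lYl j)).
  - by apply: lin_bigsum => i; exact: (lin_comp (lYl i) (tmapl_lin (ltrans_lin hS (lgi i)))).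
  rewrite !tmapl_pure // (ltrans_comp _ _ (lu j) lgp).
  rewrite (eq_bigr (fun i => pure (ltrans (fconv (u i) ((fun q => g (AdM i j * q)) \o piE)) a) x)).
    rewrite -(lin_sum (proj1 (pure_bilin A L) x)); congr (pure _ x).
    apply: functional_ext => t lt; rewrite (lin_sum lt) f_ltrans //; last exact: fconv_lin.
    rewrite {1}/form_conv /convolution.
    under eq_bigr do rewrite (Ad_fconv bas _ _ lg) mulr_suml.
    rewrite exchange_big /=; apply: eq_bigr => i _; rewrite f_ltrans //.
    exact: fconv_lin.
  move=> i _; rewrite !tmapl_pure //; last exact: ltrans_lin.
  by rewrite (ltrans_comp _ _ (lgi i) (lu i)).
rewrite (eq_bigr (fun i => tinr A L (g (AdM i j) *: l i))).
  rewrite -shom_sum -[X in X - _](_ : tinr A L (lslice g (tinr Ev L (l j) * chi)) = _).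
    by rewrite lslice_inr // mulLC subrr.
  rewrite -eigen (lin_sum (lslice_lin lg)); congr (tinr A L _).
  by apply: eq_bigr => i _; rewrite lslice_pure.
move=> i _; rewrite Yf tmapl_tinr; last exact: ltrans_lin.
have e1 : ((fun q => g (AdM i j * q)) \o piE) 1 = g (AdM i j) by rewrite /comp shom1 mulr1.
by rewrite ltrans1 // e1 pureZl -pureZr.
Qed.

Lemma lslice_ext (B M : superalgebra K) (F H : tensor B M) :
  (forall g, lin g -> lslice g F = lslice g H) -> F = H.
Proof.
move=> h; apply/eqP; rewrite -subr_eq0; apply/eqP/lslice_eq0 => g lg.
by rewrite (linB (lslice_lin lg)) h // subrr.
Qed.
Lemma rslice_ext (B M : superalgebra K) (F H : tensor B M) :
  (forall g, lin g -> rslice g F = rslice g H) -> F = H.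
Proof.
move=> h; apply/eqP; rewrite -subr_eq0; apply/eqP/rslice_eq0 => g lg.
by rewrite (linB (rslice_lin lg)) h // subrr.
Qed.

Let lpi : lin piE. Proof. exact: shom_lin. Qed.

Lemma right_f_ev phi : lin phi ->
  @tmapl K A Ev L piE (tmapl (rtrans phi) f) = tinr Ev L (lslice phi f) * chi.
Proof.
move=> lphi; have lr := rtrans_lin hS lphi; apply: lslice_ext => g lg.
have lgp : lin (g \o piE) := lin_comp lpi lg.
rewrite tmapl_lslice // tmapl_lslice // lslice_inr // mulLC -lslice_inr // -left_f //.
rewrite tmapl_lslice //; last exact: ltrans_lin.
congr (lslice _ f); apply/funext => a.
by rewrite -[LHS]/((g \o piE) (rtrans phi a)) f_rtrans //= f_ltrans.
Qed.

Lemma ker_piL (F : TL) : @tmapl K A Ev L piE F = 0 -> oddpow 1 F.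
Proof.
move=> e; have [|n [a [b [ha ->]]]] := rslice_decomp (oddpow_subspace sA 1) (F := F).
  by move=> psi lpsi; apply/oddpow1E/piE0; rewrite -tmapl_rslice // e (lin0 (rslice_lin lpsi)).
apply: (oddpow_sum sTL) => i _; rewrite -(tinl_tinr (A := A) (B := L)).
by apply: oddpowMr; apply: shom_oddpow.
Qed.

Variables (i0 : 'I_m) (r : L).
Hypothesis hr : l i0 * r = 1.

(** The function [a] in [f(xy) = f(x) + a(x) f(y)]: differentiating in [y] along [u i0] at the
    identity yields [a(x)] times [l i0], which [r] inverts. It extends the character [chi] from
    [G_ev] to [G]. *)
Definition mult_f : TL := tinr A L r * tmapl (rtrans (u i0)) f.

Let lru : lin (rtrans (u i0)). Proof. exact: rtrans_lin. Qed.

Lemma mult_f_even : gr false mult_f.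
Proof.
apply: (grM (i := false) (j := false)); first exact: (shom_gr (tinr A L) (purely_even_gr eL r)).
apply: (tmapl_gr eL (j := true) lru _ f_odd) => i x hx.
by apply: rtrans_gr => //; case: (vu i0).
Qed.

Lemma Yl_right phi j : lin phi -> Yl j (tmapl (rtrans phi) f) = phi 1 *: tinr A L (l j).
Proof.
move=> lphi; have lr := rtrans_lin hS lphi.
have -> : Yl j (tmapl (rtrans phi) f) = tmapl (rtrans phi) (Yl j f).
  move: (f); apply: lin_eq_tens => [||a x].
  - exact: (lin_comp (tmapl_lin lr) (tmapl_lin (lY j))).
  - exact: (lin_comp (tmapl_lin (lY j)) (tmapl_lin lr)).
  by rewrite !tmapl_pure // ltrans_rtrans.
by rewrite Yf tmapl_tinr // rtrans1 // pureZl.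
Qed.

Lemma Yl_mult_f j : Yl j mult_f = 0.
Proof.
by rewrite /mult_f tmapl_inr // Yl_right // (vder1 (vu i0)) scale0r mulr0.
Qed.

Lemma mult_f_ev : @tmapl K A Ev L piE mult_f = chi.
Proof.
by rewrite /mult_f tmapl_inr // right_f_ev // u_f mulrA -shomM mulLC hr shom1 mul1r.
Qed.

(** The cocycle rule [f(xy) = f(x) + a(x) f(y)], sliced in [y] by [phi]. Both sides have the same
    odd derivatives in [x] and, by [right_f_ev], the same restriction to even [x]. *)
Lemma right_f phi : lin phi ->
  tmapl (rtrans phi) f = phi 1 *: f + tinr A L (lslice phi f) * mult_f.
Proof.
move=> lphi; have lr := rtrans_lin hS lphi; apply/eqP; rewrite -subr_eq0; apply/eqP.
apply: Yl_inj => [|j].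
  apply: ker_piL; rewrite (linB (tmapl_lin lpi)) right_f_ev // (linD (tmapl_lin lpi)).
  rewrite (linZ (tmapl_lin lpi)) tmapl_inr // mult_f_ev.
  suff -> : tmapl piE f = 0 by rewrite scaler0 add0r subrr.
  move: f_odd; move: (f); apply: (tens_gr_even eL) => [|F H hF hH|a x ha].
  - exact: (lin0 (tmapl_lin lpi)).
  - by rewrite (linD (tmapl_lin lpi)) hF hH addr0.
  - by rewrite tmapl_pure // piE_odd // pure0l.
have lYl q : lin (Yl q) := tmapl_lin (lY q).
rewrite (linB (lYl j)) Yl_right // (linD (lYl j)) (linZ (lYl j)) Yf tmapl_inr //.
by rewrite Yl_mult_f mulr0 addr0 subrr.
Qed.

(** Multiplicativity of [a]: the cocycle rule for [f] is translated once more and differentiated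
    along [u i0]. *)
Lemma right_mult_f psi : lin psi ->
  tmapl (rtrans psi) mult_f = tinr A L (lslice psi mult_f) * mult_f.
Proof.
move=> lpsi; have lr := rtrans_lin hS lpsi; have lfc := fconv_lin hS lpsi (lu i0).
have e : tmapl (rtrans psi) (tmapl (rtrans (u i0)) f) = tmapl (rtrans (fconv psi (u i0))) f.
  have lrf := rtrans_lin hS lfc.
  move: (f); apply: lin_eq_tens => [||a x].
  - exact: (lin_comp (tmapl_lin lru) (tmapl_lin lr)).
  - exact: (tmapl_lin lrf).
  by rewrite !tmapl_pure // rtrans_comp.
have e1 : fconv psi (u i0) 1 = 0.
  by rewrite -f_rtrans // rtrans1 // (vder1 (vu i0)) scale0r (lin0 lpsi).
rewrite {1}/mult_f tmapl_inr // e right_f // e1 scale0r add0r mulrA -shomM.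
congr (tinr A L _ * _); rewrite /mult_f lslice_inr // tmapl_lslice //.
by congr (_ * lslice _ f); apply/funext => a /=; rewrite f_rtrans.
Qed.

Lemma tmap_sid_comp (B1 B2 B3 : superalgebra K) (h : shom B1 B2) (k : shom B2 B3)
    (s2 : supercommutative B2) (s3 : supercommutative B3) F :
  tmap k (sid L) s3 sL (tmap h (sid L) s2 sL F) = tmap (scomp k h) (sid L) s3 sL F.
Proof.
move: F; apply: lin_eq_tens => [||a x].
- by move=> c x y; rewrite !shom_lin.
- by move=> c x y; rewrite shom_lin.
by rewrite !tmap_pure.
Qed.

Section Points.
Variable R : obj (salg_cat K).

Definition ptL (x : point G R) : shom TL (tensor R L) := tmap x (sid L) (objP R) sL.

(** Passage from identities between slices of the coproduct to values at products of points. The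
    identity is verified for the two universal points, where slices separate elements, and then
    specialised. *)
Lemma ptL_sep (F p1 q1 p2 q2 : TL) :
  (forall psi : A -> K^o, lin psi -> tmapl (rtrans psi) F =
     tinr A L (lslice psi q1) * p1 + tinr A L (lslice psi q2) * p2) ->
  forall x y : point G R, ptL (gmul x y) F = ptL x p1 * ptL y q1 + ptL x p2 * ptL y q2.
Proof.
move=> h x y.
pose A2 := tens_obj hS A A.
pose X : shom TL (tensor A2 L) := tmap (tinl A A) (sid L) (objP A2) sL.
pose Z : shom TL (tensor A2 L) := tmap (tinr A A) (sid L) (objP A2) sL.
pose D : shom TL (tensor A2 L) := tmap (comult hS G) (sid L) (objP A2) sL.
pose T : shom (tensor A2 L) (tensor R L) := tmap (obj_lift hS x y) (sid L) (objP R) sL.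
have eX F0 : T (X F0) = ptL x F0.
  rewrite [LHS]tmap_sid_comp /ptL; congr (shom_fun (tmap _ _ _ _) _); exact: tlift_inl.
have eZ F0 : T (Z F0) = ptL y F0.
  rewrite [LHS]tmap_sid_comp /ptL; congr (shom_fun (tmap _ _ _ _) _); exact: tlift_inr.
have eD F0 : T (D F0) = ptL (gmul x y) F0.
  have ec : scomp (obj_lift hS x y) (comult hS G) = gmul x y.
    by rewrite /comult gmul_nat [scomp _ (tinl _ _)]tlift_inl [scomp _ (tinr _ _)]tlift_inr.
  by rewrite [LHS]tmap_sid_comp ec.
rewrite -eD -!eX -!eZ -!shomM -shomD; congr (T _).
apply: rslice_ext => s ls.
have hs : lin (s \o sid L) by [].
rewrite tmap_rslice //; apply: rslice_ext => psi lpsi.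
have lr := rtrans_lin hS lpsi.
transitivity (rslice s (tmapl (rtrans psi) F)).
  by rewrite tmapl_rslice.
have e (p q : TL) : rslice psi (rslice s (X p * Z q)) = rslice s (tinr A L (lslice psi q) * p).
  have l1 := rslice_lin ls; have l2 := rslice_lin lpsi.
  move: p; apply: lin_eq_tens => [||a b].
  - by move=> c z1 z2; rewrite shom_lin mulrDl -scalerAl l1 l2.
  - by move=> c z1 z2; rewrite mulrDr -scalerAr l1.
  move: q; apply: lin_eq_tens => [||a' b'].
  - by move=> c z1 z2; rewrite shom_lin mulrDr -scalerAr l1 l2.
  - by move=> c z1 z2; rewrite (lslice_lin lpsi) shom_lin mulrDl -scalerAl l1.
  have pm : X (pure a b) * Z (pure a' b') = pure (pure a a' : A2) (b * b').
    rewrite [X _]tmap_pure [Z _]tmap_pure -[pure a a'](tinl_tinr (A := A) (B := A)).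
    exact (pure_mulE eL (tinl A A a : A2) (tinr A A a') b b').
  rewrite pm.  rewrite [rslice s (pure _ _)](@rslice_pure K A2 L s (pure a a') (b * b') ls).
    rewrite (linZ (l2 _)). rewrite [rslice psi _](@rslice_pure K A A psi a a' lpsi). rewrite
      lslice_pure //.
  have -> : tinr A L (psi a' *: b') * pure a b = pure a ((psi a' *: b') * b).
    by rewrite -[tinr A L _]/(pure 1 _) (pure_mulE eL) mul1r.
  rewrite rslice_pure // -scalerAl (linZ ls) (mulLC b' b) !scalerA.
  by congr (_ *: _); apply: mulrC.
by rewrite h // (linD (rslice_lin ls)) -!e (linD (rslice_lin ls)) (linD (rslice_lin lpsi)).
Qed.

Lemma ptL_mult_f (x y : point G R) : ptL (gmul x y) mult_f = ptL x mult_f * ptL y mult_f.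
Proof.
have := @ptL_sep mult_f mult_f mult_f 0 0 _ x y.
rewrite shom0 mul0r addr0; apply=> psi lpsi.
by rewrite (lin0 (lslice_lin lpsi)) shom0 mul0r addr0; apply: right_mult_f.
Qed.

Lemma ptL_f (x y : point G R) : ptL (gmul x y) f = ptL x f + ptL x mult_f * ptL y f.
Proof.
have := @ptL_sep f f 1 mult_f f _ x y.
rewrite shom1 mulr1; apply=> psi lpsi.
rewrite right_f // [lslice psi 1](_ : _ = (psi 1)%:A); last exact (lslice_pure 1 1 lpsi).
by rewrite shomZ shom1 mulr_algl.
Qed.
End Points.

Lemma ptL_rslice (R : obj (salg_cat K)) (x : point G R) (s : L -> K^o) F : lin s ->
  rslice s (ptL x F) = x (rslice s F).
Proof. by move=> ls; rewrite tmap_rslice. Qed.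

(** The values of the character [a] are even and hence commute, so its [L]-coordinates are functions
    on the abelianization. On the derived subgroup they therefore equal their values at the
    identity. *)
Lemma mult_f_cocomm (s : L -> K^o) : lin s -> cocomm (rslice s mult_f).
Proof.
move=> ls R x y z v; rewrite -!ptL_rslice // !ptL_mult_f; congr (rslice s (_ * _)).
have sR := tens_supercommutative (objP R) sL.
rewrite -!mulrA; congr (_ * _).
by rewrite (sR _ _ _ _ (shom_gr (ptL y) mult_f_even) (shom_gr (ptL z) mult_f_even)) mul1r.
Qed.

Section DerivedSeries.
Variables (D : affine_supergroup K) (p : gmor D G) (dp : is_derived p).

Lemma mult_f_derived : tmap (comorph p) (sid L) (objP (coord D)) sL mult_f = 1.
Proof.
apply: rslice_ext => s ls; rewrite tmap_rslice // (derived_cocomm hS dp); last exact: mult_f_cocomm.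
rewrite [X in rslice s X](_ : (1 : tensor (coord D) L) = pure 1 1) // rslice_pure //; congr (_ *:
  _).
rewrite -[LHS]/(feps (rslice s mult_f)) slice_swap // /mult_f lslice_inr // tmapl_lslice //.
have -> : feps \o rtrans (u i0) = u i0 by apply/funext => a /=; rewrite eps_rtrans.
by rewrite u_f mulLC hr.
Qed.

Definition fD : tensor (coord D) L := tmap (comorph p) (sid L) (objP (coord D)) sL f.

Lemma ptL_fD (R : obj (salg_cat K)) (x : point D R) :
  tmap x (sid L) (objP R) sL fD = ptL (scomp x (comorph p)) f.
Proof.
exact: tmap_sid_comp.
Qed.

(** On the derived subgroup [a] is 1 and [f] is additive, so exchanging two factors does not change
    its value. *)
Lemma fD_cocomm (s : L -> K^o) : lin s -> cocomm (rslice s fD).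
Proof.
move=> ls R x y z v.
have xE (g : point D R) : g (rslice s fD) = rslice s (ptL (scomp g (comorph p)) f).
  by rewrite -ptL_fD tmap_rslice.
have m1 (g : point D R) : ptL (scomp g (comorph p)) mult_f = 1.
  transitivity (tmap g (sid L) (objP R) sL (tmap (comorph p) (sid L) (objP (coord D)) sL mult_f)).
    by rewrite tmap_sid_comp.
  by rewrite mult_f_derived shom1.
rewrite !xE !comorphM !ptL_f !ptL_mult_f !m1 !mul1r; congr (rslice s (_ + _)).
by rewrite addrAC.
Qed.

(** On the second derived subgroup [f] is constant, and the constant is 0 because [f] is odd.
    Differentiating along [v] and expanding in the basis [u] leaves the stated relation among the
    [l i]. *)
Lemma derived2_l D2 (p2 : gmor D2 D) (v : coord D2 -> K^o) : is_derived p2 -> vder v ->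
  \sum_(i < m) v (comorph p2 (comorph p (w i))) *: l i = 0.
Proof.
move=> dp2 dv; have [lv v0 vM] := dv.
pose q := scomp (comorph p2) (comorph p).
have qe a : counit_form (q a) = feps a by rewrite /counit_form /= !counit_mor.
have dvq : vder (v \o q : A -> K^o).
  split=> [|x hx|x y]; first exact: (lin_comp (shom_lin q) lv).
    by apply: v0; apply: shom_gr.
  by rewrite -[LHS]/(v (q (x * y))) (shomM q) vM !qe.
have q0 : tmapl q f = 0 :> tensor (coord D2) L.
  apply: rslice_ext => s ls; rewrite tmapl_rslice //; last exact: shom_lin.
  rewrite (lin0 (rslice_lin ls)).
  have -> : q (rslice s f) = comorph p2 (rslice s fD) by rewrite tmap_rslice.
  rewrite (derived_cocomm hS dp2); last exact: fD_cocomm.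
  rewrite tmap_rslice // counit_mor.
  suff -> : counit G (rslice s f) = 0 by rewrite scale0r.
  rewrite -[LHS]/(feps (rslice s f)) slice_swap //.
  suff -> : lslice feps f = 0 by rewrite (lin0 ls).
  move: f_odd; move: (f); apply: (tens_gr_even eL) => [|F H hF hH|a x ha].
  - exact: (lin0 (lslice_lin lfeps)).
  - by rewrite (linD (lslice_lin lfeps)) hF hH addr0.
  - by rewrite lslice_pure // feps_odd // scale0r.
have := congr1 (lslice v) q0; rewrite tmapl_lslice //; last exact: shom_lin.
rewrite (lin0 (lslice_lin lv)) => e0; rewrite -[RHS]e0.
have lvq : lin (v \o q) by case: dvq.
transitivity (\sum_(i < m) v (q (w i)) *: lslice (u i) f).
  by apply: eq_bigr => i _; rewrite u_f.
move: (f); apply: lin_eq_tens => [||a x].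
- by apply: lin_bigsum => i; apply: lin_scale; apply: lslice_lin.
- exact: lslice_lin.
rewrite lslice_pure // (vder_expand bas a dvq) scaler_suml; apply: eq_bigr => i _.
by rewrite lslice_pure // scalerA mulrC.
Qed.

End DerivedSeries.
End Eigen.

Theorem key_vanishing (L : superalgebra K) (eL : purely_even L) (sL : supercommutative L)
  (fieldL : forall x : L, x <> 0 -> exists y, x * y = 1) N
  (nilp : forall x : A, oddpow N x -> x = 0) (l : 'I_m -> L) (chi : tensor Ev L)
  (eigen : forall j, \sum_(i < m) pure (AdM i j) (l i) = tinr Ev L (l j) * chi)
  D (p : gmor D G) D2 (p2 : gmor D2 D) (v : coord D2 -> K^o) :
  is_derived p -> is_derived p2 -> vder v ->
  \sum_(i < m) v (comorph p2 (comorph p (w i))) *: l i = 0.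
Proof.
move=> dp dp2 dv.
have [[i0 hi0]|nz] := pselect (exists i, l i <> 0); last first.
  apply: big1 => i _; have -> : l i = 0.
    by apply: contrapT => h; apply: nz; exists i.
  by rewrite scaler0.
have [r hr] := fieldL _ hi0.
have [f [fo hf]] := form_ex eL sL fieldL nilp eigen.
exact: (derived2_l eL sL nilp eigen fo hf hr dp dp2 dv).
Qed.

End Key.

(** * Noetherian rings *)

Definition idealp (R : comNzRingType) (I : R -> Prop) : Prop :=
  [/\ I 0, forall x y, I x -> I y -> I (x + y) & forall a x, I x -> I (a * x)].

Definition igen (R : comNzRingType) (s : seq R) (x : R) : Prop :=
  forall I, idealp I -> (forall y, y \in s -> I y) -> I x.

Definition noeth (R : comNzRingType) : Prop := forall I : R -> Prop, idealp I ->
  exists s, (forall y, y \in s -> I y) /\ forall x, I x -> igen s x.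

Section Ideals.
Variable R : comNzRingType.
Implicit Types (s t : seq R) (x y : R).

Lemma igen_ideal s : idealp (igen s).
Proof.
split=> [I hI _|x y hx hy I hI hs|a x hx I hI hs].
- by case: hI.
- by case: (hI) => _ hD _; apply: hD; [apply: hx|apply: hy].
- by case: (hI) => _ _ hM; apply: hM; apply: hx.
Qed.

Lemma igen_mem s x : x \in s -> igen s x.
Proof. by move=> h I _; apply. Qed.

Lemma igen_sub s t x : {subset s <= t} -> igen s x -> igen t x.
Proof. by move=> st h; apply: h; [apply: igen_ideal|move=> y /st; apply: igen_mem]. Qed.

(** The union of the ideals generated by initial segments is finitely generated, and its generators
    already lie in one of them. *)
Lemma noeth_seq (b : nat -> R) : noeth R -> exists N, igen [seq b k | k <- iota 0 N] (b N).
Proof.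
move=> nR; pose I x := exists N, igen [seq b k | k <- iota 0 N] x.
have mono M N x : (M <= N)%N -> igen [seq b k | k <- iota 0 M] x ->
    igen [seq b k | k <- iota 0 N] x.
  move=> MN; apply: igen_sub => y /mapP [k]; rewrite mem_iota => /andP [_ kM] ->.
  by apply: map_f; rewrite mem_iota /= (leq_trans kM).
have hI : idealp I.
  split=> [|x y [M hM] [N hN]|a x [N hN]].
  - by exists 0%N; case: (igen_ideal [seq b k | k <- iota 0 0]).
  - exists (maxn M N); case: (igen_ideal [seq b k | k <- iota 0 (maxn M N)]) => _ hD _.
    by apply: hD; [apply: mono hM; apply: leq_maxl|apply: mono hN; apply: leq_maxr].
  - by exists N; case: (igen_ideal [seq b k | k <- iota 0 N]) => _ _ hM; apply: hM.
have [s [sI Is]] := nR _ hI.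
have [N hN] : exists N, forall y, y \in s -> igen [seq b k | k <- iota 0 N] y.
  elim: s sI {Is} => [|y s IHs] sI; first by exists 0%N.
  have [N hN] : exists N, forall y, y \in s -> igen [seq b k | k <- iota 0 N] y.
    by apply: IHs => z zs; apply: sI; rewrite inE zs orbT.
  have [M hM] := sI y (mem_head _ _); exists (maxn M N) => z; rewrite inE => /orP [/eqP ->|zs].
    by apply: mono hM; apply: leq_maxl.
  by apply: mono (hN z zs); apply: leq_maxr.
exists N; have /Is h : I (b N).
  exists N.+1; apply: igen_mem; apply: (map_f b); by rewrite mem_iota /= ltnSn.
by apply: h => //; apply: igen_ideal.
Qed.
End Ideals.

Lemma noeth_field (F : fieldType) : noeth F.
Proof.
move=> I [I0 ID IM]; have [[x [Ix nx]]|h] := pselect (exists x, I x /\ x != 0).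
  exists [:: x]; split=> [y|y _]; first by rewrite inE => /eqP ->.
  have [_ _ gM] := igen_ideal [:: x].
  by rewrite -[y](divfK nx); apply: gM; apply: igen_mem; rewrite inE.
exists [::]; split=> // x Ix; have -> : x = 0.
  by apply/eqP; apply: contrapT => /negP nx; apply: h; exists x.
by case: (igen_ideal ([::] : seq F)).
Qed.

(* Hilbert's basis theorem: pick successively elements of least degree outside
   the ideal generated by the previous ones. *)
Lemma noeth_poly (R : comNzRingType) : noeth R -> noeth {poly R}.
Proof.
move=> nR I hI; apply: contrapT => nfg; have [I0 ID IM] := hI.
have ex s : exists f, (forall y, y \in s -> I y) ->
    [/\ I f, ~ igen s f & forall g, I g -> ~ igen s g -> (size f <= size g)%N].
  have [sI|h] := pselect (forall y, y \in s -> I y); last by exists 0.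
  have exn : exists n, `[< exists g, [/\ I g, ~ igen s g & size g = n] >].
    apply: contrapT => h; apply: nfg; exists s; split=> // x Ix.
    apply: contrapT => nx; apply: h; exists (size x); apply/asboolP; by exists x.
  case: (ex_minnP exn) => n /asboolP [f [If nf sf]] minf; exists f => _; split=> // g Ig ng.
  by rewrite sf; apply: minf; apply/asboolP; exists g.
have [F hF] := choice ex.
pose S := fix S k := if k is j.+1 then F (S j) :: S j else [::].
have SI k y : y \in S k -> I y.
  elim: k y => // k IHk y; rewrite inE => /orP [/eqP ->|]; last exact: IHk.
  by have [] := hF _ IHk.
pose f k := F (S k).
have hf k : [/\ I (f k), ~ igen (S k) (f k) &
    forall g, I g -> ~ igen (S k) g -> (size (f k) <= size g)%N] by apply/hF/SI.
have Ssub j k : (j <= k)%N -> {subset S j <= S k}.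
  elim: k => [|k IHk]; first by rewrite leqn0 => /eqP ->.
  rewrite leq_eqVlt => /orP [/eqP -> //|/IHk h] y /h yS.
  by rewrite inE yS orbT.
have fS j k : (j < k)%N -> f j \in S k by move=> jk; apply: (Ssub _ _ jk); rewrite inE eqxx.
have szf j k : (j <= k)%N -> (size (f j) <= size (f k))%N.
  move=> jk; have [Ik nk _] := hf k; have [_ _ h] := hf j; apply: h => // hg.
  by apply: nk; apply: igen_sub hg; apply: Ssub.
have [N hN] := noeth_seq (fun k => lead_coef (f k)) nR.
have [IN nN minN] := hf N; have [g0 gD gM] := igen_ideal (S N).
pose d := (size (f N)).-1.
have sN : size (f N) = d.+1.
  rewrite /d prednK // lt0n size_poly_eq0; apply/eqP => e0; apply: nN.
  by rewrite e0.
(* The earlier elements yield a [q] with the leading term of [f N]; then [f N - q] is smaller but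
   still outside the ideal they generate, against minimality. The multiplication by a power of ['X]
   brings [f k] up to degree [d]. *)
have [] : (fun c => exists q, [/\ igen (S N) q, q`_d = c & (size q <= d.+1)%N]) (lead_coef (f N)).
  move: hN => /(_ (fun c => exists q, [/\ igen (S N) q, q`_d = c & (size q <= d.+1)%N])) hN.
  apply: hN => [|y /mapP [k]].
    split=> [|x y [q [hq <- sq]] [q' [hq' <- sq']]|a x [q [hq <- sq]]].
    - by exists 0; rewrite coef0 size_poly0.
    - exists (q + q'); split; [exact: gD|by rewrite coefD|].
      by apply: (leq_trans (size_polyD _ _)); rewrite geq_max sq.
    - exists (a%:P * q); split; [exact: gM|by rewrite coefCM|].
      by rewrite mul_polyC; apply: leq_trans sq; apply: size_scale_leq.
  rewrite mem_iota /= add0n => kN ->; have szk := szf _ _ (ltnW kN).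
  have kS : f k \in S N by apply: fS.
  exists ('X^(d.+1 - size (f k)) * f k); split.
  - by apply: gM; apply: igen_mem.
  - rewrite sN in szk; have [e0|n0] := eqVneq (f k) 0; first by rewrite e0 mulr0 coef0 lead_coef0.
    have p0 : (0 < size (f k))%N by rewrite lt0n size_poly_eq0.
    rewrite mulrC coefMXn /lead_coef.
    have -> : (d < d.+1 - size (f k))%N = false by lia.
    by have -> : (d - (d.+1 - size (f k)))%N = (size (f k)).-1 by lia.
  - rewrite sN in szk; apply: (leq_trans (size_polyMleq _ _)).
    by rewrite size_polyXn; lia.
move=> q [hq qd sq]; have ng : ~ igen (S N) (f N - q).
  move=> h; apply: nN; rewrite -[f N](subrK q); exact: gD.
have Iq : I (f N - q).
  apply: ID => //; rewrite -mulN1r; apply: IM; apply: hq => // y; exact: SI.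
have := minN _ Iq ng; rewrite sN leqNgt => /negP; apply.
rewrite ltnS; apply/leq_sizeP => j dj; rewrite coefB.
move: dj; rewrite leq_eqVlt => /orP [/eqP <-|dj].
  by rewrite qd /lead_coef -/d subrr.
by rewrite !nth_default ?subrr // ?sN // (leq_trans sq).
Qed.

(** The generated subring is presented as the image of an iterated polynomial ring, and its ideals
    are handled through their preimages. The last clause is an induction principle for that
    image. *)
Lemma noeth_adjoin (E : comNzRingType) (R0 : comNzRingType) (phi0 : {rmorphism R0 -> E})
    (s : seq E) : noeth R0 -> exists (R : comNzRingType) (phi : {rmorphism R -> E}),
  [/\ noeth R, forall x, x \in s -> exists r, phi r = x, forall r0, exists r, phi r = phi0 r0
    & forall S : E -> Prop, S 0 -> (forall x y, S x -> S y -> S (x + y)) ->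
      (forall x y, S x -> S y -> S (x * y)) -> (forall r0, S (phi0 r0)) ->
      (forall x, x \in s -> S x) -> forall r, S (phi r)].
Proof.
move=> n0; elim: s => [|x s [R [phi [nR hs h0 hS]]]].
  by exists R0, phi0; split=> // r0; exists r0.
have cfu : commr_rmorph phi x by move=> a; apply: mulrC.
exists {poly R}, (horner_morph cfu); split.
- exact: noeth_poly.
- move=> y; rewrite inE => /orP [/eqP ->|/hs [r <-]].
    by exists 'X; exact: horner_morphX.
  by exists r%:P; exact: horner_morphC.
- by move=> r0; have [r <-] := h0 r0; exists r%:P; exact: horner_morphC.
- move=> S S0 SD SM Sp Sx p.
  have Sphi r : S (phi r).
    by apply: hS => // y ys; apply: Sx; rewrite inE ys orbT.
  elim/poly_ind: p => [|p c IHp]; first by rewrite rmorph0.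
  rewrite [X in S X](_ : _ = horner_morph cfu p * x + phi c); last first.
    by rewrite /= /horner_morph rmorphD rmorphM /= map_polyX map_polyC hornerMXaddC.
  apply: SD => //; apply: SM => //.
  by apply: Sx; rewrite inE eqxx.
Qed.

(** * Powers of the augmentation ideal *)

Section CommutativeAlias.
Variables (K : fieldType) (B : algType K) (mC : commutative (@GRing.mul B)).
(** The algebra [B] under an alias indexed by the proof [mC], which allows it to carry a commutative
    ring structure. *)
Definition crng of phant_id mC mC : Type := B.
Local Notation T := (crng (@id_phant _ mC)).
HB.instance Definition _ := GRing.NzRing.on T.
HB.instance Definition _ := GRing.PzRing_hasCommutativeMul.Build T mC.
End CommutativeAlias.
Notation "'crng_of' mC" := (crng (@id_phant _ mC)) (at level 10).

Section Augmentation.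
Variables (K : fieldType) (B : superalgebra K).
Hypotheses (eB : purely_even B) (sB : supercommutative B).
Variable e : shom B (ground K).

Let mC : commutative (@GRing.mul B) := mulLC eB sB.
Local Notation R := (crng_of mC).

Definition aug (x : B) : K := e x.

Lemma augD x y : aug (x + y) = aug x + aug y. Proof. exact (shomD e x y). Qed.
Lemma augB x y : aug (x - y) = aug x - aug y. Proof. exact (shomB e x y). Qed.
Lemma augM x y : aug (x * y) = aug x * aug y. Proof. exact (shomM e x y). Qed.
Lemma aug1 : aug 1 = 1. Proof. exact (shom1 e). Qed.
Lemma aug0 : aug 0 = 0. Proof. exact (shom0 e). Qed.
Lemma augZ c x : aug (c *: x) = c * aug x. Proof. exact (shomZ e c x). Qed.
Lemma aug_alg c : aug c%:A = c. Proof. by rewrite augZ aug1 mulr1. Qed.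
Lemma aug_lin : lin (aug : B -> K^o). Proof. exact (shom_lin e). Qed.

Lemma aug_sub x : aug (x - (aug x)%:A) = 0.
Proof. by rewrite augB aug_alg subrr. Qed.

(** The [k]-th power of the augmentation ideal, written as an impredicative span so that membership
    comes with its induction principle. *)
Fixpoint mpow k (x : B) : Prop :=
  if k is j.+1 then
    forall P : B -> Prop, subspace P -> (forall a b, aug a = 0 -> mpow j b -> P (a * b)) -> P x
  else True.

Lemma mpow_mul k a b : aug a = 0 -> mpow k b -> mpow k.+1 (a * b).
Proof. by move=> ha hb P sP h; apply: h. Qed.

Lemma mpow_subspace k : subspace (mpow k).
Proof.
case: k => [|k]; first by [].
split=> [P sP _|c x y hx hy P sP h]; first by case: sP.
by case: (sP) => _ hl; apply: hl; [apply: hx|apply: hy].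
Qed.

Lemma mpow_ind k (P : B -> Prop) : subspace P ->
  (forall a b, aug a = 0 -> mpow k b -> P (a * b)) -> forall x, mpow k.+1 x -> P x.
Proof. by move=> sP h x; apply. Qed.

Lemma mpowM k a x : mpow k x -> mpow k (a * x).
Proof.
elim: k a x => // k IHk a; apply: mpow_ind.
  split=> [|c x y hx hy]; first by rewrite mulr0; case: (mpow_subspace k.+1).
  by rewrite mulrDr -scalerAr; case: (mpow_subspace k.+1) => _ h; apply: h.
move=> x b hx hb; rewrite mulrA (mC a) -mulrA; apply: mpow_mul => //; exact: IHk.
Qed.

Lemma mpowS k x : mpow k.+1 x -> mpow k x.
Proof. by move: x; apply: mpow_ind; [apply: mpow_subspace|move=> a b _; apply: mpowM]. Qed.

Lemma mpow_le j k x : (j <= k)%N -> mpow k x -> mpow j x.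
Proof.
elim: k => [|k IHk]; first by rewrite leqn0 => /eqP ->.
by rewrite leq_eqVlt => /orP [/eqP -> //|/IHk h /mpowS].
Qed.

Lemma mpow1 x : mpow 1 x <-> aug x = 0.
Proof.
split=> [|h]; last by rewrite -[x]mulr1; apply: mpow_mul.
move: x; apply: mpow_ind => [|a b ha _]; last by rewrite augM ha mul0r.
by split=> [|c x y hx hy]; rewrite ?aug0 // augD augZ hx hy mulr0 addr0.
Qed.

Lemma mpow_mulD j k x y : mpow j x -> mpow k y -> mpow (j + k) (x * y).
Proof.
elim: j x => [|j IHj] x hx hy; first exact: mpowM.
move: x hx; apply: mpow_ind => [|a b ha hb].
  split=> [|c x z hx hz]; first by rewrite mul0r; case: (mpow_subspace (j.+1 + k)).
  by rewrite mulrDl -scalerAl; case: (mpow_subspace (j.+1 + k)) => _ h; apply: h.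
by rewrite -mulrA addSn; apply: mpow_mul => //; apply: IHj.
Qed.

Definition minf (x : B) : Prop := forall k, mpow k x.

Lemma minf_subspace : subspace minf.
Proof.
split=> [k|c x y hx hy k]; first by case: (mpow_subspace k).
by case: (mpow_subspace k) => _ h; apply: h; [apply: hx|apply: hy].
Qed.
Lemma minfM a x : minf x -> minf (a * x).
Proof. by move=> h k; apply: mpowM. Qed.
Lemma minf_aug x : minf x -> aug x = 0.
Proof. by move=> /(_ 1%N) /mpow1. Qed.

Definition gens (s : seq B) : Prop := forall S : B -> Prop,
  S 1 -> (forall (c : K) x y, S x -> S y -> S (c *: x + y)) ->
  (forall x y, S x -> S y -> S (x * y)) -> (forall x, x \in s -> S x) -> forall x, S x.

Variables (s : seq B) (gs : gens s).

(** The augmentation ideal is generated by the elements [x - aug x] with [x] in [s]. *)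
Lemma aug_gens_ind (V : lmodType K) (f : B -> V) (P : V -> Prop) : lin f -> subspace P ->
  (forall x y, aug x = 0 -> P (f x) -> P (f (x * y))) ->
  (forall x, x \in s -> P (f (x - (aug x)%:A))) -> forall x, aug x = 0 -> P (f x).
Proof.
move=> lf sP hM hs x hx; suff : P (f (x - (aug x)%:A)) by rewrite hx scale0r subr0.
move: x {hx}; apply: gs => [|c x y hx hy|x y hx hy|//].
- by rewrite aug1 scale1r subrr (lin0 lf); case: sP.
- rewrite augD augZ scalerDl -scalerA opprD addrACA -scalerBr lf; case: (sP) => _; exact.
- have -> : x * y - (aug (x * y))%:A = (x - (aug x)%:A) * y + aug x *: (y - (aug y)%:A).
    by rewrite mulrBl scalerBr augM scalerA mulr_algl addrA subrK.
  rewrite (linD lf) (linZ lf); apply: (subspaceD sP); last exact: subspaceZ.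
  by apply: hM => //; apply: aug_sub.
Qed.

Let kc (c : K) : {poly R} := (c%:A : R)%:P.
Lemma kc_mor : (forall x y, kc (x - y) = kc x - kc y) /\ monoid_morphism kc.
Proof.
split=> [x y|]; first by rewrite /kc scalerBl raddfB.
split=> [|x y]; first by rewrite /kc scale1r.
by rewrite /kc -polyCM; congr (_%:P); rewrite -[RHS]/((x%:A : B) * y%:A) mulr_algl scalerA.
Qed.
HB.instance Definition _ := GRing.isZmodMorphism.Build K {poly R} kc (proj1 kc_mor).
HB.instance Definition _ := GRing.isMonoidMorphism.Build K {poly R} kc (proj2 kc_mor).

(* Krull's intersection theorem through the Rees algebra: the elements
   [b 'X^k] all lie in it, hence [b 'X^N] is a combination of the previous ones. *)
Lemma minf_fix b : minf b -> exists y, aug y = 0 /\ b = y * b.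
Proof.
move=> hb.
(* Generators of the Rees algebra: those of [B] in degree 0 and the shifted ones, in the
   augmentation ideal, in degree 1. *)
pose t : seq {poly R} := [seq (x : R)%:P | x <- s] ++
  [seq ((x - (aug x)%:A : B) : R) *: 'X | x <- s].
have [A [phi [nA ht hK hS]]] := noeth_adjoin kc t (@noeth_field K).
have im1 : exists r, phi r = 1 by exists 1; rewrite rmorph1.
have imD p q : (exists r, phi r = p) -> (exists r, phi r = q) -> exists r, phi r = p + q.
  by move=> [r <-] [r' <-]; exists (r + r'); rewrite rmorphD.
have imM p q : (exists r, phi r = p) -> (exists r, phi r = q) -> exists r, phi r = p * q.
  by move=> [r <-] [r' <-]; exists (r * r'); rewrite rmorphM.
have imC (x : B) : exists r, phi r = (x : R)%:P.
  move: x; apply: gs => [//|c x y hx hy|x y hx hy|x xs].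
  - rewrite [X in exists r, _ = X](_ : _ = kc c * (x : R)%:P + (y : R)%:P); last first.
      rewrite /kc -polyCM -polyCD; congr (_%:P); by rewrite -[RHS]/((c%:A : B) * x + y) mulr_algl.
    by apply: imD => //; apply: imM.
  - by rewrite [X in exists r, _ = X](polyCM (x : R) y); apply: imM.
  - by apply: ht; rewrite mem_cat (map_f (fun x : B => (x : R)%:P)).
have imX (a : B) : aug a = 0 -> exists r, phi r = (a : R) *: 'X.
  move: a; apply: (@aug_gens_ind B id (fun a => exists r, phi r = (a : R) *: 'X)) => //.
  - split=> [|c x y hx hy]; first by exists 0; rewrite rmorph0 scale0r.
    rewrite [X in exists r, _ = X](_ : _ = kc c * ((x : R) *: 'X) + (y : R) *: 'X).
      by apply: imD => //; apply: imM.
    rewrite [LHS]scalerDl /kc mul_polyC scalerA; congr (_ *: _ + _).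
    by rewrite -[RHS]/((c%:A : B) * x) mulr_algl.
  - move=> x y _ hx; rewrite [X in exists r, _ = X](_ : _ = (y : R)%:P * ((x : R) *: 'X)).
      exact: imM.
    by rewrite mul_polyC scalerA -[_ * _ in RHS]/((y : B) * x) mC.
  - by move=> x xs; apply: ht; rewrite mem_cat (map_f (fun x : B => (x - (aug x)%:A : R) *: 'X))
    ?orbT.
have imk k x : mpow k x -> exists r, phi r = (x : R) *: 'X^k.
  elim: k x => [|k IHk] x; first by move=> _; rewrite expr0 -mul_polyC mulr1.
  move: x; apply: mpow_ind => [|x y hx hy].
    split=> [|c x y hx hy]; first by exists 0; rewrite rmorph0 scale0r.
    rewrite [X in exists r, _ = X](_ : _ = kc c * ((x : R) *: 'X^(k.+1)) + (y : R) *: 'X^(k.+1)).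
      by apply: imD => //; apply: imM.
    rewrite [LHS]scalerDl /kc mul_polyC scalerA; congr (_ *: _ + _).
    by rewrite -[RHS]/((c%:A : B) * x) mulr_algl.
  rewrite [X in exists r, _ = X](_ : _ = ((x : R) *: 'X : {poly R}) * ((y : R) *: 'X^k)).
    by apply: imM; [apply: imX|apply: IHk].
  by rewrite -scalerAl -scalerAr scalerA -exprS.
have /choice [r hr] : forall k, exists r, phi r = (b : R) *: 'X^k by move=> k; apply: imk.
(* All coefficients of positive degree of an element of the Rees algebra lie in the augmentation
   ideal. *)
have coefm p j : (0 < j)%N -> aug (phi p)`_j = 0.
  move=> j0; move: p j j0; apply: (hS (fun P => forall j, (0 < j)%N -> aug P`_j = 0)) => [j _|x y
    hx hy j j0|x y hx hy j j0|c j j0|x].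
  - by rewrite coef0 aug0.
  - by rewrite coefD augD hx // hy // addr0.
  - rewrite coefM; rewrite (big_morph (aug : R -> K) augD aug0) big1 // => i _.
    rewrite [LHS]augM; have [i0|i0] := posnP i; last by rewrite hx // mul0r.
    by rewrite i0 subn0 hy // mulr0.
  - by rewrite coefC gtn_eqF // aug0.
  - rewrite mem_cat => /orP [] /mapP [y ys ->] j j0; first by rewrite coefC gtn_eqF // aug0.
    rewrite coefZ [LHS]augM aug_sub mul0r //.
have [N hN] := noeth_seq r nA.
(* The combination of earlier elements has the form [Q] times [b], where [Q] collects its
   coefficients shifted by some ['X^k] with [k < N]; so in degree [N] only coefficients from the
   augmentation ideal occur. Comparing the coefficients of ['X^N] gives [y]. *)
have [] : (fun p => exists Q, phi p = Q * (b : R)%:P /\ forall j, (N <= j)%N -> aug Q`_j = 0) (r N).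
  move: hN => /(_ (fun p => exists Q, phi p = Q * (b : R)%:P /\ forall j, (N <= j)%N -> aug Q`_j
    = 0)).
  apply=> [|y /mapP [k]].
    split=> [|x y [Q [eQ hQ]] [Q' [eQ' hQ']]|a x [Q [eQ hQ]]].
    - by exists 0; rewrite rmorph0 mul0r; split=> // j _; rewrite coef0 aug0.
    - exists (Q + Q'); rewrite rmorphD mulrDl eQ eQ'; split=> // j Nj.
      by rewrite coefD augD hQ // hQ' // addr0.
    - exists (phi a * Q); rewrite rmorphM eQ mulrA; split=> // j Nj.
      rewrite coefM (big_morph (aug : R -> K) augD aug0) big1 // => i _.
      rewrite [LHS]augM; have [i0|i0] := posnP i; last by rewrite coefm // mul0r.
      by rewrite i0 subn0 hQ // mulr0.
  rewrite mem_iota /= add0n => kN ->; exists 'X^k; split=> [|j Nj].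
    by rewrite hr mulrC mul_polyC.
  by rewrite coefXn gtn_eqF ?aug0 // (leq_trans kN).
move=> Q [eQ hQ]; exists Q`_N; split; first exact: hQ.
have := congr1 (fun p : {poly R} => p`_N) eQ.
by rewrite hr coefZ coefXn eqxx mulr1 coefMC.
Qed.

(** The intersection of the powers is finitely generated. Each generator [b] satisfies [b = y * b]
    by [minf_fix], and [f] is the product of the corresponding factors [1 - y]. *)
Lemma minf_kill : exists f, aug f = 1 /\ forall b, minf b -> f * b = 0.
Proof.
pose c0 (c : K) : R := (c%:A : B).
have c0_mor : (forall x y, c0 (x - y) = c0 x - c0 y) /\ monoid_morphism c0.
  split=> [x y|]; first exact: scalerBl.
  split=> [|x y]; first exact: scale1r.
  by rewrite /c0 -[RHS]/((x%:A : B) * y%:A) mulr_algl scalerA.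
pose M1 := GRing.isZmodMorphism.Build K R c0 (proj1 c0_mor).
pose M2 := GRing.isMonoidMorphism.Build K R c0 (proj2 c0_mor).
pose phi0 : {rmorphism K -> R} := HB.pack c0 M1 M2.
have [A [phi [nA hs hK _]]] := noeth_adjoin phi0 s (@noeth_field K).
have surj (x : B) : exists r, phi r = x.
  move: x; apply: gs => [|c x y [r hr] [r' hr']|x y [r hr] [r' hr']|x xs].
  - by exists 1; rewrite rmorph1.
  - have [r0 hr0] := hK c; exists (r0 * r + r'); rewrite rmorphD rmorphM hr0 hr hr'.
    by rewrite -[LHS]/((c%:A : B) * x + y) mulr_algl.
  - by exists (r * r'); rewrite rmorphM hr hr'.
  - exact: hs.
have [|t [ht tI]] := nA (fun r => minf (phi r)).
  split=> [|x y hx hy|a x hx].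
  - by rewrite rmorph0; case: minf_subspace.
  - by rewrite rmorphD; apply: (subspaceD minf_subspace hx hy).
  - by rewrite rmorphM; apply: minfM.
have [f [f1 hf]] : exists f : B, aug f = 1 /\ forall r, r \in t -> f * phi r = 0.
  elim: t ht {tI} => [|r t IHt] ht; first by exists 1; rewrite aug1.
  have [r' r't|f [f1 hf]] := IHt; first by apply: ht; rewrite inE r't orbT.
  have [y [y0 hy]] := minf_fix (ht r (mem_head _ _)).
  exists (f * (1 - y)); split=> [|r']; first by rewrite augM f1 augB aug1 y0 subr0 mul1r.
  rewrite inE => /orP [/eqP ->|/hf h].
    by rewrite -mulrA mulrBl mul1r -hy subrr mulr0.
  by rewrite (mC f) -mulrA h mulr0.
exists f; split=> // b hb; have [r hr] := surj b; rewrite -hr.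
have /tI h : minf (phi r) by rewrite hr.
apply: (h (fun r => f * phi r = 0 :> B)) => //; split=> [|x y hx hy|a x hx].
- by rewrite rmorph0 mulr0.
- by rewrite rmorphD mulrDr hx hy addr0.
- by rewrite rmorphM -[phi a * phi x]/((phi a : B) * phi x) mulrA (mC f) -mulrA hx mulr0.
Qed.

End Augmentation.

(** * Translation invariance of the intersection of the powers of the augmentation ideal *)

Section Separated.
Variables (K : fieldType) (Gv : affine_group K).
Local Notation B := (coord Gv).
Local Notation hC := (alg_cat_closed K).
Let eB : purely_even B := proj2 (objP B).
Let sB : supercommutative B := proj1 (objP B).
Let mC : commutative (@GRing.mul B) := mulLC eB sB.
Local Notation e := (counit Gv).
Local Notation aug := (aug e).
Local Notation mpow := (mpow e).
Local Notation minf := (minf e).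
Local Notation BB := (tens_obj hC B B).
Local Notation comult := (comult hC Gv).
Local Notation ltrans := (@ltrans K _ hC Gv).
Local Notation rtrans := (@rtrans K _ hC Gv).
Variables (s : seq B) (gs : gens s).

Definition mpow2 n (F : BB) : Prop := forall P : BB -> Prop, subspace P ->
  (forall i j a b, (i + j = n)%N -> mpow i a -> mpow j b -> P (pure a b)) -> P F.

Lemma mpow2_subspace n : subspace (mpow2 n).
Proof.
split=> [P sP _|c x y hx hy P sP h]; first by case: sP.
by case: (sP) => _ hl; apply: hl; [apply: hx|apply: hy].
Qed.

Lemma mpow2M n k F H : mpow2 n F -> mpow2 k H -> mpow2 (n + k) (F * H).
Proof.
have lm := mpow2_subspace (n + k).
move=> hF hH; apply: (hF (fun F => mpow2 (n + k) (F * H))) => [|i j a b ij ha hb].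
  split=> [|c x y hx hy]; first by rewrite mul0r; case: lm.
  by rewrite mulrDl -scalerAl; case: lm => _; apply.
apply: (hH (fun H => mpow2 (n + k) (pure a b * H))) => [|i' j' a' b' ij' ha' hb'].
  split=> [|c x y hx hy]; first by rewrite mulr0; case: lm.
  by rewrite mulrDr -scalerAr; case: lm => _; apply.
rewrite [pure a b * _](pure_mulE eB) => P sP h.
by apply: (h (i + i') (j + j'))%N; [lia|apply: mpow_mulD|apply: mpow_mulD].
Qed.

(** The case [n = 1], which subtracts the counit in the left factor, implies the general one because
    [mpow2] is multiplicative. *)
Lemma comult_mpow n a : mpow n a -> mpow2 n (comult a).
Proof.
elim: n a => [|n IHn] a ha.
  move=> P sP h; have [k [x [y ->]]] := tens_sum (comult a).
  by apply: (subspace_sum sP) => i _; apply: (h 0 0)%N.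
move: a ha; apply: mpow_ind => [|a b ha /IHn hb].
  split=> [|c x y hx hy]; first by rewrite shom0; case: (mpow2_subspace n.+1).
  by rewrite shom_lin; case: (mpow2_subspace n.+1) => _; apply.
rewrite shomM -add1n; apply: mpow2M => //.
have lau := aug_lin e.
have eq1 : lslice aug (comult a) = a by exact (ltrans_eps hC (G := Gv) a).
rewrite -[comult a](subrK (tinr B B (lslice aug (comult a)))).
apply: (subspaceD (mpow2_subspace 1)); last first.
  by rewrite eq1 => P sP h; apply: (h 0 1)%N => //; apply/mpow1.
have h0 F : mpow2 1 (F - tinr B B (lslice aug F)).
  have [k [x [y ->]]] := tens_sum F.
  rewrite (lin_sum (lslice_lin lau)) shom_sum -sumrB.
  apply: (subspace_sum (mpow2_subspace 1)) => i _; rewrite lslice_pure //.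
  have -> : pure (x i) (y i) - tinr B B (aug (x i) *: y i) = pure (x i - (aug (x i))%:A) (y i).
    rewrite (linB (proj1 (pure_bilin B B) _)); congr (_ - _).
    by rewrite -[LHS]/(pure 1 _) pureZr pureZl.
  by move=> P sP h; apply: (h 1 0)%N => //; apply/mpow1/aug_sub.
exact: h0.
Qed.

(** In a term of total order [l + k] either the left factor has order at least [l] and is killed by
    [phi], or the right factor has order at least [k]. *)
Lemma minf_ltrans_mpow l (phi : B -> K^o) x : lin phi -> (forall b, mpow l b -> phi b = 0) ->
  minf x -> minf (ltrans phi x).
Proof.
move=> lphi phi0 hx k; apply: (comult_mpow (hx (l + k)%N) (P := fun F => mpow k (lslice phi F))).
  split=> [|c F H hF hH]; first by rewrite (lin0 (lslice_lin lphi)); case: (mpow_subspace e k).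
  by rewrite (lslice_lin lphi); case: (mpow_subspace e k) => _; apply.
move=> i j a b ij ha hb; rewrite lslice_pure //.
have [li|il] := leqP l i.
  by rewrite phi0 ?scale0r; [case: (mpow_subspace e k)|apply: (mpow_le eB sB _ ha)].
by apply: (subspaceZ (mpow_subspace e k)); apply: (mpow_le eB sB _ hb); lia.
Qed.

(** Membership in the [k]-th power is tested by functionals [phi] that vanish on it. Exchanging the
    two slices reduces the test to [minf_ltrans_mpow], since [psi] kills [minf]. *)
Lemma minf_rtrans (psi : B -> K^o) x : lin psi -> (forall b, minf b -> psi b = 0) ->
  minf x -> minf (rtrans psi x).
Proof.
move=> lpsi psi0 hx k; apply: (functional_mem (mpow_subspace e k)) => phi lphi phi0.
rewrite [LHS](slice_swap (comult x) lphi lpsi); apply: psi0.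
exact: (minf_ltrans_mpow lphi phi0 hx).
Qed.

Lemma minf_superideal_gr (x0 x1 : B) : gr false x0 -> gr true x1 -> minf (x0 + x1) -> minf x0.
Proof. by move=> _ /eB ->; rewrite addr0. Qed.
Lemma minf1 : ~ minf 1.
Proof. by move=> /minf_aug; rewrite aug1 => /eqP; rewrite oner_eq0. Qed.

Definition minf_ideal : superideal B :=
  @Superideal K B minf (subspace0 (minf_subspace e)) (subspaceB (minf_subspace e))
    (@minfM K B eB sB e) (fun a x hx => eq_ind _ minf (minfM eB sB a hx) _ (mC a x))
    minf1 minf_superideal_gr.

Lemma minf_quotient_even : purely_even (squotient minf_ideal).
Proof. by move=> _ [x /eB -> <-]; apply: squot_pi0. Qed.

Definition sepB : obj (alg_cat K) :=
  @Obj K (alg_cat K) (squotient minf_ideal)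
    (conj (squotient_supercommutative sB) minf_quotient_even).
Local Notation pi := (squot_pi minf_ideal : shom B sepB).

Lemma pi0E x : pi x = 0 <-> minf x.
Proof.
by rewrite -[0 : sepB](squot_pi0 minf_ideal); split=> [/squot_piP|h];
  [|apply/squot_piP]; rewrite subr0.
Qed.

Lemma rslice_inl (A L : superalgebra K) (psi : L -> K^o) a (F : tensor A L) : lin psi ->
  rslice psi (tinl A L a * F) = a * rslice psi F.
Proof.
move=> lpsi; move: F; apply: lin_eq_tens => [||x y].
- by move=> c x y; rewrite mulrDr -scalerAr (rslice_lin lpsi).
- by move=> c x y; rewrite (rslice_lin lpsi) mulrDr -scalerAr.
by rewrite [X in rslice psi X](pure_mull a x y) !rslice_pure // scalerAr.
Qed.

(* A function killing the ideal [minf], translated by the points of the closed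
   subgroup [minf] defines, still kills it; evaluating such translates at the
   inverse point shows that the annihilator of [minf] and [minf] are comaximal. *)
Lemma minf_idem : exists j, minf j /\ forall h, minf h -> h = j * h.
Proof.
have [f [f1 fJ]] := minf_kill eB sB e gs.
pose T : obj (alg_cat K) := tens_obj hC B sepB.
pose g : point Gv T := tinl B sepB.
pose x : point Gv T := scomp (tinr B sepB) pi.
have eT : purely_even T := proj2 (objP T); have sT : supercommutative T := proj1 (objP T).
have gxE : gmul g x = scomp (tmap (sid B) pi sB (proj1 (objP sepB)) : shom BB T) comult.
  rewrite /comultiplication gmul_nat.
  have -> : scomp (tmap (sid B) pi sB (proj1 (objP sepB)) : shom BB T) (tinl B B) = g.
    by rewrite [LHS]tmap_inl scomp_id.
  by have -> : scomp (tmap (sid B) pi sB (proj1 (objP sepB)) : shom BB T) (tinr B B) = x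
    by rewrite [LHS]tmap_inr.
have gxJ h (psi : sepB -> K^o) : lin psi -> minf h -> minf (rslice psi (gmul g x h)).
  move=> lpsi hh; have lp : lin (psi \o pi : B -> K^o) := lin_comp (shom_lin pi) lpsi.
  have p0 b : minf b -> (psi \o pi) b = 0.
    by move=> hb; rewrite -[LHS]/(psi (pi b)) (proj2 (pi0E b) hb) (lin0 lpsi).
  have := minf_rtrans lp p0 hh; congr minf.
  rewrite gxE; symmetry.
  exact: (tmap_rslice (sid B) pi sB (proj1 (objP sepB)) (comult h) lpsi).
have fgx h : minf h -> tinl B sepB f * gmul g x h = 0.
  by move=> hh; apply: rslice_eq0 => psi lpsi; rewrite rslice_inl // fJ //; apply: gxJ.
(* The substitution of [g x^-1] for [g]. It turns [f(g) h(gx) = 0] into [f(g x^-1) h(g) = 0] for all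
   [h] in [minf]. *)
pose Psi : shom T T := obj_lift hC (gmul g (ginv x)) (tinr B sepB : shom sepB T).
have Psig : scomp Psi g = gmul g (ginv x) by exact: tlift_inl.
have Psix : scomp Psi x = x.
  by rewrite /x scompA; congr scomp; exact: tlift_inr.
have Psigx : scomp Psi (gmul g x) = g.
  by rewrite gmul_nat Psig Psix -gmulA gmulV gmulr1.
pose fx := gmul g (ginv x) f.
have fxJ h : minf h -> fx * tinl B sepB h = 0.
  move=> hh; have := congr1 Psi (fgx h hh); rewrite shom0 shomM => <-; congr (_ * _).
    by rewrite /fx -Psig.
  by rewrite -[tinl B sepB]/g -[in LHS]Psigx.
have [] := rslice_decomp (X := fun a => forall h, minf h -> a * h = 0) (F := fx).
- split=> [h _|c a b ha hb h hh]; first by rewrite mul0r.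
  by rewrite mulrDl -scalerAl ha // hb // scaler0 addr0.
- move=> psi lpsi h hh; rewrite mC -rslice_inl // [_ * fx](mulLC eT sT) fxJ //.
  exact: lin0 (rslice_lin lpsi).
move=> n [a [b [ha efx]]].
have /choice [c hc] : forall i, exists c, pi c = b i by move=> i; apply: squot_pi_surj.
(* The specialisation [g = x], under which [f(g x^-1)] becomes [f(1) = 1]. Hence the [a i], which
   annihilate [minf], generate the unit ideal modulo [minf], and [1 - k] is the idempotent. *)
pose m : shom T sepB := obj_lift hC pi (sid sepB).
have mfx : m fx = 1.
  have -> : m fx = gone Gv sepB f.
    rewrite -(gmulVr (pi : point Gv sepB)) /fx -[LHS]/(scomp m _ f) gmul_nat ginv_nat.
    congr (gmul _ (ginv _) f); first exact: tlift_inl.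
    rewrite /x scompA -[RHS]id_scomp; congr (scomp _ pi); exact: tlift_inr.
  by rewrite goneE /eps -[counit Gv f]/(aug f) f1 scale1r.
pose k := \sum_(i < n) a i * c i.
have ek : pi k = 1.
  rewrite -mfx efx !shom_sum; apply: eq_bigr => i _.
  by rewrite shomM hc [RHS]tliftE.
exists (1 - k); split=> [|h hh]; first by apply/pi0E; rewrite shomB shom1 ek subrr.
rewrite mulrBl mul1r [k * h](_ : _ = 0) ?subr0 // mulr_suml big1 // => i _.
by rewrite (mC (a i)) -mulrA ha // mulr0.
Qed.

End Separated.

(** * Smoothness and connectedness *)

Lemma shom_prod (K : fieldType) (A B : superalgebra K) (f : shom A B) n (F : 'I_n -> A) :
  f (\prod_(i < n) F i) = \prod_(i < n) f (F i).
Proof. exact: (big_morph f (shomM f) (shom1 f)). Qed.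

Section ProductSuperalgebra.
Variables (K : fieldType) (A E : superalgebra K).

Definition prod_gr (i : bool) (x : (A * E)%type) : Prop := gr i x.1 /\ gr i x.2.

Lemma prod_gr0 i : prod_gr i 0. Proof. by split; apply: gr0. Qed.
Lemma prod_grP i (c : K) x y : prod_gr i x -> prod_gr i y -> prod_gr i (c *: x + y).
Proof. by move=> [h1 h2] [h3 h4]; split; apply: grP. Qed.
Lemma prod_gr_split x : exists x0 x1, [/\ prod_gr false x0, prod_gr true x1 & x = x0 + x1].
Proof.
exists (pj false x.1, pj false x.2), (pj true x.1, pj true x.2).
split; try by split; apply: pj_gr.
by case: x => a b; congr pair; apply: pj_split.
Qed.
Lemma prod_gr_direct x : prod_gr false x -> prod_gr true x -> x = 0.
Proof. by case: x => a b [h1 h2] [h3 h4]; congr pair; apply: gr_direct. Qed.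
Lemma prod_gr1 : prod_gr false 1. Proof. by split; apply: gr1. Qed.
Lemma prod_grM i j x y : prod_gr i x -> prod_gr j y -> prod_gr (i (+) j) (x * y).
Proof. by move=> [h1 h2] [h3 h4]; split; apply: grM. Qed.

Definition prodsuper : superalgebra K :=
  @Superalgebra K (A * E)%type prod_gr prod_gr0 prod_grP prod_gr_split
    prod_gr_direct prod_gr1 prod_grM.

Definition sfst : shom prodsuper A :=
  @mk_shom K prodsuper A (@fst A E) (fun _ _ _ => erefl) (conj erefl (fun _ _ => erefl)) (fun _ _
    h => proj1 h).
Definition ssnd : shom prodsuper E :=
  @mk_shom K prodsuper E (@snd A E) (fun _ _ _ => erefl) (conj erefl (fun _ _ => erefl)) (fun _ _
    h => proj2 h).

Lemma prodsuper_supercommutative : supercommutative A -> supercommutative E ->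
  supercommutative prodsuper.
Proof.
move=> sA sE i j [a b] [a' b'] [/= h1 h2] [/= h3 h4].
rewrite sign_scale; congr pair; rewrite -?sign_scale.
  by rewrite (sA _ _ _ _ h1 h3) sign_scale.
by rewrite (sE _ _ _ _ h2 h4) sign_scale.
Qed.
End ProductSuperalgebra.

Lemma subsuper_supercommutative (K : fieldType) (A : superalgebra K) (X : subsuper A) :
  supercommutative A -> supercommutative (ssubalg X).
Proof.
move=> sA i j x y hx hy; apply: (@sincl_inj _ _ X).
rewrite sign_scale shomZ !shomM (sA _ _ _ _ (shom_gr (sincl X) hx) (shom_gr (sincl X) hy)).
by rewrite sign_scale.
Qed.

Section SmoothLift.
Variables (K : fieldType) (G : affine_supergroup K).
Local Notation A := (coord G).
Local Notation Bv := (even_coord G).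

(** The fibre product of [A] and [E] over [E'] maps onto [A] with nilpotent kernel. Smoothness
    splits it, and the second component of the splitting descends to the even coordinate ring
    because [E] is purely even. *)
Lemma smooth_lift (E : obj (alg_cat K)) (E' : superalgebra K) (p : shom E E') (x : shom Bv E') :
  smooth_supergroup G -> (forall y, exists z, p z = y) -> nilpotent_kernel p ->
  exists y : shom Bv E, scomp p y = x.
Proof.
move=> sm psurj [n hn].
pose P := prodsuper A E.
have e1 i (c : P) : sfst A E (pj i c) = pj i (sfst A E c) by rewrite shom_pj.
have e2 i (c : P) : ssnd A E (pj i c) = pj i (ssnd A E c) by rewrite shom_pj.
pose X (c : P) := x (piE G (sfst A E c)) = p (ssnd A E c).
have Xsub : subspace X.
  by split=> [|c a b ha hb]; rewrite /X ?shom0 // !shom_lin ha hb.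
have X1 : X 1 by rewrite /X !shom1.
have XM a b : X a -> X b -> X (a * b) by rewrite /X => ha hb; rewrite !shomM ha hb.
have Xpj i a : X a -> X (pj i a) by rewrite /X => ha; rewrite e1 e2 !shom_pj ha.
pose XX := SubSuper Xsub X1 XM Xpj.
have sP : supercommutative P.
  exact: (prodsuper_supercommutative (objP A) (proj1 (objP E))).
pose Bo : obj (salg_cat K) := @Obj K (salg_cat K) (ssubalg XX) (@subsuper_supercommutative K P XX
  sP).
pose q : shom Bo A := scomp (sfst A E) (sincl XX).
have [||t ht] := sm Bo q.
- move=> a; have [z hz] := psurj (x (piE G a)).
  have [|y hy] := @sincl_surj _ _ XX (a, z); first by rewrite /= /X [RHS]hz.
  by exists y; rewrite -[LHS]/(sfst A E (sincl XX y)) hy.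
- exists n => c hc.
  (* An exponent 0 would make the empty product 1 vanish in [E]; the first component below needs at
     least one factor. *)
  have n0 : n != 0%N.
    apply/eqP => n0; have := hn (fun=> 0) (fun=> shom0 p).
    by subst n; rewrite big_ord0 => /eqP; rewrite oner_eq0.
  have pc i : p (ssnd A E (sincl XX (c i))) = 0.
    by rewrite -(sinclP (c i)) -[sfst A E _]/(q (c i)) hc !shom0.
  apply: (@sincl_inj _ _ XX); rewrite shom0 shom_prod.
  have h1 : sfst A E (\prod_(i < n) sincl XX (c i)) = 0.
    rewrite shom_prod; case: (n) n0 c hc {pc} => // k _ c hc.
    by rewrite big_ord_recl -[sfst A E _]/(q (c ord0)) hc mul0r.
  have h2 : ssnd A E (\prod_(i < n) sincl XX (c i)) = 0 by rewrite shom_prod hn.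
  by move: h1 h2; case: (\prod_(i < n) _) => a b h1 h2; exact: (f_equal2 pair h1 h2).
pose y0 : shom A E := scomp (ssnd A E) (scomp (sincl XX) t).
exists (even_lift (y0 : shom A (E : obj (alg_cat K)))).
apply: squot_pi_epi; rewrite -scompA [scomp (even_lift _) _]even_liftK.
apply: shom_ext => a; rewrite -[LHS]/(p (ssnd A E (sincl XX (t a)))) -(sinclP (t a)).
by rewrite -[sfst A E _]/(q (t a)) ht.
Qed.

End SmoothLift.

(** * Finiteness of the odd directions and the even section *)

Section FinitelyGenerated.
Variables (K : fieldType) (char2 : 2 \notin [pchar K]) (G : affine_supergroup K).
Local Notation A := (coord G).
Let sA : supercommutative A := objP A.
Variables (s : seq A) (gs : gens s).
Local Notation n := (size s).
Let o (i : 'I_n) : A := pj true s`_i.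
Let oo i : gr true (o i). Proof. exact: pj_gr. Qed.

Definition odd_gen (y : A) : Prop := exists b : 'I_n -> A, y = \sum_i o i * b i.

Lemma odd_gen_subspace : subspace odd_gen.
Proof.
split=> [|c x y [b ->] [b' ->]]; first by exists (fun=> 0); rewrite big1 // => i _; rewrite mulr0.
exists (fun i => c *: b i + b' i); rewrite scaler_sumr -big_split; apply: eq_bigr => i _.
by rewrite mulrDr scalerAr.
Qed.

Lemma odd_genMr y z : odd_gen y -> odd_gen (y * z).
Proof.
by move=> [b ->]; exists (fun i => b i * z); rewrite mulr_suml; apply: eq_bigr => i _; rewrite
  mulrA.
Qed.

Lemma odd_genMl y z : odd_gen y -> odd_gen (z * y).
Proof.
move=> [b ->]; rewrite mulr_sumr; apply: (subspace_sum odd_gen_subspace) => i _.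
rewrite (pj_split z) mulrDl !mulrA; apply: (subspaceD odd_gen_subspace); apply: odd_genMr.
  rewrite (sA (pj_gr false z) (oo i)) mul1r; apply: odd_genMr.
  exists (fun j => (i == j)%:R); rewrite (bigD1 i) //= eqxx mulr1 big1 ?addr0 // => j ji.
  by rewrite eq_sym (negPf ji) mulr0.
rewrite (sA (pj_gr true z) (oo i)) sign_scale; apply: (subspaceZ odd_gen_subspace).
apply: odd_genMr; exists (fun j => (i == j)%:R); rewrite (bigD1 i) //= eqxx mulr1 big1 ?addr0 //
  => j ji.
by rewrite eq_sym (negPf ji) mulr0.
Qed.

Lemma odd_gen_pj x : odd_gen (pj true x).
Proof.
move: x; apply: gs => [|c x y hx hy|x y hx hy|x xs].
- by rewrite (pj_neq (gr1 A)) //; case: odd_gen_subspace.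
- by rewrite (@pj_lin _ A true); case: odd_gen_subspace => _; apply.
- rewrite (pj_split x) (pj_split y) mulrDl !mulrDr !(linD (@pj_lin _ A true)).
  rewrite (pj_neq (grM (pj_gr false x) (pj_gr false y))) // add0r.
  rewrite (pj_id (i := true) (grM (pj_gr false x) (pj_gr true y))).
  rewrite (pj_id (i := true) (grM (pj_gr true x) (pj_gr false y))).
  rewrite (pj_neq (grM (pj_gr true x) (pj_gr true y))) // addr0.
  by apply: (subspaceD odd_gen_subspace); [apply: odd_genMl|apply: odd_genMr].
- have ix : (index x s < n)%N by rewrite index_mem.
  exists (fun j => (Ordinal ix == j)%:R); rewrite (bigD1 (Ordinal ix)) //= eqxx mulr1.
  rewrite big1 ?addr0 => [|j ji]; first by rewrite /o /= nth_index.
  by rewrite eq_sym (negPf ji) mulr0.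
Qed.

Lemma odd_gen_odd x : gr true x -> odd_gen x.
Proof. by move=> hx; rewrite -(pj_id hx); apply: odd_gen_pj. Qed.

(** An odd element is a combination of the odd parts of the generators with even coefficients, and
    such a coefficient differs from its counit by an element of the augmentation ideal. *)
Lemma odd_fin_gens : exists t : seq A, odd_fin t.
Proof.
exists [seq pj true x | x <- s]; split=> [x /mapP [y _ ->]|a ha]; first exact: pj_gr.
have [b eb] := odd_gen_odd ha.
have e0 : a = \sum_i o i * pj false (b i).
  rewrite -{1}(pj_id ha) {1}eb (lin_sum (@pj_lin _ A true)); apply: eq_bigr => i _.
  by rewrite pj_oddMl.
exists (fun i => if insub i is Some j then counit_form (G := G) (pj false (b j)) else 0).
rewrite size_map {1}e0 -sumrB; apply: (subspace_sum (@mred_subspace _ _)) => i _.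
rewrite (nth_map 0) // -/(o i); case: insubP => [j _ ij|]; last by rewrite ltn_ord.
have -> : j = i by apply: val_inj.
have -> : o i * pj false (b i) - counit_form (pj false (b i)) *: o i =
    (pj false (b i) - (counit_form (G := G) (pj false (b i)))%:A) * o i.
  by rewrite mulrBl mulr_algl (sA (pj_gr false (b i)) (oo i)) mul1r.
apply: mredM => //; first exact: (subspaceB (gr_subspace A false) (pj_gr _ _) (gr_alg _ _)).
exact: (aug_sub (counit G)).
Qed.

Let mono (l : seq 'I_n) : A := \prod_(i <- l) o i.

Lemma mono_gr l : gr (odd (size l)) (mono l).
Proof.
elim: l => [|i l IHl]; first by rewrite /mono big_nil; apply: gr1.
by rewrite /mono big_cons /= -[~~ _]/(true (+) odd (size l)); apply: grM.
Qed.

Lemma mono_mem i l : i \in l -> o i * mono l = 0.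
Proof.
elim: l => // j l IHl; rewrite inE /mono big_cons => /orP [/eqP <-|il].
  by rewrite mulrA (odd_sq sA char2) // mul0r.
by rewrite mulrA (odd_odd_comm sA (oo j) (oo i)) mulNr -mulrA [o i * _]IHl // mulr0 oppr0.
Qed.

(** Multiples of the monomials in [k] distinct odd generators. They span the [k]-th power of the odd
    ideal, since a repeated odd factor gives zero, and so that power vanishes once [k] exceeds the
    number of generators. *)
Definition mono_span k (x : A) : Prop := forall P : A -> Prop, subspace P ->
  (forall l b, uniq l -> size l = k -> P (mono l * b)) -> P x.

Lemma mono_span_subspace k : subspace (mono_span k).
Proof.
split=> [P sP _|c x y hx hy P sP h]; first by case: sP.
by case: (sP) => _ hl; apply: hl; [apply: hx|apply: hy].
Qed.

Lemma mono_spanMl k z x : mono_span k x -> mono_span k (z * x).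
Proof.
have sS := mono_span_subspace k.
move=> h; apply: (h (fun x => mono_span k (z * x))) => [|l b ul sl].
  split=> [|c a b ha hb]; first by rewrite mulr0; case: sS.
  by rewrite mulrDr -scalerAr; case: sS => _; apply.
rewrite (pj_split z) mulrDl !mulrA; apply: (subspaceD sS).
  rewrite (sA (pj_gr false z) (mono_gr l)) sign_scale -scalerAl; apply: (subspaceZ sS).
  by rewrite -mulrA => P sP; apply.
rewrite (sA (pj_gr true z) (mono_gr l)) sign_scale -scalerAl; apply: (subspaceZ sS).
by rewrite -mulrA => P sP; apply.
Qed.

Lemma oddpow_mono k x : oddpow k x -> mono_span k x.
Proof.
elim: k x => [|k IHk] x.
  by move=> _ P sP h; have := h [::] x isT erefl; by rewrite /mono big_nil mul1r.
have sS := mono_span_subspace k.+1.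
move: x; apply: oddpow_ind' => [|x y|z x hz /IHk hx]; first by case: sS.
  exact: subspaceD.
have [b ->] := odd_gen_odd hz; rewrite mulr_suml; apply: (subspace_sum sS) => i _.
rewrite -mulrA; have := mono_spanMl (b i) hx; move: (b i * x) => y hy.
apply: (hy (fun y => mono_span k.+1 (o i * y))) => [|l c ul sl].
  split=> [|d a a' ha ha']; first by rewrite mulr0; case: sS.
  by rewrite mulrDr -scalerAr; case: sS => _; apply.
rewrite mulrA; have [il|il] := boolP (i \in l).
  by rewrite mono_mem // mul0r; case: sS.
have -> : o i * mono l = mono (i :: l) by rewrite /mono big_cons.
by move=> P sP; apply; rewrite /= ?il ?ul ?sl.
Qed.

Lemma oddpow_nilp (x : A) : oddpow n.+1 x -> x = 0.
Proof.
move=> /oddpow_mono h; refine (h (fun x => x = 0) (subspace_eq0 A) _) => l b ul sl.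
have := max_card (mem l); rewrite card_ord.
by have /card_uniqP -> := ul; rewrite sl ltnn.
Qed.

Lemma odd_ideal_nilp (x : 'I_n.+1 -> A) : (forall i, piE G (x i) = 0) ->
  \prod_(i < n.+1) x i = 0.
Proof.
move=> h; apply: oddpow_nilp.
have : forall k (y : 'I_k -> A), (forall i, piE G (y i) = 0) -> oddpow k (\prod_(i < k) y i).
  elim=> [|k IHk] y hy; first exact: oddpow0.
  rewrite big_ord_recl; apply: (@oddpowM _ _ sA 1 k); last by apply: IHk.
  by apply/oddpow1E/piE0.
exact.
Qed.

Local Notation Bv := (even_coord G).
Local Notation Gv := (even_part G).

Lemma gens_even : gens [seq piE G x | x <- s].
Proof.
move=> S S1 Sl SM Ss y; have [x <-] := piE_surj y; move: x.
apply: gs => [|c x y' hx hy|x y' hx hy|x xs].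
- by rewrite shom1.
- by rewrite shom_lin; apply: Sl.
- by rewrite shomM; apply: SM.
- by apply: Ss; apply: map_f.
Qed.

Lemma even_subalg_pj i (x : A) : gr false x -> gr false (pj i x).
Proof.
by move=> hx; case: i; [rewrite (pj_neq hx) //; exact: gr0|exact: pj_gr].
Qed.
Definition even_subalg : subsuper A :=
  @SubSuper K A (gr false) (gr_subspace A false) (gr1 A)
    (fun x y hx hy => grM hx hy) even_subalg_pj.

Lemma even_subalg_even : purely_even (ssubalg even_subalg).
Proof.
move=> x hx; apply: (@sincl_inj _ _ even_subalg); rewrite shom0.
exact: gr_direct (sinclP x) (shom_gr _ hx).
Qed.

Definition even_subalg_obj : obj (alg_cat K) :=
  @Obj K (alg_cat K) (ssubalg even_subalg) (conj (subsuper_supercommutative sA) even_subalg_even).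

(** The even subalgebra of [K[G]] maps onto [K[G_ev]] with nilpotent kernel. The splitting carries
    idempotents of [K[G_ev]] into [K[G]], which is where connectedness is formulated. *)
Lemma even_section : smooth_supergroup G ->
  exists t : shom Bv A, (forall y, gr false (t y)) /\ forall y, piE G (t y) = y.
Proof.
move=> sm; pose p : shom even_subalg_obj Bv := scomp (piE G) (sincl even_subalg).
have [||t ht] := smooth_lift (E := even_subalg_obj) (p := p) (sid Bv) sm.
- move=> y; have [x <-] := piE_surj y.
  have [z hz] := @sincl_surj _ _ even_subalg _ (pj_gr false x).
  by exists z; rewrite -[LHS]/(piE G (sincl even_subalg z)) hz piE_pj.
- exists n.+1 => x hx; apply: (@sincl_inj _ _ even_subalg); rewrite shom0 shom_prod.
  exact: odd_ideal_nilp.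
exists (scomp (sincl even_subalg) t); split=> y; first exact: sinclP.
by have := congr1 (fun f : shom Bv Bv => f y) ht.
Qed.

End FinitelyGenerated.

Section EvenSuper.
Variables (K : fieldType) (A : algType K).
Definition evens_gr (i : bool) (x : A) : Prop := i -> x = 0.
Lemma evens_gr0 i : evens_gr i 0. Proof. by []. Qed.
Lemma evens_grP i (c : K) x y : evens_gr i x -> evens_gr i y -> evens_gr i (c *: x + y).
Proof. by move=> hx hy ti; rewrite hx // hy // scaler0 addr0. Qed.
Lemma evens_split x : exists x0 x1, [/\ evens_gr false x0, evens_gr true x1 & x = x0 + x1].
Proof. by exists x, 0; split=> //; rewrite addr0. Qed.
Lemma evens_direct x : evens_gr false x -> evens_gr true x -> x = 0.
Proof. by move=> _ ->. Qed.
Lemma evens_gr1 : evens_gr false 1. Proof. by []. Qed.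
Lemma evens_grM i j x y : evens_gr i x -> evens_gr j y -> evens_gr (i (+) j) (x * y).
Proof.
case: i; case: j => //= hx hy _; first by rewrite hx // mul0r.
by rewrite hy // mulr0.
Qed.
Definition evens : superalgebra K :=
  Superalgebra evens_gr0 evens_grP evens_split evens_direct evens_gr1 evens_grM.
Lemma evens_even : purely_even evens.
Proof. by move=> x; apply. Qed.
Lemma evens_supercommutative : commutative (@GRing.mul A) -> supercommutative evens.
Proof.
move=> mC i j x y hx hy; case: i hx; case: j hy => /= hy hx; rewrite ?expr0 ?mul1r; try exact: mC.
by rewrite hx // hy // !mul0r mulr0.
Qed.
End EvenSuper.

Lemma shom_even_gr (K : fieldType) (A B : superalgebra K) (f : A -> B) : purely_even A ->
  lin f -> (forall x, gr false (f x)) -> forall i x, gr i x -> gr i (f x).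
Proof. by move=> eA lf h [] x hx //; rewrite (eA _ hx) (lin0 lf); apply: gr0. Qed.

Section Connected.
Variables (K : fieldType) (char2 : 2 \notin [pchar K]) (G : affine_supergroup K).
Variables (s : seq (coord G)) (gs : gens s).
Hypotheses (con : connected_supergroup G) (sm : smooth_supergroup G).
Local Notation Bv := (even_coord G).
Local Notation Gv := (even_part G).
Local Notation A := (coord G).

(** An idempotent other than 0 and 1 would span, together with its complement, a separable
    subalgebra isomorphic to [K x K]. *)
Lemma idempotent_scalar (i : A) : gr false i -> i * i = i -> exists c : K, i = c%:A.
Proof.
move=> gi ii; apply: contrapT => nc; apply: (nc); apply/con.
have i0 : i <> 0 by move=> e0; apply: nc; exists 0; rewrite scale0r.
have i1 : 1 - i <> 0.
  by move=> /eqP; rewrite subr_eq0 => /eqP e1; apply: nc; exists 1; rewrite scale1r.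
have iC : i * (1 - i) = 0 by rewrite mulrBr mulr1 ii subrr.
have Ci : (1 - i) * i = 0 by rewrite mulrBl mul1r ii subrr.
have CC : (1 - i) * (1 - i) = 1 - i by rewrite mulrBl mul1r iC subr0.
pose L (k : 'I_2) : fieldExtType K := K^o.
pose phi (u : forall k, L k) : A := (u ord0 : K) *: i + (u ord_max : K) *: (1 - i).
exists (fun x => exists u, phi u = x); last first.
  by exists (fun k => if k == ord0 then 1 else 0); rewrite /phi /= scale1r scale0r addr0.
have ci (c : K) : c *: i = 0 -> c = 0.
  by move=> /eqP; rewrite scaler_eq0 => /orP [/eqP|/eqP].
have ci' (c : K) : c *: (1 - i) = 0 -> c = 0.
  by move=> /eqP; rewrite scaler_eq0 => /orP [/eqP|/eqP].
split=> [x [u <-]|].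
  rewrite /phi; apply: (subspaceD (gr_subspace A false)).
    exact: (subspaceZ (gr_subspace A false)).
  apply: (subspaceZ (gr_subspace A false)).
  exact: (subspaceB (gr_subspace A false) (gr1 A) gi).
exists 2%N, L, phi; split.
- by move=> k; rewrite regular_fullv; apply: separable_refl.
- split=> [c u v|u v|].
  + by rewrite /phi !scalerDl !scalerDr !scalerA addrACA.
  + rewrite /phi mulrDl !mulrDr -!scalerAl -!scalerAr ii iC Ci CC !scaler0 addr0 add0r.
    by rewrite !scalerA.
  + by rewrite /phi !scale1r addrC subrK.
- move=> u v e; have e2 : (u ord0 - v ord0 : K) *: i + (u ord_max - v ord_max : K) *: (1 - i) = 0.
    by rewrite !scalerBl addrACA -opprD -/(phi u) -/(phi v) e subrr.
  have e0 : u ord0 = v ord0.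
    apply/eqP; rewrite -subr_eq0; apply/eqP/ci; have := congr1 (fun x => x * i) e2.
    by rewrite mulrDl -!scalerAl ii Ci scaler0 addr0 mul0r.
  have e1 : u ord_max = v ord_max.
    apply/eqP; rewrite -subr_eq0; apply/eqP/ci'; have := congr1 (fun x => x * (1 - i)) e2.
    by rewrite mulrDl -!scalerAl CC iC scaler0 add0r mul0r.
  apply: functional_extensionality_dep => k.
  have [k0|k1] : k = ord0 \/ k = ord_max.
    by case: k => [[|[]]] //= kk; [left|right]; apply: val_inj.
  - by rewrite k0.
  - by rewrite k1.
- by [].
Qed.

(** The idempotent generating [minf] lifts to [K[G]] through the section, hence is a scalar by
    connectedness; its augmentation is 0, so it vanishes. *)
Lemma minf_eq0 (h : Bv) : minf (counit Gv) h -> h = 0.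
Proof.
have [j [hj jh]] := @minf_idem K Gv _ (gens_even gs).
have [t [tev tK]] := even_section char2 gs sm.
have [|c hc] := @idempotent_scalar (t j) (tev j); first by rewrite -shomM -jh.
have j0 : j = 0.
  have : j = c%:A by rewrite -[LHS]tK hc (shomZ (piE G)) shom1.
  move=> ec; have := minf_aug hj; rewrite {1}ec (aug_alg (counit Gv)) => c0.
  by rewrite ec c0 scale0r.
by move=> /jh ->; rewrite j0 mul0r.
Qed.
End Connected.

(** * Truncated polynomial rings *)

Section Truncated.
Variables (K : fieldType) (N : nat).

Definition trunc_pred (p : {poly K}) : Prop := exists q, p = 'X^(N.+1) * q.

Lemma trunc_pred1 : ~ trunc_pred 1.
Proof.
move=> [q /(congr1 (fun p => p.[0]))]; rewrite hornerM hornerXn expr0n mul0r hornerC.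
by move/eqP; rewrite oner_eq0.
Qed.

Local Notation PK := (evens {poly K}).

Lemma truncB (p q : PK) : trunc_pred p -> trunc_pred q -> trunc_pred (p - q).
Proof. by move=> [p' ->] [q' ->]; exists (p' - q'); rewrite mulrBr. Qed.
Lemma truncMl (a p : PK) : trunc_pred p -> trunc_pred (a * p).
Proof. by move=> [p' ->]; exists (a * p'); rewrite [LHS]mulrCA. Qed.
Lemma truncMr (a p : PK) : trunc_pred p -> trunc_pred (p * a).
Proof. by move=> [p' ->]; exists (p' * a); symmetry; exact: mulrA. Qed.
Lemma trunc_gr (p q : PK) : gr false p -> gr true q -> trunc_pred (p + q) -> trunc_pred p.
Proof. by move=> _ /(_ isT) ->; rewrite addr0. Qed.
Lemma trunc0 : trunc_pred (0 : PK).
Proof. by exists 0; rewrite mulr0. Qed.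

Definition trunc_ideal : superideal PK :=
  Superideal trunc0 truncB truncMl truncMr trunc_pred1 trunc_gr.
Definition trunc : obj (alg_cat K).
Proof.
refine (@Obj K (alg_cat K) (squotient trunc_ideal) (conj _ _)).
  by apply: squotient_supercommutative; apply: evens_supercommutative; apply: mulrC.
by move=> _ [x /(_ isT) -> <-]; apply: squot_pi0.
Defined.
Definition tpi : shom PK trunc := squot_pi trunc_ideal.

Lemma tpi_surj y : exists p, tpi p = y.
Proof. exact: squot_pi_surj. Qed.
Lemma tpiE (p q : {poly K}) : tpi p = tpi q <-> trunc_pred (p - q).
Proof. exact: squot_piP. Qed.

(** Read off from a chosen representative, hence meaningful only for [r] at most [N]. *)
Definition cf (r : nat) (y : trunc) : K^o := (squot_repr y : {poly K})`_r.

Lemma cfE r p : (r <= N)%N -> cf r (tpi p) = p`_r.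
Proof.
move=> rN; have : tpi (squot_repr (tpi p)) = tpi p by apply: squot_reprK.
move=> /tpiE [q eq]; have e' : (squot_repr (tpi p) : {poly K}) - p = 'X^(N.+1) * q := eq.
apply/eqP; rewrite /cf -subr_eq0 -coefB e'.
by rewrite coefXnM ltnS rN.
Qed.

Lemma cf_lin r : (r <= N)%N -> lin (cf r).
Proof.
move=> rN c x y; have [p <-] := tpi_surj x; have [q <-] := tpi_surj y.
by rewrite -(shom_lin tpi) !cfE // [LHS]coefD coefZ.
Qed.

Lemma cfM r x y : (r <= N)%N -> cf r (x * y) = \sum_(i < r.+1) cf i x * cf (r - i) y.
Proof.
move=> rN; have [p <-] := tpi_surj x; have [q <-] := tpi_surj y.
rewrite -shomM cfE // [LHS]coefM; apply: eq_bigr => i _.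
by rewrite !cfE //; [lia|have := ltn_ord i; lia].
Qed.

End Truncated.

Section TruncMap.
Variables (K : fieldType) (M N : nat) (MN : (M <= N)%N).
Lemma trunc_map_ker (p : evens {poly K}) : trunc_ideal K N p -> tpi K M p = 0.
Proof.
move=> [q ->]; rewrite -(shom0 (tpi K M)); apply/tpiE; rewrite subr0.
by exists ('X^(N - M) * q); rewrite mulrA -exprD; congr ('X^_ * _); lia.
Qed.
Definition trunc_map : shom (trunc K N) (trunc K M) := squot_lift trunc_map_ker.
Lemma trunc_mapE p : trunc_map (tpi K N p) = tpi K M p.
Proof. exact: (squot_lift_pi trunc_map_ker p). Qed.
Lemma trunc_map_surj y : exists x, trunc_map x = y.
Proof. by have [p <-] := tpi_surj y; exists (tpi K N p); rewrite trunc_mapE. Qed.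
(** The kernel consists of multiples of ['X], so [N + 1] factors suffice. *)
Lemma trunc_map_nilp : nilpotent_kernel trunc_map.
Proof.
exists N.+1 => x hx.
have /choice [q hq] : forall i, exists q, x i = tpi K N ('X * q).
  move=> i; have [p ep] := tpi_surj (x i); have := hx i; rewrite -ep trunc_mapE.
  rewrite -(shom0 (tpi K M)) => /tpiE [q]; rewrite subr0 exprS -mulrA => ->.
  by exists ('X^M * q).
rewrite (eq_bigr (fun i => tpi K N ('X * q i))); last by move=> i _; apply: hq.
rewrite -shom_prod -(shom0 (tpi K N)); apply/tpiE; rewrite subr0.
exists (\prod_(i < N.+1) q i); rewrite [LHS]big_split /=.
by rewrite prodr_const card_ord.
Qed.
End TruncMap.

(** * Curves through the identity *)

Lemma digits_inj n d (a b : 'I_n -> 'I_d) :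
  (\sum_(i < n) a i * d ^ i = \sum_(i < n) b i * d ^ i)%N -> a =1 b.
Proof.
elim: n a b => [|n IHn] a b; first by move=> _ [].
rewrite !big_ord_recl !expn0 !muln1.
have e (c : 'I_n.+1 -> 'I_d) : (\sum_(i < n) c (lift ord0 i) * d ^ lift ord0 i =
    d * \sum_(i < n) c (lift ord0 i) * d ^ i)%N.
  rewrite big_distrr; apply: eq_bigr => i _ /=.
  by rewrite /bump leq0n add1n expnS mulnCA.
rewrite !e => h.
have h0 : a ord0 = b ord0.
  have m (c : 'I_d) k : ((c + d * k) %% d = c)%N.
    by rewrite addnC mulnC modnMDl modn_small.
  by apply: val_inj; have := congr1 (modn^~ d) h; rewrite !m.
move: h; rewrite h0 => /addnI /eqP; rewrite eqn_pmul2l; last exact: leq_trans (ltn_ord (a ord0)).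
move=> /eqP /IHn h i; case: (unliftP ord0 i) => [j ->|-> //]; exact: h.
Qed.

Definition domainp (K : fieldType) (R : superalgebra K) : Prop :=
  forall x y : R, x * y = 0 -> x = 0 \/ y = 0.

Section Curve.
Variables (K : fieldType) (Bv : superalgebra K) (eB : purely_even Bv) (sB : supercommutative Bv).
Variable e : shom Bv (ground K).
Let mC : commutative (@GRing.mul Bv) := mulLC eB sB.
Local Notation aug := (aug e).
Local Notation mpow := (mpow e).

Lemma shift_mul (x y a b : Bv) : (x - a) * (y - b) = x * y - b * x - a * y + a * b.
Proof. have h : forall x y a b : crng_of mC, (x - a) * (y - b) = x * y - b * x - a * y + a * b by
  move=> *; ring. exact: h. Qed.

Lemma shift_mul2 (x y a b : Bv) :
  x * y = x * y - b * x - a * y + a * b + (b * x + a * y - a * b).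
Proof.
have h : forall x y a b : crng_of mC,
  x * y = x * y - b * x - a * y + a * b + (b * x + a * y - a * b) by move=> *; ring.
exact: h.
Qed.

(** A basis of the augmentation ideal modulo its square, with the dual basis of the tangent space at
    the identity. *)
Definition coordinates n (w : 'I_n -> Bv) (u : 'I_n -> Bv -> K^o) : Prop :=
  [/\ forall i, lin (u i), forall i j, u i (w j) = (i == j)%:R, forall i, aug (w i) = 0,
      forall i x y, u i (x * y) = u i x * aug y + aug x * u i y
    & forall x, mpow 2 (x - (aug x)%:A - \sum_(i < n) u i x *: w i)].

Lemma coordinates_ex (s : seq Bv) : gens s -> exists n (w : 'I_n -> Bv) u, coordinates w u.
Proof.
move=> gs; have s2 := mpow_subspace e 2.
pose M x := mpow 2 (x - (aug x)%:A).
have sM : subspace M.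
  split=> [|c x y hx hy]; first by rewrite /M aug0 scale0r subr0; case: s2.
  rewrite /M augD augZ scalerDl -scalerA opprD addrACA -scalerBr.
  by case: s2 => _; apply.
have M1 : M 1 by rewrite /M aug1 scale1r subrr; case: s2.
have M2 z : mpow 2 z -> M z.
  move=> h; have /mpow1 z0 := mpowS eB sB h.
  by rewrite /M z0 scale0r subr0.
have mm x y : aug x = 0 -> aug y = 0 -> mpow 2 (x * y).
  by move=> hx hy; apply: (@mpow_mul _ _ e 1 _ _ hx); apply/mpow1.
have [n [w [u [lu uM uw ws hs]]]] := dual_basis [seq x - (aug x)%:A | x <- s] sM.
have w0 i : aug (w i) = 0 by have /mapP [x _ ->] := ws i; apply: aug_sub.
have u1 i : u i 1 = 0 by apply: uM.
have uprod i x y : u i (x * y) = u i x * aug y + aug x * u i y.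
  have : u i ((x - (aug x)%:A) * (y - (aug y)%:A)) = 0.
    exact: (uM _ _ (M2 _ (mm _ _ (aug_sub e x) (aug_sub e y)))).
  have -> : (x - (aug x)%:A) * (y - (aug y)%:A) =
      x * y - aug y *: x - aug x *: y + (aug x * aug y)%:A.
    by rewrite shift_mul !mulr_algl scalerA.
  rewrite !(linD (lu i)) !(linN (lu i)) !(linZ (lu i)) u1 [_ *: 0]mulr0 addr0 => /eqP.
  by rewrite -addrA -opprD subr_eq0 => /eqP ->; rewrite mulrC.
exists n, w, u; split=> // x.
pose Q x := M (x - \sum_(i < n) u i x *: w i).
have sQ : subspace Q.
  split=> [|c y z hy hz]; first rewrite /Q big1 ?subr0; first by case: sM.
    by move=> i _; rewrite (lin0 (lu i)) scale0r.
  rewrite /Q [X in M X](_ : _ = c *: (y - \sum_(i < n) u i y *: w i) + (z - \sum_(i < n) u i z *: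
    w i)).
    by case: sM => _; apply.
  rewrite scalerBr addrACA -opprD scaler_sumr -big_split; congr (_ - _); apply: eq_bigr => i _.
  by rewrite (lu i) scalerDl scalerA.
have QM z : M z -> Q z.
  by move=> h; rewrite /Q big1 ?subr0 // => i _; rewrite uM // scale0r.
suff : Q x.
  have a0 : aug (\sum_(i < n) u i x *: w i) = 0.
    rewrite (big_morph aug (augD e) (aug0 e)) big1 // => i _.
    by rewrite augZ w0 mulr0.
  rewrite /Q /M augB a0 subr0 => h.
  by rewrite [X in mpow _ X]addrAC.
move: x; apply: gs => [|c y z hy hz|y z hy hz|y ys].
- exact: QM.
- by case: sQ => _; apply.
- rewrite [X in Q X](_ : _ = (y - (aug y)%:A) * (z - (aug z)%:A) + (aug z *: y + aug y *: z -
  (aug y * aug z)%:A)); last first.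
    rewrite -scalerA -(mulr_algl (aug z) y) -(mulr_algl (aug y) z) -(mulr_algl (aug y) (aug z)%:A).
    by rewrite shift_mul; exact: shift_mul2.
  apply: (subspaceD sQ).
    exact: (QM _ (M2 _ (mm _ _ (aug_sub e y) (aug_sub e z)))).
  apply: (subspaceB sQ); last by apply: (subspaceZ sQ); apply: QM.
  by apply: (subspaceD sQ); apply: (subspaceZ sQ).
- rewrite -[y](subrK (aug y)%:A); apply: (subspaceD sQ); last by apply: (subspaceZ sQ); apply: QM.
  by apply: hs; apply: map_f.
Qed.

Variables (n : nat) (w : 'I_n -> Bv) (u : 'I_n -> Bv -> K^o).
Hypothesis cwu : coordinates w u.
Let lu i : lin (u i). Proof. by case: cwu. Qed.
Let uw i j : u i (w j) = (i == j)%:R. Proof. by case: cwu. Qed.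
Let w0 i : aug (w i) = 0. Proof. by case: cwu. Qed.
Let uprod i x y : u i (x * y) = u i x * aug y + aug x * u i y. Proof. by case: cwu. Qed.
Let uexp x : mpow 2 (x - (aug x)%:A - \sum_(i < n) u i x *: w i). Proof. by case: cwu. Qed.

Definition smooth_point : Prop := forall (E : obj (alg_cat K)) (E' : superalgebra K)
  (p : shom E E') (x : shom Bv E'), (forall y, exists z, p z = y) -> nilpotent_kernel p ->
  exists y : shom Bv E, scomp p y = x.
Hypothesis smp : smooth_point.

Variables (d D N : nat) (d0 : (0 < d)%N) (D0 : (0 < D)%N) (DN : (D.*2 <= N.+1)%N).

(** The [i]-th coordinate moves with speed ['X^(d ^ i)], so that a monomial in the coordinates
    records its exponents as digits in base [d]. *)
Definition tangent_poly (a : Bv) : {poly K} := \sum_(i < n) u i a *: 'X^(d ^ i).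

Lemma tangent_poly_lin : lin tangent_poly.
Proof.
move=> c x y; rewrite /tangent_poly scaler_sumr -big_split; apply: eq_bigr => i _.
by rewrite (lu i) scalerDl scalerA.
Qed.

Lemma tangent_poly1 : tangent_poly 1 = 0.
Proof.
apply: big1 => i _; have := uprod i 1 1; rewrite mulr1 aug1 mulr1 mul1r => /eqP.
by rewrite -subr_eq0 opprD addNKr oppr_eq0 => /eqP ->; rewrite scale0r.
Qed.

(** First order motion with parameter ['X^D]. It is multiplicative because products of two tangent
    terms vanish modulo ['X^(D.*2)], and smoothness lifts it to a curve of any order. *)
Definition jet_fun (a : Bv) : trunc K (D.*2).-1 := tpi K _ ((aug a)%:P + 'X^D * tangent_poly a).

Lemma jet_linear : linear jet_fun.
Proof.
move=> c x y; rewrite /jet_fun -(shom_lin (tpi K _)); congr (tpi K _ _).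
rewrite tangent_poly_lin augD augZ polyCD polyCM mulrDr -scalerAr scalerDr !mul_polyC.
by rewrite addrACA -[X in _ + X + _]/(_ *: _).
Qed.

Lemma jet_monoid : monoid_morphism jet_fun.
Proof.
split=> [|x y]; first by rewrite /jet_fun aug1 tangent_poly1 mulr0 addr0; exact: shom1.
rewrite /jet_fun -shomM; apply/tpiE; exists (- (tangent_poly x * tangent_poly y)).
have -> : tangent_poly (x * y) = aug y *: tangent_poly x + aug x *: tangent_poly y.
  rewrite /tangent_poly !scaler_sumr -big_split; apply: eq_bigr => i _.
  by rewrite uprod scalerDl !scalerA [u i x * _]mulrC.
rewrite prednK ?double_gt0 // -addnn exprD augM polyCM -!mul_polyC.
rewrite -[X in _ - X]/(((aug x)%:P + 'X^D * tangent_poly x) * ((aug y)%:P + 'X^D * tangent_poly y)).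
ring.
Qed.

Definition jet : shom Bv (trunc K (D.*2).-1) :=
  mk_shom jet_linear jet_monoid (shom_even_gr eB jet_linear (fun x => purely_even_gr (proj2 (objP
    (trunc K (D.*2).-1))) (jet_fun x))).

Lemma curve_ex : exists theta : shom Bv (trunc K N), forall a, exists R,
  theta a = tpi K N ((aug a)%:P + 'X^D * tangent_poly a + 'X^(D.*2) * R).
Proof.
have MN : ((D.*2).-1 <= N)%N by lia.
have [y hy] := smp jet (@trunc_map_surj K _ _ MN) (@trunc_map_nilp K _ _ MN).
exists y => a; have [p hp] := tpi_surj (y a).
have := congr1 (fun f : shom Bv _ => f a) hy; rewrite /= -hp.
rewrite [LHS](@trunc_mapE K _ _ MN) => /tpiE [R]; rewrite prednK ?double_gt0 // => eR.
exists R; congr (tpi K N _); rewrite -eR.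
by rewrite -[LHS](subrK ((aug a)%:P + 'X^D * tangent_poly a)) addrC.
Qed.

Section OneCurve.
Variable theta : shom Bv (trunc K N).
Hypothesis thetaE : forall a, exists R,
  theta a = tpi K N ((aug a)%:P + 'X^D * tangent_poly a + 'X^(D.*2) * R).

(** A leading monomial with an error term one block of length [D] further on; the weight [v] is
    meant to stay below [D]. *)
Definition leads (k : nat) (b : Bv) (v : nat) : Prop :=
  exists Q : {poly K}, theta b = tpi K N ('X^(k * D + v) + 'X^(k.+1 * D) * Q).

Lemma leads1 : leads 0 1 0.
Proof. by exists 0; rewrite mulr0 addr0 !shom1. Qed.

Lemma leadsM k1 k2 b1 b2 v1 v2 : leads k1 b1 v1 -> leads k2 b2 v2 ->
  leads (k1 + k2) (b1 * b2) (v1 + v2).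
Proof.
move=> [Q1 e1] [Q2 e2].
exists ('X^v1 * Q2 + 'X^v2 * Q1 + 'X^D * (Q1 * Q2)).
rewrite shomM e1 e2 -shomM; congr (tpi K N _).
rewrite !mulSn !exprD !mulnDl !exprD.
rewrite -[LHS]/(('X^(k1 * D) * 'X^v1 + 'X^D * 'X^(k1 * D) * Q1) *
  ('X^(k2 * D) * 'X^v2 + 'X^D * 'X^(k2 * D) * Q2) : {poly K}).
ring.
Qed.

Lemma leadsX k b v j : leads k b v -> leads (k * j) (b ^+ j) (v * j).
Proof.
move=> h; elim: j => [|j IHj]; first by rewrite !muln0; apply: leads1.
by rewrite exprS !mulnS; apply: leadsM.
Qed.

Lemma leads_coord i : leads 1 (w i) (d ^ i).
Proof.
have [R eR] := thetaE (w i); exists R; rewrite eR; congr (tpi K N _).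
rewrite w0 polyC0 add0r mul1n mul2n exprD; congr ('X^D * _ + _).
rewrite /tangent_poly (bigD1 i) //= uw eqxx scale1r big1 ?addr0 // => j ji.
by rewrite uw (negPf ji) scale0r.
Qed.

Definition monomial (al : 'I_n -> nat) : Bv := \prod_(i < n) w i ^+ al i.

Lemma leads_monomial al :
  leads (\sum_(i < n) al i) (monomial al) (\sum_(i < n) al i * d ^ i).
Proof.
rewrite /monomial; elim/big_rec3: _ => [|i k b v _ h]; first exact: leads1.
apply: leadsM => //; have := leadsX (al i) (leads_coord i).
by rewrite mul1n mulnC.
Qed.

Lemma mpow_curve k a : mpow k a -> exists Q : {poly K}, theta a = tpi K N ('X^(k * D) * Q).
Proof.
elim: k a => [|k IHk] a.
  by move=> _; have [p <-] := tpi_surj (theta a); exists p; rewrite mul1r.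
move: a; apply: (@mpow_ind _ _ e k (fun a => exists Q : {poly K}, theta a = tpi K N ('X^(k.+1 *
  D) * Q))).
  split=> [|c x y [Q eQ] [Q' eQ']]; first by exists 0; rewrite mulr0 !shom0.
  exists (c *: Q + Q'); rewrite (shom_lin theta) eQ eQ' -(shom_lin (tpi K N)).
  by congr (tpi K N _); rewrite mulrDr -scalerAr.
move=> x y x0 /IHk [Q eQ]; have [R eR] := thetaE x.
exists ((tangent_poly x + 'X^D * R) * Q); rewrite shomM eR eQ -shomM; congr (tpi K N _).
rewrite x0 polyC0 add0r -addnn exprD mulSn exprD.
rewrite -[LHS]/(('X^D * tangent_poly x + 'X^D * 'X^D * R) * ('X^(k * D) * Q) : {poly K}).
ring.
Qed.

End OneCurve.
End Curve.

Section Domain.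
Variables (K : fieldType) (Bv : superalgebra K) (eB : purely_even Bv) (sB : supercommutative Bv).
Variable e : shom Bv (ground K).
Let mC : commutative (@GRing.mul Bv) := mulLC eB sB.
Local Notation aug := (aug e).
Local Notation mpow := (mpow e).
Variables (n : nat) (w : 'I_n -> Bv) (u : 'I_n -> Bv -> K^o).
Hypothesis cwu : coordinates e w u.
Hypothesis smp : smooth_point Bv.

Local Notation mo al := (monomial w (fun i => nat_of_ord (al i))).

(** Exponents are bounded by [d] only to keep the index type finite; for [k < d] no monomial of
    degree [k] is lost. *)
Definition expands d k (a : Bv) : Prop := exists h : {ffun 'I_n -> 'I_d} -> K,
  mpow k.+1 (a - \sum_(al : {ffun 'I_n -> 'I_d} | (\sum_(i < n) al i)%N == k) h al *: mo al).

Lemma expands_subspace d k : subspace (expands d k).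
Proof.
have sk := mpow_subspace e k.+1; split=> [|c x y [h hx] [h' hy]].
  exists (fun=> 0); rewrite big1 ?subr0; first by case: sk.
  by move=> al _; rewrite scale0r.
exists (fun al => c * h al + h' al).
have -> : \sum_(al : {ffun 'I_n -> 'I_d} | (\sum_(i < n) al i)%N == k)
    (c * h al + h' al) *: mo al =
  c *: (\sum_(al : {ffun 'I_n -> 'I_d} | (\sum_(i < n) al i)%N == k) h al *: mo al) +
  \sum_(al : {ffun 'I_n -> 'I_d} | (\sum_(i < n) al i)%N == k) h' al *: mo al.
  rewrite scaler_sumr -big_split; apply: eq_bigr => al _.
  by rewrite scalerDl scalerA.
by rewrite opprD addrACA -scalerBr; case: sk => _; apply.
Qed.

Lemma expands_small d k a : mpow k.+1 a -> expands d k a.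
Proof.
move=> h; exists (fun=> 0); rewrite big1 ?subr0 //.
by move=> al _; rewrite scale0r.
Qed.

Lemma expands_monomial d k (al : 'I_n -> nat) : (k < d)%N ->
  (\sum_(i < n) al i)%N = k -> expands d k (monomial w al).
Proof.
move=> kd sal; have ald i : (al i < d)%N.
  apply: leq_ltn_trans kd; rewrite -sal (bigD1 i) //=; exact: leq_addr.
pose be : {ffun 'I_n -> 'I_d} := [ffun i => Ordinal (ald i)].
have bE i : be i = al i :> nat by rewrite ffunE.
exists (fun ga => (ga == be)%:R); rewrite (bigD1 be) /=; last first.
  by apply/eqP; rewrite -sal; apply: eq_bigr.
rewrite eqxx scale1r big1 ?addr0 => [|ga /andP [_ nga]]; last by rewrite (negPf nga) scale0r.
have -> : mo be = monomial w al by apply: eq_bigr => i _; rewrite bE.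
by rewrite subrr; case: (mpow_subspace e k.+1).
Qed.

Lemma monomialS (al : 'I_n -> nat) i :
  w i * monomial w al = monomial w (fun j => (j == i) + al j)%N.
Proof.
have h (I : seq 'I_n) (P : pred 'I_n) (f g : 'I_n -> Bv) :
    (\prod_(j <- I | P j) f j) * (\prod_(j <- I | P j) g j) = \prod_(j <- I | P j) (f j * g j).
  elim/big_rec3: _ => [|j x y z _ <-]; first by rewrite mulr1.
  by rewrite -!mulrA; congr (_ * _); rewrite !mulrA; congr (_ * _); apply: mC.
have -> : w i = \prod_(j < n) w j ^+ (j == i).
  rewrite (eq_bigr (fun j => if j == i then w j else 1)).
    by rewrite -big_mkcond big_pred1_eq.
  by move=> j _; case: (j == i); rewrite ?expr1 ?expr0.
by rewrite h; apply: eq_bigr => j _; rewrite exprD.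
Qed.

Lemma mpow_expands d k a : (k < d)%N -> mpow k a -> expands d k a.
Proof.
have [lu uw w0 uprod uexp] := cwu.
elim: k a => [|k IHk] a kd.
  move=> _; rewrite -[a](subrK (aug a)%:A); apply: (subspaceD (expands_subspace d 0)).
    by apply/expands_small/mpow1/aug_sub.
  apply: (subspaceZ (expands_subspace d 0)).
  have <- : monomial w (fun=> 0%N) = 1 by apply: big1.
  by apply: expands_monomial => //; rewrite big1.
have sk := expands_subspace d k.+1.
move: a; apply: (mpow_ind sk) => x y x0 hy.
have [h hh] := IHk y (ltnW kd) hy.
rewrite -[y](subrK (\sum_(al : {ffun 'I_n -> 'I_d} | (\sum_(i < n) al i)%N == k) h al *: mo al)).
rewrite mulrDr; apply: (subspaceD sk); first exact: (expands_small d (mpow_mul x0 hh)).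
rewrite mulr_sumr; apply: (subspace_sum sk) => al /eqP sal.
rewrite -scalerAr; apply: (subspaceZ sk).
have hx := uexp x; rewrite x0 scale0r subr0 in hx.
rewrite -[x](subrK (\sum_(i < n) u i x *: w i)) mulrDl; apply: (subspaceD sk).
  apply: expands_small; suff hm : forall al' : 'I_n -> nat, mpow (\sum_(i < n) al' i) (monomial w
    al').
    have := hm (fun i => al i); rewrite sal => hm'; exact: (mpow_mulD eB sB hx hm').
  move=> al'; rewrite /monomial; elim/big_rec2: _ => // i m z _ hz.
  apply: (mpow_mulD eB sB _ hz); elim: (al' i) => [//|j IHj].
  by rewrite exprS; exact: (mpow_mul (w0 i) IHj).
rewrite mulr_suml; apply: (subspace_sum sk) => i _; rewrite -scalerAl; apply: (subspaceZ sk).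
rewrite monomialS; apply: expands_monomial => //.
rewrite big_split /= sal (bigD1 i) //= eqxx big1 ?addn0 ?add1n // => j /negPf -> //.
Qed.

(** Distinct monomials of degree [k] have distinct leading exponents along the curve, by uniqueness
    of digits, and all of them precede the error terms, which start at [(k + 1) D]. So the vanishing
    of the low coefficients kills the leading form of [a]. *)
Lemma curve_separates d D N (theta : shom Bv (trunc K N)) k a :
  (forall a, exists R, theta a = tpi K N ((aug a)%:P + 'X^D * tangent_poly u d a + 'X^(D.*2) *
    R)) ->
  (k < d)%N -> (k * d ^ n < D)%N -> (k.+1 * D <= N.+1)%N -> mpow k a ->
  (forall r, (r <= k * D + k * d ^ n)%N -> cf r (theta a) = 0) -> mpow k.+1 a.
Proof.
move=> thE kd kD kN ha h0; have [h hh] := mpow_expands kd ha.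
set S := \sum_(al | _) _ in hh.
have cfm (al : 'I_n -> nat) r : (\sum_(i < n) al i)%N = k -> (r < k.+1 * D)%N ->
    cf r (theta (monomial w al)) = (r == k * D + \sum_(i < n) al i * d ^ i)%N%:R.
  move=> sal rk; have [Q] := leads_monomial cwu thE al.
  rewrite sal => ->; rewrite cfE; last by lia.
  by rewrite coefD coefXn coefXnM rk addr0.
have wtb (al : 'I_n -> nat) : (\sum_(i < n) al i)%N = k -> (\sum_(i < n) al i * d ^ i <= k * d ^
  n)%N.
  move=> <-; rewrite big_distrl; apply: leq_sum => i _; rewrite leq_mul2l.
  by rewrite leq_pexp2l ?orbT //; [lia|apply: ltnW].
have S0 : S = 0.
  apply: big1 => be /eqP sbe; pose r := (k * D + \sum_(i < n) be i * d ^ i)%N.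
  have rb : (r <= k * D + k * d ^ n)%N by rewrite leq_add2l; apply: wtb.
  have rk : (r < k.+1 * D)%N by rewrite mulSn; lia.
  have rN : (r <= N)%N by lia.
  have := h0 r rb; rewrite -[a](subrK S) shomD (linD (cf_lin rN)).
  have [Q ->] := mpow_curve thE hh; rewrite cfE // coefXnM rk add0r.
  rewrite shom_sum (lin_sum (cf_lin rN)) (bigD1 be) /=; last by apply/eqP.
  rewrite big1 ?addr0 => [|al /andP [/eqP sal nal]].
    by rewrite shomZ (linZ (cf_lin rN)) cfm // eqxx [_ *: _]mulr1 => ->; rewrite scale0r.
  rewrite shomZ (linZ (cf_lin rN)) cfm // eqn_add2l.
  have -> : (\sum_(i < n) be i * d ^ i == \sum_(i < n) al i * d ^ i)%N = false.
    apply/negP => /eqP /digits_inj ee; move/eqP: nal; apply; apply/ffunP => i.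
    by rewrite ee.
  by rewrite scaler0.
by move: hh; rewrite S0 subr0.
Qed.

Hypothesis sep : forall h, minf e h -> h = 0.

Variables (R : superalgebra K) (dR : domainp R).
Hypotheses (eR : purely_even R) (sR : supercommutative R).
Local Notation T := (tensor Bv R).

Section Coef.
Variables (N : nat) (theta : shom Bv (trunc K N)).
Definition tcf r (F : T) : R := lslice (fun a => cf r (theta a)) F.
Let lcf r : (r <= N)%N -> lin (fun a => cf r (theta a)).
Proof. by move=> rN; exact (lin_comp (shom_lin theta) (cf_lin rN)). Qed.
Lemma tcf_lin r : (r <= N)%N -> lin (tcf r).
Proof. by move=> rN; apply: lslice_lin; apply: lcf. Qed.
Lemma tcf_slice r F (psi : R -> K^o) : (r <= N)%N -> lin psi ->
  psi (tcf r F) = cf r (theta (rslice psi F)).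
Proof. by move=> rN lpsi; rewrite -(slice_swap F (lcf rN) lpsi). Qed.
Lemma tcfM r (F H : T) : (r <= N)%N -> tcf r (F * H) = \sum_(i < r.+1) tcf i F * tcf (r - i) H.
Proof.
move=> rN; have iN (i : 'I_r.+1) : (i <= N)%N by have := ltn_ord i; lia.
have jN (i : 'I_r.+1) : (r - i <= N)%N by lia.
move: F; apply: lin_eq_tens => [||a x].
- by move=> c F F'; rewrite mulrDl -scalerAl (tcf_lin rN).
- apply: lin_bigsum => i c F F'; rewrite (tcf_lin (iN i)) mulrDl -scalerAl //.
move: H; apply: lin_eq_tens => [||a' x'].
- by move=> c F F'; rewrite mulrDr -scalerAr (tcf_lin rN).
- apply: lin_bigsum => i c F F'; rewrite (tcf_lin (jN i)) mulrDr -scalerAr //.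
rewrite [X in tcf r X](pure_mulE eR) /tcf lslice_pure; last exact: lcf.
rewrite shomM cfM // scaler_suml; apply: eq_bigr => i _.
rewrite !lslice_pure; try by apply: lcf.
by rewrite -scalerAl -scalerAr scalerA.
Qed.
End Coef.

(** The order of [F] along the identity section; it is finite because the powers of the augmentation
    ideal have zero intersection. *)
Lemma order_ex (F : T) : F <> 0 -> exists k, (forall psi, lin psi -> mpow k (rslice psi F)) /\
  exists psi, lin psi /\ ~ mpow k.+1 (rslice psi F).
Proof.
move=> F0; have ex : exists k, `[< exists psi, lin psi /\ ~ mpow k (rslice psi F) >].
  apply: contrapT => h; apply: F0; apply: rslice_eq0 => psi lpsi; apply: sep => k.
  by apply: contrapT => hk; apply: h; exists k; apply/asboolP; exists psi.
case: (ex_minnP ex) => [[|k]] /asboolP [psi [lpsi hpsi]] mink; first by case: hpsi.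
exists k; split; last by exists psi.
move=> psi' lpsi'; apply: contrapT => hk.
suff : (k.+1 <= k)%N by rewrite ltnn.
by apply: mink; apply/asboolP; exists psi'.
Qed.

Lemma first_coef d D N (theta : shom Bv (trunc K N)) k (F : T) :
  (forall a, exists R, theta a = tpi K N ((aug a)%:P + 'X^D * tangent_poly u d a + 'X^(D.*2) *
    R)) ->
  (k < d)%N -> (k * d ^ n < D)%N -> (k.+1 * D <= N.+1)%N ->
  (forall psi, lin psi -> mpow k (rslice psi F)) ->
  (exists psi, lin psi /\ ~ mpow k.+1 (rslice psi F)) ->
  exists r, [/\ (r <= k * D + k * d ^ n)%N, tcf theta r F <> 0 &
    forall i, (i < r)%N -> tcf theta i F = 0].
Proof.
move=> thE kd kD kN hk [psi [lpsi npsi]].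
have ex : exists r, (r <= k * D + k * d ^ n)%N && `[< tcf theta r F <> 0 >].
  apply: contrapT => h; apply: npsi; apply: (curve_separates thE kd kD kN (hk _ lpsi)) => r rb.
  have rN : (r <= N)%N by move: kN; rewrite mulSn; lia.
  rewrite -tcf_slice //; have -> : tcf theta r F = 0.
    by apply: contrapT => hr; apply: h; exists r; rewrite rb; apply/asboolP.
  exact: lin0.
case: (ex_minnP ex) => r /andP [rb /asboolP hr] minr; exists r; split=> // i ir.
apply: contrapT => hi; move: (ir); rewrite ltnNge => /negP; apply; apply: minr.
by apply/andP; split; [exact: leq_trans (ltnW ir) rb|apply/asboolP].
Qed.

(* The lowest order terms of two nonzero elements along a curve
   [w i = 'X^(D + d ^ i) + O('X^(2 D))] have nonzero product; the exponents
   [d ^ i] keep distinct monomials apart. *)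
Theorem tensor_domain : domainp T.
Proof.
move=> F H FH; apply: contrapT => /not_orP [F0 H0].
have [k [hk nk]] := order_ex F0; have [l [hl nl]] := order_ex H0.
(* Here [d] exceeds all exponents in degrees [k] and [l], [D] exceeds the sum of their weights, and
   [N] leaves room for the product of the two leading terms. *)
pose d := (k + l).+1; pose D := ((k + l) * d ^ n).+1; pose N := ((k + l).+2 * D).-1.
have D0 : (0 < D)%N by [].
have N1 : N.+1 = ((k + l).+2 * D)%N by rewrite prednK // muln_gt0 /=.
have kl0 : ((k * d ^ n <= (k + l) * d ^ n) && (l * d ^ n <= (k + l) * d ^ n))%N.
  by rewrite !leq_mul2r leq_addr leq_addl !orbT.
have [kD lD] := andP kl0.
have DN : (D.*2 <= N.+1)%N by rewrite N1 -mul2n leq_mul2r; apply/orP; right; lia.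
have [theta thE] := curve_ex eB cwu smp (ltn0Sn (k + l)) D0 DN.
have [r [rb hr r0]] : exists r, [/\ (r <= k * D + k * d ^ n)%N, tcf theta r F <> 0 &
    forall i, (i < r)%N -> tcf theta i F = 0].
  apply: first_coef thE _ _ _ hk nk; [by rewrite ltnS leq_addr|by rewrite ltnS|].
  by rewrite N1 leq_mul2r; apply/orP; right; lia.
have [q [qb hq q0]] : exists r, [/\ (r <= l * D + l * d ^ n)%N, tcf theta r H <> 0 &
    forall i, (i < r)%N -> tcf theta i H = 0].
  apply: first_coef thE _ _ _ hl nl; [by rewrite ltnS leq_addl|by rewrite ltnS|].
  by rewrite N1 leq_mul2r; apply/orP; right; lia.
have rqN : (r + q <= N)%N.
  rewrite -ltnS N1 !mulSn mulnDl.
  have : (k * d ^ n + l * d ^ n < D)%N by rewrite -mulnDl.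
  lia.
have := tcfM theta F H rqN; rewrite FH (lin0 (tcf_lin theta rqN)).
have rr : (r < (r + q).+1)%N by lia.
rewrite (bigD1 (Ordinal rr)) //= addKn big1 ?addr0 => [/esym /dR [/hr|/hq] //|i ni].
have [ir|ir] := ltnP i r; first by rewrite r0 // mul0r.
have nir : (i : nat) != r by apply: contra ni => /eqP ie; apply/eqP/val_inj.
by rewrite q0 ?mulr0 //; have := ltn_ord i; lia.
Qed.

End Domain.

(** * The Lie-Kolchin theorem *)

Section ExtensionAlgebra.
Variables (K L : fieldType) (f : {rmorphism K -> L}).
(** The field [L] as a [K]-algebra through [f]; the alias is indexed by the embedding. *)
Definition extf of phant_id f f : Type := L.
Local Notation E := (extf (@id_phant _ f)).
HB.instance Definition _ := GRing.Field.on E.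
Definition ext_scale (c : K) (x : E) : E := (f c : E) * x.
Lemma ext_scaleA a b x : ext_scale a (ext_scale b x) = ext_scale (a * b) x.
Proof. by rewrite /ext_scale rmorphM [LHS]mulrA. Qed.
Lemma ext_scale1 : left_id 1 ext_scale.
Proof. by move=> x; rewrite /ext_scale rmorph1 [LHS]mul1r. Qed.
Lemma ext_scaleDr : right_distributive ext_scale +%R.
Proof. by move=> a x y; rewrite /ext_scale [LHS]mulrDr. Qed.
Lemma ext_scaleDl x : {morph ext_scale^~ x : a b / a + b}.
Proof. by move=> a b; rewrite /ext_scale rmorphD [LHS]mulrDl. Qed.
HB.instance Definition _ := GRing.Zmodule_isLmodule.Build K E
  ext_scaleA ext_scale1 ext_scaleDr ext_scaleDl.
Lemma ext_scaleAl (a : K) (x y : E) : a *: (x * y) = a *: x * y.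
Proof. exact: mulrA. Qed.
HB.instance Definition _ := GRing.Lmodule_isLalgebra.Build K E ext_scaleAl.
Lemma ext_scaleAr (a : K) (x y : E) : a *: (x * y) = x * (a *: y).
Proof. exact: mulrCA. Qed.
HB.instance Definition _ := GRing.Lalgebra_isAlgebra.Build K E ext_scaleAr.

Definition exts : superalgebra K := evens E.
Lemma exts_even : purely_even exts. Proof. exact: evens_even. Qed.
Lemma exts_supercommutative : supercommutative exts.
Proof. by apply: evens_supercommutative; apply: mulrC. Qed.
Lemma exts_domain : domainp exts.
Proof. by move=> x y /eqP; rewrite mulf_eq0 => /orP [/eqP|/eqP]; [left|right]. Qed.
Lemma exts_field (x : exts) : x <> 0 -> exists y, x * y = 1.
Proof. by move=> /eqP nx; exists ((x : E)^-1); exact: (@divff E). Qed.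
End ExtensionAlgebra.

(** Take a matrix of maximal rank whose row space lies in [P]; any further vector of [P] would raise
    the rank. *)
Lemma subspace_mx (E : fieldType) n (P : 'rV[E]_n -> Prop) : P 0 ->
  (forall c u v, P u -> P v -> P (c *: u + v)) ->
  exists U : 'M[E]_n, forall u, P u <-> (u <= U)%MS.
Proof.
move=> P0 Pl.
have ex : exists r, `[< exists U : 'M[E]_n, (forall u : 'rV_n, (u <= U)%MS -> P u) /\ (n - \rank
  U)%N = r >].
  by exists (n - \rank (0%R : 'M[E]_n))%N; apply/asboolP; exists 0%R; split=> // u; rewrite
    submx0 => /eqP ->.
case: (ex_minnP ex) => r /asboolP [U [hU rU]] minr; exists U => u; split=> [hu|]; last exact: hU.
have sub : (U <= U + u)%MS by apply: addsmxSl.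
have : (r <= n - \rank (U + u))%N.
  apply: minr; apply/asboolP; exists (U + u)%MS; split=> // v.
  move=> /sub_addsmxP [[v1 v2] ->] /=; rewrite [v2 *m u](_ : _ = v2 0 0 *: u).
    by rewrite addrC; apply: Pl => //; apply: hU; apply: submxMl.
  by rewrite {1}[v2]mx11_scalar mul_scalar_mx.
rewrite -rU => h; have h1 := mxrankS sub; have h2 := rank_leq_row (U + u)%MS.
have : (U + u <= U)%MS.
  by rewrite -(geq_leqif (mxrank_leqif_sup sub)); lia.
exact: submx_trans (addsmxSr _ _).
Qed.

(** The product of the factors [X - z]; it vanishes when the characteristic polynomial of [X]
    divides the product of the ['X - z]. *)
Definition pann (E : fieldType) n (rs : seq E) (X : 'M[E]_n) : 'M[E]_n :=
  foldr (fun z Y => (X - z%:M) *m Y) 1%:M rs.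

(** * Parameter algebras and families of commutators *)

Section Good.
Variables (K : fieldType) (Gv : affine_group K).
Local Notation hC := (alg_cat_closed K).
Local Notation Bv := (coord Gv).

(** Integrality that survives every extension by a domain. In contrast to being a domain, it passes
    to tensor products, which are formed whenever two families of points are made independent. *)
Definition good (S : obj (alg_cat K)) : Prop := forall R : superalgebra K,
  purely_even R -> supercommutative R -> domainp R -> domainp (tensor S R).

(** The tensor product with [R] embeds into [S1 (x) (S2 (x) R)], a domain by two applications of the
    hypotheses. *)
Lemma good_tensor (S1 S2 : obj (alg_cat K)) : good S1 -> good S2 -> good (tens_obj hC S1 S2).
Proof.
move=> g1 g2 R eR sR dR.
have [s1 e1] := objP S1; have [s2 e2] := objP S2.
pose T2 := tensor S2 R; have sT2 : supercommutative T2 := tens_supercommutative s2 sR.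
have eT2 : purely_even T2 by apply: tens_purely_even.
pose T := tensor S1 T2; have sT : supercommutative T := tens_supercommutative s1 sT2.
have dT : domainp T by apply: g1 => //; apply: g2.
pose f12 : shom (tens_obj hC S1 S2) T := tlift (tinl S1 T2) (scomp (tinr S1 T2) (tinl S2 R)) sT.
pose f : shom (tensor (tens_obj hC S1 S2) R) T := tlift f12 (scomp (tinr S1 T2) (tinr S2 R)) sT.
have fE (a : S1) (b : S2) (r : R) : f (pure (pure a b : tens_obj hC S1 S2) r) = pure a (pure b r
  : T2).
  rewrite [LHS]tliftE [f12 _]tliftE -mulrA -(shomM (tinr S1 T2)).
  by rewrite [tinl S2 R b * _]tinl_tinr [LHS]tinl_tinr.
have f0 F : f F = 0 -> F = 0.
  move=> eF; apply: rslice_eq0 => psi lpsi; apply: rslice_eq0 => psi2 lpsi2.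
  have -> : rslice psi2 (rslice psi F) = rslice (fun G => psi2 (rslice psi G)) (f F).
    have ll : lin (fun G : T2 => psi2 (rslice psi G)) := lin_comp (rslice_lin lpsi) lpsi2.
    move: F {eF}; apply: lin_eq_tens => [||P r].
    - exact (lin_comp (rslice_lin lpsi) (rslice_lin lpsi2)).
    - exact (lin_comp (shom_lin f) (rslice_lin ll)).
    move: P; apply: lin_eq_tens => [||a b].
    - by move=> c x y; rewrite pureDl pureZl (rslice_lin lpsi) (rslice_lin lpsi2).
    - by move=> c x y; rewrite pureDl pureZl shom_lin (rslice_lin ll).
    rewrite fE rslice_pure // (linZ (rslice_lin lpsi2)) !rslice_pure // (linZ lpsi2) scalerA.
    by [].
  by rewrite eF; apply: lin0; apply: rslice_lin; apply: (lin_comp (rslice_lin lpsi) lpsi2).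
move=> x y xy; have := dT (f x) (f y); rewrite -shomM xy shom0 => /(_ erefl) [/f0|/f0];
  [left|right] => //.
Qed.

Variables (eB : good Bv).

(** An irreducible family of iterated commutators through the identity: [S] is the ring of
    parameters and [e] the parameter at which the family is trivial. Such families replace the
    connected derived subgroups of the classical argument. *)
Definition gpoint i (S : obj (alg_cat K)) (e : shom S (ground K)) (g : point Gv S) : Prop :=
  [/\ good S, dpoint i g & scomp e g = gone Gv (ground_obj (alg_cat K))].

Lemma gpoint_tensor (S1 S2 : obj (alg_cat K)) i e1 e2 (g1 : point Gv S1) (g2 : point Gv S2) :
  gpoint i e1 g1 -> gpoint i e2 g2 ->
  exists e : shom (tens_obj hC S1 S2) (ground K),
    gpoint i e (scomp (tinl S1 S2) g1 : point Gv (tens_obj hC S1 S2)) /\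
    gpoint i e (scomp (tinr S1 S2) g2 : point Gv (tens_obj hC S1 S2)).
Proof.
move=> [d1 p1 h1] [d2 p2 h2].
pose e : shom (tens_obj hC S1 S2) (ground K) := tlift e1 e2 (@ground_supercommutative K).
exists e; split; split.
- exact: good_tensor.
- exact: (@dpoint_nat K (alg_cat K) Gv S1 (tens_obj hC S1 S2) (tinl S1 S2)).
- by rewrite scompA [scomp e _]tlift_inl.
- exact: good_tensor.
- exact: (@dpoint_nat K (alg_cat K) Gv S2 (tens_obj hC S1 S2) (tinr S1 S2)).
- by rewrite scompA [scomp e _]tlift_inr.
Qed.

Lemma gpointM S i e (g h : point Gv S) : gpoint i e g -> gpoint i e h -> gpoint i e (gmul g h).
Proof.
move=> [d p h1] [_ p2 h2]; split=> //; first exact: dpointM.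
by rewrite (@gmul_nat _ _ Gv S (ground_obj (alg_cat K)) e) h1 h2 gmul1.
Qed.
Lemma gpointC S i e (g h : point Gv S) : gpoint i e g -> gpoint i e h -> gpoint i.+1 e (gcomm g h).
Proof.
move=> [d p h1] [_ p2 h2]; split=> //; first exact: dpointC.
by rewrite (@gcomm_nat _ _ Gv S (ground_obj (alg_cat K)) e) h1 h2 /gcomm gmulVr.
Qed.
Lemma gpointJ S i j e (g h : point Gv S) : gpoint j e g -> gpoint i e h -> gpoint i e (gconj g h).
Proof.
move=> [d p h1] [_ p2 h2]; split=> //; first exact: dpointJ.
by rewrite (@gconj_nat _ _ Gv S (ground_obj (alg_cat K)) e) h1 h2 /gconj gmulr1 gmulVr.
Qed.
Lemma gpointS S i e (g : point Gv S) : gpoint i.+1 e g -> gpoint i e g.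
Proof. by move=> [d p h1]; split=> //; apply: dpointS. Qed.

Lemma dpointV (S : obj (alg_cat K)) i (g : point Gv S) : dpoint i g -> dpoint i (ginv g).
Proof.
elim=> {i g} [g|i|i f g _ hf _ hg|i f g hf _ hg _].
- exact: dpoint0.
- by rewrite ginv1; apply: dpoint1.
- by rewrite ginvM; apply: dpointM.
- by rewrite /gcomm ginvM ginvK; apply: dpointC.
Qed.

Lemma gpointV S i e (g : point Gv S) : gpoint i e g -> gpoint i e (ginv g).
Proof.
move=> [d p h1]; split=> //; first exact: dpointV.
by rewrite (@ginv_nat _ _ Gv S (ground_obj (alg_cat K)) e) h1 ginv1.
Qed.

Lemma gpoint_univ : gpoint 0 (counit Gv) (sid Bv : point Gv Bv).
Proof. by split=> //; [apply: dpoint0|rewrite scomp_id]. Qed.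

End Good.

Section LieKolchin.
Variables (K : fieldType) (Gv : affine_group K) (L : fieldType) (phi : {rmorphism K -> L}).
Local Notation hC := (alg_cat_closed K).
Local Notation Bv := (coord Gv).
Local Notation E := (extf (@id_phant _ phi)).
Local Notation Ls := (exts phi).
Implicit Types S : obj (alg_cat K).
Let sL : supercommutative Ls := @exts_supercommutative K L phi.
Let eL : purely_even Ls := @exts_even _ _ phi.

Lemma tring_even (S : obj (alg_cat K)) : purely_even (tensor S Ls).
Proof. exact: tens_purely_even (proj2 (objP S)) eL. Qed.
Lemma tring_comm (S : obj (alg_cat K)) : commutative (@GRing.mul (tensor S Ls)).
Proof. move=> x y; exact (mulLC (@tring_even S) (tens_supercommutative (proj1 (objP S)) sL) x y).
  Qed.
Definition tring (S : obj (alg_cat K)) : comNzRingType := crng_of (@tring_comm S).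

Definition tscal S (x : E) : tring S := tinr S Ls x.
Lemma tscal_mor S : (forall x y, tscal S (x - y) = tscal S x - tscal S y) /\ monoid_morphism
  (tscal S).
Proof.
split=> [x y|]; first exact (shomB (tinr S Ls) x y).
by split=> [|x y]; [exact (shom1 (tinr S Ls))|exact (shomM (tinr S Ls) x y)].
Qed.
HB.instance Definition _ S := GRing.isZmodMorphism.Build E (tring S) (tscal S) (proj1 (tscal_mor
  S)).
HB.instance Definition _ S := GRing.isMonoidMorphism.Build E (tring S) (tscal S) (proj2
  (tscal_mor S)).

Definition tslice S (la : S -> K^o) (F : tring S) : E := lslice la (F : tensor S Ls).

Lemma tsliceD S la (F H : tring S) : lin la -> tslice la (F + H) = tslice la F + tslice la H.
Proof. by move=> ll; exact (linD (lslice_lin ll) F H). Qed.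
Lemma tslice0 S (la : S -> K^o) : lin la -> tslice la (0 : tring S) = 0.
Proof. by move=> ll; exact (lin0 (@lslice_lin K S Ls la ll)). Qed.
Lemma tslice_sum S la I (r : seq I) (P : pred I) (F : I -> tring S) : lin la ->
  tslice la (\sum_(i <- r | P i) F i) = \sum_(i <- r | P i) tslice la (F i).
Proof. by move=> ll; exact: (big_morph _ (fun x y => tsliceD x y ll) (tslice0 ll)). Qed.
Lemma tslice_scall S la x (F : tring S) : lin la -> tslice la (tscal S x * F) = x * tslice la F.
Proof. by move=> ll; exact (lslice_inr eL F x ll). Qed.
Lemma tslice_scalr S la x (F : tring S) : lin la -> tslice la (F * tscal S x) = tslice la F * x.
Proof. by move=> ll; rewrite mulrC tslice_scall // mulrC. Qed.
Lemma tslice_ext S (F H : tring S) : (forall la, lin la -> tslice la F = tslice la H) -> F = H.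
Proof. by move=> h; apply: (@lslice_ext K S Ls F H) => la ll; apply: h. Qed.

Definition ptm S (g : point Gv S) (F : tensor Bv Ls) : tring S :=
  tmap g (sid Ls) (proj1 (objP S)) sL F.

Lemma tslice_ptm S (la : S -> K^o) g F : lin la -> tslice la (ptm g F) = lslice (la \o g) F.
Proof. by move=> ll; rewrite /tslice /ptm tmap_lslice. Qed.

Lemma ptm_gone S F : ptm (gone Gv S) F = tscal S (lslice (aug (counit Gv) : Bv -> K^o) F).
Proof.
have la := aug_lin (counit Gv).
move: F; apply: lin_eq_tens => [||a x].
- exact (shom_lin (tmap (gone Gv S) (sid Ls) (proj1 (objP S)) sL)).
- exact (lin_comp (lslice_lin la) (shom_lin (tinr S Ls))).
rewrite lslice_pure // /ptm tmap_pure /tscal goneE /eps pureZl.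
by rewrite -[RHS]/(pure 1 (_ *: x)) pureZr.
Qed.

(** Integrates out the parameters of the second family and keeps those of the first together with
    the scalars in [L]. *)
Definition midslice (S1 S2 : obj (alg_cat K)) (mu : S2 -> K^o) (F : tring (tens_obj hC S1 S2)) :
  tring S1 :=
  @tmapl K (tensor S1 S2) S1 Ls (rslice mu) F.

Section Mid.
Variables (S1 S2 : obj (alg_cat K)) (mu : S2 -> K^o) (lmu : lin mu).
Local Notation S12 := (tens_obj hC S1 S2).
Definition jl (F : tring S1) : tring S12 :=
  @tmap K S12 Ls S1 Ls (tinl S1 S2) (sid Ls) (proj1 (objP S12)) sL F.
Definition jr (F : tring S2) : tring S12 :=
  @tmap K S12 Ls S2 Ls (tinr S1 S2) (sid Ls) (proj1 (objP S12)) sL F.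

Lemma midslice_lin : lin (midslice mu : tensor S12 Ls -> tensor S1 Ls).
Proof. exact (tmapl_lin (L := Ls) (rslice_lin (A := S1) lmu)). Qed.

Lemma midslice_jl H F : midslice mu (H * jl F) = midslice mu H * F.
Proof.
move: H; apply: (@lin_eq_tens K S12 Ls (tensor S1 Ls)
  (fun H => midslice mu ((H : tring S12) * jl F)) (fun H => midslice mu (H : tring S12) * F)) =>
    [||a x].
- by move=> c H H'; rewrite -(midslice_lin c (H * jl F)) scalerAl -mulrDl.
- by move=> c H H'; rewrite (midslice_lin c H) mulrDl -scalerAl.
move: F; apply: (@lin_eq_tens K S1 Ls (tensor S1 Ls)
  (fun F => midslice mu ((pure a x : tring S12) * jl F)) (fun F => midslice mu (pure a x) * (F :
    tring S1))) => [||b y].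
- move=> c F F'; rewrite -(midslice_lin c (pure a x * jl F)) scalerAr -mulrDr.
  by congr (midslice mu (_ * _)); exact (shom_lin (tmap _ _ _ _) c F F').
- by move=> c F F'; rewrite mulrDr -scalerAr.
have -> : jl (pure b y) = pure (tinl S1 S2 b) y by exact: tmap_pure.
rewrite [X in midslice mu X](pure_mulE eL (A := S12)) /midslice !(tmapl_pure (rslice_lin lmu)).
rewrite [RHS](pure_mulE eL (A := S1)); congr pure.
move: a; apply: lin_eq_tens => [||a a'].
- by move=> c p q; rewrite mulrDl -scalerAl (rslice_lin lmu).
- by move=> c p q; rewrite (rslice_lin lmu) mulrDl -scalerAl.
rewrite [X in rslice mu X](pure_mulE (proj2 (objP S2))) !rslice_pure // mulr1.
by rewrite scalerAl.
Qed.

Lemma midslice_jlr F H : midslice mu (jl F * jr H) = F * tscal S1 (tslice mu H).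
Proof.
rewrite mulrC midslice_jl mulrC; congr (_ * _).
move: H; apply: (@lin_eq_tens K S2 Ls (tensor S1 Ls)
  (fun H => midslice mu (jr H)) (fun H => tscal S1 (tslice mu H))) => [||a x].
- by move=> c p q; rewrite -midslice_lin; congr (midslice mu _); exact (shom_lin (tmap _ _ _ _) c
  p q).
- exact (lin_comp (lslice_lin lmu) (shom_lin (tinr S1 Ls))).
have -> : jr (pure a x) = pure (tinr S1 S2 a) x by exact: tmap_pure.
rewrite /midslice (tmapl_pure (rslice_lin lmu)) rslice_pure // /tslice lslice_pure //.
by rewrite pureZl -pureZr.
Qed.

Lemma tslice_mid (la : S1 -> K^o) F : lin la ->
  tslice la (midslice mu F) = tslice (fun G : S12 => la (rslice mu G)) F.
Proof. by move=> ll; exact (tmapl_lslice (L := Ls) (rslice_lin (A := S1) lmu) F ll). Qed.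
End Mid.

Lemma ptm_jl S1 S2 (g : point Gv S1) F :
  ptm (scomp (tinl S1 S2) g : point Gv (tens_obj hC S1 S2)) F = jl S2 (ptm g F).
Proof. by rewrite /ptm /jl [RHS]tmap_sid_comp. Qed.
Lemma ptm_jr S1 S2 (g : point Gv S2) F :
  ptm (scomp (tinr S1 S2) g : point Gv (tens_obj hC S1 S2)) F = jr S1 (ptm g F).
Proof. by rewrite /ptm /jr [RHS]tmap_sid_comp. Qed.

Local Notation iota S := (map_mx (tscal S)).
Definition lsm S (la : S -> K^o) p q (F : 'M[tring S]_(p, q)) : 'M[E]_(p, q) := map_mx (tslice
  la) F.
Definition Mt S (g : point Gv S) n (D : 'M[tensor Bv Ls]_n) : 'M[tring S]_n := map_mx (ptm g) D.

Lemma lsm_iotal S (la : S -> K^o) p q r (A : 'M[E]_(p, q)) (F : 'M[tring S]_(q, r)) : lin la ->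
  lsm la (iota S A *m F) = A *m lsm la F.
Proof.
move=> ll; apply/matrixP => i j; rewrite !mxE tslice_sum //; apply: eq_bigr => k _.
by rewrite !mxE tslice_scall.
Qed.
Lemma lsm_iotar S (la : S -> K^o) p q r (F : 'M[tring S]_(p, q)) (A : 'M[E]_(q, r)) : lin la ->
  lsm la (F *m iota S A) = lsm la F *m A.
Proof.
move=> ll; apply/matrixP => i j; rewrite !mxE tslice_sum //; apply: eq_bigr => k _.
by rewrite !mxE tslice_scalr.
Qed.
Lemma lsm_ext S p q (F H : 'M[tring S]_(p, q)) : (forall la, lin la -> lsm la F = lsm la H) -> F
  = H.
Proof.
move=> h; apply/matrixP => i j; apply: tslice_ext => la ll.
by have := h la ll => /matrixP /(_ i j); rewrite !mxE.
Qed.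

(** Multiplicativity is asked only along families of level [i], because subquotients will be formed
    by subspaces that are stable at that level. *)
Definition rep i n (D : 'M[tensor Bv Ls]_n) : Prop :=
  map_mx (lslice (aug (counit Gv) : Bv -> K^o)) D = (1%:M : 'M[E]_n) /\
  forall S e (g h : point Gv S), gpoint i e g -> gpoint i e h ->
    Mt (gmul g h) D = Mt g D *m Mt h D.

(** The matrices over the field hidden in the action of families: values at parameters are replaced
    by arbitrary functionals on the parameter ring, which also works when there are few rational
    points. *)
Definition Aset i n (D : 'M[tensor Bv Ls]_n) (X : 'M[E]_n) : Prop :=
  exists S e (g : point Gv S) la, [/\ gpoint i e g, lin la & X = lsm la (Mt g D)].

Lemma AsetS i n (D : 'M[tensor Bv Ls]_n) X : Aset i.+1 D X -> Aset i D X.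
Proof. by move=> [S [e [g [la [hg ll ->]]]]]; exists S, e, g, la; split=> //; apply: gpointS. Qed.

Lemma Aset_le i j n (D : 'M[tensor Bv Ls]_n) X : (i <= j)%N -> Aset j D X -> Aset i D X.
Proof.
elim: j => [|j IHj]; first by rewrite leqn0 => /eqP ->.
by rewrite leq_eqVlt => /orP [/eqP -> //|/IHj h /AsetS].
Qed.

Lemma repS i n (D : 'M[tensor Bv Ls]_n) : rep i D -> rep i.+1 D.
Proof. by move=> [h1 hM]; split=> // S e g h hg hh; exact: (hM _ _ _ _ (gpointS hg) (gpointS
  hh)). Qed.

Lemma Mt_gone i n (D : 'M[tensor Bv Ls]_n) S : rep i D -> Mt (gone Gv S) D = 1%:M.
Proof.
move=> [h1 _]; have -> : (1%:M : 'M[tring S]_n) = iota S 1%:M by rewrite map_mx1.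
rewrite -h1; apply/matrixP => a b; rewrite !mxE; exact: ptm_gone.
Qed.

Lemma lsm_aug i j n (D : 'M[tensor Bv Ls]_n) S e (g : point Gv S) : rep i D -> gpoint j e g ->
  lsm (e : S -> K^o) (Mt g D) = 1%:M.
Proof.
move=> [h1 _] [_ _ eg]; have le : lin (e : S -> K^o) by exact (shom_lin e).
have eE : (e : S -> K^o) \o g = (aug (counit Gv) : Bv -> K^o).
  apply/funext => x; rewrite -[LHS]/(scomp e g x) eg.
  by rewrite -[RHS]/(counit Gv x).
apply/matrixP => a b; rewrite -h1 !mxE tslice_ptm //; exact: (congr1 (fun f => lslice f (D a b))
  eE).
Qed.

Hypothesis gB : good Bv.

Lemma tring_domain S : good S -> domainp (tensor S Ls).
Proof. by move=> gS; apply: gS => //; apply: exts_domain. Qed.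

Lemma scale_mx_eq0 S p q (c : tring S) (F : 'M[tring S]_(p, q)) : good S -> c *: F = 0 -> c = 0
  \/ F = 0.
Proof.
move=> gS e0; have [->|c0] := pselect (c = 0); [by left|right].
apply/matrixP => i j; have /matrixP /(_ i j) := e0; rewrite !mxE => h.
by have [] := tring_domain gS h.
Qed.

(** An eigenvalue depending on parameters, of a constant matrix with a split annihilating
    polynomial, is one of the finitely many roots, hence constant because the parameter ring is a
    domain. *)
Lemma pann_eigen S q n (v : 'M[tring S]_(q, n)) (X : 'M[E]_n) (c : tring S) rs : good S ->
  v *m iota S X = c *: v -> v <> 0 -> v *m iota S (pann rs X) = 0 -> exists z, c = tscal S z.
Proof.
move=> gS hv v0; elim: rs => [|z rs IHrs] /=; first by rewrite map_mx1 mulmx1.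
rewrite map_mxM mulmxA map_mxB map_scalar_mx mulmxBr hv mul_mx_scalar -scalerBl -scalemxAl.
move=> /(scale_mx_eq0 gS) [/eqP|/IHrs //].
by rewrite subr_eq0 => /eqP ->; exists z.
Qed.

(** Rigidity of weights. As [h] varies, [u h] remains an eigenvector of [X] with a possibly varying
    eigenvalue, which is constant by [pann_eigen] and equals [z] where [h] is the identity. *)
Lemma rigid i n (D : 'M[tensor Bv Ls]_n) (u : 'rV[E]_n) rs S1 e1 (h : point Gv S1) la S2 e2
    (g : point Gv S2) mu z : rep i D ->
  (forall X, Aset i.+1 D X -> exists z, u *m X = z *: u) ->
  gpoint i e1 h -> lin la -> gpoint i.+1 e2 g -> lin mu ->
  pann rs (lsm mu (Mt g D)) = 0 -> u *m lsm mu (Mt g D) = z *: u ->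
  u *m lsm la (Mt h D) *m lsm mu (Mt g D) = z *: (u *m lsm la (Mt h D)).
Proof.
move=> hD hu hh ll hg lmu pX uX; have [->|u0] := eqVneq u 0; first by rewrite !mul0mx scaler0.
have [b0 ub0] : exists b, u 0 b != 0.
  apply/existsP; rewrite -negb_forall; apply: contra u0 => /forallP h0.
  by apply/eqP/rowP => b; rewrite mxE; apply/eqP.
have le1 : lin (e1 : S1 -> K^o) by exact (shom_lin e1).
have [gS1 _ _] := hh.
set X := lsm mu (Mt g D) in pX uX *.
pose S12 := tens_obj hC S1 S2.
have [e [hh2 hg2]] := gpoint_tensor hh (gpointS hg).
have [e' [_ hg2']] := gpoint_tensor hh (gpointS hg).
set h2 : point Gv S12 := scomp (tinl S1 S2) h in hh2 *.
set g2 : point Gv S12 := scomp (tinr S1 S2) g in hg2 hg2' *.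
have hg2S : gpoint i.+1 e g2.
  have [a b c] := hg2; split=> //.
  by apply: (@dpoint_nat K (alg_cat K) Gv S2 S12 (tinr S1 S2)); case: hg.
(* The conjugate is again of level [i + 1], so [u] is an eigenvector for it, and [h g = q h] turns
   this into a statement about [u h]. *)
pose q := gconj h2 g2.
have hq : gpoint i.+1 e q by apply: gpointJ hh2 hg2S.
have eqM : Mt q D *m Mt h2 D = Mt h2 D *m Mt g2 D.
  have [_ hM] := hD.
  have eqp : gmul q h2 = gmul h2 g2 by rewrite /q /gconj -gmulA gmulV gmulr1.
  by rewrite -(hM _ _ _ _ (gpointS hq) hh2) -(hM _ _ _ _ hh2 hg2) eqp.
pose sg p r (F : 'M[tring S12]_(p, r)) : 'M[tring S1]_(p, r) := map_mx (midslice mu) F.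
have ml := @midslice_lin S1 S2 mu lmu.
have e1' : sg _ _ (Mt h2 D *m Mt g2 D) = Mt h D *m iota S1 X.
  apply/matrixP => a b; rewrite !mxE [LHS](lin_sum ml); apply: eq_bigr => k _.
  by rewrite !mxE ptm_jl ptm_jr midslice_jlr.
have e2' : sg _ _ (Mt q D *m Mt h2 D) = sg _ _ (Mt q D) *m Mt h D.
  apply/matrixP => a b; rewrite !mxE [LHS](lin_sum ml); apply: eq_bigr => k _.
  by rewrite !mxE ptm_jl midslice_jl.
pose v := iota S1 u *m Mt h D.
(* The eigenvalue of [u] under the conjugate, as a function of the parameters of [h], read off at a
   nonzero coordinate of [u]. *)
pose c : tring S1 := (iota S1 u *m sg _ _ (Mt q D)) 0 b0 * tscal S1 (u 0 b0)^-1.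
have hc : iota S1 u *m sg _ _ (Mt q D) = c *: iota S1 u.
  apply: lsm_ext => la' ll'; rewrite lsm_iotal //.
  have lc : lin (fun G : S12 => la' (rslice mu G)) := lin_comp (rslice_lin lmu) ll'.
  have eS : lsm la' (sg _ _ (Mt q D)) = lsm (fun G : S12 => la' (rslice mu G)) (Mt q D).
    by apply/matrixP => a b; rewrite !mxE tslice_mid.
  have [z' hz'] := hu _ (ex_intro _ S12 (ex_intro _ e (ex_intro _ q (ex_intro _ _ (And3 hq lc
    erefl))))).
  have cz : tslice la' c = z'.
    rewrite /c tslice_scalr //.
    have -> : tslice la' ((iota S1 u *m sg _ _ (Mt q D)) 0 b0) = lsm la' (iota S1 u *m sg _ _ (Mt
      q D)) 0 b0.
      by rewrite [RHS]mxE.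
    by rewrite lsm_iotal // eS hz' mxE mulfK.
  rewrite eS hz'; apply/matrixP => a b; rewrite !mxE tslice_scalr // cz.
  by rewrite ord1.
have hv : v *m iota S1 X = c *: v.
  by rewrite /v -mulmxA -e1' -eqM e2' mulmxA hc scalemxAl.
have ev : lsm (e1 : S1 -> K^o) v = u by rewrite lsm_iotal // (lsm_aug hD hh) mulmx1.
have v0 : v <> 0.
  move=> v0; move: u0; rewrite -ev v0 => /eqP; apply; apply/matrixP => a b.
  by rewrite !mxE tslice0.
have [|z0 ez] := pann_eigen (rs := rs) gS1 hv v0.
  by rewrite pX (_ : iota S1 0 = 0) ?mulmx0 //; apply/matrixP => a b; rewrite !mxE rmorph0.
have hz0 la' : lin la' -> lsm la' v *m X = z0 *: lsm la' v.
  move=> ll'; rewrite -lsm_iotar // hv ez; apply/matrixP => a b.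
  by rewrite !mxE tslice_scall.
(* Specialising [h] to the identity identifies the constant. *)
have := hz0 _ le1; rewrite ev uX => /matrixP /(_ 0 b0); rewrite !mxE => /(mulIf ub0) ->.
by have := hz0 _ ll; rewrite lsm_iotal.
Qed.

Definition tev S (e : shom S (ground K)) : shom (tensor S Ls) Ls := tlift (scomp (@galg K Ls) e)
  (sid Ls) sL.

Lemma tevE S (e : shom S (ground K)) (F : tring S) : tslice (e : S -> K^o) F = tev e F.
Proof.
have le : lin (e : S -> K^o) by exact (shom_lin e).
move: F; apply: (@lin_eq_tens K S Ls Ls (fun F => tslice (e : S -> K^o) F) (fun F => tev e F)) =>
  [||a x].
- exact (lslice_lin le).
- exact (shom_lin (tev e)).
rewrite [LHS]lslice_pure // [RHS]tliftE sidE.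
by rewrite -[scomp _ e a]/((e a : K)%:A) mulr_algl.
Qed.

(* Write ['X^n - 1 = q * ('X - 1)^k] with [q] nonzero at [1]. *)
Lemma root1_eq1 S (e : shom S (ground K)) (th : tring S) n : good S -> tslice (e : S -> K^o) th =
  1 -> (0 < n)%N ->
  th ^+ n = 1 -> th = 1.
Proof.
move=> gS the n0 thn.
have p0 : ('X^n - 1 : {poly E}) != 0.
  by rewrite -size_poly_eq0 size_XnsubC.
have [k [q /(implyP) q1 eq]] := multiplicity_XsubC ('X^n - 1 : {poly E}) 1.
have ev (p : {poly E}) : tslice (e : S -> K^o) (map_poly (tscal S) p).[th] = p.[1].
  elim/poly_ind: p => [|p c IHp]; first by rewrite rmorph0 !horner0 tslice0 //; exact (shom_lin e).
  rewrite rmorphD rmorphM /= map_polyX map_polyC !hornerMXaddC tevE.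
  rewrite [LHS](shomD (tev e) ((map_poly (tscal S) p).[th] * th) (tscal S c)).
  rewrite (shomM (tev e) (map_poly (tscal S) p).[th] th) -!tevE IHp the; congr (_ + _).
  rewrite tevE; exact (congr1 (fun f : shom Ls Ls => f c) (tlift_inr _ _ sL)).
have : (map_poly (tscal S) ('X^n - 1)).[th] = 0.
  by rewrite rmorphB /= map_polyXn rmorph1 !hornerE thn subrr.
rewrite eq rmorphM rmorphXn /= map_polyXsubC rmorph1 hornerM horner_exp hornerXsubC.
move=> /(tring_domain gS) [h|].
  by move: (ev q) (q1 p0); rewrite h tslice0 /root => [<-|]; [rewrite eqxx|exact (shom_lin e)].
elim: k {eq} => [|k IHk]; first by rewrite expr0 => /eqP; rewrite oner_eq0.
rewrite exprS => /(tring_domain gS) [/eqP|/IHk //]; by rewrite subr_eq0 => /eqP.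
Qed.

(** A commutator acts by a scalar function [th] and has determinant 1, so [th] is a root of unity;
    it is 1 at the base parameter, and [root1_eq1] applies. *)
Lemma comm_one i n (D : 'M[tensor Bv Ls]_n) S e (g h : point Gv S) : rep i D ->
  (forall X, Aset i.+1 D X -> exists z, X = z%:M) -> gpoint i e g -> gpoint i e h ->
  Mt (gcomm g h) D = 1%:M.
Proof.
case: n D => [|n] D hD hX hg hh; first by apply/matrixP => -[].
have [gS _ _] := hg; have [_ hM] := hD.
have hk := gpointC hg hh; set k := gcomm g h in hk *.
have le : lin (e : S -> K^o) by exact (shom_lin e).
pose th := Mt k D ord0 ord0.
have eN : Mt k D = th%:M.
  apply: lsm_ext => la ll; have [|z hz] := hX (lsm la (Mt k D)); first by exists S, e, k, la.
  have tz : tslice la th = z.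
    have -> : tslice la th = lsm la (Mt k D) ord0 ord0 by rewrite [RHS]mxE.
    by rewrite hz mxE.
  rewrite hz -tz; apply/matrixP => a b; rewrite !mxE.
  by case: (a == b); rewrite ?mulr1n ?mulr0n ?tslice0.
have dk := gpointS hk.
have eM : Mt k D *m (Mt h D *m Mt g D) = Mt g D *m Mt h D.
  by rewrite -(hM _ _ _ _ hh hg) -(hM _ _ _ _ hg hh) -(hM _ _ _ _ dk (gpointM hh hg)) gcommE.
have unit_det (x : point Gv S) : gpoint i e x -> exists y, \det (Mt x D) * y = 1.
  move=> dx; exists (\det (Mt (ginv x) D)); rewrite -det_mulmx -(hM _ _ _ _ dx (gpointV dx)).
  by rewrite gmulVr (Mt_gone _ hD) det1.
have the : th ^+ n.+1 = 1.
  have := congr1 determinant eM; rewrite eN det_mulmx det_scalar det_mulmx [RHS]det_mulmx.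
  have [y hy] := unit_det _ hg; have [y' hy'] := unit_det _ hh.
  set dG := \det (Mt g D) in hy *; set dH := \det (Mt h D) in hy' *.
  move=> /(congr1 (fun x => x * (y * y'))).
  have -> : th ^+ n.+1 * (dH * dG) * (y * y') = th ^+ n.+1 * ((dG * y) * (dH * y')) by ring.
  have -> : dG * dH * (y * y') = (dG * y) * (dH * y') by ring.
  by rewrite hy hy' !mulr1.
rewrite eN (root1_eq1 (e := e) gS _ _ the) //.
have := lsm_aug hD hk => /matrixP /(_ ord0 ord0); rewrite !mxE eqxx => h1.
by rewrite /th mxE; exact: h1.
Qed.

(** The two families are made independent over the tensor product of their parameter rings; there
    the matrices commute since the commutator acts trivially, and slicing separates them again. *)
Lemma Aset_commute i n (D : 'M[tensor Bv Ls]_n) X Y : rep i D ->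
  (forall X, Aset i.+1 D X -> exists z, X = z%:M) -> Aset i D X -> Aset i D Y -> X *m Y = Y *m X.
Proof.
move=> hD hX [S1 [e1 [g [la [hg ll ->]]]]] [S2 [e2 [h [mu [hh lmu ->]]]]].
have [e [hg2 hh2]] := gpoint_tensor hg hh; pose S12 := tens_obj hC S1 S2.
set g2 : point Gv S12 := scomp (tinl S1 S2) g in hg2 *.
set h2 : point Gv S12 := scomp (tinr S1 S2) h in hh2 *.
have [_ hM] := hD; have dk := gpointS (gpointC hg2 hh2).
have eM : Mt g2 D *m Mt h2 D = Mt h2 D *m Mt g2 D.
  rewrite -(hM _ _ _ _ hg2 hh2) -(hM _ _ _ _ hh2 hg2) -gcommE (hM _ _ _ _ dk (gpointM hh2 hg2)).
  by rewrite (comm_one hD hX hg2 hh2) mul1mx.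
pose nu (G : S12) : K^o := la (rslice mu G).
have sl : lsm nu (Mt g2 D *m Mt h2 D) = lsm la (Mt g D) *m lsm mu (Mt h D).
  have lc : lin nu := lin_comp (rslice_lin lmu) ll.
  apply/matrixP => a b; rewrite !mxE tslice_sum //; apply: eq_bigr => k _.
  by rewrite !mxE ptm_jl ptm_jr -tslice_mid // midslice_jlr // tslice_scalr.
have sr : lsm nu (Mt h2 D *m Mt g2 D) = lsm mu (Mt h D) *m lsm la (Mt g D).
  have lc : lin nu := lin_comp (rslice_lin lmu) ll.
  apply/matrixP => a b; rewrite !mxE tslice_sum //; apply: eq_bigr => k _.
  by rewrite !mxE ptm_jl ptm_jr -tslice_mid // mulrC midslice_jlr // tslice_scalr // mulrC.
by rewrite -sl eM sr.
Qed.

(** The elements of [Aset] are combinations of those annihilated by the split polynomial, so that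
    linear statements need only be proved for the latter. *)
Definition spectral rs i n (D : 'M[tensor Bv Ls]_n) : Prop := forall Z : 'M[E]_n -> Prop,
  Z 0 -> (forall c X Y, Z X -> Z Y -> Z (c *: X + Y)) ->
  (forall X, Aset i D X -> pann rs X = 0 -> Z X) -> forall X, Aset i D X -> Z X.

Lemma ptmM S (g : point Gv S) (x y : tring Bv) : ptm g (x * y) = ptm g x * ptm g y.
Proof. exact (shomM (tmap g (sid Ls) (proj1 (objP S)) sL) x y). Qed.
Lemma ptm_sum S (g : point Gv S) I (r : seq I) (P : pred I) (F : I -> tring Bv) :
  ptm g (\sum_(i <- r | P i) F i) = \sum_(i <- r | P i) ptm g (F i).
Proof. exact (lin_sum (shom_lin (tmap g (sid Ls) (proj1 (objP S)) sL)) r P F). Qed.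
Lemma ptm_tscal S (g : point Gv S) x : ptm g (tscal Bv x) = tscal S x.
Proof. by rewrite /ptm [LHS]tmap_pure shom1. Qed.

Definition compress n r (B : 'M[E]_(r, n)) (P : 'M[E]_(n, r)) (D : 'M[tensor Bv Ls]_n) :
  'M[tensor Bv Ls]_r := iota Bv B *m (D : 'M[tring Bv]_n) *m iota Bv P.

Lemma Mt_compress n r (B : 'M[E]_(r, n)) (P : 'M[E]_(n, r)) D S (g : point Gv S) :
  Mt g (compress B P D) = iota S B *m Mt g D *m iota S P.
Proof.
apply/matrixP => a b; rewrite !mxE ptm_sum; apply: eq_bigr => k _.
rewrite ptmM !mxE ptm_tscal ptm_sum; congr (_ * _); apply: eq_bigr => l _.
by rewrite ptmM !mxE ptm_tscal.
Qed.

Lemma Aset_compress i n r (B : 'M[E]_(r, n)) (P : 'M[E]_(n, r)) D X :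
  Aset i (compress B P D) X <-> exists2 Y, Aset i D Y & X = B *m Y *m P.
Proof.
split=> [[S [e [g [la [hg ll ->]]]]]|[Y [S [e [g [la [hg ll ->]]]]] ->]].
  by exists (lsm la (Mt g D)); [exists S, e, g, la|rewrite Mt_compress lsm_iotar // lsm_iotal].
by exists S, e, g, la; split=> //; rewrite Mt_compress lsm_iotar // lsm_iotal.
Qed.

(** For row vectors: either the row space of [B] is stable and [compress] is the action on it, or
    the kernel of [P] is stable and [compress] is the action on the quotient. *)
Definition sub_or_quotient i n r (B : 'M[E]_(r, n)) (P : 'M[E]_(n, r)) D : Prop :=
  (forall X, Aset i D X -> B *m X *m P *m B = B *m X) \/
  (forall X, Aset i D X -> P *m B *m X *m P = X *m P).

Lemma compress_rep i n r (B : 'M[E]_(r, n)) (P : 'M[E]_(n, r)) D :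
  rep i D -> B *m P = 1%:M -> sub_or_quotient i B P D -> rep i (compress B P D).
Proof.
move=> [h1 hM] BP hs; split.
  have la := aug_lin (counit Gv).
  transitivity (lsm (aug (counit Gv) : Bv -> K^o) (compress B P D)).
    by apply/matrixP => a b; rewrite !mxE.
  rewrite lsm_iotar // lsm_iotal // [lsm _ _](_ : _ = 1%:M) ?mulmx1 //; exact: h1.
move=> S e g h hg hh; rewrite !Mt_compress (hM _ _ _ _ hg hh).
case: hs => hs.
  have -> : iota S B *m Mt g D *m iota S P *m (iota S B *m Mt h D *m iota S P) =
      iota S B *m Mt g D *m iota S (P *m B) *m Mt h D *m iota S P.
    by rewrite map_mxM !mulmxA.
  have -> : iota S B *m Mt g D *m iota S (P *m B) = iota S B *m Mt g D.
    apply: lsm_ext => la ll; rewrite lsm_iotar // lsm_iotal // mulmxA; apply: hs.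
    by exists S, e, g, la.
  by rewrite !mulmxA.
have -> : iota S B *m Mt g D *m iota S P *m (iota S B *m Mt h D *m iota S P) =
    iota S B *m Mt g D *m (iota S (P *m B) *m Mt h D *m iota S P).
  by rewrite map_mxM !mulmxA.
have -> : iota S (P *m B) *m Mt h D *m iota S P = Mt h D *m iota S P.
  apply: lsm_ext => la ll; rewrite !lsm_iotar // lsm_iotal //; apply: hs.
  by exists S, e, h, la.
by rewrite !mulmxA.
Qed.

Lemma compress_spectral i j rs n r (B : 'M[E]_(r, n)) (P : 'M[E]_(n, r)) D : (i <= j)%N ->
  B *m P = 1%:M -> sub_or_quotient i B P D -> spectral rs j D -> spectral rs j (compress B P D).
Proof.
move=> ij BP hs hspec Z Z0 Zl Zp X /Aset_compress [Y hY ->].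
apply: (hspec (fun Y => Z (B *m Y *m P))) hY => [|c X1 X2 h1 h2|X1 hX1 pX1].
- by rewrite mulmx0 mul0mx.
- by rewrite mulmxDr mulmxDl -scalemxAr -scalemxAl; apply: Zl.
apply: Zp; first by apply/Aset_compress; exists X1.
have hX1' := Aset_le ij hX1.
suff -> : pann rs (B *m X1 *m P) = B *m pann rs X1 *m P by rewrite pX1 mulmx0 mul0mx.
case: hs => hs; have hX := hs _ hX1'.
  elim: rs {hspec pX1} => [|z rs IHrs] /=; first by rewrite mulmx1 BP.
  rewrite IHrs !mulmxBl !mul_scalar_mx mulmxBr mulmxBl -scalemxAr -scalemxAl; congr (_ - _).
  by rewrite !mulmxA hX.
suff [] : pann rs (B *m X1 *m P) = B *m pann rs X1 *m P /\ P *m B *m pann rs X1 *m P = pann rs X1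
  *m P by [].
elim: rs {hspec pX1} => [|z rs [IH1 IH2]] /=.
  by split; rewrite mulmx1 ?BP // mul1mx -mulmxA BP mulmx1.
set Y1 := pann rs X1 in IH1 IH2 *.
have hXY : X1 *m P *m B *m Y1 *m P = X1 *m Y1 *m P.
  by rewrite -[RHS]mulmxA -IH2 !mulmxA.
split.
  rewrite IH1 !mulmxBl !mul_scalar_mx mulmxBr mulmxBl -scalemxAr -scalemxAl; congr (_ - _).
  transitivity (B *m (X1 *m P *m B *m Y1 *m P)); first by rewrite !mulmxA.
  by rewrite hXY !mulmxA.
rewrite !mulmxBl !mul_scalar_mx mulmxBr mulmxBl -scalemxAr -!scalemxAl IH2; congr (_ - _).
transitivity (P *m B *m (X1 *m Y1 *m P)); first by rewrite !mulmxA.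
by rewrite -hXY !mulmxA hX.
Qed.

(** Descending induction on the commutator level, starting at [r] where all points are trivial, and
    within a level induction on the dimension. *)
Lemma lie_kolchin rs r : (forall S (g : point Gv S), dpoint r g -> g = gone Gv S) ->
  forall k i, (i + k = r)%N -> forall n (D : 'M[tensor Bv Ls]_n), (0 < n)%N -> rep i D ->
  (forall j, (i <= j)%N -> (j <= r)%N -> spectral rs j D) ->
  exists l : 'rV[E]_n, l <> 0 /\ forall X, Aset i D X -> exists z, l *m X = z *: l.
Proof.
move=> triv.
have row_ex n : (0 < n)%N -> exists l : 'rV[E]_n, l <> 0.
  case: n => // n _; exists (delta_mx 0 ord0) => /matrixP /(_ 0 ord0).
  by rewrite !mxE !eqxx => /eqP; rewrite oner_eq0.
elim=> [|k IHk] i ik.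
  move=> n D n0 hD _; have [l l0] := row_ex n n0; exists l; split=> // X.
  move=> [S [e [g [la [[_ dg _] ll ->]]]]].
  have -> : g = gone Gv S by apply: triv; rewrite -ik addn0.
  rewrite (Mt_gone _ hD); exists (tslice la 1).
  have -> : lsm la (1%:M : 'M[tring S]_n) = (tslice la 1)%:M.
    by apply/matrixP => a b; rewrite !mxE; case: (a == b); rewrite ?mulr1n ?mulr0n ?tslice0.
  by rewrite mul_mx_scalar.
move=> n; elim/ltn_ind: n => n IHn D n0 hD hspec.
pose stable (U : 'M[E]_n) := forall X, Aset i D X -> (U *m X <= U)%MS.
(* A proper stable subspace carries a smaller representation, and an eigenvector in it is one in the
   whole space. In the irreducible case the action turns out to be scalar. *)
have [[U [sU U0 Ufull]]|irr] := pselect (exists U, [/\ stable U, U != 0 & ~~ row_full U]).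
  have [B [P [BU BP BK]]] : exists (B : 'M[E]_(\rank U, n)) (P : 'M[E]_(n, \rank U)),
      [/\ (B :=: U)%MS, B *m P = 1%:M & forall F : 'M[E]_(\rank U, n), (F <= B)%MS -> F *m P *m B
        = F].
    exists (row_base U), (pinvmx (row_base U)); split; first exact: eq_row_base.
      by apply: mulmxVp; apply: row_base_free.
    by move=> F; apply: mulmxKpV.
  have BX X : Aset i D X -> B *m X *m P *m B = B *m X.
    by move=> hX; apply: BK; rewrite (eqmxMr _ BU) BU; apply: sU.
  have hs : sub_or_quotient i B P D by left.
  have rn : (\rank U < n)%N by rewrite ltn_neqAle Ufull rank_leq_col.
  have r0 : (0 < \rank U)%N by rewrite lt0n mxrank_eq0.
  have [|l [l0 hl]] := IHn _ rn (compress B P D) r0 (compress_rep hD BP hs).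
    by move=> j ij jr; apply: (compress_spectral ij BP hs); apply: hspec.
  exists (l *m B); split=> [lB|X hX].
    by apply: l0; rewrite -[l]mulmx1 -BP mulmxA lB mul0mx.
  have [|z hz] := hl (B *m X *m P); first by apply/Aset_compress; exists X.
  exists z; rewrite scalemxAl -hz.
  transitivity (l *m (B *m X *m P *m B)); first by rewrite BX // mulmxA.
  by rewrite !mulmxA.
have full U : stable U -> U != 0 -> row_full U.
  by move=> sU U0; apply: contrapT => /negP h; apply: irr; exists U.
have subspace_full (Q : 'rV[E]_n -> Prop) : Q 0 ->
    (forall c u v, Q u -> Q v -> Q (c *: u + v)) ->
    (forall X u, Aset i D X -> Q u -> Q (u *m X)) -> (exists u, u <> 0 /\ Q u) -> forall u, Q u.
  move=> Q0 Ql QX [u [u0 Qu]]; have [U hU] := subspace_mx Q0 Ql.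
  have sU : stable U.
    move=> X hX; apply/row_subP => a; apply/hU; rewrite row_mul; apply: QX => //.
    by apply/hU; apply: row_sub.
  have U0 : U != 0.
    apply/eqP => U0; apply: u0; move: Qu => /hU; rewrite U0 submx0 => /eqP //.
  by move=> v; apply/hU; apply: submx_full; apply: full.
have [||l [l0 hl]] := IHk i.+1 _ n D n0 (repS hD); first by rewrite addSnnS.
  by move=> j ij; apply: hspec; apply: ltnW.
have ir : (i.+1 <= r)%N by lia.
(* The vectors on which level [i + 1] acts with the same weight as on [l]. They form a subspace,
   stable at level [i] by [rigid], hence everything. *)
pose th (u : 'rV[E]_n) := forall X, Aset i.+1 D X -> forall z, l *m X = z *: l -> u *m X = z *: u.
have th_all : forall u, th u.
  apply: subspace_full.
  - by move=> X _ z _; rewrite mul0mx scaler0.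
  - move=> c u v hu hv X hX z hz; rewrite mulmxDl -scalemxAl (hu _ hX z hz) (hv _ hX z hz).
    by rewrite scalerDr !scalerA mulrC.
  - move=> Y u [S1 [e1 [h [la [hh ll ->]]]]] hu X hX z hz.
    suff [z' [hz' hz'']] : exists z', l *m X = z' *: l /\
        u *m lsm la (Mt h D) *m X = z' *: (u *m lsm la (Mt h D)).
      suff -> : z = z' by [].
      have : (z - z') *: l = 0 by rewrite scalerBl -hz -hz' subrr.
      by move=> /eqP; rewrite scaler_eq0 subr_eq0 => /orP [/eqP|/eqP].
    apply: (hspec i.+1 (leqnSn i) ir (fun X => exists z', l *m X = z' *: l /\
      u *m lsm la (Mt h D) *m X = z' *: (u *m lsm la (Mt h D)))) hX => [|c X1 X2 [z1 [h1 h1']]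
        [z2 [h2 h2']]|X1 hX1 pX1].
    + by exists 0; rewrite !mulmx0 !scale0r.
    + by exists (c * z1 + z2); rewrite !mulmxDr -!scalemxAr h1 h1' h2 h2' !scalerA -!scalerDl.
    have [z1 hz1] := hl _ hX1; exists z1; split=> //.
    have hu1 := hu _ hX1 _ hz1; move: hX1 pX1 hu1 => [S2 [e2 [g [mu [hg lmu ->]]]]] pX1 hu1.
    apply: (rigid hD _ hh ll hg lmu pX1 hu1) => X2 hX2.
    by have [z2 hz2] := hl _ hX2; exists z2; apply: hu.
  - by exists l; split=> // X hX z.
have scal X : Aset i.+1 D X -> exists z, X = z%:M.
  move=> hX; have [z hz] := hl _ hX; exists z; apply/row_matrixP => a.
  by rewrite !rowE mul_mx_scalar; apply: th_all hX z hz.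
have scal0 X : Aset i D X -> exists z, X = z%:M.
  apply: (hspec i (leqnn i) (ltnW ir) (fun X => exists z, X = z%:M)) => [|c X1 X2 [z1 ->] [z2
    ->]|{}X hX pX].
  - by exists 0; apply/matrixP => a b; rewrite !mxE mul0rn.
  - by exists (c * z1 + z2); rewrite scale_scalar_mx -raddfD.
  (* Schur's lemma: a vanishing product of factors [X - z] has a singular factor. Its kernel is
     stable because level [i] commutes by [Aset_commute], so it is the whole space. *)
  have [z kz] : exists z, kermx (X - z%:M) != 0.
    apply: contrapT => nz; have unit z : X - z%:M \in unitmx.
      rewrite -row_free_unit -kermx_eq0; apply: contrapT => /negP h; apply: nz; by exists z.
    have : pann rs X \in unitmx.
      by elim: (rs) => [|z rs' IH] /=; [apply: unitmx1|rewrite unitmx_mul unit].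
    rewrite pX -row_free_unit -row_leq_rank mxrank0 leqn0.
    by rewrite (gtn_eqF n0).
  exists z; apply/eqP; rewrite -subr_eq0.
  have sk : stable (kermx (X - z%:M)).
    move=> Y hY; apply/sub_kermxP; have cXY := Aset_commute hD scal hX hY.
    rewrite -mulmxA; have -> : Y *m (X - z%:M) = (X - z%:M) *m Y.
      by rewrite mulmxBr mulmxBl cXY mul_mx_scalar mul_scalar_mx.
    by rewrite mulmxA mulmx_ker mul0mx.
  have := full _ sk kz; rewrite -sub1mx => /sub_kermxP; rewrite mul1mx => ->.
  by [].
have [l' l'0] := row_ex n n0; exists l'; split=> // X /scal0 [z ->]; exists z.
by rewrite mul_mx_scalar.
Qed.

End LieKolchin.

(** * Splitting characteristic polynomials of coefficient matrices *)

Lemma irreducible_divisor (F : fieldType) (p : {poly F}) : (1 < size p)%N ->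
  exists q, irreducible_poly q /\ q %| p.
Proof.
move=> sp; have p0 : p != 0 by rewrite -size_poly_gt0 ltnW.
have ex : exists n, `[< exists q : {poly F}, [/\ (1 < size q)%N, q %| p & size q = n] >].
  by exists (size p); apply/asboolP; exists p.
case: (ex_minnP ex) => n /asboolP [q [sq qp nq]] minq; exists q; split=> //; split=> // d d1 dq.
rewrite -dvdp_size_eqp // eqn_leq dvdp_leq ?nq; last 2 first.
- by apply: contraTneq sq => ->; rewrite size_poly0.
- by [].
apply: minq; apply/asboolP; exists d; split=> //; last exact: dvdp_trans qp.
have d0 : d != 0 by apply: contraTneq dq => ->; rewrite dvd0p; apply: contraTneq sq => ->;
  rewrite size_poly0.
by rewrite ltn_neqAle eq_sym d1 size_poly_gt0.
Qed.

(** A root is adjoined for an irreducible divisor, and the quotient by the linear factor has smaller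
    size. *)
Lemma split_poly n (F : fieldType) (p : {poly F}) : (size p <= n)%N -> p != 0 ->
  exists (L : fieldType) (f : {rmorphism F -> L}) (rs : seq L),
    map_poly f p %= \prod_(z <- rs) ('X - z%:P).
Proof.
elim: n F p => [|n IHn] F p; first by rewrite leqn0 size_poly_eq0 => ->.
move=> sp p0; have [p1|p1] := leqP (size p) 1.
  exists F, idfun, [::]; rewrite big_nil map_poly_id //.
  have /eqP : size p == 1%N by rewrite eqn_leq p1 size_poly_gt0.
  by move=> /eqP; rewrite size_poly_eq1.
have [q [irr qp]] := irreducible_divisor p1.
have [L1 _ [z qz _]] := irredp_FAdjoin irr.
have pz : root (map_poly (in_alg L1) p) z.
  by move: qp => /dvdpP [c ->]; rewrite rmorphM rootM qz orbT.
have /factor_theorem [p2 ep2] := pz.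
have mp0 : map_poly (in_alg L1) p != 0 by rewrite map_poly_eq0.
have p20 : p2 != 0 by apply: contraNneq mp0 => e; rewrite ep2 e mul0r.
have sp2 : (size p2 <= n)%N.
  have := congr1 (fun r : {poly L1} => size r) ep2.
  rewrite size_map_poly size_Mmonic ?monicXsubC // size_XsubC addn2 /= => e.
  by rewrite -ltnS -e.
have [L [f [rs hrs]]] := IHn L1 p2 sp2 p20.
exists L, (f \o in_alg L1), (f z :: rs); rewrite big_cons map_poly_comp ep2 rmorphM /=.
by rewrite map_polyXsubC mulrC eqp_mull.
Qed.

(** A list from [S] of maximal span; any element of [S] outside that span would enlarge it. *)
Lemma span_list (K : fieldType) m (S : 'M[K]_m -> Prop) : exists s : seq 'M[K]_m,
  (forall X, X \in s -> S X) /\ forall Z : 'M[K]_m -> Prop, Z 0 ->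
  (forall c X Y, Z X -> Z Y -> Z (c *: X + Y)) -> (forall X, X \in s -> Z X) -> forall X, S X ->
    Z X.
Proof.
pose d := \dim {: 'M[K]_m}.
have ex : exists k, `[< exists s : seq 'M[K]_m, (forall X, X \in s -> S X) /\ (d - \dim <<s>>)%N
  = k >].
  by exists (d - \dim <<([::] : seq 'M[K]_m)>>)%N; apply/asboolP; exists [::].
case: (ex_minnP ex) => k /asboolP [s [sS ks]] mink; exists s; split=> // Z Z0 Zl Zs X SX.
have Xs : X \in <<s>>%VS.
  have sub : (<<s>> <= <<X :: s>>)%VS by rewrite span_cons addvSr.
  have : (k <= d - \dim <<X :: s>>)%N.
    apply: mink; apply/asboolP; exists (X :: s); split=> // Y.
    by rewrite inE => /orP [/eqP ->|/sS].
  have h1 := dimvS sub; have h2 : (\dim <<X :: s>> <= d)%N by apply: dimvS; apply: subvf.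
  rewrite -ks => h; have /eqP -> : (<<s>> == <<X :: s>>)%VS.
    by rewrite eqEdim sub; lia.
  by apply: memv_span; rewrite inE eqxx.
rewrite (coord_span (X := in_tuple s) Xs).
have : forall k (F : 'I_k -> K) (Y : 'I_k -> 'M[K]_m), (forall i, Z (Y i)) -> Z (\sum_(i < k) F i
  *: Y i).
  elim=> [|j IHj] F Y hY; first by rewrite big_ord0.
  by rewrite big_ord_recl; apply: Zl => //; apply: IHj.
by apply=> i; apply: Zs; apply: mem_nth.
Qed.

Lemma pann_horner (E : fieldType) n (rs : seq E) (X : 'M[E]_n.+1) :
  horner_mx X (\prod_(z <- rs) ('X - z%:P)) = pann rs X.
Proof.
elim: rs => [|z rs IHrs] /=; first by rewrite big_nil rmorph1.
by rewrite big_cons rmorphM rmorphB /= horner_mx_X horner_mx_C IHrs.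
Qed.

Lemma pann_char_poly (E : fieldType) n (rs : seq E) (X : 'M[E]_n) :
  (0 < n)%N -> char_poly X %| \prod_(z <- rs) ('X - z%:P) -> pann rs X = 0.
Proof.
case: n X => // n X _ /dvdpP [q eq]; rewrite -pann_horner eq rmorphM /=.
by rewrite Cayley_Hamilton mulr0.
Qed.

Section Spectral.
Variables (K : fieldType) (Gv : affine_group K).
Local Notation Bv := (coord Gv).
Variables (m : nat) (m0 : (0 < m)%N) (M : 'M[Bv]_m).

Definition AK j (X : 'M[K]_m) : Prop := exists (S : obj (alg_cat K)) e (g : point Gv S) (la : S
  -> K^o),
  [/\ gpoint j e g, lin la & X = map_mx (la \o g) M].

(** The coefficient matrices exist over [K] before any extension is chosen. For each level up to [r]
    a finite spanning list is fixed, and [L] splits the product of the characteristic polynomials of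
    all matrices in these lists. *)
Lemma split_ex r : exists (L : fieldType) (f : {rmorphism K -> L}) (rs : seq L),
  forall j, (j <= r)%N -> forall Z : 'M[K]_m -> Prop, Z 0 ->
    (forall c X Y, Z X -> Z Y -> Z (c *: X + Y)) ->
    (forall X, AK j X -> pann rs (map_mx f X) = 0 -> Z X) -> forall X, AK j X -> Z X.
Proof.
have [s hs] := choice (fun j => span_list (AK j)).
pose p : {poly K} := \prod_(j < r.+1) \prod_(X <- s j) char_poly X.
have p0 : p != 0.
  apply/prodf_neq0 => j _; rewrite prodf_seq_neq0; apply/allP => X _.
  exact: monic_neq0 (char_poly_monic X).
have [L [f [rs hrs]]] := split_poly (leqnn _) p0.
exists L, f, rs => j jr Z Z0 Zl Zp; have [sS sZ] := hs j; apply: sZ => // X Xs.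
apply: Zp; first exact: sS.
apply: pann_char_poly => //; rewrite -map_char_poly -(eqp_dvdr _ hrs) dvdp_map.
have jr' : (j < r.+1)%N by [].
rewrite /p (bigD1 (Ordinal jr')) //=; apply: dvdp_mulr.
by rewrite (big_rem X) //=; apply: dvdp_mulr.
Qed.

Section Extend.
Variables (L : fieldType) (phi : {rmorphism K -> L}).
Local Notation E := (extf (@id_phant _ phi)).
Local Notation Ls := (exts phi).
Definition extM : 'M[tensor Bv Ls]_m := map_mx (tinl Bv Ls) M.

Lemma lsm_extM (S : obj (alg_cat K)) (g : point Gv S) (la : S -> K^o) : lin la ->
  lsm la (Mt g extM) = (map_mx phi (map_mx (la \o g) M) : 'M[E]_m).
Proof.
move=> ll; apply/matrixP => a b; rewrite !mxE /tslice /ptm [tmap _ _ _ _ _]tmap_pure lslice_pure //.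
exact: mulr1.
Qed.

(** As [M] and the functionals are defined over [K], extending scalars adds no new coefficient
    matrices. This is what lets [L] be chosen in advance. *)
Lemma Aset_extM j (X : 'M[E]_m) : Aset j extM X <-> exists2 Y, AK j Y & X = map_mx phi Y.
Proof.
split=> [[S [e [g [la [hg ll ->]]]]]|[Y [S [e [g [la [hg ll ->]]]]] ->]].
  by exists (map_mx (la \o g) M); [exists S, e, g, la|rewrite lsm_extM].
by exists S, e, g, la; split=> //; rewrite lsm_extM.
Qed.

Lemma spectral_extM (rs : seq E) j :
  (forall Z : 'M[K]_m -> Prop, Z 0 -> (forall c X Y, Z X -> Z Y -> Z (c *: X + Y)) ->
    (forall X, AK j X -> pann rs (map_mx phi X : 'M[E]_m) = 0 -> Z X) -> forall X, AK j X -> Z X) ->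
  spectral rs j extM.
Proof.
move=> h Z Z0 Zl Zp X /Aset_extM [Y hY ->].
apply: (h (fun Y => Z (map_mx phi Y))) hY => [|c X1 X2 h1 h2|X1 hX1 pX1].
- by rewrite map_mx0.
- by rewrite map_mxD map_mxZ; apply: Zl.
- by apply: Zp => //; apply/Aset_extM; exists X1.
Qed.

Lemma rep_extM : map_mx (aug (counit Gv) : Bv -> K) M = 1%:M ->
  (forall (S : obj (alg_cat K)) (g h : point Gv S) a b,
    gmul g h (M a b) = \sum_(k < m) g (M a k) * h (M k b)) -> rep 0 extM.
Proof.
move=> h1 hM; split.
  have la := aug_lin (counit Gv).
  transitivity (map_mx phi (map_mx (aug (counit Gv) : Bv -> K) M) : 'M[E]_m).
    by apply/matrixP => a b; rewrite !mxE lslice_pure //; exact: mulr1.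
  by rewrite h1 map_mx1.
have pE (S : obj (alg_cat K)) (g : point Gv S) b : ptm g (tinl Bv Ls b) = tinl S Ls (g b).
  exact: tmap_pure.
move=> S e g h _ _; apply/matrixP => a b; rewrite !mxE pE hM.
rewrite [LHS]shom_sum; apply: eq_bigr => k _; rewrite !mxE !pE.
exact: shomM.
Qed.
End Extend.
End Spectral.

(** * The main theorem *)

Section AdjointMatrix.
Variables (K : fieldType) (G : affine_supergroup K).
Local Notation A := (coord G).
Local Notation hS := (salg_cat_closed K).
Local Notation Gv := (even_part G).
Let sA : supercommutative A := objP A.

Definition conj_pt (S : obj (alg_cat K)) (g : point Gv S) :
    point G (tens_obj hS (salg_of_alg S) A) :=
  gconj (scomp (tinl S A) (even_res g) : point G (tens_obj hS (salg_of_alg S) A)) (tinr S A :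
    point G (tens_obj hS (salg_of_alg S) A)).

Lemma point_Adu (S : obj (alg_cat K)) (g : point Gv S) (v : A -> K^o) a : lin v ->
  g (Adu v a) = rslice v (conj_pt g a).
Proof.
move=> lv; have sS : supercommutative S := proj1 (objP S).
pose t : shom (EvA G) (tens_obj hS (salg_of_alg S) A) := tmap (g : shom (Ev G) S) (sid A) sS sA.
have e : scomp t (ad_c G) = conj_pt g.
  rewrite /ad_c gconj_nat; congr gconj.
    by rewrite /ad_g scompA [scomp t _]tmap_inl -scompA.
  by rewrite [LHS]tmap_inr scomp_id.
rewrite -e; symmetry.
exact: (tmap_rslice (g : shom (Ev G) S) (sid A) sS sA (ad_c G a) lv).
Qed.

Variables (m : nat) (u : 'I_m -> A -> K^o) (w : 'I_m -> A) (bas : odd_basis u w).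
Let vu i : vder (u i). Proof. by case: bas. Qed.
Let lu i : lin (u i). Proof. by case: (vu i). Qed.

(** Conjugation by [gh] is conjugation by [h] substituted into conjugation by [g]; expanding the
    inner tangent vector in the basis produces the matrix product. *)
Lemma AdM_mul (S : obj (alg_cat K)) (g h : point Gv S) i j :
  gmul g h (AdM u w i j) = \sum_(k < m) g (AdM u w i k) * h (AdM u w k j).
Proof.
have sS : supercommutative S := proj1 (objP S); have eS : purely_even S := proj2 (objP S).
pose T := tens_obj hS (salg_of_alg S) A.
pose th : shom T T := tlift (tinl S A) (conj_pt h) (objP T).
have thl : scomp th (tinl S A) = tinl S A by apply: tlift_inl.
have thr : scomp th (tinr S A) = conj_pt h by apply: tlift_inr.
have e : conj_pt (gmul g h) = scomp th (conj_pt g).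
  rewrite {2}/conj_pt gconj_nat scompA thl thr /conj_pt.
  have -> : even_res (gmul g h) = @gmul _ _ G (salg_of_alg S) (even_res g) (even_res h).
    exact: even_liftK.
  rewrite (@gmul_nat _ _ G (salg_of_alg S) T (tinl S A)) /gconj ginvM.
  by rewrite !gmulA.
rewrite point_Adu // e -[X in rslice _ X]/(th (conj_pt g (w i))).
have -> : \sum_(k < m) g (AdM u w i k) * h (AdM u w k j) =
    \sum_(k < m) rslice (u k) (conj_pt g (w i)) * h (AdM u w k j).
  by apply: eq_bigr => k _; rewrite point_Adu.
move: (conj_pt g (w i)); apply: (@lin_eq_tens K S A S) => [||b a].
- exact (lin_comp (shom_lin th) (rslice_lin (lu j))).
- apply: lin_bigsum => k c x y; rewrite (rslice_lin (lu k)) mulrDl -scalerAl //.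
rewrite [th _]tliftE rslice_inl // -point_Adu // (Adu_expand bas _ (vu j)) shom_sum mulr_sumr.
apply: eq_bigr => k _; rewrite rslice_pure // shomZ -scalerAr scalerAl.
by [].
Qed.

Lemma AdM_one : map_mx (aug (counit Gv) : coord Gv -> K) (\matrix_(i, j) AdM u w i j : 'M[coord
  Gv]_m) = 1%:M.
Proof.
apply/matrixP => i j; rewrite !mxE.
have [mu emu] := piE_surj (AdM u w i j); rewrite -(feps_AdM bas emu) -emu.
have h := even_liftK (R := ground_obj (alg_cat K)) (gone G (salg_of_alg (ground_obj (alg_cat K)))).
have := congr1 (fun f : shom A (ground K) => f mu) h.
rewrite -[X in X = _ -> _]/(counit Gv (piE G mu)) -[X in _ = X -> _]/(gone G (salg_of_alg
  (ground_obj (alg_cat K))) mu).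
rewrite [X in _ = X](goneE (salg_of_alg (ground_obj (alg_cat K)))) => e; rewrite -[LHS]/(counit
  Gv (piE G mu)) e.
exact: mulr1.
Qed.
End AdjointMatrix.

Section AdjointSubgroup.
Variables (K : fieldType) (G H : affine_supergroup K) (q : gmor H G).
Local Notation A := (coord G).
Local Notation B := (coord H).
Local Notation hS := (salg_cat_closed K).

Lemma vder_comorph (v : B -> K^o) : vder v -> vder (v \o comorph q : A -> K^o).
Proof.
move=> [lv v0 vM]; split=> [|x hx|x y]; first exact: (lin_comp (shom_lin (comorph q)) lv).
  by apply: v0; apply: shom_gr.
by rewrite -[LHS]/(v (comorph q (x * y))) (shomM (comorph q)) vM /counit_form !counit_mor.
Qed.

Definition even_comor : shom (even_coord G) (even_coord H) :=
  even_lift (scomp (piE H) (comorph q) : shom A (even_coord H)).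

Lemma even_comorE a : even_comor (piE G a) = piE H (comorph q a).
Proof.
have h := even_liftK (R := even_coord H) (scomp (piE H) (comorph q)).
exact (congr1 (fun f : shom A (even_coord H) => f a) h).
Qed.

Lemma even_comor_Adu (v : B -> K^o) a : lin v ->
  even_comor (Adu (v \o comorph q) a) = Adu v (comorph q a).
Proof.
move=> lv; have sH : supercommutative (EvA H) := objP (EvA H).
pose t : shom (EvA G) (EvA H) := tmap even_comor (comorph q) (objP (Ev H)) (objP B).
have e : scomp t (ad_c G) = scomp (ad_c H) (comorph q).
  rewrite {2}/ad_c /gconj !comorphM ginv_mor /ad_c gconj_nat /gconj.
  have -> : scomp t (ad_g G) = scomp (ad_g H) (comorph q).
    rewrite /ad_g scompA [scomp t _]tmap_inl -!scompA; congr scomp.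
    by apply: shom_ext => x; apply: even_comorE.
  by have -> : scomp t (ad_y G) = scomp (ad_y H) (comorph q) by exact: tmap_inr.
have := congr1 (fun f : shom A (EvA H) => rslice v (f a)) e.
rewrite -[X in _ = X -> _]/(Adu v (comorph q a)) => <-; symmetry.
exact: (tmap_rslice even_comor (comorph q) (objP (Ev H)) (objP B) (ad_c G a) lv).
Qed.

Variables (m : nat) (u : 'I_m -> A -> K^o) (w : 'I_m -> A) (bas : odd_basis u w).
Variables (n : nat) (u' : 'I_n -> B -> K^o) (w' : 'I_n -> B) (bas' : odd_basis u' w').

(** The map from the odd tangent space of [H] to that of [G] intertwines the adjoint action of
    [H_ev] with the restricted action of [G_ev]. *)
Lemma AdM_restrict p j :
  \sum_(i < n) u' i (comorph q (w p)) *: AdM u' w' i j =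
  \sum_(k < m) u' j (comorph q (w k)) *: even_comor (AdM u w p k).
Proof.
have vu' i : vder (u' i) by case: bas'.
have lu' i : lin (u' i) by case: (vu' i).
have lu i : lin (u i) by case: bas => /(_ i) [].
rewrite -(Adu_expand bas' _ (vu' j)) -even_comor_Adu //.
have -> : Adu (u' j \o comorph q) (w p) = \sum_(k < m) u' j (comorph q (w k)) *: AdM u w p k.
  rewrite /AdM /Adu; move: (ad_c G (w p)).
  apply: (@lin_eq_tens K (Ev G) A (Ev G)) => [||b a].
  - exact (rslice_lin (lin_comp (shom_lin (comorph q)) (lu' j))).
  - by apply: lin_bigsum => k; apply: lin_scale; apply: rslice_lin.
  rewrite rslice_pure; last exact: (lin_comp (shom_lin (comorph q)) (lu' j)).
  rewrite (vder_expand bas a (vder_comorph (vu' j))) scaler_suml; apply: eq_bigr => k _.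
  by rewrite rslice_pure // scalerA mulrC.
by rewrite shom_sum; apply: eq_bigr => k _; rewrite shomZ.
Qed.
End AdjointSubgroup.

(** [P] is the projection modulo the row space of [W], taken from the column basis of its cokernel
    matrix, and [B] is a section of it. *)
Lemma quotient_maps (E : fieldType) m (W : 'M[E]_m) : exists r (B : 'M[E]_(r, m)) (P : 'M[E]_(m,
  r)),
  [/\ r = (m - \rank W)%N, B *m P = 1%:M, W *m P = 0 &
    forall p (x : 'M[E]_(p, m)), x *m P = 0 -> (x <= W)%MS].
Proof.
pose C := cokermx W; exists (\rank C), (pinvmx (col_base C)), (col_base C); split.
- exact: mxrank_coker.
- by apply: mulVpmx; apply: col_base_full.
- have [Q hQ] : exists Q, row_base C *m Q = 1%:M.
    by apply/row_freeP; apply: row_base_free.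
  by rewrite -[col_base C]mulmx1 -hQ [col_base C *m _]mulmxA mulmx_base mulmxA mulmx_coker mul0mx.
- by move=> p x h; rewrite submxE -[cokermx W]mulmx_base mulmxA h mul0mx.
Qed.

(** With no odd tangent vectors [bcoord_gen] puts every odd element into the square of the odd
    ideal, hence into all its powers, and these are eventually zero. *)
Lemma even_of_no_vder (K : fieldType) (char2 : 2 \notin [pchar K]) (H : affine_supergroup K)
    (s : seq (coord H)) : gens s -> (forall v : coord H -> K^o, vder v -> forall a, v a = 0) ->
  purely_even (coord H).
Proof.
move=> gs nov; have [t ht] := odd_fin_gens gs; have [m [u [w bas]]] := odd_basis_ex ht.
have m0 : m = 0%N.
  case: m u w bas => // m u w [vu _ uw _].
  have := uw ord0 ord0; rewrite (nov _ (vu ord0)) eqxx => /esym /eqP.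
  by rewrite oner_eq0.
subst m; have sA := objP (coord H).
have odd2 (a : coord H) : gr true a -> oddpow 2 a.
  by move=> ha; have := bcoord_gen bas ha; rewrite big_ord0 subr0.
have step k (a : coord H) : oddpow k.+1 a -> oddpow k.+2 a.
  move: a; apply: oddpow_ind' => [|x y|o x ho hx].
  - exact: oddpow_zero.
  - exact: oddpowD.
  - exact: (oddpowM sA (odd2 _ ho) hx).
move=> a ha; apply: (oddpow_nilp char2 gs).
by elim: (size s) => [|k IHk]; [apply: oddpow_odd|apply: step].
Qed.

Lemma gens_surj (K : fieldType) (A B : superalgebra K) (f : shom A B) (s : seq A) :
  (forall y, exists x, f x = y) -> gens s -> gens (map f s).
Proof.
move=> fs gs S S1 Sl SM Ss y; have [x <-] := fs y; move: x.
apply: gs => [|c x z hx hz|x z hx hz|x xs].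
- by rewrite shom1.
- by rewrite shom_lin; apply: Sl.
- by rewrite shomM; apply: SM.
- by apply: Ss; apply: map_f.
Qed.

Section Main.
Variables (K : fieldType) (char2 : 2 \notin [pchar K]) (G : affine_supergroup K).
Variables (s : seq (coord G)) (gs : gens s).
Hypotheses (con : connected_supergroup G) (sm : smooth_supergroup G).
Local Notation A := (coord G).
Local Notation Gv := (even_part G).
Local Notation Bv := (coord Gv).

Lemma good_even : good Bv.
Proof.
have eB : purely_even Bv := proj2 (objP Bv); have sB : supercommutative Bv := proj1 (objP Bv).
have [n [w [u cwu]]] := @coordinates_ex K Bv eB sB (counit Gv) _ (gens_even gs).
have smp : smooth_point Bv.
  by move=> E E' p x psurj pn; apply: (@smooth_lift K G E E' p x sm psurj pn).
move=> R eR sR dR; apply: (tensor_domain eB sB cwu smp _ dR eR).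
by move=> h; apply: (minf_eq0 char2 gs con sm).
Qed.

Variables (m : nat) (m0 : (0 < m)%N) (u : 'I_m -> A -> K^o) (w : 'I_m -> A) (bas : odd_basis u w).
Let M : 'M[Bv]_m := \matrix_(i, j) AdM u w i j.
Variables (r : nat) (triv : forall (S : obj (alg_cat K)) (g : point Gv S), dpoint r g -> g = gone
  Gv S).
Variables (L : fieldType) (phi : {rmorphism K -> L}).
Local Notation E := (extf (@id_phant _ phi)).
Local Notation Ls := (exts phi).
Variable rs : seq E.
Hypothesis spec : forall j, (j <= r)%N -> spectral rs j (extM M phi).

Let rep0 : rep 0 (extM M phi).
Proof.
apply: rep_extM; first exact: AdM_one.
by move=> S g h a b; rewrite mxE (AdM_mul bas); apply: eq_bigr => k _; rewrite !mxE.
Qed.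

Definition annihilates (H : affine_supergroup K) (q : gmor H G) (x : 'rV[E]_m) : Prop :=
  forall v : coord H -> K^o, vder v -> \sum_(p < m) v (comorph q (w p)) *: (x 0 p : Ls) = 0.

(** The derived length [n] is left free: only the growth of [W] is controlled, and it stops after at
    most [m] enlargements. *)
Definition admissible (W : 'M[E]_m) : Prop :=
  (forall X, Aset 0 (extM M phi) X -> (W *m X <= W)%MS) /\
  exists n (H : affine_supergroup K) (q : gmor H G), [/\ derived_series G n H, closed_embedding q &
    forall x : 'rV[E]_m, (x <= W)%MS -> annihilates q x].

Lemma annihilates_lin H (q : gmor H G) c x y : annihilates q x -> annihilates q y ->
  annihilates q (c *: x + y).
Proof.
move=> hx hy v dv; rewrite (eq_bigr (fun p => (c : Ls) * (v (comorph q (w p)) *: (x 0 p : Ls)) +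
  v (comorph q (w p)) *: (y 0 p : Ls))); last first.
  by move=> p _; rewrite !mxE [LHS]scalerDr -scalerAr.
by rewrite big_split /= -mulr_sumr hx // hy // mulr0 addr0.
Qed.

(** [W] grows by a lift [l] of an eigenvector in the quotient by [W], while [H] is replaced by its
    second derived subgroup. *)
Lemma admissible_ext W : admissible W -> ~~ row_full W ->
  exists W', admissible W' /\ (\rank W < \rank W')%N.
Proof.
move=> [stW [n [H [q [dH cq annW]]]]] nfull.
have [k [B [P [ek BP WP kerP]]]] := quotient_maps W.
have k0 : (0 < k)%N.
  by rewrite ek subn_gt0 ltn_neqAle nfull rank_leq_col.
have hs : sub_or_quotient 0 B P (extM M phi).
  right=> X hX; apply/eqP; rewrite -subr_eq0 -opprB oppr_eq0 -mulmxBl -[X in X - _]mul1mx -mulmxBl.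
  have h : (1%:M - P *m B <= W)%MS.
    by apply: kerP; rewrite mulmxBl mul1mx -mulmxA BP mulmx1 subrr.
  have := submx_trans (submxMr X h) (stW X hX); move=> /submxP [Q ->].
  by rewrite -mulmxA WP mulmx0.
have [|l' [l'0 hl']] := lie_kolchin triv (add0n r) k0 (compress_rep rep0 BP hs) (rs := rs).
  by move=> j _ jr; apply: (compress_spectral (leq0n j) BP hs); apply: spec.
pose l := l' *m B.
have lP : l *m P = l' by rewrite -mulmxA BP mulmx1.
have hl X : Aset 0 (extM M phi) X -> exists z, (l *m X - z *: l <= W)%MS.
  move=> hX; have [|z hz] := hl' (B *m X *m P); first by apply/Aset_compress; exists X.
  exists z; apply: kerP; rewrite mulmxBl -scalemxAl lP -hz /l !mulmxA subrr //.
have lW : ~~ (l <= W)%MS.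
  apply/negP => /submxP [Q eQ]; apply: l'0; by rewrite -lP eQ -mulmxA WP mulmx0.
exists (W + l)%MS; split; last first.
  rewrite ltn_neqAle mxrankS ?addsmxSl // andbT; apply: contra lW => /eqP e.
  have : (W + l <= W)%MS by rewrite -(geq_leqif (mxrank_leqif_sup (addsmxSl W l))) e.
  exact: submx_trans (addsmxSr _ _).
split=> [X hX|].
  rewrite addsmxMr addsmx_sub (submx_trans (stW X hX) (addsmxSl _ _)) /=.
  have [z hz] := hl X hX; rewrite -[l *m X](subrK (z *: l)).
  by apply: addmx_sub; [apply: submx_trans hz (addsmxSl _ _)|apply: scalemx_sub; apply: addsmxSr].
have gH : gens (map (comorph q) s) by apply: gens_surj.
have [t ht] := odd_fin_gens gH; have [m' [u' [w' bas']]] := odd_basis_ex ht.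
have vu' i : vder (u' i) by case: bas'.
pose lH (i : 'I_m') : Ls := \sum_(p < m) u' i (comorph q (w p)) *: (l 0 p : Ls).
(* On the odd tangent vectors of [H] the functional [l] is a genuine eigenvector, because it is one
   modulo [W] and [W] vanishes there. *)
have [chi hchi] : exists chi : tensor (Ev H) Ls, forall j,
    \sum_(i < m') pure (AdM u' w' i j) (lH i) = tinr (Ev H) Ls (lH j) * chi.
  pose F j : tensor (Ev H) Ls := \sum_(i < m') pure (AdM u' w' i j) (lH i).
  have FE j : F j = \sum_(p < m) \sum_(k < m) u' j (comorph q (w k)) *:
      (pure (even_comor q (AdM u w p k) : Ev H) (l 0 p : Ls) : tensor (Ev H) Ls).
    rewrite /F (eq_bigr (fun i => \sum_(p < m)
      (pure (u' i (comorph q (w p)) *: AdM u' w' i j : Ev H) (l 0 p : Ls) : tensor (Ev H) Ls))).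
      rewrite exchange_big /=; apply: eq_bigr => p _.
      rewrite -(lin_sum (proj1 (pure_bilin (Ev H) Ls) (l 0 p : Ls))) (AdM_restrict q bas bas').
      rewrite (lin_sum (proj1 (pure_bilin (Ev H) Ls) (l 0 p : Ls))); apply: eq_bigr => k' _.
      by rewrite pureZl.
    move=> i _; rewrite /lH (lin_sum (proj2 (pure_bilin (Ev H) Ls) _)); apply: eq_bigr => p _.
    by rewrite pureZr pureZl.
  (* Each slice comes from a matrix in [Aset] for the universal point of [G_ev]; the error
     [l X - z l] lies in [W] and is killed by [annW]. *)
  have hF la : lin la -> exists z : Ls, forall j, lslice la (F j) = lH j * z.
    move=> ll; pose la' : Bv -> K^o := la \o even_comor q.
    have ll' : lin la' := lin_comp (shom_lin (even_comor q)) ll.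
    have hX : Aset 0 (extM M phi) (map_mx phi (map_mx la' M)).
      apply/Aset_extM; exists (map_mx la' M) => //; exists Bv, (counit Gv), (sid Bv : point Gv
        Bv), la'.
      by split=> //; apply: gpoint_univ; apply: good_even.
    have [z hz] := hl _ hX; exists z => j.
    have := annW _ hz (u' j) (vu' j) => h0; apply/eqP; rewrite -subr_eq0; apply/eqP; rewrite
      -[RHS]h0.
    rewrite FE (lin_sum (lslice_lin ll)) /lH mulr_suml.
    rewrite (eq_bigr (fun p => \sum_(k < m) u' j (comorph q (w k)) *: (la (even_comor q (AdM u w
      p k)) *: (l 0 p : Ls)))); last first.
      move=> p _; rewrite (lin_sum (lslice_lin ll)); apply: eq_bigr => k' _.
      by rewrite (linZ (lslice_lin ll)) lslice_pure.
    rewrite exchange_big /= -sumrB; apply: eq_bigr => k' _.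
    rewrite -scaler_sumr -scalerAl -scalerBr; congr (_ *: _); rewrite !mxE.
    congr (_ - _); last by rewrite mulrC.
    apply: eq_bigr => p _; rewrite !mxE; exact: mulrC.
  (* The slices determine [chi] after division by a nonzero coordinate of [lH]; if there is none,
     [chi = 0] will do. *)
  have [[j0 hj0]|nz] := pselect (exists j, lH j <> 0); last first.
    have l0 j : lH j = 0 by apply: contrapT => h; apply: nz; exists j.
    exists 0 => j; rewrite mulr0 big1 // => i _; by rewrite l0 pure0r.
  have [y hy] := exts_field hj0; exists (tinr (Ev H) Ls y * F j0) => j.
  apply: lslice_ext => la ll; have [z hz] := hF la ll.
  rewrite !(lslice_inr (@exts_even _ _ phi)) // [LHS]hz hz.
  rewrite [y * _]mulrA -[X in _ = _ * (X * _)](mulrC (lH j0)) hy mul1r //.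
have hC := salg_cat_closed K.
pose p1 := derived_mor hC H; pose p2 := derived_mor hC (derived hC H).
have d1 : is_derived p1 := derived_is_derived hC H.
have d2 : is_derived p2 := derived_is_derived hC (derived hC H).
pose q2 := gmor_comp q (gmor_comp p1 p2).
exists n.+2, (derived hC (derived hC H)), q2; split.
- by apply: (derived_seriesS (p := p2)) => //; apply: (derived_seriesS (p := p1)).
- move=> y; have [[c2 _] _ _] := d2; have [[c1 _] _ _] := d1.
  have [y2 <-] := c2 y; have [y1 <-] := c1 y2; have [x <-] := cq y1.
  by exists x.
move=> x; have annl : annihilates q2 l.
  move=> v dv.
  have := key_vanishing char2 bas' (@exts_even _ _ phi) (@exts_supercommutative _ _ phi)
    (@exts_field _ _ phi) (@oddpow_nilp _ char2 _ _ gH) hchi d1 d2 dv => e0.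
  rewrite -[RHS]e0 /lH.
  rewrite [RHS](eq_bigr (fun i => \sum_(p < m) (u' i (comorph q (w p)) * v (comorph p2 (comorph
    p1 (w' i)))) *: (l 0 p : Ls))); last first.
    by move=> i _; rewrite scaler_sumr; apply: eq_bigr => p _; rewrite scalerA mulrC.
  rewrite exchange_big /=; apply: eq_bigr => p _; rewrite -scaler_suml; congr (_ *: _).
  exact: (vder_expand bas' _ (vder_comorph p1 (vder_comorph p2 dv))).
(* Odd tangent vectors of the second derived subgroup are in particular tangent vectors of [H], so
   the old [W] still vanishes on them. *)
have annW2 y : (y <= W)%MS -> annihilates q2 y.
  by move=> hy v dv; apply: (annW y hy _ (vder_comorph p1 (vder_comorph p2 dv))).
move=> /sub_addsmxP [[x1 x2] ->] /=; rewrite [x2 *m l](_ : _ = x2 0 0 *: l).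
  by rewrite addrC; apply: annihilates_lin => //; apply: annW2; apply: submxMl.
by rewrite {1}[x2]mx11_scalar mul_scalar_mx.
Qed.

(** An admissible [W] of maximal rank is everything, by [admissible_ext]; the start is [W = 0] with
    [H = G]. *)
Lemma admissible_full : exists W, admissible W /\ row_full W.
Proof.
have ex : exists k, `[< exists W, admissible W /\ (m - \rank W)%N = k >].
  exists (m - \rank (0%R : 'M[E]_m))%N; apply/asboolP; exists 0%R; split=> //; split=> [X _|].
    by rewrite mul0mx sub0mx.
  exists 0%N, G, (gmor_id G); split; [exact: derived_series0|by move=> y; exists y|].
  move=> x; rewrite submx0 => /eqP -> v _; apply: big1 => p _; rewrite mxE; exact: scaler0.
case: (ex_minnP ex) => k /asboolP [W [aW kW]] mink; exists W; split=> //.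
apply: contrapT => /negP nf; have [W' [aW' rW']] := admissible_ext aW nf.
have : (k <= m - \rank W')%N by apply: mink; apply/asboolP; exists W'.
have := rank_leq_col W'; lia.
Qed.
End Main.

Theorem solvable_of_even_part (K : fieldType) (char2 : 2 \notin [pchar K]) (G : affine_supergroup
  K) :
  algebraic_supergroup G -> connected_supergroup G -> smooth_supergroup G ->
  solvable_scheme (even_part G) -> solvable_scheme G.
Proof.
move=> [s gs] con sm sol; have [t ht] := odd_fin_gens gs.
have [m [u [w bas]]] := odd_basis_ex ht.
suff [n [H [q [dH cq hv]]]] : exists n (H : affine_supergroup K) (q : gmor H G),
    [/\ derived_series G n H, closed_embedding q &
      forall v : coord H -> K^o, vder v -> forall p, v (comorph q (w p)) = 0].
  apply: (solvable_of_even dH cq _ sol).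
  apply: (even_of_no_vder char2 (gens_surj cq gs)) => v dv a; have [x <-] := cq a.
  have := vder_expand bas x (vder_comorph q dv) => /= ->.
  by apply: big1 => i _; rewrite [X in _ * X](hv v dv) mulr0.
(* Without odd tangent vectors [H = G] already works; the Lie-Kolchin argument needs a space of
   positive dimension. *)
have [m0|m0] := posnP m.
  subst m; exists 0%N, G, (gmor_id G); split; [exact: derived_series0|by move=> y; exists y|].
  by move=> v _ [].
have [r triv] := solvable_dpoint (alg_cat_closed K) sol.
have [L [phi [rs hrs]]] := split_ex m0 (\matrix_(i, j) AdM u w i j : 'M[coord (even_part G)]_m) r.
have spec j : (j <= r)%N -> spectral rs j (extM (\matrix_(i, j) AdM u w i j : 'M[coord (even_part
  G)]_m) phi).
  by move=> jr; apply: spectral_extM; apply: hrs.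
have [W [[_ [n [H [q [dH cq hW]]]]] fW]] := admissible_full char2 gs con sm m0 bas triv spec.
exists n, H, q; split=> // v dv p.
have := hW (delta_mx 0 p) (submx_full _ fW) v dv.
rewrite (bigD1 p) //= big1 ?addr0 => [|i ip]; last by rewrite mxE (negPf ip) andbF; exact: scaler0.
rewrite mxE !eqxx => /eqP; rewrite scaler_eq0 => /orP [/eqP //|].
by rewrite (negPf (@oner_neq0 _)).
Qed.

Local Close Scope ring_scope.

Theorem corollary6p4 (K : fieldType) (charK : 2 \notin [pchar K]%R)
    (G : affine_supergroup K) :
  algebraic_supergroup G -> connected_supergroup G -> smooth_supergroup G ->
  (solvable_scheme G <-> solvable_scheme (even_part G)).
Proof.
move=> alg con sm; split; first exact: solvable_even_part.
exact: solvable_of_even_part.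
Qed.
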